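(* Let $\Gamma$ be an arrangement of pseudocircles on some closed orientable surface. Then $\Gamma$ is embeddable into the sphere if and only if every subarrangement of $\Gamma$ consisting of exactly four of its pseudocircles is embeddable into the sphere.
   Context: A pseudocircle is an oriented closed Jordan curve on a closed orientable surface. An arrangement of pseudocircles is a finite set of pseudocircles on one closed orientable surface such that (i) no three of the curves pass through a common point, (ii) whenever two of the curves have a point in common they cross each other there, and (iii) every pair of curves intersects in exactly two points. A subarrangement is a subset of the pseudocircles of an arrangement (itself an arrangement). For an arrangement of labelled pseudocircles $\gamma_1,\dots,\gamma_n$, its intersection matrix is the $n\times 2(n-1)$ array whose row $i$ is the cyclic list obtained by walking once along $\gamma_i$ in the direction of its orientation (starting anywhere; rows are regarded as cyclic sequences) and recording, at each crossing with some $\gamma_k$, the entry $+k$ if $\gamma_k$ comes from the left and $-k$ if it comes from the right. Two arrangements are (combinatorially) isomorphic if they can be described by the same intersection matrix. An arrangement $\Gamma$ is embeddable into a surface $\mathcal S$ if there is an arrangement of pseudocircles on $\mathcal S$ isomorphic to $\Gamma$.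
   Formalization: The arrangement is assumed to have at least four pseudocircles: with fewer the condition on four-element subarrangements is vacuous, and two curves on the torus crossing twice in the same direction are not embeddable into the sphere. *)

(* Defs.v *)
From HB Require Import structures.
From mathcomp Require Import all_boot all_order all_algebra.
From mathcomp Require Import all_classical all_reals all_analysis.

Set Implicit Arguments.
Unset Strict Implicit.
Unset Printing Implicit Defensive.

Import Order.TTheory GRing.Theory Num.Theory.
Import numFieldNormedType.Exports.

Local Open Scope classical_set_scope.
Local Open Scope ring_scope.

Section Plane.
Variable R : realType.

Definition polar (x : R * R) (r a : R) : R * R :=
  (x.1 + r * cos a, x.2 + r * sin a).

(* [c] is read as a loop on [0, 2 pi]; [a] is a continuous choice of the angle
   at which [c] is seen from [x]. *)
Definition winding_number (c : R -> R * R) (x : R * R) (k : int) : Prop :=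
  exists a r : R -> R,
    [/\ continuous a,
        forall u, 0 < r u,
        forall u, c u = polar x (r u) (a u) &
        a (2 * pi) = a 0 + 2 * pi * k%:~R].

(* For a map which is a homeomorphism near [x]: small counterclockwise circles
   around [x] are sent to loops winding once counterclockwise around [h x]. *)
Definition orientation_preserving_at (h : R * R -> R * R) (x : R * R) : Prop :=
  \forall r \near 0^'+, winding_number (fun u => h (polar x r u)) (h x) 1.

End Plane.

Section Surface.
Variables (R : realType) (T : topologicalType).

(* A homeomorphism from the open set [dom] onto the open set [cod] of the
   plane; [to_plane] and [of_plane] are junk outside of [dom] and [cod]. *)
Record chart := Chart {
  dom : set T;
  cod : set (R * R);
  to_plane : T -> R * R;
  of_plane : R * R -> T;
  dom_open : open dom;
  cod_open : open cod;
  to_plane_cod : forall p, dom p -> cod (to_plane p);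
  of_plane_dom : forall x, cod x -> dom (of_plane x);
  to_planeK : forall p, dom p -> of_plane (to_plane p) = p;
  of_planeK : forall x, cod x -> to_plane (of_plane x) = x;
  to_plane_continuous : forall p, dom p -> {for p, continuous to_plane};
  of_plane_continuous : forall x, cod x -> {for x, continuous of_plane}
}.

Definition oriented_compatible (f g : chart) : Prop :=
  forall p, dom f p -> dom g p ->
    orientation_preserving_at (to_plane g \o of_plane f) (to_plane f p).

Definition positive_chart (O : set chart) (f : chart) : Prop :=
  forall g, O g -> oriented_compatible f g.

(* Such an [O] is the choice of an orientation of [T]. *)
Definition oriented_atlas (O : set chart) : Prop :=
  (forall p, exists2 f, O f & dom f p) /\ (forall f, O f -> positive_chart O f).

Definition closed_oriented_surface (O : set chart) : Prop :=
  [/\ [set: T] !=set0, compact [set: T], hausdorff_space T, connected [set: T] &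
      oriented_atlas O].

(* Oriented closed Jordan curves are given by 1-periodic parametrizations. *)
Definition pseudocircle (c : R -> T) : Prop :=
  continuous c /\ forall s t, c s = c t <-> s - t \is a Num.int.

(* At the point [c s = d t] the two curves cross, [d] coming from the left of
   [c] if [b = true] and from the right if [b = false]: in some positively
   oriented chart [c] runs rightwards along the x-axis, while [d] runs along
   the y-axis, downwards if [b] and upwards otherwise. *)
Definition crossing (O : set chart) (b : bool) (c d : R -> T) (s t : R) : Prop :=
  c s = d t /\
  exists f : chart, [/\ positive_chart O f, dom f (c s) &
    \forall u \near (0 : R),
      to_plane f (c (s + u)) = (u, 0) /\
      to_plane f (d (t + u)) = (0, if b then - u else u)].

Definition arrangement (O : set chart) (n : nat) (c : 'I_n -> R -> T) : Prop :=
  [/\ forall i, pseudocircle (c i),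
      forall i j k : 'I_n, i != j -> j != k -> i != k ->
        range (c i) `&` range (c j) `&` range (c k) = set0,
      forall i j : 'I_n, i != j -> forall s t, c i s = c j t ->
        exists b, crossing O b (c i) (c j) s t &
      forall i j : 'I_n, i != j ->
        exists p q, p <> q /\ range (c i) `&` range (c j) = [set p; q]].

Definition subarrangement (n : nat) (c : 'I_n -> R -> T) (A : {set 'I_n}) :
  'I_#|A| -> R -> T := fun i => c (enum_val i).

(* The entries [+k] and [-k] are [(true, k)] and [(false, k)]. *)
Definition intersection_mx (n : nat) : Type := 'M[bool * 'I_n]_(n, 2 * n.-1).

(* [t] lists the times at which a walk once along the [i]-th curve, from an
   arbitrary starting point, meets the other curves. *)
Definition describes (O : set chart) (n : nat) (M : intersection_mx n)
    (c : 'I_n -> R -> T) : Prop :=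
  forall i : 'I_n, exists t : 'I_(2 * n.-1) -> R,
    [/\ forall a b : 'I_(2 * n.-1), (a < b)%N -> t a < t b,
        forall a b, t b < t a + 1,
        forall (j : 'I_n) s, j != i -> range (c j) (c i s) ->
          exists a, c i s = c i (t a) &
        forall a, (M i a).2 != i /\
          exists u, crossing O (M i a).1 (c i) (c (M i a).2) (t a) u].

End Surface.

Arguments subarrangement [R T n] c A _ _.

Definition isomorphic (R : realType) (S T : topologicalType)
    (O : set (chart R S)) (O' : set (chart R T)) (n : nat)
    (c : 'I_n -> R -> S) (d : 'I_n -> R -> T) : Prop :=
  exists s : 'I_n -> 'I_n, bijective s /\
    exists M : intersection_mx n, describes O M c /\ describes O' M (d \o s).

Definition embeddable (R : realType) (T : topologicalType)
    (O : set (chart R T)) (n : nat) (c : 'I_n -> R -> T)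
    (S : topologicalType) : Prop :=
  exists (O' : set (chart R S)) (d : 'I_n -> R -> S),
    [/\ closed_oriented_surface O', arrangement O' d & isomorphic O O' c d].

Definition sphere (R : realType) : topologicalType :=
  set_type [set p : R * R * R | p.1.1 ^+ 2 + p.1.2 ^+ 2 + p.2 ^+ 2 = 1].

(* Main.v *)
From HB Require Import structures.
From mathcomp Require Import all_boot all_order all_algebra.
From mathcomp Require Import all_classical all_reals all_analysis.
From mathcomp Require Import ring lra zify.
Require Import Defs.
Set Implicit Arguments. Unset Strict Implicit. Unset Printing Implicit Defensive.
Import Order.TTheory GRing.Theory Num.Theory.
Import numFieldNormedType.Exports.
Local Open Scope classical_set_scope.
Local Open Scope ring_scope.

(* A spherical arrangement is recognised on its rows: every row contains each entry [+k]
   and [-k] once, and the intersection form on the cycles of the arrangement graph (which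
   only depends on the rows) vanishes. On the sphere minus a point this holds because the
   winding number of a cycle jumps across an edge by the multiplicity of the edge, and its
   values on the sides of the edges are a primitive for the form.

   Conversely, such rows are drawn by following the curves: each new crossing is put at the
   free end of a curve, so one obtains chords of a half plane, cut open along some edges,
   with prescribed crossings. The arcs closing the cut edges in the other half plane can be
   drawn without further crossings precisely because the intersection form vanishes.

   Finally, the cycles are generated by whole curves and by cycles supported on three
   curves, and the form on two of them which involve five curves is invariant under the even
   permutations of the five indices, up to the sign of its antisymmetry, hence is zero. So
   the condition on the rows only has to be checked on subarrangements of four curves. *)

(** * Winding angles *)

(** Charts are only homeomorphisms and orientations are defined by winding numbers, so no derivative
    tells the left of a curve from its right. Every statement about sides and signs is therefore
    reduced to the variation of an angle along a path. Faces and Euler's formula do not appear. The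
    winding number of a chain of edges, read on the right of an edge, stands for the face there.
    Since a chain may contain the edge itself, one subtracts a multiple of the whole curve; the
    value of a whole curve on its own right side must then be the same all along it, which is what
    the Jordan curve theorem provides. The same theorem makes the two crossings of a pair of curves
    have opposite signs. The number four arises from cones: a test cycle with apex on one of two
    given curves involves at most two further curves, so cycles on two curves are orthogonal to
    everything. Modulo these, only pairs of triangles with a common curve remain, hence five curves.
    In the converse, each side of an edge is recorded as a point of a segment whose ends are
    identified, so that the form is computed from the order of real numbers alone. *)

Definition cta (X Y : topologicalType) (f : X -> Y) (x : X) : Prop :=
  {for x, continuous f}.

Section Continuity.
Variables (R : realType) (X : topologicalType).
Implicit Types (f g : X -> R) (x : X).

Lemma cta_cst (Y : topologicalType) (c : Y) x : cta (fun _ : X => c) x.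
Proof. exact: cvg_cst. Qed.

Lemma cta_id x : cta (fun u : X => u) x.
Proof. exact: cvg_id. Qed.

Lemma cta_add f g x : cta f x -> cta g x -> cta (fun u => f u + g u) x.
Proof. exact: cvgD. Qed.

Lemma cta_opp f x : cta f x -> cta (fun u => - f u) x.
Proof. exact: cvgN. Qed.

Lemma cta_mul f g x : cta f x -> cta g x -> cta (fun u => f u * g u) x.
Proof. exact: cvgM. Qed.

Lemma cta_inv f x : f x != 0 -> cta f x -> cta (fun u => (f u)^-1) x.
Proof. exact: cvgV. Qed.

Lemma cta_exp f n x : cta f x -> cta (fun u => f u ^+ n) x.
Proof.
move=> hf; elim: n => [|n IH].
  by rewrite (_ : (fun u => _) = (fun=> 1)); [exact: cta_cst|apply/funext].
rewrite (_ : (fun u => _) = (fun u => f u * f u ^+ n)); first exact: cta_mul.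
by apply/funext => u; rewrite exprS.
Qed.

Lemma cta_comp (Y Z : topologicalType) (f : X -> Y) (g : Y -> Z) x :
  cta f x -> cta g (f x) -> cta (fun u => g (f u)) x.
Proof. by move=> hf hg; apply: (@continuous_comp _ _ _ f g). Qed.

Lemma cta_cos f x : cta f x -> cta (fun u => cos (f u)) x.
Proof. by move=> hf; apply: (cta_comp hf); exact: continuous_cos. Qed.

Lemma cta_sin f x : cta f x -> cta (fun u => sin (f u)) x.
Proof. by move=> hf; apply: (cta_comp hf); exact: continuous_sin. Qed.

Lemma cta_atan f x : cta f x -> cta (fun u => atan (f u)) x.
Proof. by move=> hf; apply: (cta_comp hf); exact: continuous_atan. Qed.

Lemma cta_sqrt f x : cta f x -> cta (fun u => Num.sqrt (f u)) x.
Proof. by move=> hf; apply: (cta_comp hf); exact: sqrt_continuous. Qed.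

Lemma cta_max f g x : cta f x -> cta g x -> cta (fun u => Num.max (f u) (g u)) x.
Proof. exact: continuous_max. Qed.

Lemma cta_min f g x : cta f x -> cta g x -> cta (fun u => Num.min (f u) (g u)) x.
Proof. exact: continuous_min. Qed.

Lemma cta_norm f x : cta f x -> cta (fun u => `|f u|) x.
Proof. by move=> hf; apply: cvg_norm. Qed.

Lemma cta_pair (Y Z : topologicalType) (f : X -> Y) (g : X -> Z) x :
  cta f x -> cta g x -> cta (fun u => (f u, g u)) x.
Proof. by move=> hf hg; apply: cvg_pair. Qed.

Lemma cta_fst (Y Z : topologicalType) (f : X -> Y * Z) x :
  cta f x -> cta (fun u => (f u).1) x.
Proof. by move=> hf; apply: (cta_comp hf); exact: cvg_fst. Qed.

Lemma cta_snd (Y Z : topologicalType) (f : X -> Y * Z) x :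
  cta f x -> cta (fun u => (f u).2) x.
Proof. by move=> hf; apply: (cta_comp hf); exact: cvg_snd. Qed.

Lemma cta_near (Y : topologicalType) (f g : X -> Y) x :
  (\forall u \near x, f u = g u) -> cta f x -> cta g x.
Proof.
move=> h hf; have e : f x = g x by exact: nbhs_singleton h.
rewrite /cta /prop_for /continuous_at -e; apply: cvg_trans hf.
by apply: near_eq_cvg; near=> u; near: u; exact: h.
Unshelve. all: by end_near. Qed.

Lemma cta_gt0 f x : cta f x -> 0 < f x -> \forall u \near x, 0 < f u.
Proof. by move=> hf h; apply: (cvgr_gt (f x)). Qed.

Lemma cta_lt f g x : cta f x -> cta g x -> f x < g x -> \forall u \near x, f u < g u.
Proof.
move=> hf hg h.
have : \forall u \near x, 0 < g u - f u.
  apply: cta_gt0; last by rewrite subr_gt0.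
  by apply: cta_add => //; apply: cta_opp.
by apply: filterS => u; rewrite subr_gt0.
Qed.

End Continuity.

Lemma ctI (X Y : topologicalType) (f : X -> Y) : (forall x, cta f x) -> continuous f.
Proof. by []. Qed.

Ltac leaf := solve [assumption
  | match goal with
    | H : continuous ?f |- @cta _ _ ?f ?x => exact (H x)
    | H : continuous ?f |- @cta _ _ (fun u => ?f u) ?x => exact (H x)
    | H : forall u, cta ?f u |- @cta _ _ ?f ?x => exact (H x)
    end].

Ltac ct0 := cbv beta;
  lazymatch goal with
  | |- @cta _ _ (fun _ => ?c) _ => apply: cta_cst
  | |- @cta _ _ (fun u => u) _ => apply: cta_id
  | |- @cta _ _ (fun u => @?f u + @?g u) _ => apply: (@cta_add _ _ f g); ct0
  | |- @cta _ _ (fun u => - @?f u) _ => apply: (@cta_opp _ _ f); ct0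
  | |- @cta _ _ (fun u => @?f u * @?g u) _ => apply: (@cta_mul _ _ f g); ct0
  | |- @cta _ _ (fun u => (@?f u)^-1) _ => apply: (@cta_inv _ _ f); [|ct0]
  | |- @cta _ _ (fun u => @?f u ^+ ?n) _ => apply: (@cta_exp _ _ f n); ct0
  | |- @cta _ _ (fun u => cos (@?f u)) _ => apply: (@cta_cos _ _ f); ct0
  | |- @cta _ _ (fun u => sin (@?f u)) _ => apply: (@cta_sin _ _ f); ct0
  | |- @cta _ _ (fun u => atan (@?f u)) _ => apply: (@cta_atan _ _ f); ct0
  | |- @cta _ _ (fun u => Num.sqrt (@?f u)) _ => apply: (@cta_sqrt _ _ f); ct0
  | |- @cta _ _ (fun u => Num.max (@?f u) (@?g u)) _ => apply: (@cta_max _ _ f g); ct0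
  | |- @cta _ _ (fun u => Num.min (@?f u) (@?g u)) _ => apply: (@cta_min _ _ f g); ct0
  | |- @cta _ _ (fun u => `|@?f u|) _ => apply: (@cta_norm _ _ f); ct0
  | |- @cta _ _ (fun u => (@?f u, @?g u)) _ => apply: (@cta_pair _ _ _ f g); ct0
  | |- @cta _ _ (fun u => (@?f u).1) _ => apply: (@cta_fst _ _ _ f); ct0
  | |- @cta _ _ (fun u => (@?f u).2) _ => apply: (@cta_snd _ _ _ f); ct0
  | |- @cta _ _ (fun u => ?F u) _ => try leaf
  | |- @cta _ _ (fun u => ?F (@?g u)) _ =>
      first [leaf | apply: (@cta_comp _ _ _ g F); [ct0 | try leaf]]
  | |- _ => try leaf
  end.

Ltac ct := lazymatch goal with
  | |- @cta _ _ _ _ => ct0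
  | |- _ => apply: ctI; let x := fresh "x" in intro x; ct0
  end.

(** * Angle functions along plane paths *)

Section Lift.
Variable R : realType.
Implicit Types (c : R -> R * R) (p q : R * R) (a : R -> R).

Definition dot q p q' p' : R := (q.1 - p.1) * (q'.1 - p'.1) + (q.2 - p.2) * (q'.2 - p'.2).
Definition crs q p q' p' : R := (q.1 - p.1) * (q'.2 - p'.2) - (q.2 - p.2) * (q'.1 - p'.1).
(** The signed angle from [q - p] to [q' - p'], correct as long as [dot q p q' p'] is positive;
    beyond a right angle the arctangent is on the wrong branch. *)
Definition eta q p q' p' : R := atan (crs q p q' p' / dot q p q' p').

Lemma eta_refl q p : eta q p q p = 0.
Proof.
by rewrite /eta (_ : crs _ _ _ _ = 0) ?mul0r ?atan0 // /crs; ring.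
Qed.

Definition lift c p a : Prop :=
  continuous a /\ forall u, exists r, 0 < r /\ c u = polar p r (a u).

Lemma polar_cos_sin (X Y : R) : 0 < X ->
  exists r, [/\ 0 < r, X = r * cos (atan (Y / X)) & Y = r * sin (atan (Y / X))].
Proof.
move=> X0; set t := atan _.
have C0 : 0 < cos t by apply: cos_gt0_pihalf; rewrite atan_gtNpi2 atan_ltpi2.
have st : sin t = Y / X * cos t.
  by rewrite -[Y / X]atanK -/t /tan mulfVK // gt_eqF.
exists (X / cos t); split; first exact: divr_gt0.
- by rewrite mulfVK // gt_eqF.
- rewrite st; field; rewrite !gt_eqF //.
Qed.

(* As long as the two moving vectors make an acute angle, their angles differ by [eta]:
   all invariance properties of [ang] come from this. *)
Lemma dog_leash c p a c' p' : lift c p a -> continuous c -> continuous c' ->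
  (forall u, 0 < dot (c u) p (c' u) p') ->
  lift c' p' (fun u => a u + eta (c u) p (c' u) p').
Proof.
move=> [ca h] cc cc' hd; split.
  by rewrite /eta /crs /dot; ct; rewrite gt_eqF // hd.
move=> u; have [r [r0 e]] := h u; have := hd u.
rewrite /eta /crs /dot e /polar /=.
set x' := (c' u).1 - p'.1; set y' := (c' u).2 - p'.2; set A := a u.
have -> : p.1 + r * cos A - p.1 = r * cos A by ring.
have -> : p.2 + r * sin A - p.2 = r * sin A by ring.
set Xr := (X in 0 < X) => Xr0; set Yr := (X in X / Xr).
(* [X] and [Y] are the coordinates of [c' u - p'] in the frame turned by [A]; the hypothesis on
   [dot] becomes [0 < X], so the remaining angle is an arctangent. *)
pose X := x' * cos A + y' * sin A; pose Y := y' * cos A - x' * sin A.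
have eX : Xr = r * X by rewrite /Xr /X; ring.
have eY : Yr = r * Y by rewrite /Yr /Y; ring.
have X0 : 0 < X by rewrite -(pmulr_rgt0 _ r0) -eX.
have -> : Yr / Xr = Y / X by rewrite eX eY; field; rewrite !gt_eqF.
have [k [k0 eX' eY']] := polar_cos_sin Y X0.
exists k; split=> //; have e1 := cos2Dsin2 A.
move: eX' eY'; set t := atan _; clearbody t => eX' eY'.
rewrite cosD sinD [c' u]surjective_pairing; congr (_, _).
  transitivity (p'.1 + x'); first by rewrite /x'; ring.
  congr (_ + _); transitivity (X * cos A - Y * sin A); last by rewrite eX' eY'; ring.
  by rewrite -[LHS]mulr1 -e1 /X /Y; ring.
transitivity (p'.2 + y'); first by rewrite /y'; ring.
congr (_ + _); transitivity (X * sin A + Y * cos A); last by rewrite eX' eY'; ring.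
by rewrite -[LHS]mulr1 -e1 /X /Y; ring.
Qed.

Lemma cos_lt1 (x : R) : 0 < x <= 1 -> cos x < 1.
Proof.
move=> /andP[x0 x1]; rewrite -[X in _ < X](cos0 R) ltr_cos // in_itv /= ?lexx ?pi_ge0 ?(ltW x0) //=.
by apply: le_trans x1 (le_trans _ (pi_ge2 R)); rewrite ler1n.
Qed.

Lemma cont_within (f : R -> R) (s t : R) : continuous f -> {within `[s, t], continuous f}.
Proof. by move=> cf; apply: continuous_subspaceT. Qed.

(** Otherwise the intermediate value theorem gives a value of [g] exceeding another one by an amount
    in []0, 1]]. The difference would have cosine 1, since both sines vanish, against [cos_lt1]. *)
Lemma cos1_constant (g : R -> R) s t : continuous g -> (forall u, cos (g u) = 1) ->
  g s = g t.
Proof.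
move=> cg h.
suff H : forall s t, ~~ (g s < g t).
  by apply/eqP; rewrite eq_le !leNgt !H.
move=> {}s {}t; apply/negP => l.
have [u e] : exists u, g u = Num.min (g t) (g s + 1).
  set v := Num.min _ _.
  have [v1 v2] : g s <= v /\ v <= g t.
    by rewrite /v; case: (leP (g t) (g s + 1)) => ?; split; lra.
  case: (leP s t) => st.
    have [|w _ <-] := IVT (f := g) (v := v) st (cont_within cg); last by exists w.
    by rewrite ge_min v1 le_max v2 orbT.
  have [|w _ <-] := IVT (f := g) (v := v) (ltW st) (cont_within cg); last by exists w.
  by rewrite ge_min v1 le_max v2 !orbT.
have d : 0 < g u - g s <= 1.
  by rewrite e; case: (leP (g t) (g s + 1)) => ?; lra.
have := cos_lt1 d; rewrite cosB !h.
have s0 x : sin (g x) = 0 by apply: cos1sin0; rewrite h normr1.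
by rewrite !s0 mul1r mul0r addr0 ltxx.
Qed.

Lemma lift_uniq c p a a' : lift c p a -> lift c p a' -> forall s t, a t - a s = a' t - a' s.
Proof.
move=> [ca h] [ca' h'] s t.
have H : forall u, cos (a u - a' u) = 1.
  move=> u; have [r [r0 e]] := h u; have [r' [r'0 e']] := h' u.
  move: e; rewrite e' /polar => -[/addrI e1 /addrI e2]; rewrite cosB.
  have q1 : r' = r.
    apply/eqP; rewrite -(eqrXn2 (n := 2)) ?ltW //; apply/eqP.
    rewrite -[LHS]mulr1 -(cos2Dsin2 (a' u)) -[RHS]mulr1 -(cos2Dsin2 (a u)) !mulrDr -!exprMn.
    by rewrite e1 e2.
  move: e1 e2; rewrite q1 => /(mulfI (lt0r_neq0 r0)) -> /(mulfI (lt0r_neq0 r0)) ->.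
  by rewrite -!expr2 cos2Dsin2.
have cg : continuous (fun u => a u - a' u) by ct.
by have /= := cos1_constant s t cg H; lra.
Qed.

(** Composing with [clamp s t] prolongs a path on a segment by constants, so that lifts and
    homotopies are functions on the whole line. *)
Definition clamp (s t u : R) : R := Num.max s (Num.min u t).

Lemma clamp_id s t u : s <= u <= t -> clamp s t u = u.
Proof. by move=> /andP[h1 h2]; rewrite /clamp (min_idPl h2) (max_idPr h1). Qed.

Lemma clamp_in s t u : s <= t -> s <= clamp s t u <= t.
Proof. by move=> h; rewrite /clamp le_max lexx /= ge_max h ge_min lexx orbT. Qed.

Lemma clamp_cont s t : continuous (clamp s t).
Proof. rewrite /clamp; ct. Qed.

(* The variation of the angle under which [c] is seen from [p] during [[s, t]]; junk if
   [c] passes through [p]. *)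
Definition ang c (s t : R) p : R :=
  let a := xget (fun _ => 0) [set a | lift (c \o clamp s t) p a] in a t - a s.

Lemma ang_lift c s t p a : lift (c \o clamp s t) p a -> ang c s t p = a t - a s.
Proof.
move=> h; rewrite /ang; set b := xget _ _.
have hb : lift (c \o clamp s t) p b by apply: (@xgetI _ _ [set a | _] a h).
exact: lift_uniq hb h s t.
Qed.

Lemma ang_lift_on c s t p a : s <= t -> continuous a ->
  (forall u, s <= u <= t -> exists r, 0 < r /\ c u = polar p r (a u)) ->
  ang c s t p = a t - a s.
Proof.
move=> st ca h; rewrite (@ang_lift _ _ _ _ (a \o clamp s t)) /=.
  by rewrite !clamp_id // ?lexx ?st.
split; last by move=> u; apply: h; exact: clamp_in.
have := clamp_cont (s := s) (t := t); move=> cc x.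
exact: (cta_comp (cc x) (ca _)).
Qed.

(** The indicator of [f x = f s] is a continuous real function with values 0 and 1, so it cannot
    take the value [1 / 2]. The target is an arbitrary type because the lemma is also applied to
    propositions and booleans. *)
Lemma locconst (T : Type) (f : R -> T) s t : s <= t ->
  (forall x, s <= x <= t -> \forall y \near x, f y = f x) -> f s = f t.
Proof.
move=> st h; pose g x : R := if `[< f x = f s >] then 0 else 1.
apply: contrapT => ne.
have [||u _ e] := @IVT R g s t (1 / 2) st.
- apply: continuous_in_subspaceT => x; rewrite inE /= in_itv /= => xi.
  apply: (@cta_near _ _ (fun _ => g x)); last exact: cta_cst.
  by have := h x xi; apply: filterS => y e; rewrite /g e.
- rewrite /g; case: asboolP => // _; case: asboolP => [/esym //|_].
  by rewrite ge_min le_max; apply/andP; split; apply/orP; [left|right]; lra.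
- by move: e; rewrite /g; case: asboolP => _; lra.
Qed.

(** The tube lemma: compactness of the segment makes the neighbourhood of [s0] uniform in [u]. *)
Lemma tube (D : R -> R -> R) s0 s t :
  (forall u, s <= u <= t -> cta (fun z : R * R => D z.1 z.2) (s0, u)) ->
  (forall u, s <= u <= t -> 0 < D s0 u) ->
  \forall x \near s0, forall u, s <= u <= t -> 0 < D x u.
Proof.
move=> cD hD.
have /compact_near_coveringP H := @segment_compact R s t.
have : \forall x \near s0, `[s, t]%classic `<=` (fun u => 0 < D x u).
  apply: (H R (nbhs s0) (fun x u => 0 < D x u)) => u /= ui.
  have ui' : s <= u <= t by move: ui; rewrite in_itv.
  have := cta_gt0 (cD u ui') (hD u ui').
  move=> [[/= A B] [nA nB] AB]; exists (B, A) => //= -[y x] /= [By Ax].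
  exact: (AB (x, y)).
by apply: filterS => x hx u ui; apply: hx; rewrite /= in_itv.
Qed.

End Lift.

(** * Homotopy invariance of the variation of angle *)

Section Homotopy.
Variable R : realType.
Implicit Types (c : R -> R * R) (p q : R * R) (a : R -> R) (H : R -> R -> R * R).

Lemma polar_ex q p : q <> p -> exists r (a : R), 0 < r /\ q = polar p r a.
Proof.
move=> ne; pose X := q.1 - p.1; pose Y := q.2 - p.2.
have -> : q = (p.1 + X, p.2 + Y) by rewrite [LHS]surjective_pairing /X /Y; congr (_, _); ring.
have {ne} : ~ (X = 0 /\ Y = 0).
  move=> [x0 y0]; apply: ne; rewrite [LHS]surjective_pairing [RHS]surjective_pairing.
  by congr (_, _); apply/eqP; rewrite -subr_eq0; apply/eqP.
rewrite /polar; case: (ltgtP X 0) => [Xn|Xp|X0] h.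
- have X0 : 0 < - X by lra.
  have [r [r0 e1 e2]] := polar_cos_sin (- Y) X0.
  exists r, (atan (- Y / - X) + pi); split=> //; rewrite cosDpi sinDpi.
  by congr (_, _); congr (_ + _); lra.
- have [r [r0 e1 e2]] := polar_cos_sin Y Xp.
  by exists r, (atan (Y / X)); split=> //; rewrite -e1 -e2.
- case: (ltgtP Y 0) => [Yn|Yp|Y0].
  + exists (- Y), (- (pi / 2)); split; first lra.
    by rewrite cosN sinN cos_pihalf sin_pihalf X0; congr (_, _); ring.
  + exists Y, (pi / 2); split; first lra.
    by rewrite cos_pihalf sin_pihalf X0; congr (_, _); ring.
  + by case: h.
Qed.

Lemma polar_neq p (r x : R) : 0 < r -> polar p r x <> p.
Proof.
move=> r0 e; have := congr1 fst e; have := congr1 snd e; rewrite /polar /= => e2 e1.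
have c0 : cos x = 0 by apply: (mulfI (lt0r_neq0 r0)); lra.
have s0 : sin x = 0 by apply: (mulfI (lt0r_neq0 r0)); lra.
by have := cos2Dsin2 x; rewrite c0 s0; lra.
Qed.

Lemma dot_gt0 q p : q <> p -> 0 < dot q p q p.
Proof.
move=> ne; rewrite /dot lt_neqAle -!expr2 addr_ge0 ?sqr_ge0 // andbT eq_sym.
rewrite paddr_eq0 ?sqr_ge0 // !sqrf_eq0 !subr_eq0; apply/negP => /andP[/eqP e1 /eqP e2].
by apply: ne; rewrite [LHS]surjective_pairing e1 e2 -surjective_pairing.
Qed.

Lemma dotC q p q' p' : dot q p q' p' = dot q' p' q p.
Proof. by rewrite /dot; ring. Qed.

Lemma clamp_path_cont c s t : s <= t -> (forall u, s <= u <= t -> cta c u) ->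
  continuous (c \o clamp s t).
Proof.
move=> st h u; apply: (@cta_comp _ _ _ (clamp s t) c); first exact: clamp_cont.
exact/h/clamp_in.
Qed.

Lemma cta_slice H (x u : R) : cta (fun z : R * R => H z.1 z.2) (x, u) -> cta (H x) u.
Proof.
move=> h.
apply: (@cta_comp _ _ _ (fun v : R => (x, v)) (fun z : R * R => H z.1 z.2) u _ h).
by ct.
Qed.

Section Near.
Variables (H : R -> R -> R * R) (p : R -> R * R) (s t : R).
Hypothesis st : s <= t.
Hypothesis cH : forall x u, s <= u <= t -> cta (fun z : R * R => H z.1 z.2) (x, u).
Hypothesis cp : continuous p.
Hypothesis av : forall x u, s <= u <= t -> H x u <> p x.

Lemma near_dot x0 : \forall x \near x0, forall u, s <= u <= t ->
  0 < dot (H x0 u) (p x0) (H x u) (p x).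
Proof.
apply: (@tube R (fun x u => dot (H x0 u) (p x0) (H x u) (p x))) => u ui; last exact/dot_gt0/av.
have c1 := @cH x0 _ ui.
have c2 : cta (fun z : R * R => H x0 z.2) (x0, u).
  apply: (@cta_comp _ _ _ (fun z : R * R => z.2) (H x0)); [by ct|exact: cta_slice].
rewrite /dot; ct; exact: c1.
Qed.

Lemma near_lift x0 : \forall x \near x0, forall a, lift (H x0 \o clamp s t) (p x0) a ->
  lift (H x \o clamp s t) (p x)
    (fun u => a u + eta ((H x0 \o clamp s t) u) (p x0) ((H x \o clamp s t) u) (p x)).
Proof.
have := near_dot x0; apply: filterS => x hx a la.
apply: (dog_leash la); try by apply: clamp_path_cont => // u ui; apply: cta_slice; exact: cH.
by move=> u; apply: hx; exact: clamp_in.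
Qed.

(** An equality of propositions, so that [locconst] can transport the existence of a lift along a
    homotopy. *)
Lemma near_lift_iff x0 : \forall x \near x0,
  (exists a, lift (H x \o clamp s t) (p x) a) = (exists a, lift (H x0 \o clamp s t) (p x0) a).
Proof.
have := near_dot x0; apply: filterS => x hx; apply/propext; split => -[a la].
  eexists; apply: (dog_leash la); try by apply: clamp_path_cont => // u ui; apply: cta_slice; exact: cH.
  by move=> u; rewrite dotC; apply: hx; exact: clamp_in.
eexists; apply: (dog_leash la); try by apply: clamp_path_cont => // u ui; apply: cta_slice; exact: cH.
by move=> u; apply: hx; exact: clamp_in.
Qed.

End Near.

(** The path is contracted to its starting point by slowing it down. The constant path has a lift,
    and having a lift is locally constant in the parameter of the contraction. *)
Lemma lift_ex c p s t : s <= t -> (forall u, s <= u <= t -> cta c u) ->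
  (forall u, s <= u <= t -> c u <> p) -> exists a, lift (c \o clamp s t) p a.
Proof.
move=> st cc av.
pose H x u := c (s + clamp 0 1 x * (u - s)).
have inI x u : s <= u <= t -> s <= s + clamp 0 1 x * (u - s) <= t.
  move=> /andP[h1 h2]; have /andP[] := @clamp_in R 0 1 x ler01.
  by set k := clamp _ _ _ => k0 k1; nra.
have cH x u : s <= u <= t -> cta (fun z : R * R => H z.1 z.2) (x, u).
  move=> ui; rewrite /H.
  apply: (@cta_comp _ _ _ (fun z : R * R => s + clamp 0 1 z.1 * (z.2 - s)) c); last exact/cc/inI.
  have := @clamp_cont R 0 1 => cl; ct; exact: cl.
have av' x u : s <= u <= t -> H x u <> p by move=> ui; apply/av/inI.
have : (exists a, lift (H 0 \o clamp s t) p a) = (exists a, lift (H 1 \o clamp s t) p a).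
  apply: (@locconst R Prop (fun x => exists a, lift (H x \o clamp s t) p a)); first lra.
  move=> x _; apply: (@near_lift_iff H (fun=> p)) => //; ct.
have -> : H 0 = fun=> c s by apply/funext => u; rewrite /H clamp_id ?lexx ?ler01 //; congr c; lra.
have -> : H 1 = c by apply/funext => u; rewrite /H clamp_id ?lexx ?ler01 //; congr c; lra.
move=> <-; have [|r [a [r0 e]]] := @polar_ex (c s) p; first by apply: av; rewrite lexx.
exists (fun=> a); split; first by ct.
by move=> u; exists r.
Qed.

Lemma ang_ex c p s t : s <= t -> (forall u, s <= u <= t -> cta c u) ->
  (forall u, s <= u <= t -> c u <> p) ->
  exists a, [/\ continuous a, ang c s t p = a t - a s &
    forall u, s <= u <= t -> exists r, 0 < r /\ c u = polar p r (a u)].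
Proof.
move=> st cc av; have [a la] := lift_ex st cc av.
exists a; split; [by case: la | exact: ang_lift |].
by move=> u ui; case: la => _ /(_ u); rewrite /= clamp_id.
Qed.

(** A small deformation changes the angle only through its two ends. These end terms cancel for
    loops, vanish for fixed ends, and are balanced by Kirchhoff's law in [Omega_path]. *)
Lemma ang_near H (p : R -> R * R) s t x0 : s <= t ->
  (forall x u, s <= u <= t -> cta (fun z : R * R => H z.1 z.2) (x, u)) ->
  continuous p -> (forall x u, s <= u <= t -> H x u <> p x) ->
  \forall x \near x0, ang (H x) s t (p x) - ang (H x0) s t (p x0) =
    eta (H x0 t) (p x0) (H x t) (p x) - eta (H x0 s) (p x0) (H x s) (p x).
Proof.
move=> st cH cp av.
have [a la] : exists a, lift (H x0 \o clamp s t) (p x0) a.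
  by apply: lift_ex => // u ui; [apply: cta_slice; exact: cH | exact: av].
have := near_lift st cH cp av x0; apply: filterS => x /(_ a la) la'.
rewrite (ang_lift la) (ang_lift la') /= !clamp_id ?lexx ?st //; ring.
Qed.

Lemma ang_homotopy H (p : R -> R * R) s t : s <= t ->
  (forall x u, 0 <= x <= 1 -> s <= u <= t -> cta (fun z : R * R => H z.1 z.2) (x, u)) ->
  continuous p -> (forall x u, 0 <= x <= 1 -> s <= u <= t -> H x u <> p x) ->
  ((forall x, 0 <= x <= 1 -> H x s = H x t) \/
   (forall x, 0 <= x <= 1 -> [/\ H x s = H 0 s, H x t = H 0 t & p x = p 0])) ->
  ang (H 0) s t (p 0) = ang (H 1) s t (p 1).
Proof.
move=> st cH cp av cl.
(* The hypotheses hold for parameters in [[0, 1]] only, while [ang_near] asks for all of them. *)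
pose H' x := H (clamp 0 1 x); pose p' x := p (clamp 0 1 x).
have in01 (x : R) : 0 <= clamp 0 1 x <= 1 by apply: clamp_in; lra.
have [e0 e1] : clamp 0 1 0 = 0 :> R /\ clamp 0 1 1 = 1 :> R by split; rewrite clamp_id //; lra.
have := @locconst R R (fun x => ang (H' x) s t (p' x)) 0 1.
rewrite /H' /p' e0 e1; apply; first lra.
have clc := @clamp_cont R 0 1.
move=> x _.
have := @ang_near H' p' s t x st; have : continuous p' by rewrite /p'; ct.
move=> cp' /(_ _ cp' _) X.
have : \forall y \near x, ang (H' y) s t (p' y) - ang (H' x) s t (p' x) =
   eta (H' x t) (p' x) (H' y t) (p' y) - eta (H' x s) (p' x) (H' y s) (p' y).
  apply: X.
  - move=> y u ui; rewrite /H'.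
    apply: (@cta_comp _ _ _ (fun z : R * R => (clamp 0 1 z.1, z.2)) (fun z : R * R => H z.1 z.2)).
      by ct.
    exact: cH.
  - by move=> y u ui; apply: av.
apply: filterS => y; rewrite /H' /p'.
case: cl => cl; first by rewrite !cl // => /eqP; rewrite subrr subr_eq0 => /eqP.
have [-> -> ->] := cl _ (in01 x); have [-> -> ->] := cl _ (in01 y).
by rewrite !eta_refl subrr => /eqP; rewrite subr_eq0 => /eqP.
Qed.

Lemma ang_add c p s t u : s <= t -> t <= u -> (forall v, s <= v <= u -> cta c v) ->
  (forall v, s <= v <= u -> c v <> p) -> ang c s t p + ang c t u p = ang c s u p.
Proof.
move=> st tu cc av; have [a [ca -> h]] := ang_ex (le_trans st tu) cc av.
rewrite (ang_lift_on (a := a) st) //; first rewrite (ang_lift_on (a := a) tu) //; first by ring.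
  by move=> v /andP[v1 v2]; apply: h; rewrite v2 (le_trans st v1).
by move=> v /andP[v1 v2]; apply: h; rewrite v1 (le_trans v2 tu).
Qed.

Lemma ang_comp c p (f : R -> R) s t s' t' a : s <= t -> continuous a ->
  (forall u, s' <= u <= t' -> exists r, 0 < r /\ c u = polar p r (a u)) ->
  continuous f -> (forall u, s <= u <= t -> s' <= f u <= t') ->
  ang (fun u => c (f u)) s t p = a (f t) - a (f s).
Proof.
move=> st ca h cf hf; rewrite (ang_lift_on (a := a \o f) st) //.
  by move=> x; exact: (cta_comp (cf x) (ca _)).
by move=> u ui; apply/h/hf.
Qed.

Lemma ang_eq c c' p s t : s <= t -> (forall u, s <= u <= t -> c u = c' u) ->
  ang c s t p = ang c' s t p.
Proof.
move=> st h; rewrite /ang; suff -> : c \o clamp s t = c' \o clamp s t by [].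
by apply/funext => u /=; rewrite h //; exact: clamp_in.
Qed.

Lemma ang_shift c p v s t : s <= t -> ang (fun u => c (u + v)) s t p = ang c (s + v) (t + v) p.
Proof.
move=> st; rewrite /ang.
set A := [set a | _]; set A' := [set a | lift (c \o _) p a].
have e u : clamp s t u + v = clamp (s + v) (t + v) (u + v).
  by rewrite /clamp addr_maxl addr_minl.
have AA' a : A' a -> A (fun u => a (u + v)).
  move=> [ca h]; split; first by ct.
  by move=> u /=; rewrite e; apply: h.
have A'A a : A a -> A' (fun u => a (u - v)).
  move=> [ca h]; split; first by ct.
  move=> u /=; have [r [r0 er]] := h (u - v); exists r; split=> //.
  by move: er; rewrite /= e subrK.
case: (pselect (exists a, A' a)) => [ex|nex].
  have h' := xgetPex (fun=> 0) ex; have h := AA' _ h'.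
  have ex2 : exists a, A a by eexists; exact: h.
  by have := lift_uniq (xgetPex (fun=> 0) ex2) h s t.
(* Without any lift both choices default to the zero function, and both sides are 0. *)
rewrite !xgetPN ?subr0 //; first by move=> x Ax; apply: nex; exists x.
by move=> x Ax; apply: nex; exists (fun u => x (u - v)); exact: A'A.
Qed.

Lemma ang_const c p s t : s <= t -> (forall u, s <= u <= t -> c u = c s) -> c s <> p ->
  ang c s t p = 0.
Proof.
move=> st h ne; have [r [a [r0 e]]] := polar_ex ne.
rewrite (ang_lift_on (a := fun=> a) st) ?subrr //; first by ct.
by move=> u ui; exists r; rewrite h.
Qed.

(** The dog on a leash for loops: the corrections [eta] at the two ends are equal. This is the basic
    tool for computing an angle by comparison with an explicit loop. *)
Lemma ang_dot c c' p p' s t : s <= t -> (forall u, s <= u <= t -> cta c u) ->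
  (forall u, s <= u <= t -> cta c' u) ->
  (forall u, s <= u <= t -> 0 < dot (c u) p (c' u) p') ->
  c s = c t -> c' s = c' t -> ang c s t p = ang c' s t p'.
Proof.
move=> st cc cc' hd e e'.
have [|a la] := lift_ex (p := p) st cc.
  by move=> u ui ex; have := hd u ui; rewrite /dot ex !subrr !mul0r addr0 ltxx.
have la' := dog_leash la (clamp_path_cont st cc) (clamp_path_cont st cc') (p' := p') _.
rewrite (ang_lift la) (ang_lift (la' _)) => [|u]; last by apply: hd; exact: clamp_in.
by rewrite /= !clamp_id ?lexx ?st // e e'; ring.
Qed.

Lemma cos_int (x : R) (k : int) : cos (x + 2 * pi * k%:~R) = cos x.
Proof.
have cn n y : cos (y + 2 * pi * n%:R) = cos y :> R.
  elim: n => [|n IH]; first by rewrite mulr0 addr0.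
  rewrite -[RHS]IH -[RHS]cosD2pi; congr cos; rewrite -natr1 -mulr_natr; ring.
case: k => n; first by rewrite -pmulrn cn.
rewrite -[LHS](cn n.+1); congr cos; rewrite NegzE mulrNz -pmulrn; ring.
Qed.

Lemma cos_eq1 (x : R) : cos x = 1 -> exists k : int, x = 2 * pi * k%:~R.
Proof.
move=> cx; have p0 := pi_gt0 R; pose k := Num.floor (x / (2 * pi)).
have p20 : 0 < 2 * pi :> R by lra.
pose y := x + 2 * pi * (- k)%:~R.
have cy : cos y = 1 by rewrite /y cos_int.
have ey : y = x - 2 * pi * k%:~R by rewrite /y mulrNz; ring.
have /andP[] : k%:~R <= x / (2 * pi) < k%:~R + 1.
  by rewrite -[X in _ < _ + X]/(1%:~R) -intrD floor_itv.
rewrite ler_pdivlMr // ltr_pdivrMr // => k1 k2.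
have y0 : 0 <= y by lra.
have y2 : y < 2 * pi by lra.
exists k; suff : y = 0 by lra.
apply/eqP/negPn/negP => ny; have yp : 0 < y by rewrite lt_neqAle eq_sym ny.
have c1 z : 0 < z <= pi -> cos z < 1 :> R.
  move=> /andP[z0 z1]; rewrite -[X in _ < X](cos0 R) ltr_cos // in_itv /= ?lexx ?pi_ge0 ?(ltW z0) //.
case: (leP y pi) => yq; first by have := c1 y; rewrite cy ltxx yp yq => /(_ isT).
have := c1 (2 * pi - y); have -> : cos (2 * pi - y) = 1.
  by transitivity (cos y) => //; rewrite -[RHS]cosN -[RHS]cosD2pi; congr cos; rewrite -mulr_natr; ring.
by rewrite ltxx => h; suff : false by []; apply: h; lra.
Qed.

Lemma ang_closed c p s t : s <= t -> (forall u, s <= u <= t -> cta c u) ->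
  (forall u, s <= u <= t -> c u <> p) -> c s = c t ->
  exists k : int, ang c s t p = 2 * pi * k%:~R.
Proof.
move=> st cc av e; apply: cos_eq1; have [a [ca -> h]] := ang_ex st cc av.
have [|r [r0 er]] := h s; first by rewrite lexx.
have [|r' [r'0 er']] := h t; first by rewrite lexx st.
move: er; rewrite e er' /polar => -[/addrI e1 /addrI e2]; rewrite cosB.
have q1 : r' = r.
  apply/eqP; rewrite -(eqrXn2 (n := 2)) ?ltW //; apply/eqP.
  rewrite -[LHS]mulr1 -(cos2Dsin2 (a t)) -[RHS]mulr1 -(cos2Dsin2 (a s)) !mulrDr -!exprMn.
  by rewrite e1 e2.
move: e1 e2; rewrite q1 => /(mulfI (lt0r_neq0 r0)) -> /(mulfI (lt0r_neq0 r0)) ->.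
by rewrite -!expr2 cos2Dsin2.
Qed.

End Homotopy.

(** * Local degrees and crossings *)

Section Degree.
Variable R : realType.
Implicit Types (c : R -> R * R) (h : R * R -> R * R) (x y p q : R * R) (e r s t u v : R).

Definition box x (e : R) y : Prop := `|y.1 - x.1| < e /\ `|y.2 - x.2| < e.

Lemma nbhs_box x (A : set (R * R)) : nbhs x A -> exists2 e, 0 < e & forall y, box x e y -> A y.
Proof.
move=> /nbhs_ballP[e /= e0 he]; exists e => // y [h1 h2]; apply: he.
by split; rewrite /ball /= distrC.
Qed.

Lemma box_nbhs x e : 0 < e -> \forall y \near x, box x e y.
Proof.
move=> e0; apply/nbhs_ballP; exists e => // y [h1 h2].
by split; rewrite distrC.
Qed.

Lemma boxW x e e' y : e <= e' -> box x e y -> box x e' y.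
Proof. by move=> h [h1 h2]; split; apply: lt_le_trans h. Qed.

Lemma box_center x e : 0 < e -> box x e x.
Proof. by move=> e0; split; rewrite subrr normr0. Qed.

Lemma box_polar x q e r u : `|q.1 - x.1| + r < e -> `|q.2 - x.2| + r < e -> 0 < r ->
  box x e (polar q r u).
Proof.
move=> h1 h2 r0; rewrite /box /polar /=.
have hc : `|r * cos u| <= r by rewrite normrM gtr0_norm // ger_pMr // cos_max.
have hs : `|r * sin u| <= r by rewrite normrM gtr0_norm // ger_pMr // sin_max.
rewrite [q.1 + _ - _]addrAC [q.2 + _ - _]addrAC.
by split; apply: le_lt_trans (ler_normD _ _) _; lra.
Qed.

Lemma box_polar0 x e r u : 0 < r < e -> box x e (polar x r u).
Proof. by move=> /andP[r0 re]; apply: box_polar; rewrite ?subrr ?normr0 ?add0r. Qed.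

Lemma norm_conv (a b e k : R) : `|a| < e -> `|b| < e -> 0 <= k <= 1 ->
  `|(1 - k) * a + k * b| < e.
Proof.
rewrite !ltr_norml => /andP[a1 a2] /andP[b1 b2] /andP[k0 k1].
case: (leP a b) => ab.
  have h1 : 0 <= (1 - k) * (b - a) by rewrite mulr_ge0; lra.
  have h2 : 0 <= k * (b - a) by rewrite mulr_ge0; lra.
  by apply/andP; split; lra.
have h1 : 0 <= (1 - k) * (a - b) by rewrite mulr_ge0; lra.
have h2 : 0 <= k * (a - b) by rewrite mulr_ge0; lra.
by apply/andP; split; lra.
Qed.

Lemma box_conv x e y y' (k : R) : 0 <= k <= 1 -> box x e y -> box x e y' ->
  box x e ((1 - k) * y.1 + k * y'.1, (1 - k) * y.2 + k * y'.2).
Proof.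
move=> hk [h1 h2] [h1' h2']; split => /=.
  have -> : (1 - k) * y.1 + k * y'.1 - x.1 = (1 - k) * (y.1 - x.1) + k * (y'.1 - x.1) by ring.
  exact: norm_conv.
have -> : (1 - k) * y.2 + k * y'.2 - x.2 = (1 - k) * (y.2 - x.2) + k * (y'.2 - x.2) by ring.
exact: norm_conv.
Qed.

Lemma polar_int q r (u : R) (k : int) : polar q r (u + 2 * pi * k%:~R) = polar q r u.
Proof.
rewrite /polar cos_int; congr (_, _ + _ * _).
by rewrite -!cosBpihalf -[RHS](cos_int _ k); congr cos; ring.
Qed.

Lemma polar_2pi q r (u : R) : polar q r (u + 2 * pi) = polar q r u.
Proof. by have := polar_int q r u 1; rewrite mulr1. Qed.

Lemma twopi_gt0 : 0 < 2 * pi :> R.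
Proof. by have := pi_gt0 R; lra. Qed.

Lemma polar_cont q r : continuous (fun u : R => polar q r u).
Proof. by rewrite /polar; ct. Qed.

Definition emb h x (e : R) : Prop :=
  [/\ 0 < e, forall y, box x e y -> cta h y &
      forall y y', box x e y -> box x e y' -> h y = h y' -> y = y'].

Lemma embW h x e q e' : emb h x e -> 0 < e' -> `|q.1 - x.1| + e' <= e -> `|q.2 - x.2| + e' <= e ->
  emb h q e'.
Proof.
move=> [e0 ch ih] e'0 h1 h2.
have sub y : box q e' y -> box x e y.
  move=> [k1 k2]; split.
    have -> : y.1 - x.1 = (y.1 - q.1) + (q.1 - x.1) by ring.
    by apply: le_lt_trans (ler_normD _ _) _; lra.
  have -> : y.2 - x.2 = (y.2 - q.2) + (q.2 - x.2) by ring.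
  by apply: le_lt_trans (ler_normD _ _) _; lra.
by split=> // [y /sub|y y' /sub b1 /sub b2]; [exact: ch | exact: ih].
Qed.

Lemma emb_small h x e e' : emb h x e -> 0 < e' <= e -> emb h x e'.
Proof. by move=> he /andP[h0 h1]; apply: embW he _ _ _ => //; rewrite subrr normr0 add0r. Qed.

(* Equals [2 * pi] times the local degree of [h] at [q] when [h] is injective near [q]. *)
Definition degr h q r : R := ang (fun u => h (polar q r u)) 0 (2 * pi) (h q).

(** The gain of angle over one period does not depend on where the period starts. The lift is only
    available on [[- X, X]], hence the bounds. *)
Lemma periodic_lift_mul c p a X D (v : R) (m : nat) : continuous a ->
  (forall u, - X <= u <= X -> exists r, 0 < r /\ c u = polar p r (a u)) ->
  (forall u, c (u + 2 * pi) = c u) -> 2 * pi <= X -> a (2 * pi) - a 0 = D ->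
  - X <= v -> v + 2 * pi * m%:R <= X -> a (v + 2 * pi * m%:R) - a v = m%:R * D.
Proof.
move=> ca h per X2 eD hv; have p0 := twopi_gt0.
have step w w' : - X <= w -> w <= w' -> w' + 2 * pi <= X ->
    a (w' + 2 * pi) - a w' = a (w + 2 * pi) - a w.
  move=> h1 h2 h3.
  have e1 := @ang_lift_on R c w w' p a h2 ca.
  have e2 := @ang_lift_on R (fun u => c (u + 2 * pi)) w w' p (fun u => a (u + 2 * pi)) h2.
  have : ang c w w' p = ang (fun u => c (u + 2 * pi)) w w' p by apply: ang_eq.
  rewrite e1 => [|u /andP[u1 u2]]; last by apply: h; lra.
  rewrite e2; first lra; first by ct.
  by move=> u /andP[u1 u2]; apply: h; lra.
have step0 w : - X <= w -> w + 2 * pi <= X -> a (w + 2 * pi) - a w = D.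
  move=> h1 h2; rewrite -eD -[X in a X - a 0]add0r; case: (leP w 0) => w0.
    by rewrite (step w 0) //; lra.
  by rewrite (step 0 w) //; lra.
elim: m => [|m IH] hm; first by rewrite mulr0 addr0 subrr mul0r.
have e : v + 2 * pi * m.+1%:R = v + 2 * pi * m%:R + 2 * pi by rewrite -natr1; ring.
have m0 : 0 <= 2 * pi * m%:R :> R by apply: mulr_ge0; [exact: ltW | exact: ler0n].
rewrite e in hm *; have -> : m.+1%:R * D = m%:R * D + D by rewrite -natr1; ring.
have h1 : a (v + 2 * pi * m%:R + 2 * pi) - a (v + 2 * pi * m%:R) = D by apply: step0; lra.
have h2 : a (v + 2 * pi * m%:R) - a v = m%:R * D by apply: IH; lra.
lra.
Qed.

(** Multiplicativity of the local degree: inside the box the loop [c] can be deformed, away from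
    [q], into the circle of radius [r] run [k] times at constant speed, and [h] carries this
    deformation over because it is injective there. *)
Lemma deg_ball h x e q r c s t (k : int) : emb h x e -> box x e q ->
  0 < r -> (forall u, box x e (polar q r u)) -> s < t ->
  (forall u, s <= u <= t -> cta c u) -> (forall u, s <= u <= t -> box x e (c u)) ->
  (forall u, s <= u <= t -> c u <> q) -> c s = c t -> ang c s t q = 2 * pi * k%:~R ->
  ang (fun u => h (c u)) s t (h q) = k%:~R * degr h q r.
Proof.
move=> [e0 ch ih] bq r0 br st cc bc av cst ak.
have st' := ltW st; have p0 := twopi_gt0.
have [a [ca ea ha]] := ang_ex st' cc av.
have eat : a t = a s + 2 * pi * k%:~R by lra.
pose rr u := Num.sqrt (dot (c u) q (c u) q).
have rrE u : s <= u <= t -> 0 < rr u /\ c u = polar q (rr u) (a u).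
  move=> ui; have [r' [r'0 er]] := ha u ui.
  suff -> : rr u = r' by [].
  rewrite /rr er /dot /polar /=; apply/eqP.
  rewrite -(eqrXn2 (n := 2)) ?sqrtr_ge0 ?ltW // sqr_sqrtr.
    by apply/eqP; rewrite -[RHS]mulr1 -(cos2Dsin2 (a u)); ring.
  by rewrite -!expr2 addr_ge0 ?sqr_ge0.
have rrc u : s <= u <= t -> cta rr u by move=> ui; have := cc u ui => cu; rewrite /rr /dot; ct.
have ss : s <= s <= t by rewrite lexx st'.
have tt : s <= t <= t by rewrite lexx st'.
have rst : rr s = rr t by rewrite /rr cst.
have pst rho : polar q rho (a s) = polar q rho (a t) by rewrite eat polar_int.
have inj y : box x e y -> y <> q -> h y <> h q by move=> by_ ne /ih -/(_ by_ bq).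
have B1 k' u : 0 <= k' <= 1 -> s <= u <= t -> box x e (polar q ((1 - k') * rr u + k' * r) (a u)).
  move=> hk ui; have [_ eu] := rrE u ui.
  have := box_conv hk (bc u ui) (br (a u)); rewrite eu /polar /=.
  by congr box; congr (_, _); ring.
have pos1 k' u : 0 <= k' <= 1 -> s <= u <= t -> 0 < (1 - k') * rr u + k' * r.
  by move=> /andP[k0 k1] ui; have [u0 _] := rrE u ui; nra.
(* Radial deformation onto the circle; it stays in the box by convexity. *)
have E1 : ang (fun u => h (c u)) s t (h q) = ang (fun u => h (polar q r (a u))) s t (h q).
  have := @ang_homotopy R (fun k' u => h (polar q ((1 - k') * rr u + k' * r) (a u))) (fun=> h q) s t st'.
  move=> H; rewrite (@ang_eq _ _ (fun u => h (polar q ((1 - 0) * rr u + 0 * r) (a u)))) //; last first.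
    by move=> u ui; rewrite subr0 mul1r mul0r addr0; have [_ <-] := rrE u ui.
  rewrite [RHS](@ang_eq _ _ (fun u => h (polar q ((1 - 1) * rr u + 1 * r) (a u)))) //; last first.
    by move=> u ui; rewrite subrr mul1r mul0r add0r.
  apply: H.
  - move=> k' u hk ui; have cu := rrc u ui.
    have := ch _ (B1 k' u hk ui) => chu.
    apply: (@cta_comp _ _ _ (fun z : R * R => polar q ((1 - z.1) * rr z.2 + z.1 * r) (a z.2)) h) => //.
    by rewrite /polar; ct.
  - by ct.
  - by move=> k' u hk ui; apply: inj; [exact: B1 | apply: polar_neq; exact: pos1].
  - by left=> k' hk; rewrite rst pst.
(* The angle is now deformed, on the circle, into an affine function of time with the same end
   values. *)
rewrite E1; have E2 : ang (fun u => h (polar q r (a u))) s t (h q) =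
    ang (fun u => h (polar q r (a s + 2 * pi * k%:~R * ((u - s) / (t - s))))) s t (h q).
  have := @ang_homotopy R (fun k' u => h (polar q r ((1 - k') * a u +
    k' * (a s + 2 * pi * k%:~R * ((u - s) / (t - s)))))) (fun=> h q) s t st'.
  move=> H; rewrite (@ang_eq _ _ (fun u => h (polar q r ((1 - 0) * a u +
    0 * (a s + 2 * pi * k%:~R * ((u - s) / (t - s))))))) //; last first.
    by move=> u ui; rewrite subr0 mul1r mul0r addr0.
  rewrite [RHS](@ang_eq _ _ (fun u => h (polar q r ((1 - 1) * a u +
    1 * (a s + 2 * pi * k%:~R * ((u - s) / (t - s))))))) //; last first.
    by move=> u ui; rewrite subrr mul1r mul0r add0r.
  apply: H.
  - move=> k' u hk ui.
    apply: (@cta_comp _ _ _ (fun z : R * R => polar q r ((1 - z.1) * a z.2 +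
      z.1 * (a s + 2 * pi * k%:~R * ((z.2 - s) / (t - s))))) h).
      by rewrite /polar; ct.
    exact/ch/br.
  - by ct.
  - by move=> k' u hk ui; apply: inj => //; exact: polar_neq.
  - left=> k' hk; have -> : (s - s) / (t - s) = 0 by rewrite subrr mul0r.
    have -> : (t - s) / (t - s) = 1 by rewrite divff // subr_eq0 gt_eqF.
    congr (h _); rewrite mulr0 addr0 mulr1 -eat.
    have -> : (1 - k') * a s + k' * a s = a s by ring.
    by have -> : (1 - k') * a t + k' * a t = a t by ring.
rewrite E2; set L := fun u => h (polar q r u).
(* A range containing [k] full turns from [a s] in either direction, with room to spare. *)
pose X := `|a s| + 2 * pi * (`|k|%N.+2)%:R.
have aX := normr_ge0 (a s); have [aX1 aX2] : - `|a s| <= a s /\ a s <= `|a s|.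
  by split; [rewrite lerNl; have := ler_norm (- a s); rewrite normrN; lra | exact: ler_norm].
have eX : X = `|a s| + 2 * pi * `|k|%N%:R + 2 * pi * 2 by rewrite /X -[_.+2]addn2 natrD; ring.
have kX : 0 <= 2 * pi * `|k|%N%:R :> R by apply: mulr_ge0; [exact: ltW | exact: ler0n].
have [|||A [cA eA hA]] := @ang_ex R L (h q) (- X) X.
- lra.
- by move=> u _; apply: (cta_comp (@polar_cont q r u)); exact/ch/br.
- by move=> u _; apply: inj => //; exact: polar_neq.
rewrite (@ang_comp R L (h q) (fun u => a s + 2 * pi * k%:~R * ((u - s) / (t - s))) s t (- X) X A) //; last first.
- move=> u /andP[u1 u2]; set w := (u - s) / (t - s).
  have ts : 0 < t - s by lra.
  have [w0 w1] : 0 <= w /\ w <= 1.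
    by split; [apply: divr_ge0; lra | rewrite /w ler_pdivrMr //; lra].
  have kk : `|2 * pi * k%:~R * w| <= 2 * pi * `|k|%N%:R.
    rewrite normrM (ger0_norm w0) normrM (gtr0_norm p0) -intr_norm -natr_absz ler_piMr //.
  by move: kk; rewrite ler_norml => /andP[k1 k2]; lra.
- by ct.
have DE : A (2 * pi) - A 0 = degr h q r.
  rewrite /degr -/L (ang_lift_on (a := A)) //; first exact: ltW.
  by move=> u /andP[u1 u2]; apply: hA; lra.
have perL u : L (u + 2 * pi) = L u by rewrite /L polar_2pi.
have -> : (t - s) / (t - s) = 1 by rewrite divff // subr_eq0 gt_eqF.
have -> : (s - s) / (t - s) = 0 by rewrite subrr mul0r.
rewrite mulr0 mulr1 addr0.
have X2 : 2 * pi <= X by lra.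
move: kX eX; case: (k) => n kX eX.
  have := @periodic_lift_mul L (h q) A X _ (a s) n cA hA perL X2 DE.
  by rewrite -!pmulrn; apply; lra.
(* For negative [k] the turns are counted forwards from their final angle. *)
have := @periodic_lift_mul L (h q) A X _ (a s - 2 * pi * n.+1%:R) n.+1 cA hA perL X2 DE.
rewrite NegzE !mulrNz -pmulrn.
have -> : a s - 2 * pi * n.+1%:R + 2 * pi * n.+1%:R = a s by ring.
have -> : a s + 2 * pi * - n.+1%:R = a s - 2 * pi * n.+1%:R by ring.
move: kX eX; rewrite /absz => kX eX.
by move=> H; have := H _ _; lra.
Qed.

End Degree.

(** * Invariance and multiplicativity of the local degree *)

Section Orientation.
Variable R : realType.
Implicit Types (c : R -> R * R) (h : R * R -> R * R) (x y p q : R * R) (e r s t u v : R).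

Lemma polar_inj p (r r' a a' : R) : 0 < r -> 0 < r' -> polar p r a = polar p r' a' ->
  exists k : int, a = a' + 2 * pi * k%:~R.
Proof.
move=> r0 r'0; rewrite /polar => -[/addrI e1 /addrI e2].
have q1 : r' = r.
  apply/eqP; rewrite -(eqrXn2 (n := 2)) ?ltW //; apply/eqP.
  rewrite -[LHS]mulr1 -(cos2Dsin2 a') -[RHS]mulr1 -(cos2Dsin2 a) !mulrDr -!exprMn.
  by rewrite e1 e2.
have [k ek] : exists k : int, a - a' = 2 * pi * k%:~R.
  apply: cos_eq1; rewrite cosB.
  move: e1 e2; rewrite q1 => /(mulfI (lt0r_neq0 r0)) -> /(mulfI (lt0r_neq0 r0)) ->.
  by rewrite -!expr2 cos2Dsin2.
by exists k; lra.
Qed.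

Lemma polar_02pi q (r : R) : polar q r (2 * pi) = polar q r 0.
Proof. by rewrite -[RHS]polar_2pi add0r. Qed.

(** [winding_number] asks for an angle continuous on the whole line. The angle measured from time 0
    differs by a constant from a lift on each segment [[- n, n]], hence is continuous. *)
Lemma lift_line c p : continuous c -> (forall u, c u <> p) -> exists a, lift c p a.
Proof.
move=> cc av; have [r0 [a0 [r00 e0]]] := polar_ex (av 0).
pose a (u : R) : R := a0 + if 0 <= u then ang c 0 u p else - ang c u 0 p.
have H (n : R) : 0 < n -> exists A : R -> R, continuous A /\ forall u, - n <= u <= n ->
    a u = a0 - A 0 + A u /\ exists r, 0 < r /\ c u = polar p r (A u).
  move=> n0; have [|||A [cA _ hA]] := @ang_ex R c p (- n) n; [lra | by move=> *; apply: cc | by [] |].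
  exists A; split=> // u ui; split; last exact: hA.
  rewrite /a; case: ifP => u0.
    rewrite (ang_lift_on (a := A)) //; first by ring.
    by move=> v vi; apply: hA; lra.
  rewrite (ang_lift_on (a := A)) //; [by ring | lra |].
  by move=> v vi; apply: hA; lra.
have in_n (u : R) : - (`|u| + 1) <= u <= `|u| + 1.
  by have := ler_norm u; have := ler_norm (- u); rewrite normrN => *; lra.
exists a; split.
  move=> u; have n0 : 0 < `|u| + 1 by have := normr_ge0 u; lra.
  have [A [cA hA]] := H _ n0.
  apply: (@cta_near _ _ (fun v => a0 - A 0 + A v)); last by ct.
  have : \forall v \near u, `|v - u| < 1.
    apply: (cta_lt (f := fun v => `|v - u|) (g := fun=> 1)); [by ct | by ct |].
    by rewrite subrr normr0.
  apply: filterS => v hv; have [|-> //] := hA v.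
  by move: hv; rewrite ltr_norml; have := in_n u => /andP[? ?] /andP[? ?]; 
     have := ler_norm u; have := ler_norm (- u); rewrite normrN => *; lra.
move=> u; have n0 : 0 < `|u| + 1 by have := normr_ge0 u; lra.
have [A [cA hA]] := H _ n0.
have [eu [r [rp er]]] := hA u (in_n u).
have [|_ [r' [r'p er']]] := hA 0; first lra.
have [k ek] : exists k : int, A 0 = a0 + 2 * pi * k%:~R.
  by apply: (@polar_inj p r' r0) => //; rewrite -er' -e0.
exists r; split=> //; rewrite er eu ek.
by rewrite -[RHS](polar_int _ _ _ k); congr polar; ring.
Qed.

Lemma ang_polar q (r : R) : 0 < r -> ang (polar q r) 0 (2 * pi) q = 2 * pi.
Proof.
move=> r0; have := twopi_gt0 R => p0.
rewrite (ang_lift_on (a := fun u => u)) ?subr0 //; [lra | by ct |].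
by move=> u _; exists r.
Qed.

Lemma emb_neq h x e q y : emb h x e -> box x e q -> box x e y -> y <> q -> h y <> h q.
Proof. by move=> [_ _ ih] bq b ne /ih -/(_ b bq). Qed.

Definition circ x (e : R) q (r : R) : Prop :=
  [/\ 0 < r, `|q.1 - x.1| + r < e & `|q.2 - x.2| + r < e].

Lemma circ_box x e q r : circ x e q r -> box x e q.
Proof. by case=> r0 h1 h2; split; lra. Qed.

Lemma circ_polar x e q r u : circ x e q r -> box x e (polar q r u).
Proof. by case=> r0 h1 h2; apply: box_polar. Qed.

Lemma circ_center x e r : 0 < r < e -> circ x e x r.
Proof. by move=> /andP[r0 re]; split; rewrite // subrr normr0 add0r. Qed.

Lemma degr_mul h x e q r c s t (k : int) : emb h x e -> circ x e q r -> s < t ->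
  (forall u, s <= u <= t -> cta c u) -> (forall u, s <= u <= t -> box x e (c u)) ->
  (forall u, s <= u <= t -> c u <> q) -> c s = c t -> ang c s t q = 2 * pi * k%:~R ->
  ang (fun u => h (c u)) s t (h q) = k%:~R * degr h q r.
Proof.
move=> he hq; apply: deg_ball he _ _ _ => //; first exact: circ_box hq.
  by case: hq.
by move=> u; exact: circ_polar.
Qed.

Lemma degr_rad h x e q r r' : emb h x e -> circ x e q r -> circ x e q r' ->
  degr h q r = degr h q r'.
Proof.
move=> he h1 h2; have p0 := twopi_gt0 R; have r0 : 0 < r by case: h1.
rewrite -[RHS]mul1r -[1]/(1%:~R) -(@degr_mul h x e q r' (polar q r) 0 (2 * pi) 1) //.
- by move=> u _; exact: polar_cont.
- by move=> u _; exact: circ_polar.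
- by move=> u _; exact: polar_neq.
- by rewrite polar_02pi.
- by rewrite ang_polar // mulr1.
Qed.

Lemma degr_move h x e q q' r : emb h x e -> circ x e q r -> circ x e q' r ->
  degr h q r = degr h q' r.
Proof.
move=> he [r0 h1 h2] [_ h1' h2']; have p0 := ltW (twopi_gt0 R).
pose m (k : R) : R * R := ((1 - k) * q.1 + k * q'.1, (1 - k) * q.2 + k * q'.2).
have nc (a b k d : R) : `|a| + d < e -> `|b| + d < e -> 0 <= k <= 1 ->
    `|(1 - k) * a + k * b| + d < e.
  move=> ha hb hk; rewrite -ltrBrDr; apply: norm_conv => //; lra.
have cm k : 0 <= k <= 1 -> circ x e (m k) r.
  move=> hk; split=> //=.
    have -> : (1 - k) * q.1 + k * q'.1 - x.1 = (1 - k) * (q.1 - x.1) + k * (q'.1 - x.1) by ring.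
    exact: nc.
  have -> : (1 - k) * q.2 + k * q'.2 - x.2 = (1 - k) * (q.2 - x.2) + k * (q'.2 - x.2) by ring.
  exact: nc.
have c01 (k : R) : 0 <= clamp 0 1 k <= 1 by apply: clamp_in; lra.
have clc := @clamp_cont R 0 1.
have := @ang_homotopy R (fun k u => h (polar (m (clamp 0 1 k)) r u)) (fun k => h (m (clamp 0 1 k))) 0 (2 * pi) p0.
have [m0 m1] : m (clamp 0 1 0) = q /\ m (clamp 0 1 1) = q'.
  split; rewrite clamp_id ?lexx ?ler01 // /m.
    by rewrite subr0 !mul1r !mul0r !addr0 -surjective_pairing.
  by rewrite subrr !mul1r !mul0r !add0r -surjective_pairing.
rewrite m0 m1; apply.
- move=> k u _ _.
  apply: (@cta_comp _ _ _ (fun z : R * R => polar (m (clamp 0 1 z.1)) r z.2) h).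
    by rewrite /polar /m /=; ct.
  by case: he => _ ch _; apply/ch/circ_polar/cm.
- apply: ctI => k; apply: (@cta_comp _ _ _ (fun k => m (clamp 0 1 k)) h).
    by rewrite /m; ct.
  by case: he => _ ch _; apply/ch/(circ_box (cm _ _)).
- move=> k u _ _; apply: (emb_neq he); [exact/(circ_box (cm _ _)) | exact/circ_polar/cm |].
  exact: polar_neq.
- by left=> k _; rewrite polar_02pi.
Qed.

Lemma degr_const h x e q q' r r' : emb h x e -> circ x e q r -> circ x e q' r' ->
  degr h q r = degr h q' r'.
Proof.
move=> he h1 h2; have [r0 a1 a2] := h1; have [r0' a1' a2'] := h2.
pose m := Num.min r r'.
have [m0 m1 m2] : [/\ 0 < m, m <= r & m <= r'].
  by rewrite /m lt_min r0 r0' ge_min lexx ge_min lexx orbT.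
have c1 : circ x e q m by split; lra.
have c2 : circ x e q' m by split; lra.
by rewrite (degr_rad he h1 c1) (degr_move he c1 c2) (degr_rad he c2 h2).
Qed.

Lemma near_right_ex (P : R -> Prop) (e : R) : 0 < e -> (\forall r \near 0^'+, P r) ->
  exists r, 0 < r < e /\ P r.
Proof.
move=> e0 hP; have : \forall r \near 0^'+, 0 < r < e /\ P r.
  near=> r; split; last by near: r.
  by apply/andP; split; near: r; [exact: nbhs_right_gt | exact: nbhs_right_lt].
by move=> /filter_ex.
Unshelve. all: by end_near. Qed.

Lemma op_degr h x e r : emb h x e -> orientation_preserving_at h x -> 0 < r < e ->
  degr h x r = 2 * pi.
Proof.
move=> he hop re; have e0 : 0 < e by case: he.
have [r' [re' [a [f [ca f0 ef ea]]]]] := near_right_ex e0 hop.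
rewrite (degr_rad he (circ_center x re) (circ_center x re')) /degr.
rewrite (ang_lift_on (a := a)) //; [by rewrite ea mulr1; ring | exact: ltW (twopi_gt0 R) |].
by move=> u _; exists (f u).
Qed.

Lemma degr_op h x e r : emb h x e -> 0 < r < e -> degr h x r = 2 * pi ->
  orientation_preserving_at h x.
Proof.
move=> he re hr; have e0 : 0 < e by case: he.
near=> r'; have re' : 0 < r' < e.
  by apply/andP; split; near: r'; [exact: nbhs_right_gt | exact: nbhs_right_lt].
have [||a [ca ha]] := @lift_line (fun u => h (polar x r' u)) (h x).
- apply: ctI => u; apply: (@cta_comp _ _ _ (fun u => polar x r' u) h); first exact: polar_cont.
  by case: he => _ ch _; apply/ch/circ_polar/circ_center.
- move=> u; apply: (emb_neq he); [exact: box_center | exact/circ_polar/circ_center |].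
  by apply: polar_neq; case/andP: re'.
have [f hf] := choice ha; exists a, f; split=> // [u|u|]; try by case: (hf u).
rewrite mulr1; have := degr_rad he (circ_center x re') (circ_center x re); rewrite hr.
by rewrite /degr (ang_lift_on (a := a)) //; [lra | exact: ltW (twopi_gt0 R)].
Unshelve. all: by end_near. Qed.

Lemma degr_comp h1 h2 x e e' r r' (k : int) : emb h1 x e -> emb h2 (h1 x) e' ->
  0 < r < e -> (forall y, box x e y -> box (h1 x) e' (h1 y)) -> 0 < r' < e' ->
  degr h1 x r = 2 * pi * k%:~R -> degr (h2 \o h1) x r = k%:~R * degr h2 (h1 x) r'.
Proof.
move=> he1 he2 re sub re' hk; have r0 : 0 < r by case/andP: re.
rewrite {1}/degr /=.
rewrite (@degr_mul h2 (h1 x) e' (h1 x) r' (fun u => h1 (polar x r u)) 0 (2 * pi) k) //.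
- exact: circ_center.
- exact: twopi_gt0.
- move=> u _; apply: (@cta_comp _ _ _ (polar x r) h1); first exact: polar_cont.
  by case: he1 => _ ch _; apply/ch/circ_polar/circ_center.
- by move=> u _; apply/sub/circ_polar/circ_center.
- move=> u _; apply: (emb_neq he1); [by apply: box_center; lra | exact/circ_polar/circ_center |].
  exact: polar_neq.
- by rewrite polar_02pi.
Qed.

Lemma emb_shrink h x e d : emb h x e -> 0 < d ->
  exists2 e' : R, 0 < e' <= e & forall y, box x e' y -> box (h x) d (h y).
Proof.
move=> [e0 ch _] d0.
have := ch x (box_center x e0) _ (box_nbhs (h x) d0).
move=> /nbhs_box[e1 e10 he1]; exists (Num.min e e1).
  by rewrite lt_min e0 e10 ge_min lexx.
by move=> y hy; apply: he1; apply: boxW hy; rewrite ge_min lexx orbT.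
Qed.

Lemma emb_comp h1 h2 x e e' : emb h1 x e -> emb h2 (h1 x) e' ->
  (forall y, box x e y -> box (h1 x) e' (h1 y)) -> emb (h2 \o h1) x e.
Proof.
move=> [e0 c1 i1] [e0' c2 i2] sub; split=> // [y hy|y y' hy hy' /= E].
  by apply: (@cta_comp _ _ _ h1 h2); [exact: c1 | exact/c2/sub].
by apply: i1 => //; apply: i2 => //; exact: sub.
Qed.

Lemma op_comp h1 h2 x e e' : emb h1 x e -> emb h2 (h1 x) e' ->
  orientation_preserving_at h1 x -> orientation_preserving_at h2 (h1 x) ->
  orientation_preserving_at (h2 \o h1) x.
Proof.
move=> he1 he2 o1 o2; have e0' : 0 < e' by case: he2.
have [d /andP[d0 de] sub] := emb_shrink he1 e0'.
have he1' : emb h1 x d by apply: emb_small he1 _; rewrite d0 de.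
have hd : 0 < d / 2 < d by lra.
have hd' : 0 < e' / 2 < e' by lra.
apply: (degr_op (emb_comp he1' he2 sub) hd).
rewrite (degr_comp (k := 1) he1' he2 hd sub hd'); first by rewrite (op_degr he2 o2 hd') mul1r.
by rewrite (op_degr he1' o1 hd) mulr1.
Qed.

Lemma op_near h h' x : (\forall y \near x, h y = h' y) ->
  orientation_preserving_at h x -> orientation_preserving_at h' x.
Proof.
move=> /nbhs_box[e e0 he] hop.
have hx : h x = h' x by apply/he/box_center.
near=> r; have re : 0 < r < e.
  by apply/andP; split; near: r; [exact: nbhs_right_gt | exact: nbhs_right_lt].
have : winding_number (fun u => h (polar x r u)) (h x) 1 by near: r.
rewrite hx; congr winding_number; apply/funext => u.
exact/he/circ_polar/circ_center.
Unshelve. all: by end_near. Qed.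

(** Displacements from [x] are turned by less than a right angle, so a small circle and its image
    have the same winding number. *)
Lemma op_dot h x e : emb h x e -> (forall y, box x e y -> y <> x -> 0 < dot y x (h y) (h x)) ->
  orientation_preserving_at h x.
Proof.
move=> he hd; have e0 : 0 < e by case: he.
have p0 := twopi_gt0 R.
have re : 0 < e / 2 < e by lra.
have r0 : 0 < e / 2 by lra.
apply: (degr_op he re); rewrite -(ang_polar x r0) /degr; apply/esym/ang_dot.
- exact: ltW.
- by move=> u _; exact: polar_cont.
- move=> u _; apply: (@cta_comp _ _ _ (polar x (e / 2)) h); first exact: polar_cont.
  by case: he => _ ch _; apply/ch/circ_polar/circ_center.
- by move=> u _; apply: hd; [exact/circ_polar/circ_center | exact: polar_neq].
- by rewrite polar_02pi.
- by rewrite polar_02pi.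
Qed.

End Orientation.

Section PlaneMaps.
Variable R : realType.
Implicit Types (h : R * R -> R * R) (x y p q : R * R) (e d r u v : R).

Lemma min_pos2 (a b : R) : 0 < a -> 0 < b ->
  [/\ 0 < Num.min a b, Num.min a b <= a & Num.min a b <= b].
Proof. by move=> a0 b0; split; case: (leP a b) => // /ltW. Qed.

Lemma pos_seg (F : R -> R) : (forall k : R, 0 <= k <= 1 -> cta F k) ->
  (forall k : R, 0 <= k <= 1 -> F k <> 0) -> 0 < F 0 -> 0 < F 1.
Proof.
move=> cF nF F0; rewrite -(@locconst R bool (fun k => 0 < F k) 0 1) ?ler01 //.
move=> k hk; case: (ltgtP (F k) 0) => [Fn|Fp|/(nF k hk)//].
  have cN : cta (fun v => - F v) k by apply: cta_opp; exact: cF.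
  have := cta_gt0 cN; rewrite oppr_gt0 => /(_ Fn).
  by apply: filterS => y hy; apply/negbTE; rewrite -leNgt; lra.
by have := cta_gt0 (cF k hk) Fp; apply: filterS => y ->.
Qed.

Lemma box_sign h x e (i : R * R -> R) : emb h x e ->
  (forall y, cta i y) ->
  forall y y', box x e y -> box x e y' ->
  (forall k : R, 0 <= k <= 1 -> i (h ((1 - k) * y.1 + k * y'.1, (1 - k) * y.2 + k * y'.2)) <> 0) ->
  0 < i (h y) -> 0 < i (h y').
Proof.
move=> [e0 ch _] ci y y' by_ by' ne.
have := @pos_seg (fun k => i (h ((1 - k) * y.1 + k * y'.1, (1 - k) * y.2 + k * y'.2))).
rewrite !subr0 !subrr !mul1r !mul0r !addr0 !add0r -!surjective_pairing; apply => //.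
move=> k hk.
apply: (@cta_comp _ _ _ (fun k : R => h ((1 - k) * y.1 + k * y'.1, (1 - k) * y.2 + k * y'.2)) i); last exact: ci.
apply: (@cta_comp _ _ _ (fun k : R => ((1 - k) * y.1 + k * y'.1, (1 - k) * y.2 + k * y'.2)) h).
  by ct.
exact/ch/box_conv.
Qed.

(** By injectivity the two axes cut the image as they cut the source, so [h] sends each open
    quadrant into its mirror image across the first axis. The image of the circle thus stays at an
    acute angle with the circle run backwards, whose degree is -1. *)
Lemma flip_degr h e d : emb h (0, 0) e -> 0 < d ->
  (forall v, `|v| < d -> h (v, 0) = (v, 0) /\ h (0, v) = (0, - v)) ->
  exists2 e' : R, 0 < e' & forall r, 0 < r < e' -> degr h (0, 0) r = - (2 * pi).
Proof.
move=> he d0 hax; have [e0 ch ih] := he.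
pose d' := Num.min d e.
have [d'0 d'd d'e] : [/\ 0 < d', d' <= d & d' <= e].
  exact: min_pos2.
have h0 : h (0, 0) = (0, 0) by have [|-> _] := hax 0; rewrite ?normr0.
have [e1 /andP[e10 e1e] sub] := emb_shrink he d'0; rewrite h0 in sub.
pose e' := Num.min e1 d'.
have [e'0 e'1 e'd] : [/\ 0 < e', e' <= e1 & e' <= d'].
  exact: min_pos2.
exists e' => // r re; have r0 : 0 < r by case/andP: re.
have bv1 v : `|v| < d' -> box (0, 0) e (v, 0).
  by move=> hv; split; rewrite /= subr0 ?normr0 //; apply: lt_le_trans d'e.
have bv2 v : `|v| < d' -> box (0, 0) e (0, v).
  by move=> hv; split; rewrite /= subr0 ?normr0 //; apply: lt_le_trans d'e.
have be y : box (0, 0) e' y -> box (0, 0) e y by apply: boxW; apply: le_trans e'd d'e.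
(* An image point on the second axis is already the image of a point of that axis. *)
have nz1 y : box (0, 0) e' y -> y.1 <> 0 -> (h y).1 <> 0.
  move=> hy ny Z; have [/= b1 b2] := sub y (boxW e'1 hy).
  rewrite !subr0 in b1 b2.
  have [|_ E] := hax (- (h y).2); first by rewrite normrN; apply: lt_le_trans d'd.
  apply: ny; suff -> : y = (0, - (h y).2) by [].
  by apply: ih; [exact: be | by apply: bv2; rewrite normrN | rewrite E opprK -Z -surjective_pairing].
have nz2 y : box (0, 0) e' y -> y.2 <> 0 -> (h y).2 <> 0.
  move=> hy ny Z; have [/= b1 b2] := sub y (boxW e'1 hy).
  rewrite !subr0 in b1 b2.
  have [|E _] := hax ((h y).1); first by apply: lt_le_trans d'd.
  apply: ny; suff -> : y = ((h y).1, 0) by [].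
  by apply: ih; [exact: be | by apply: bv1 | rewrite E -Z -surjective_pairing].
have he' : emb h (0, 0) e' by apply: emb_small he _; rewrite e'0 (le_trans e'd d'e).
have axb (y : R * R) : box (0, 0) e' y -> box (0, 0) e' (y.1, 0) /\ box (0, 0) e' (0, y.2).
  by move=> [/= b1 b2]; split; split; rewrite /= ?subr0 ?normr0 //; move: b1 b2; rewrite ?subr0.
have axh (y : R * R) : box (0, 0) e' y -> h (y.1, 0) = (y.1, 0) /\ h (0, y.2) = (0, - y.2).
  move=> [/= b1 b2]; rewrite !subr0 in b1 b2; split.
    by have [|-> //] := hax y.1; lra.
  by have [|_ -> //] := hax y.2; lra.
(* The sign is known at the projection of [y] on the axis and is kept along the segment from there
   to [y], where the coordinate does not vanish. *)
have s1 y : box (0, 0) e' y -> 0 < y.1 -> 0 < (h y).1.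
  move=> hy y1; apply: (@box_sign h (0, 0) e' (fun z => z.1) he' _ (y.1, 0) y) => //.
  - by move=> z; ct.
  - by case: (axb y hy).
  - move=> k hk; apply: nz1; last by rewrite /=; lra.
    by apply: box_conv => //; case: (axb y hy).
  - by have [-> _] := axh y hy.
have s1' y : box (0, 0) e' y -> y.1 < 0 -> (h y).1 < 0.
  move=> hy y1; rewrite -oppr_gt0.
  apply: (@box_sign h (0, 0) e' (fun z => - z.1) he' _ (y.1, 0) y) => //.
  - by move=> z; ct.
  - by case: (axb y hy).
  - move=> k hk /eqP; rewrite oppr_eq0 => /eqP; apply: nz1; last by rewrite /=; lra.
    by apply: box_conv => //; case: (axb y hy).
  - by have [-> _] := axh y hy; rewrite /=; lra.
have s2 y : box (0, 0) e' y -> 0 < y.2 -> (h y).2 < 0.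
  move=> hy y1; rewrite -oppr_gt0.
  apply: (@box_sign h (0, 0) e' (fun z => - z.2) he' _ (0, y.2) y) => //.
  - by move=> z; ct.
  - by case: (axb y hy).
  - move=> k hk /eqP; rewrite oppr_eq0 => /eqP; apply: nz2; last by rewrite /=; lra.
    by apply: box_conv => //; case: (axb y hy).
  - by have [_ ->] := axh y hy; rewrite /=; lra.
have s2' y : box (0, 0) e' y -> y.2 < 0 -> 0 < (h y).2.
  move=> hy y1; apply: (@box_sign h (0, 0) e' (fun z => z.2) he' _ (0, y.2) y) => //.
  - by move=> z; ct.
  - by case: (axb y hy).
  - move=> k hk; apply: nz2; last by rewrite /=; lra.
    by apply: box_conv => //; case: (axb y hy).
  - by have [_ ->] := axh y hy; rewrite /=; lra.
have p0 := twopi_gt0 R.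
have -> : - (2 * pi) = ang (fun u => polar (0, 0) r (- u)) 0 (2 * pi) (0, 0) :> R.
  rewrite (ang_lift_on (a := fun u => - u)); [by ring | exact: ltW | by ct |].
  by move=> u _; exists r.
rewrite /degr h0; apply: ang_dot.
- exact: ltW.
- move=> u _; apply: (@cta_comp _ _ _ (polar (0, 0) r) h); first exact: polar_cont.
  by case: he' => _ ch' _; apply/ch'/circ_polar/circ_center.
- by move=> u _; apply: (@cta_comp _ _ _ (fun u => - u) (polar (0, 0) r)); [by ct | exact: polar_cont].
- move=> u _; have bp : box (0, 0) e' (polar (0, 0) r u) by exact/circ_polar/circ_center.
  rewrite /dot /= !subr0 !add0r cosN sinN; have := cos2Dsin2 u.
  have /= := s1 _ bp; have /= := s1' _ bp; have /= := s2 _ bp; have /= := s2' _ bp.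
  rewrite !add0r !pmulr_rgt0 // !pmulr_rlt0 //.
  set C := cos u; set S := sin u; set A := (h _).1; set B := (h _).2.
  move=> i4 i3 i2 i1 CS.
  have q1 : 0 <= A * C /\ (C != 0 -> 0 < A * C).
    case: (ltgtP C 0) => [l|l|->]; last by rewrite mulr0.
      by have := i2 l => a; split=> [|_]; [apply: ltW|]; rewrite nmulr_rgt0.
    by have := i1 l => a; split=> [|_]; [apply: ltW|]; exact: mulr_gt0.
  have q2 : 0 <= - (B * S) /\ (S != 0 -> 0 < - (B * S)).
    case: (ltgtP S 0) => [l|l|->]; last by rewrite mulr0 oppr0.
      have := i4 l => a; have : B * S < 0 by rewrite pmulr_rlt0.
      by split=> [|_]; lra.
    have := i3 l => a; have : B * S < 0 by rewrite pmulr_llt0.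
    by split=> [|_]; lra.
  have -> : A * (r * C) + B * (r * - S) = r * (A * C + - (B * S)) by ring.
  apply: mulr_gt0 => //; case: q1 q2 => [a1 a2] [b1 b2].
  (* Both summands are nonnegative, and one is positive since cosine and sine do not vanish
     together. *)
  case: (eqVneq C 0) => [C0|/a2]; last lra.
  by have : S != 0; [apply/eqP => S0; move: CS; rewrite C0 S0; lra | move=> /b2; lra].
- by rewrite polar_02pi.
- have -> : polar (0, 0) r (- (2 * pi)) = polar (0, 0) r (- (2 * pi) + 2 * pi) by rewrite polar_2pi.
  by rewrite addNr oppr0.
Qed.

Lemma op_rot (B : R * R -> R * R) (k : R) x :
  (forall r u, B (polar x r u) = polar (B x) r (u + k)) -> orientation_preserving_at B x.
Proof.
move=> h; near=> r; exists (fun u => u + k), (fun=> r); split.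
- by ct.
- by move=> u; near: r; exact: nbhs_right_gt.
- by move=> u; rewrite h.
- by rewrite mulr1; ring.
Unshelve. all: by end_near. Qed.

End PlaneMaps.

(** * Degrees of transition maps and signs of crossings *)

Section Charts.
Variables (R : realType) (T : topologicalType) (O : set (chart R T)).
Hypothesis hO : oriented_atlas O.
Implicit Types (f g : chart R T) (p : T) (e d r s t u v : R).

Definition tr f g : R * R -> R * R := to_plane g \o of_plane f.

Lemma tr_near f (A : set T) p : dom f p -> open A -> A p ->
  \forall y \near to_plane f p, cod f y /\ A (of_plane f y).
Proof.
move=> fp oA Ap; have cp := to_plane_cod fp.
apply: filterI; first by apply: open_nbhs_nbhs; split=> //; exact: cod_open.
have := of_plane_continuous cp; apply; rewrite to_planeK //.
exact: open_nbhs_nbhs.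
Qed.

Lemma tr_emb f g p : dom f p -> dom g p -> exists2 e, emb (tr f g) (to_plane f p) e &
  forall y, box (to_plane f p) e y -> cod f y /\ dom g (of_plane f y).
Proof.
move=> fp gp.
have [e e0 he] := nbhs_box (tr_near fp (@dom_open _ _ g) gp).
exists e => //; split=> // [y /he[cy dy]|y y' /he[cy dy] /he[cy' dy'] E].
  apply: (@cta_comp _ _ _ (of_plane f) (to_plane g)); first exact: of_plane_continuous.
  exact: to_plane_continuous.
have := congr1 (of_plane g) E; rewrite /tr /= !to_planeK // => /(congr1 (to_plane f)).
by rewrite !of_planeK.
Qed.

Lemma tr_comp_near f g k p : dom f p -> dom g p -> dom k p ->
  \forall y \near to_plane f p, (tr g k \o tr f g) y = tr f k y.
Proof.
move=> fp gp kp; have := tr_near fp (@dom_open _ _ g) gp.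
by apply: filterS => y [cy dy]; rewrite /tr /= to_planeK.
Qed.

Lemma trE f g p : dom f p -> tr f g (to_plane f p) = to_plane g p.
Proof. by move=> fp; rewrite /tr /= to_planeK. Qed.

Lemma degr_eq (h h' : R * R -> R * R) x e r : (forall y, box x e y -> h y = h' y) -> 0 < r < e ->
  degr h x r = degr h' x r.
Proof.
move=> E re; rewrite /degr (E x); last by apply: box_center; lra.
apply: ang_eq; first exact: ltW (twopi_gt0 R).
by move=> u _; apply/E/circ_polar/circ_center.
Qed.

Lemma tr_degr_comp f g k p (m : int) e1 e2 : dom f p -> dom g p -> dom k p ->
  emb (tr f g) (to_plane f p) e1 -> emb (tr g k) (to_plane g p) e2 ->
  (forall r, 0 < r < e1 -> degr (tr f g) (to_plane f p) r = 2 * pi * m%:~R) ->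
  forall r' e3 r'', 0 < r' < e2 -> emb (tr f k) (to_plane f p) e3 -> 0 < r'' < e3 ->
  degr (tr f k) (to_plane f p) r'' = m%:~R * degr (tr g k) (to_plane g p) r'.
Proof.
move=> fp gp kp E1 E2 hd r' e3 r'' hr' E3 hr''.
have e20 : 0 < e2 by case: E2.
have [d1 /andP[d10 d1e] sub] := emb_shrink E1 e20.
rewrite trE // in sub.
have [d2 d20 hd2] := nbhs_box (tr_comp_near fp gp kp).
have e30 : 0 < e3 by case: E3.
(* The composed and the direct transition agree only near [p], so both degrees are computed on a
   circle small enough for all three maps. *)
pose d := Num.min d1 (Num.min d2 e3).
have [dp [dd1 dd2 dd3]] : 0 < d /\ [/\ d <= d1, d <= d2 & d <= e3].
  have [a1 a2 a3] := min_pos2 d20 e30; have [b1 b2 b3] := min_pos2 d10 a1.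
  by split=> //; split=> //; apply: le_trans b3 _.
have hr : 0 < d / 2 < d by lra.
have hr3 : 0 < d / 2 < e3 by lra.
rewrite (degr_rad E3 (circ_center _ hr'') (circ_center _ hr3)).
rewrite -(@degr_eq (tr g k \o tr f g) _ _ d) //; last first.
  by move=> y by_; apply: hd2; exact: boxW by_.
have E1' : emb (tr f g) (to_plane f p) d by apply: emb_small E1 _; lra.
rewrite (@degr_comp _ (tr f g) (tr g k) _ d e2 (d / 2) r' m) //.
- by rewrite trE.
- by rewrite trE.
- by move=> y by_; rewrite trE //; apply: sub; exact: boxW by_.
- by apply: hd; lra.
Qed.

Lemma atlas_at p : exists2 g, O g & dom g p.
Proof. by case: hO. Qed.

Lemma atlas_positive g : O g -> positive_chart O g.
Proof. by case: hO => _; exact. Qed.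

Lemma positive_degr f g p e r : positive_chart O f -> O g -> dom f p -> dom g p ->
  emb (tr f g) (to_plane f p) e -> 0 < r < e -> degr (tr f g) (to_plane f p) r = 2 * pi * 1%:~R.
Proof. by move=> pf Og fp gp he hr; rewrite mulr1; apply: (op_degr he) hr; exact: pf. Qed.

(** Two adapted charts with opposite signs would differ by a transition fixing one axis and
    reversing the other, of degree -1. Through a chart of the atlas, with respect to which both are
    positive, its degree is 1. *)
Lemma crossing_sign b b' (c d : R -> T) s t : continuous c -> continuous d ->
  crossing O b c d s t -> crossing O b' c d s t -> b = b'.
Proof.
move=> cc cd [cst [f [pf fp hf]]] [_ [f' [pf' fp' hf']]].
apply: contrapT => nb; have [g Og gp] := atlas_at (c s).
have f0 : to_plane f (c s) = (0, 0).
  by have := nbhs_singleton hf; rewrite /= addr0 => -[].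
have f'0 : to_plane f' (c s) = (0, 0).
  by have := nbhs_singleton hf'; rewrite /= addr0 => -[].
have [e he _] := tr_emb fp fp'; have [e1 he1 _] := tr_emb fp' gp; have [e2 he2 _] := tr_emb fp gp.
have nd (k : R -> T) (w : R) (a : chart R T) : continuous k -> dom a (k w) -> \forall u \near (0 : R), dom a (k (w + u)).
  move=> ck aw; have := @cta_comp _ _ _ (fun u => w + u) k 0.
  move=> /(_ _ _) H; have /= := H _ (ck _); apply; first by ct.
  by rewrite addr0; apply: open_nbhs_nbhs; split=> //; exact: dom_open.
have : \forall u \near (0 : R), tr f f' (u, 0) = (u, 0) /\
    tr f f' (0, if b then - u else u) = (0, if b' then - u else u).
  near=> u.
  have [a1 a2] : to_plane f (c (s + u)) = (u, 0) /\ to_plane f (d (t + u)) = (0, if b then - u else u) by near: u.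
  have [b1 b2] : to_plane f' (c (s + u)) = (u, 0) /\ to_plane f' (d (t + u)) = (0, if b' then - u else u) by near: u.
  rewrite -{1}a1 -a2 -{1}b1 -b2 /tr /= !to_planeK //.
  - by near: u; apply: nd => //; rewrite -cst.
  - by near: u; apply: nd.
move=> /nbhs_ballP[/= d0 d00 hd].
have hd' v : `|v| < d0 -> tr f f' (v, 0) = (v, 0) /\ tr f f' (0, v) = (0, - v).
  move=> hv; have := hd v; rewrite /ball /= sub0r normrN => /(_ hv) [-> _]; split=> //.
  case: b b' nb hd {hf hf'} => -[] // _ hd.
    have := hd (- v); rewrite /ball /= sub0r opprK => /(_ hv) [_].
    by [].
  have := hd v; rewrite /ball /= sub0r normrN => /(_ hv) [_].
  by [].
rewrite f0 in he; have [e' e'0 hflip] := flip_degr he d00 hd'.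
have e0 : 0 < e by case: he.
have h1 r : 0 < r < e -> degr (tr f f') (to_plane f (c s)) r = 2 * pi * (-1)%:~R.
  move=> re; pose m := Num.min e e'.
  have [m0 m1 m2] : [/\ 0 < m, m <= e & m <= e'].
    exact: min_pos2.
  have hm : 0 < m / 2 < e by lra.
  rewrite f0 (degr_rad he (circ_center _ re) (circ_center _ hm)) hflip; last lra.
  by rewrite mulrNz; ring.
rewrite -f0 in he; have e10 : 0 < e1 by case: he1. 
have e20 : 0 < e2 by case: he2.
have r1 : 0 < e1 / 2 < e1 by lra.
have r2 : 0 < e2 / 2 < e2 by lra.
have := tr_degr_comp fp fp' gp he he1 h1 r1 he2 r2.
rewrite (positive_degr pf Og fp gp he2 r2) (positive_degr pf' Og fp' gp he1 r1).
by rewrite mulrNz; have := twopi_gt0 R; lra.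
Unshelve. all: by end_near. Qed.

Section CompChart.
Variables (f : chart R T) (A B : R * R -> R * R).
Hypotheses (cA : continuous A) (cB : continuous B).
Hypotheses (AB : cancel A B) (BA : cancel B A).

Definition comp_chart : chart R T.
Proof.
refine (@Chart R T (dom f) (B @^-1` cod f) (A \o to_plane f) (of_plane f \o B) _ _ _ _ _ _ _ _).
- exact: dom_open.
- by apply: open_comp; [move=> *; exact: cB | exact: cod_open].
- by move=> p fp; rewrite /= AB; exact: to_plane_cod.
- by move=> x; exact: of_plane_dom.
- by move=> p fp; rewrite /= AB; exact: to_planeK.
- by move=> x cx; rewrite /= of_planeK.
- move=> p fp; apply: (@cta_comp _ _ _ (to_plane f) A); last exact: cA.
  exact: to_plane_continuous.
- move=> x cx; apply: (@cta_comp _ _ _ B (of_plane f)); first exact: cB.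
  exact: of_plane_continuous.
Defined.

Lemma comp_chart_positive : positive_chart O f -> (forall x, orientation_preserving_at B x) ->
  positive_chart O comp_chart.
Proof.
move=> pf oB g Og p /= fp gp.
have hB : emb B (A (to_plane f p)) 1.
  by split=> // [y _|y y' _ _ E]; [exact: cB | exact: can_inj BA _ _ E].
have [e he _] := tr_emb fp gp.
apply: (@op_comp _ B (tr f g) _ 1 e) => //; first by rewrite AB.
by rewrite AB; exact: pf.
Qed.

End CompChart.

(** The adapted chart is turned by a quarter turn, in the direction that makes [d] run rightwards
    along the first axis. *)
Lemma crossing_sym b (c d : R -> T) s t : crossing O b c d s t -> crossing O (~~ b) d c t s.
Proof.
move=> [cst [f [pf fp hf]]]; split=> //.
pose A (z : R * R) := if b then (- z.2, z.1) else (z.2, - z.1).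
pose B (z : R * R) := if b then (z.2, - z.1) else (- z.2, z.1).
have AB : cancel A B by move=> z; rewrite /A /B [RHS]surjective_pairing; case: (b) => /=; rewrite ?opprK.
have BA : cancel B A by move=> z; rewrite /A /B [RHS]surjective_pairing; case: (b) => /=; rewrite ?opprK.
have cA : continuous A by rewrite /A; case: (b); ct.
have cB : continuous B by rewrite /B; case: (b); ct.
exists (comp_chart f cA cB AB BA); split=> //=.
- apply: comp_chart_positive => // x.
  apply: (@op_rot _ B (if b then - (pi / 2) else pi / 2)) => r u; rewrite /B /polar.
  case: (b) => /=.
    by rewrite cosBpihalf sinBpihalf; congr (_, _); ring.
  by rewrite cosDpihalf sinDpihalf; congr (_, _); ring.
- by rewrite -cst.
- apply: filterS hf => u [-> ->]; rewrite /A.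
  by case: (b) => /=; rewrite ?opprK ?oppr0.
Qed.

Section Sign.
Variable k : chart R T.
Hypothesis kT : cod k = setT.

(* The plane chart [k] preserves ([m = 1]) or reverses ([m = -1]) the orientation [O]
   at the point of coordinates [y]. *)
Definition signed (y : R * R) (m : int) : Prop :=
  forall f e r, positive_chart O f -> dom f (of_plane k y) ->
    emb (tr f k) (to_plane f (of_plane k y)) e -> 0 < r < e ->
    degr (tr f k) (to_plane f (of_plane k y)) r = 2 * pi * m%:~R.

Lemma kdom y : dom k (of_plane k y).
Proof. by apply: of_plane_dom; rewrite kT. Qed.

Lemma signed_atlas g y m e r : O g -> dom g (of_plane k y) ->
  emb (tr g k) (to_plane g (of_plane k y)) e -> 0 < r < e ->
  degr (tr g k) (to_plane g (of_plane k y)) r = 2 * pi * m%:~R -> signed y m.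
Proof.
move=> Og gp he hr hm f e' r' pf fp he' hr'.
have [e1 he1 _] := tr_emb fp gp.
rewrite (tr_degr_comp (m := 1) fp gp (kdom y) he1 he _ hr he' hr'); first by rewrite mulr1z mul1r.
by move=> r1 hr1; exact: (positive_degr pf Og fp gp he1 hr1).
Qed.

(** The transition to [k] and the transition back have integer degrees whose product is 1. *)
Lemma signed_ex y : exists2 m : int, (m = 1 \/ m = -1) & signed y m.
Proof.
have [g Og gp] := atlas_at (of_plane k y); have kp := kdom y.
have [e he hb] := tr_emb gp kp; have [e' he' hb'] := tr_emb kp gp.
have [e0 ce ie] := he; have [e0' ce' ie'] := he'.
have r1 : 0 < e / 2 < e by lra.
have r2 : 0 < e' / 2 < e' by lra.
have int_deg (h : R * R -> R * R) x d r : emb h x d -> 0 < r < d -> exists m : int, degr h x r = 2 * pi * m%:~R.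
  move=> hd rd; apply: ang_closed; first exact: ltW (twopi_gt0 R).
  - move=> u _; apply: (@cta_comp _ _ _ (polar x r) h); first exact: polar_cont.
    by case: hd => _ ch _; apply/ch/circ_polar/circ_center.
  - move=> u _; apply: (emb_neq hd); [by apply: box_center; lra | exact/circ_polar/circ_center |].
    by apply: polar_neq; lra.
  - by rewrite polar_02pi.
have [m hm] := int_deg _ _ _ _ he r1; have [m' hm'] := int_deg _ _ _ _ he' r2.
have mm : m * m' = 1.
  have hm1 r : 0 < r < e -> degr (tr g k) (to_plane g (of_plane k y)) r = 2 * pi * m%:~R.
    by move=> hr; rewrite (degr_rad he (circ_center _ hr) (circ_center _ r1)).
  have [e3 he3 hb3] := tr_emb gp gp; have [e30 _ _] := he3.
  have r3 : 0 < e3 / 2 < e3 by lra.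
  have := tr_degr_comp gp kp gp he he' hm1 r2 he3 r3.
  rewrite hm' (positive_degr (atlas_positive Og) Og gp gp he3 r3) => E.
  have : (1%:~R : R) = (m * m')%:~R.
    have := twopi_gt0 R => p0; rewrite intrM; apply: (mulfI (lt0r_neq0 p0)).
    by rewrite E; ring.
  by move=> /intr_inj <-.
exists m; last exact: signed_atlas Og gp he r1 hm.
have : `|(m * m')%R|%N = 1%N by rewrite mm.
rewrite abszM => /eqP; rewrite muln_eq1 => /andP[/eqP h _].
by case: m h {hm mm} => -[|[|n]] //= _; [left|right].
Qed.

Lemma signed_uniq y m m' : signed y m -> signed y m' -> m = m'.
Proof.
move=> h h'; have [g Og gp] := atlas_at (of_plane k y); have kp := kdom y.
have [e he _] := tr_emb gp kp; have [e0 _ _] := he.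
have r1 : 0 < e / 2 < e by lra.
have := h g e _ (atlas_positive Og) gp he r1; rewrite (h' g e _ (atlas_positive Og) gp he r1).
by move=> /(mulfI (lt0r_neq0 (twopi_gt0 R)))/intr_inj.
Qed.

Lemma signed_near y m : signed y m -> \forall y' \near y, signed y' m.
Proof.
move=> h; have [g Og gp] := atlas_at (of_plane k y); have kp := kdom y.
have [e he hb] := tr_emb gp kp; have [e0 ce ie] := he.
have e40 : 0 < e / 4 by lra.
have r1 : 0 < e / 4 < e by lra.
have n1 : \forall y' \near y, dom g (of_plane k y').
  have := of_plane_continuous (c := k) (x := y); rewrite kT => /(_ I); apply.
  by apply: open_nbhs_nbhs; split=> //; exact: dom_open.
have n2 : \forall y' \near y, box (to_plane g (of_plane k y)) (e / 4) (to_plane g (of_plane k y')).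
  have H : cta (fun y' => to_plane g (of_plane k y')) y.
    apply: (@cta_comp _ _ _ (of_plane k) (to_plane g)).
      by apply: of_plane_continuous; rewrite kT.
    exact: to_plane_continuous.
  exact: H _ (box_nbhs _ e40).
near=> y'.
have gp' : dom g (of_plane k y') by near: y'.
have [b1 b2] : box (to_plane g (of_plane k y)) (e / 4) (to_plane g (of_plane k y')) by near: y'.
have he' : emb (tr g k) (to_plane g (of_plane k y')) (e / 2).
  by apply: (embW he); lra.
apply: (signed_atlas (r := e / 4) Og gp' he'); first lra.
rewrite -(h g e (e / 4) (atlas_positive Og) gp he r1).
by apply: (degr_const he); split; rewrite ?subrr ?normr0; lra.
Unshelve. all: by end_near. Qed.

(** The sign is locally constant, and every point of the plane is joined to the origin by a
    segment. *)
Lemma signed_const : exists2 m : int, (m = 1 \/ m = -1) & forall y, signed y m.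
Proof.
have [m hm h] := signed_ex (0, 0); exists m => // y.
pose g (u : R) : R * R := (u * y.1, u * y.2).
have e0 : g 0 = (0, 0) by rewrite /g !mul0r.
have e1 : g 1 = y by rewrite /g !mul1r -surjective_pairing.
rewrite -e1 -(@locconst R Prop (fun u => signed (g u) m) 0 1) ?ler01 //; first by rewrite e0.
move=> u _; have cg : cta g u by rewrite /g; ct.
have [m' hm' h'] := signed_ex (g u).
have hn : \forall v \near u, signed (g v) m' := cg _ (signed_near h').
apply: filterS hn => v hv; apply/propext; split => q.
  by rewrite (signed_uniq q hv).
by rewrite (signed_uniq q h').
Qed.

End Sign.

End Charts.

(** * Jordan curves *)

Section ArcSep.
Variable R : realType.
Implicit Types (c : R -> R * R) (x y z p q : R * R) (e r s t u v : R).

Lemma cta_if (X Y : topologicalType) (U : set X) (G1 G2 : X -> Y) (z : X) :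
  cta G1 z -> cta G2 z -> G1 z = G2 z ->
  cta (fun w : X => if `[< U w >] then G1 w else G2 w) z.
Proof.
move=> c1 c2 e B; rewrite /= => hB.
have n1 : nbhs (G1 z) B by move: hB; rewrite -e if_same.
have n2 : nbhs (G2 z) B by rewrite -e.
have m1 : \forall w \near z, B (G1 w) := c1 _ n1.
have m2 : \forall w \near z, B (G2 w) := c2 _ n2.
by apply: filterS2 m1 m2 => w b1 b2 /=; case: ifP.
Qed.

Lemma plane_hausdorff : hausdorff_space (R * R)%type.
Proof. exact: norm_hausdorff. Qed.

Lemma arc_compact c s t : continuous c -> compact [set c u | u in `[s, t]%classic].
Proof.
move=> cc; apply: continuous_compact; last exact: segment_compact.
exact: continuous_subspaceT.
Qed.

Lemma arc_closed c s t : continuous c -> closed [set c u | u in `[s, t]%classic].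
Proof. by move=> cc; apply: compact_closed; [exact: plane_hausdorff | exact: arc_compact]. Qed.

(** The angle, transported to the arc by its parametrization, is continuous there because the arc is
    compact; Tietze's theorem extends it to the plane. *)
Lemma arc_angle c s t x : s <= t -> continuous c ->
  (forall u v, s <= u <= t -> s <= v <= t -> c u = c v -> u = v) ->
  (forall u, s <= u <= t -> c u <> x) ->
  exists2 Th : R * R -> R, continuous Th & forall u, s <= u <= t ->
    exists r, 0 < r /\ c u = polar x r (Th (c u)).
Proof.
move=> st cc ic av.
have [|a [ca _ ha]] := @ang_ex R c x s t st _ av; first by move=> u _; exact: cc.
pose A := [set c u | u in `[s, t]%classic].
pose th z : R := a (xget s [set u | s <= u <= t /\ c u = z]).
have thE u : s <= u <= t -> th (c u) = a u.
  move=> ui; congr a; apply: (@xget_unique _ _ [set v | _]) => //= v [vi /ic e].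
  by apply: e.
have clA : closed A by exact: arc_closed.
have [M M0 hM] : exists2 M, 0 < M & forall z, A z -> `|th z| <= M.
  have [m1 _ h1] := EVT_max st (cont_within ca).
  have [m2 _ h2] := EVT_min st (cont_within ca).
  exists (`|a m1| + `|a m2| + 1); first by have := normr_ge0 (a m1); have := normr_ge0 (a m2); lra.
  move=> _ [u /= ui <-]; have ui' : s <= u <= t by rewrite in_itv in ui.
  rewrite thE // ler_norml; have := h1 u ui; have := h2 u ui.
  have := ler_norm (a m1); have := ler_norm (- a m2); rewrite normrN.
  by have := normr_ge0 (a m1); have := normr_ge0 (a m2); lra.
(* Preimages of closed sets are images under [c] of compact sets of times, hence closed. *)
have cth : {within A, continuous (th : R * R -> R^o)}.
  apply/continuous_closedP => C clC.
  apply/closed_subspaceP; exists [set c u | u in (`[s, t]%classic `&` a @^-1` C)].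
    apply: compact_closed; first exact: plane_hausdorff.
    apply: continuous_compact; first exact: continuous_subspaceT.
    apply: (subclosed_compact _ (@segment_compact R s t)); last exact: subIsetl.
    apply: closedI; first exact: interval_closed.
    by have /continuous_closedP := ca; apply.
  apply/seteqP; split=> z.
    move=> [[u [/= ui Cu] <-] Az]; split=> //; change (C (th (c u))); by rewrite thE.
  move=> [Cz' [u /= ui e]]; have Cz : C (th z) := Cz'; split; last by exists u.
  exists u => //; split=> //=; by move: Cz; rewrite -e thE.
have [Th [e1 cTh _]] := continuous_bounded_extension pseudometric_normal clA M0 cth hM.
exists Th => // u ui; rewrite -(e1 (c u)); last by rewrite inE; exists u => //=; rewrite in_itv.
by rewrite thE //; exact: ha.
Qed.

(* The angle seen from [x] extends from the arc to a continuous function, so a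
   bounded component [U] of the complement containing [x] would give a nowhere
   vanishing field, equal to [z - x] outside of [U]. *)
Lemma arc_no_bounded_component c s t (U : set (R * R)) (M : R) x : s <= t -> continuous c ->
  (forall u v, s <= u <= t -> s <= v <= t -> c u = c v -> u = v) ->
  open U -> (forall z, U z -> `|z.1| < M /\ `|z.2| < M) ->
  (forall z, closure U z -> U z \/ exists2 u, s <= u <= t & z = c u) ->
  (forall u, s <= u <= t -> ~ U (c u)) -> ~ U x.
Proof.
move=> st cc ic oU bU clU dU Ux.
have avx u : s <= u <= t -> c u <> x by move=> ui e; apply: (dU u ui); rewrite e.
have [Th cTh hTh] := arc_angle st cc ic avx.
pose N z : R := Num.sqrt (dot z x z x).
pose G1 z : R * R := (cos (Th z), sin (Th z)).
pose G2 z : R * R := ((z.1 - x.1) / N z, (z.2 - x.2) / N z).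
pose F z : R * R := if `[< U z >] then G1 z else G2 z.
have N0 z : z <> x -> 0 < N z by move=> nz; rewrite sqrtr_gt0; exact: dot_gt0.
have cG1 z : cta G1 z by rewrite /G1; ct.
have cG2 z : z <> x -> cta G2 z.
  by move=> nz; have Nz := N0 z nz; rewrite /G2 /N /dot; ct; rewrite gt_eqF.
have G2polar r u : 0 < r -> G2 (polar x r u) = (cos u, sin u).
  move=> r0; rewrite /G2.
  have -> : N (polar x r u) = r.
    rewrite /N /dot /polar /=; apply/eqP.
    rewrite -(eqrXn2 (n := 2)) ?sqrtr_ge0 ?ltW // sqr_sqrtr.
      by apply/eqP; rewrite -[RHS]mulr1 -(cos2Dsin2 u); ring.
    by rewrite -!expr2 addr_ge0 ?sqr_ge0.
  by rewrite /polar /=; congr (_, _); field; rewrite gt_eqF.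
have cF z : cta F z.
  have [Uz|nUz] := pselect (U z).
    apply: (@cta_near _ _ G1) => //; have : nbhs z U by apply: open_nbhs_nbhs.
    by apply: filterS => y Uy; rewrite /F; case: asboolP.
  have nz : z <> x by move=> e; apply: nUz; rewrite e.
  have [cUz|ncUz] := pselect (closure U z).
    apply: cta_if; [exact: cG1 | exact: cG2 |].
    have [//|[u ui e]] := clU z cUz.
    have [r [r0 er]] := hTh u ui.
    by rewrite e er G2polar // -er.
  apply: (@cta_near _ _ G2); last exact: cG2.
  have : nbhs z (~` closure U) by apply: open_nbhs_nbhs; split=> //; exact/closed_openC/closed_closure.
  apply: filterS => y nU; rewrite /F; case: asboolP => // Uy.
  by case: nU; exact: subset_closure.
have unit_neq (w : R) : (cos w, sin w) <> (0, 0) :> R * R.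
  by move=> [h1 h2]; have := cos2Dsin2 w; rewrite h1 h2; lra.
have F0 z : F z <> (0, 0).
  rewrite /F; case: asboolP => [_|nUz]; first exact: unit_neq.
  have nz : z <> x by move=> e; apply: nUz; rewrite e.
  by have [r [a [r0 ->]]] := polar_ex nz; rewrite G2polar.
have [x1 x2] := bU x Ux.
have M0 : 0 < M by apply: le_lt_trans x1.
have p0 := twopi_gt0 R.
have := @ang_homotopy R (fun k u => F (polar x (k * (3 * M)) u)) (fun=> (0, 0)) 0 (2 * pi) (ltW p0).
rewrite (@ang_const _ (fun u => F (polar x (0 * (3 * M)) u))); last 3 first.
- exact: ltW.
- by move=> u _; rewrite /polar !mul0r.
- exact: F0.
rewrite (@ang_eq _ (fun u => F (polar x (1 * (3 * M)) u)) (polar (0, 0) 1)); last 2 first.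
- exact: ltW.
- move=> u _; rewrite mul1r /F.
  (* The coordinates of a difference of two points of [U] are below [2 * M], so its squared length
     is below [8 * M ^+ 2]; the circle of radius [3 * M] around [x] therefore misses [U]. *)
  have M30 : 0 < 3 * M by lra.
  case: asboolP => [/bU|_]; last by rewrite G2polar // /polar !mul1r !add0r.
  rewrite /polar /= => -[h1 h2]; exfalso.
  have := cos2Dsin2 u; move: h1 h2 x1 x2; rewrite !ltr_norml.
  set C := cos u; set S := sin u => /andP[a1 a2] /andP[a3 a4] /andP[a5 a6] /andP[a7 a8] CS.
  have q1 : (3 * M * C) ^+ 2 < (2 * M) ^+ 2.
    by rewrite -ltr_sqrt ?sqrtr_sqr; [|nra]; rewrite ltr_norml gtr0_norm; [lra|lra].
  have q2 : (3 * M * S) ^+ 2 < (2 * M) ^+ 2.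
    by rewrite -ltr_sqrt ?sqrtr_sqr; [|nra]; rewrite ltr_norml gtr0_norm; [lra|lra].
  have q3 : (3 * M * C) ^+ 2 + (3 * M * S) ^+ 2 = 9 * M ^+ 2.
    by have -> : 9 * M ^+ 2 = 9 * M ^+ 2 * (C ^+ 2 + S ^+ 2); [rewrite CS mulr1 | ring].
  have : 0 < M ^+ 2 by rewrite exprn_gt0.
  have : (2 * M) ^+ 2 = 4 * M ^+ 2 by ring.
  by move=> e4 e5; lra.
rewrite ang_polar // => H.
suff : 0 = 2 * pi :> R by lra.
apply: H.
- move=> k u _ _; apply: (@cta_comp _ _ _ (fun z : R * R => polar x (z.1 * (3 * M)) z.2) F) => //.
  by rewrite /polar; ct.
- by ct.
- by move=> *; exact: F0.
- by left=> k _; rewrite polar_02pi.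
Qed.

End ArcSep.

(** * Winding numbers on the two sides of a Jordan curve *)

Section Jordan.
Variables (R : realType) (c : R -> R * R).
Implicit Types (h : R * R -> R * R) (x y z p q : R * R) (e d r s t u v : R) (m : int).
Hypothesis jc : pseudocircle c.

Let cc : continuous c. Proof. by case: jc. Qed.

Lemma jordan_per u (k : int) : c (u + k%:~R) = c u.
Proof. by case: jc => _ /(_ (u + k%:~R) u)[_]; apply; rewrite addrAC subrr add0r intr_int. Qed.

Lemma jordan_per1 u : c (u + 1) = c u.
Proof. exact: (jordan_per u 1). Qed.

Lemma jordan_inj u v : c u = c v -> exists k : int, u = v + k%:~R.
Proof. by case: jc => _ /(_ u v)[h _] /h /intrP[k e]; exists k; lra. Qed.

Lemma jordan_inj_lt u v : c u = c v -> `|u - v| < 1 -> u = v.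
Proof.
move=> /jordan_inj[k ->]; rewrite addrAC subrr add0r -intr_norm -[1]/(1%:~R) ltr_int => h.
by have -> : k = 0; [lia | rewrite addr0].
Qed.

Definition wnd p : R := ang c 0 1 p.

Lemma wnd_start s p : (forall u, c u <> p) -> ang c s (s + 1) p = wnd p.
Proof.
move=> av; have -> : ang c s (s + 1) p = ang (fun u => c (u + s)) 0 1 p.
  by rewrite ang_shift ?ler01 // add0r [1 + s]addrC.
have := @ang_homotopy R (fun k u => c (u + k * s)) (fun=> p) 0 1 ler01.
rewrite (@ang_eq _ (fun u => c (u + 0 * s)) c) ?ler01 // => [|u _]; last by rewrite mul0r addr0.
rewrite (@ang_eq _ (fun u => c (u + 1 * s)) (fun u => c (u + s))) ?ler01 // => [H|u _]; last by rewrite mul1r.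
apply/esym/H.
- move=> k u _ _; apply: (@cta_comp _ _ _ (fun z : R * R => z.2 + z.1 * s) c); [by ct | exact: cc].
- by ct.
- by move=> *; exact: av.
- by left=> k _; rewrite add0r -(jordan_per1 (k * s)) addrC.
Qed.

Lemma wnd_path (g : R -> R * R) : (forall k, 0 <= k <= 1 -> cta g k) ->
  (forall k u, 0 <= k <= 1 -> c u <> g k) -> wnd (g 0) = wnd (g 1).
Proof.
move=> cg av.
have c01 (k : R) : 0 <= clamp 0 1 k <= 1 by apply: clamp_in; lra.
have := @ang_homotopy R (fun=> c) (g \o clamp 0 1) 0 1 ler01.
rewrite /= !clamp_id ?lexx ?ler01 //; apply.
- by move=> k u _ _; apply: (@cta_comp _ _ _ (fun z : R * R => z.2) c); [by ct | exact: cc].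
- by apply: clamp_path_cont; rewrite ?ler01.
- by move=> k u _ _; apply: av.
- by left=> k _; rewrite -[1]add0r jordan_per1.
Qed.

Lemma curve_closed : closed (range c).
Proof.
have -> : range c = [set c u | u in `[0, 1]%classic].
  apply/seteqP; split=> z; last by move=> [u _ <-]; exists u.
  move=> [u _ <-]; exists (u - (Num.floor u)%:~R).
    rewrite /= in_itv /=; have := floor_itv u; rewrite intrD /= => /andP[h1 h2].
    by apply/andP; split; lra.
  by rewrite -mulrNz jordan_per.
exact: arc_closed.
Qed.

Lemma wnd_box p : (forall u, c u <> p) -> exists2 e, 0 < e & forall q, box p e q ->
  (forall u, c u <> q) /\ wnd q = wnd p.
Proof.
move=> av; have nb : nbhs p (~` range c).
  apply: open_nbhs_nbhs; split; first exact/closed_openC/curve_closed.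
  by move=> [u _ e]; apply: (av u).
have [e e0 he] := nbhs_box nb; exists e => // q bq; split.
  by move=> u E; apply: (he q bq); exists u.
pose g k : R * R := ((1 - k) * p.1 + k * q.1, (1 - k) * p.2 + k * q.2).
have e1 : g 0 = p by rewrite /g subr0 !mul1r !mul0r !addr0 -surjective_pairing.
have e2 : g 1 = q by rewrite /g subrr !mul1r !mul0r !add0r -surjective_pairing.
rewrite -[in RHS]e1 -[in LHS]e2; apply/esym/wnd_path.
  by move=> k _; rewrite /g; ct.
move=> k u hk E; apply: (he (g k)); last by exists u.
by apply: box_conv => //; exact: box_center.
Qed.

Lemma curve_bounded : exists2 M, 0 < M & forall u, `|(c u).1| < M /\ `|(c u).2| < M.
Proof.
have cf : continuous (fun u => `|(c u).1| + `|(c u).2|) by ct.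
have [m1 _ h1] := EVT_max ler01 (cont_within (s := 0) (t := 1) cf).
exists (`|(c m1).1| + `|(c m1).2| + 1).
  by have := normr_ge0 (c m1).1; have := normr_ge0 (c m1).2; lra.
move=> u; have <- : c (u - (Num.floor u)%:~R) = c u by rewrite -mulrNz jordan_per.
have := h1 (u - (Num.floor u)%:~R); rewrite in_itv /=.
have := floor_itv u; rewrite intrD /= => /andP[i1 i2].
set w := u - _; have := normr_ge0 (c w).1; have := normr_ge0 (c w).2.
move=> n1 n2 H; have : `|(c w).1| + `|(c w).2| <= `|(c m1).1| + `|(c m1).2|.
  by apply: H; rewrite /w; apply/andP; split; lra.
by move=> H2; split; lra.
Qed.

Lemma wnd_far : exists2 M, 0 < M & forall p, M <= `|p.1| \/ M <= `|p.2| ->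
  (forall u, c u <> p) /\ wnd p = 0.
Proof.
have [M M0 hM] := curve_bounded; exists (2 * M); first lra.
have H p (i : R * R -> R) : (i = fst \/ i = snd) -> 2 * M <= `|i p| ->
    (forall u, c u <> p) /\ wnd p = 0.
  move=> hi hp.
  have bi u : `|i (c u)| < M by have := hM u; case: hi => -> [].
  have av u : c u <> p by move=> e; have := bi u; rewrite e; lra.
  split=> //; rewrite /wnd.
  (* From [p] the whole curve is seen in an open half plane, whose inner normal is [v]; it is
     compared with the constant path at [v]. *)
  pose v : R * R := if pselect (i = fst) then (- p.1, 0) else (0, - p.2).
  have hd u : 0 < dot (c u) p v (0, 0).
    have := bi u; rewrite /dot /v; case: pselect => [e|ne]; rewrite /= !subr0 ?mulr0 ?addr0 ?add0r.
      rewrite e; move: hp; rewrite e; case: (ger0P p.1) => s hp; rewrite ltr_norml => /andP[h1 h2]; nra.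
    have -> : i = snd by case: hi.
    move: hp; have -> : i = snd by case: hi.
    by case: (ger0P p.2) => s hp; rewrite ltr_norml => /andP[h1 h2]; nra.
  rewrite (@ang_dot R c (fun=> v) p (0, 0)) ?ler01 //.
  - apply: ang_const; [exact: ler01 | by [] |].
    by move=> e; have := hd 0; rewrite e /dot /= !subrr !mulr0 addr0 ltxx.
  - by move=> u _; exact: cc.
  - by move=> u _; ct.
  - by rewrite -[1]add0r jordan_per1.
move=> p [] hp; [apply: (H p fst) | apply: (H p snd)] => //; [by left | by right].
Qed.

(* [h] straightens [c] near the time [s]; for [m = 1] the upper half of the box goes to
   the left of [c]. *)
Definition flat h e s m : Prop :=
  [/\ emb h (0, 0) e, forall u, `|u| < e -> h (u, 0) = c (s + u),
      forall y, box (0, 0) e y -> forall A, nbhs y A -> nbhs (h y) [set h z | z in A] &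
      forall r, 0 < r < e -> degr h (0, 0) r = 2 * pi * m%:~R].

Lemma flat_isolated h e s m : flat h e s m ->
  exists2 d, 0 < d <= e & forall y u, box (0, 0) d y -> h y = c u -> y.2 = 0.
Proof.
move=> [he hax _ _]; have [e0 ch ih] := he.
have e20 : 0 < e / 2 by lra.
have q0 : 0 < 1 / 4 :> R by lra.
have [d0 de d4] := min_pos2 e20 q0; set d := Num.min _ _ in d0 de d4.
have h0 : h (0, 0) = c s by rewrite hax ?normr0 ?addr0.
(* The rest of the curve is compact and misses [c s], so only times close to [s] can enter a small
   box. *)
have nb : nbhs (c s) (~` [set c u | u in `[s + d, s + 1 - d]%classic]).
  apply: open_nbhs_nbhs; split; first exact/closed_openC/arc_closed.
  move=> [u /=]; rewrite in_itv /= => /andP[u1 u2] E.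
  have : u = s by apply: jordan_inj_lt => //; rewrite ltr_norml; apply/andP; split; lra.
  lra.
have n2 : \forall y \near ((0, 0) : R * R), (~` [set c u | u in `[s + d, s + 1 - d]%classic]) (h y).
  by apply: (ch (0, 0) (box_center _ e0)); rewrite /= h0.
have [d1 d10 hd1] := nbhs_box n2.
have [d20 d2d d21] := min_pos2 d0 d10.
exists (Num.min d d1); first by rewrite d20; lra.
move=> y u by_ E.
pose k := Num.floor (u - (s - d)); pose v := u - k%:~R.
have E' : h y = c v by rewrite E /v -mulrNz jordan_per.
have /andP[k1 k2] := floor_itv (u - (s - d)).
have [v1 v2] : s - d <= v /\ v < s + 1 - d.
  by move: k1 k2; rewrite intrD /= /v -/k; lra.
case: (ltP v (s + d)) => hv.
  have vd : `|v - s| < e by rewrite ltr_norml; apply/andP; split; lra.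
  have : y = (v - s, 0); last by move=> ->.
  apply: ih.
  - by apply: boxW by_; lra.
  - by split; rewrite /= subr0 ?normr0.
  - by rewrite hax // E' addrC subrK.
case: (hd1 y (boxW d21 by_)); exists v => //=.
by rewrite in_itv /=; apply/andP; split; lra.
Qed.

Lemma flat_small h e s m e' : flat h e s m -> 0 < e' <= e -> flat h e' s m.
Proof.
move=> [he hax op hd] /andP[e0 ee]; split.
- by apply: emb_small he _; rewrite e0.
- by move=> u hu; apply: hax; lra.
- by move=> y by_; apply: op; exact: boxW by_.
- by move=> r hr; apply: hd; lra.
Qed.

(** The piece of curve on the axis is replaced by a lower half circle when seen from the point [pL]
    above it, by an upper one when seen from [pR] below it. The loop closed by the lower half circle
    has the same winding number at both points, so the jump is the angle of the full circle seen
    from [pR], that is the degree. *)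
Lemma flat_jump h e s m : flat h e s m ->
  exists d a b, [/\ 0 < d <= e, a - b = 2 * pi * m%:~R &
    forall y, box (0, 0) d y -> [/\ 0 < y.2 -> wnd (h y) = a, y.2 < 0 -> wnd (h y) = b &
      y.2 <> 0 -> forall u, c u <> h y]].
Proof.
move=> hf0; have [d1 hd1 iso1] := flat_isolated hf0.
have q0 : 0 < 1 / 2 :> R by lra.
have d10 : 0 < d1 by case/andP: hd1.
have [d0 dd1 dd2] := min_pos2 d10 q0; set d := Num.min _ _ in d0 dd1 dd2.
have de : 0 < d <= e by lra.
have hf := flat_small hf0 de.
have iso y u : box (0, 0) d y -> h y = c u -> y.2 = 0 by move=> by_; apply: iso1; exact: boxW by_.
have [he hax _ hdeg] := hf; have [_ ch ih] := he.
have off y u : box (0, 0) d y -> y.2 <> 0 -> c u <> h y.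
  by move=> by_ ny /esym /(iso _ _ by_).
have connect y y' : box (0, 0) d y -> box (0, 0) d y' -> 0 < y.2 * y'.2 -> wnd (h y) = wnd (h y').
  move=> by_ by' yy.
  pose g k : R * R := ((1 - k) * y.1 + k * y'.1, (1 - k) * y.2 + k * y'.2).
  have e1 : g 0 = y by rewrite /g subr0 !mul1r !mul0r !addr0 -surjective_pairing.
  have e2 : g 1 = y' by rewrite /g subrr !mul1r !mul0r !add0r -surjective_pairing.
  have bg k : 0 <= k <= 1 -> box (0, 0) d (g k) by move=> hk; exact: box_conv.
  rewrite -e1 -e2; apply: (@wnd_path (fun k => h (g k))).
    by move=> k hk; apply: (@cta_comp _ _ _ g h); [by rewrite /g; ct | exact/ch/bg].
  move=> k u /[dup] hk /andP[k0 k1]; apply: off; first exact: bg.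
  rewrite /g /=; case: (ltgtP y.2 0) => s0.
  - have s1 : y'.2 < 0 by move: yy; rewrite nmulr_rgt0.
    by move=> E; have : (1 - k) * y.2 + k * y'.2 < 0; [nra | rewrite E ltxx].
  - have s1 : 0 < y'.2 by move: yy; rewrite pmulr_rgt0.
    by move=> E; have : 0 < (1 - k) * y.2 + k * y'.2; [nra | rewrite E ltxx].
  - by move: yy; rewrite s0 mul0r ltxx.
pose rho := d / 2; pose tau := d / 4.
have [rho0 tau0 taur rhod] : [/\ 0 < rho, 0 < tau, tau < rho & rho < d] by rewrite /rho /tau; split; lra.
pose phi t := Num.sqrt (rho ^+ 2 - t ^+ 2).
have phi0 t : 0 <= phi t by exact: sqrtr_ge0.
have phile t : phi t <= rho.
  rewrite -[leRHS](ger0_norm (ltW rho0)) -sqrtr_sqr ler_wsqrtr //.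
  by have := sqr_ge0 t; lra.
have phic t : phi (rho * cos t) = rho * `|sin t|.
  rewrite /phi -[RHS](ger0_norm (mulr_ge0 (ltW rho0) (normr_ge0 _))) -sqrtr_sqr; congr Num.sqrt.
  by rewrite !exprMn -normrX (ger0_norm (sqr_ge0 _)) sin2cos2; ring.
have phir : phi rho = 0 by rewrite /phi subrr sqrtr0.
have phirN : phi (- rho) = 0 by rewrite /phi sqrrN subrr sqrtr0.
have bD k t : `|k| <= 1 -> - rho <= t <= rho -> box (0, 0) d (t, k * phi t).
  move=> hk ht; split; rewrite /= subr0.
    by apply: le_lt_trans rhod; rewrite ler_norml.
  rewrite normrM (ger0_norm (phi0 t)); have := phile t; have := phi0 t; have := normr_ge0 k; nra.
(* Arcs with common ends: [D 0] is the piece of curve, [D 1] and [D (- 1)] are the upper and the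
   lower half circle, all run from left to right. *)
pose D k t := h (t, k * phi t).
have cD k t : `|k| <= 1 -> - rho <= t <= rho -> cta (fun z : R * R => D z.1 z.2) (k, t).
  move=> hk ht; apply: (@cta_comp _ _ _ (fun z : R * R => (z.2, z.1 * phi z.2)) h).
    by rewrite /phi; ct.
  exact/ch/bD.
have cD1 k t : `|k| <= 1 -> - rho <= t <= rho -> cta (D k) t.
  by move=> hk ht; apply: cta_slice; exact: cD.
have rr : - rho <= rho by lra.
have n01 (k : R) : 0 <= k <= 1 -> `|k| <= 1 by move=> hk; rewrite ler_norml; lra.
have bq v : - tau <= v <= tau -> box (0, 0) d (0, v).
  by move=> hv; split; rewrite /= subr0 ?normr0 // ltr_norml; lra.
have n1 : `|-1 : R| <= 1 by rewrite normrN normr1.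
have n1' : `|1 : R| <= 1 by rewrite normr1.
pose rest p := ang c (s + rho) (s + 1 - rho) p.
have splitE p : (forall u, c u <> p) -> wnd p = ang (D 0) (- rho) rho p + rest p.
  move=> av; rewrite -(wnd_start (s - rho) av).
  rewrite -(@ang_add R c p (s - rho) (s + rho) (s - rho + 1)); [| lra | lra | by move=> *; exact: cc | by []].
  congr (_ + _); last by rewrite /rest; congr ang; ring.
  have -> : s - rho = - rho + s by ring.
  have -> : s + rho = rho + s by ring.
  rewrite -ang_shift //; apply: ang_eq => // t ht.
  by rewrite /D mul0r hax 1?addrC // ltr_norml; lra.
pose pL := h (0, tau); pose pR := h (0, - tau).
have avL u : c u <> pL by apply: off; [apply: bq; lra | rewrite /=; lra].
have avR u : c u <> pR by apply: off; [apply: bq; lra | rewrite /=; lra].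
(* Pushing the piece downwards does not meet the upper point; [hR] is the mirror image. *)
have hL : ang (D 0) (- rho) rho pL = ang (D (- 1)) (- rho) rho pL.
  have := @ang_homotopy R (fun k => D (- k)) (fun=> pL) (- rho) rho rr.
  rewrite oppr0; apply.
  - move=> k t hk ht; apply: (@cta_comp _ _ _ (fun z : R * R => (- z.1, z.2)) (fun z : R * R => D z.1 z.2)).
      by ct.
    by apply: cD => //; rewrite normrN; exact: n01.
  - by ct.
  - move=> k t hk ht /ih; rewrite /D => /(_ _ _) E; have [] : (t, - k * phi t) = (0, tau).
      by apply: E; [apply: bD => //; rewrite normrN; exact: n01 | apply: bq; lra].
    by move=> _; have := phi0 t; move: hk => /andP[k0 k1] f0; nra.
  - by right=> k _; rewrite /D phir phirN !mulr0.
have hR : ang (D 0) (- rho) rho pR = ang (D 1) (- rho) rho pR.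
  have := @ang_homotopy R D (fun=> pR) (- rho) rho rr; apply.
  - by move=> k t hk ht; apply: cD => //; exact: n01.
  - by ct.
  - move=> k t hk ht /ih; rewrite /D => /(_ _ _) E; have [] : (t, k * phi t) = (0, - tau).
      by apply: E; [apply: bD => //; exact: n01 | apply: bq; lra].
    by move=> _; have := phi0 t; move: hk => /andP[k0 k1] f0; nra.
  - by right=> k _; rewrite /D phir phirN !mulr0.
have ends : D (- 1) rho = c (s + rho) /\ D (- 1) (- rho) = c (s + 1 - rho).
  rewrite /D phir phirN !mulr0 !hax ?normrN ?gtr0_norm //; split=> //.
  by rewrite -[LHS]jordan_per1; congr c; ring.
(* The segment between the two points meets neither the rest of the curve nor the lower half circle.
   The end terms of [ang_near] cancel since these two arcs form a loop. *)
have hC : rest pL + ang (D (- 1)) (- rho) rho pL = rest pR + ang (D (- 1)) (- rho) rho pR.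
  pose g v := h (0, clamp (- tau) tau v).
  have tt : - tau <= tau by lra.
  have gin v : - tau <= clamp (- tau) tau v <= tau by exact: clamp_in.
  have clc := @clamp_cont R (- tau) tau.
  have cg : continuous g.
    apply: ctI => v; apply: (@cta_comp _ _ _ (fun v => (0, clamp (- tau) tau v)) h); first by ct.
    exact/ch/bq.
  have := @locconst R R (fun v => rest (g v) + ang (D (- 1)) (- rho) rho (g v)) (- tau) tau tt.
  rewrite /g !clamp_id ?lexx ?tt // -/pL -/pR => H; apply/esym/H => v _.
  have N1 := @ang_near R (fun=> c) g (s + rho) (s + 1 - rho) v.
  have N2 := @ang_near R (fun=> D (- 1)) g (- rho) rho v rr.
  have {}N1 : \forall v' \near v, rest (g v') - rest (g v) =
     eta (c (s + 1 - rho)) (g v) (c (s + 1 - rho)) (g v') - eta (c (s + rho)) (g v) (c (s + rho)) (g v').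
    apply: N1 => //; first lra.
    - by move=> k u _; apply: (@cta_comp _ _ _ (fun z : R * R => z.2) c); [by ct | exact: cc].
    - move=> v' u hu E.
      have := iso _ u (bq _ (gin v')) (esym E); rewrite /= => v0.
      move: E; rewrite /g v0 hax ?normr0 // addr0 => E.
      have : u = s by apply: jordan_inj_lt => //; rewrite ltr_norml; apply/andP; split; lra.
      lra.
  have {}N2 : \forall v' \near v, ang (D (- 1)) (- rho) rho (g v') - ang (D (- 1)) (- rho) rho (g v) =
     eta (D (- 1) rho) (g v) (D (- 1) rho) (g v') - eta (D (- 1) (- rho)) (g v) (D (- 1) (- rho)) (g v').
    apply: N2 => //.
    - by move=> k u hu; apply: (@cta_comp _ _ _ (fun z : R * R => z.2) (D (- 1))); [by ct | exact: cD1].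
    - move=> v' u hu /ih E; have [] : (u, -1 * phi u) = (0, clamp (- tau) tau v').
        by apply: E; [exact: bD | exact: bq].
      move=> -> E2; have := gin v'; rewrite -E2 /phi expr0n subr0 sqrtr_sqr gtr0_norm //; lra.
  have [E1 E2] := ends; rewrite E1 E2 in N2.
  by apply: filterS2 N1 N2 => v' a1 a2; rewrite /= -!/(g _); lra.
(* The lower half circle followed by the reversed upper one is the counterclockwise circle; it also
   winds once around the lower point, and the degree may be taken there. *)
have hT : ang (D (- 1)) (- rho) rho pR - ang (D 1) (- rho) rho pR = 2 * pi * m%:~R.
  have pi0 := pi_gt0 R; have bh : circ (0, 0) d (0, - tau) (d / 4).
    by split; rewrite /= ?subr0 ?normr0 ?normrN ?gtr0_norm; rewrite /tau; lra.
  have bh0 : circ (0, 0) d (0, 0) (d / 4).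
    by split; rewrite /= ?subr0 ?normr0; lra.
  have E := @degr_mul R h (0, 0) d (0, - tau) (d / 4) (polar (0, 0) rho) (- pi) pi 1 he bh.
  have bp u : box (0, 0) d (polar (0, 0) rho u) by apply: box_polar0; lra.
  have pp : polar (0, 0) rho (- pi) = polar (0, 0) rho pi :> R * R.
    by rewrite -(polar_2pi _ _ (- pi)); congr polar; ring.
  have avq u : polar (0, 0) rho u <> (0, - tau).
    rewrite /polar /= !add0r => -[c0 s0]; have := cos2Dsin2 u.
    have : cos u = 0 by apply: (mulfI (lt0r_neq0 rho0)); rewrite mulr0.
    move=> -> /eqP; rewrite expr0n add0r -subr_eq0 subr_sqr_1 mulf_eq0 subr_eq0 addr_eq0.
    by move=> /orP[] /eqP sE; rewrite sE in s0; lra.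
  have {}E : ang (fun u => h (polar (0, 0) rho u)) (- pi) pi pR = 2 * pi * m%:~R.
    rewrite E //.
    - by rewrite mulr1z mul1r (degr_const he bh bh0) hdeg //; lra.
    - lra.
    - by move=> *; exact: polar_cont.
    - rewrite (@ang_dot _ _ (polar (0, 0) rho) _ (0, 0)) //; [| lra | by move=> *; exact: polar_cont | by move=> *; exact: polar_cont |].
        rewrite (ang_lift_on (a := fun u => u)) //; [by rewrite mulr1z; ring | lra | by ct | by move=> u _; exists rho].
      move=> u _; rewrite /dot /polar /= !subr0 !add0r opprK.
      have := cos2Dsin2 u; have := sin_geN1 u; set C := cos u; set S := sin u => S1 CS.
      have -> : rho * C * (rho * C) + (rho * S + tau) * (rho * S) = rho ^+ 2 * (C ^+ 2 + S ^+ 2) + rho * tau * S by ring.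
      rewrite CS mulr1.
      have q1 : 0 < rho * tau by exact: mulr_gt0.
      have q2 : rho * tau < rho ^+ 2 by rewrite expr2 ltr_pM2l.
      have q3 : 0 <= rho * tau * (S + 1) by apply: mulr_ge0; lra.
      lra.
  rewrite -E -(@ang_add _ _ _ (- pi) 0 pi); [| lra | lra | |]; last 2 first.
  - by move=> u _; apply: (@cta_comp _ _ _ (polar (0, 0) rho) h); [exact: polar_cont | exact/ch/bp].
  - by move=> u _ /ih F; apply: (avq u); apply: F => //; apply: bq; lra.
  have avD k t : `|k| = 1 -> - rho <= t <= rho -> D k t <> pR.
    move=> hk ht /ih F; have [] : (t, k * phi t) = (0, - tau).
      by apply: F; [apply: bD => //; rewrite hk | apply: bq; lra].
    move=> -> /(congr1 Num.norm); rewrite normrM hk mul1r normrN !ger0_norm //; last lra.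
    by rewrite /phi expr0n subr0 sqrtr_sqr gtr0_norm //; lra.
  have k1 : `|- 1 : R| = 1 by rewrite normrN normr1.
  have k2 : `|1 : R| = 1 by rewrite normr1.
  have [aN [caN eN hN]] := ang_ex rr (fun t ht => cD1 _ t n1 ht) (fun t ht => avD _ t k1 ht).
  have [aP [caP eP hP]] := ang_ex rr (fun t ht => cD1 _ t n1' ht) (fun t ht => avD _ t k2 ht).
  have cosin u : - rho <= rho * cos u <= rho.
    by have := cos_geN1 u; have := cos_le1 u; nra.
  have ccos : continuous (fun u => rho * cos u) by ct.
  rewrite (@ang_eq _ _ (fun u => D (- 1) (rho * cos u)) _ (- pi) 0); [| lra |]; last first.
    move=> u hu; rewrite /D phic /polar /= !add0r; congr (h (_, _)).
    rewrite ler0_norm; first by ring.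
    by have : 0 <= sin (- u); [apply: sin_ge0_pi; lra | rewrite sinN; lra].
  rewrite (@ang_comp R (D (- 1)) pR _ (- pi) 0 (- rho) rho aN) //; [| lra].
  rewrite (@ang_eq _ _ (fun u => D 1 (rho * cos u)) _ 0 pi); [| lra |]; last first.
    move=> u hu; rewrite /D phic /polar /= !add0r; congr (h (_, _)).
    by rewrite mul1r ger0_norm //; exact: sin_ge0_pi.
  rewrite (@ang_comp R (D 1) pR _ 0 pi (- rho) rho aP) //; [| lra].
  by rewrite cosN cospi cos0 mulr1 mulrN1 eN eP; ring.
exists d, (wnd pL), (wnd pR); split=> //.
  by rewrite (splitE _ avL) (splitE _ avR) hL hR; lra.
move=> y by_; split; last by move=> ny u; exact: off.
  by move=> y0; apply: connect => //; [apply: bq; lra | rewrite /= mulr_gt0].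
by move=> y0; apply: connect => //; [apply: bq; lra | rewrite /=; nra].
Qed.

(** A small hole is made in the curve at [h (0, 0)], joining the two sides. What remains of the
    curve is an arc, and [arc_no_bounded_component] rules out first that both values are nonzero,
    then that a third value occurs. *)
Lemma jordan_two_values h e s m d a b : flat h e s m -> 0 < d <= e ->
  (forall y, box (0, 0) d y -> [/\ 0 < y.2 -> wnd (h y) = a, y.2 < 0 -> wnd (h y) = b &
      y.2 <> 0 -> forall u, c u <> h y]) ->
  forall p, (forall u, c u <> p) -> wnd p = a \/ wnd p = b.
Proof.
move=> hf de hab.
have {hf}[he hax opn _] := flat_small hf de; have [d0 ch ih] := he.
have [M M0 far] := wnd_far.
pose rho := Num.min (d / 2) (1 / 4).
have [rho0 rd rq] : [/\ 0 < rho, rho <= d / 2 & rho <= 1 / 4] by apply: min_pos2; lra.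
(* [V] consists of the points with one of the two values, together with the hole; [U] of the points
   with any other value. Both are open, and the arc is all that is left. *)
pose V : set (R * R) := [set p | (forall u, c u <> p) /\ (wnd p = a \/ wnd p = b)] `|`
  [set h y | y in box (0, 0) rho].
pose U : set (R * R) := [set p | (forall u, c u <> p) /\ ~ (wnd p = a \/ wnd p = b)].
have oU : open U.
  rewrite openE => p [av nw]; have [e' e'0 he'] := wnd_box av.
  have := box_nbhs p e'0; apply: filterS => q /he'[av' E]; split=> //.
  by rewrite E.
have brho y : box (0, 0) rho y -> box (0, 0) d y by apply: boxW; lra.
have oV : open V.
  rewrite openE => p [[av nw]|[y by_ <-]].
    have [e' e'0 he'] := wnd_box av.
    have := box_nbhs p e'0; apply: filterS => q /he'[av' E]; left; split=> //.
    by rewrite E.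
  have nb : nbhs y (box (0, 0) rho).
    have g0 : cta (fun z : R * R => Num.max `|z.1 - 0| `|z.2 - 0|) y by ct.
    have g1 : cta (fun z : R * R => rho) y by ct.
    have := cta_lt g0 g1; rewrite gt_max; case: (by_) => /= -> ->.
    by move=> /(_ isT); apply: filterS => z; rewrite gt_max => /andP[].
  by have := opn y (brho _ by_) _ nb; apply: filterS => q hq; right.
have disj p : U p -> V p -> False.
  move=> [av nw] [[_ //]|[y by_ E]]; have [h1 h2 h3] := hab y (brho _ by_).
  case: (ltgtP y.2 0) => y0.
  - by apply: nw; right; rewrite -E h2.
  - by apply: nw; left; rewrite -E h1.
  - apply: (av (s + y.1)); rewrite -E [y]surjective_pairing y0 hax //.
    by have [+ _] := brho _ by_; rewrite /= subr0.
have cov p : U p \/ V p \/ exists2 u, s + rho <= u <= s + 1 - rho & p = c u.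
  have [[u E]|nE] := pselect (exists u, c u = p); last first.
    have av u : c u <> p by move=> E; apply: nE; exists u.
    have [w|w] := pselect (wnd p = a \/ wnd p = b); [by right; left; left | by left].
  right; pose k := Num.floor (u - (s - rho)); pose v := u - k%:~R.
  have E' : p = c v by rewrite -E /v -mulrNz jordan_per.
  have /andP[k1 k2] := floor_itv (u - (s - rho)).
  have [v1 v2] : s - rho <= v /\ v < s + 1 - rho.
    by move: k1 k2; rewrite intrD /= /v -/k; lra.
  case: (leP (s + rho) v) => hv; first by right; exists v => //; apply/andP; split; lra.
  case: (eqVneq v (s - rho)) => [ev|nv].
    right; exists (s + 1 - rho); first by apply/andP; split; lra.
    by rewrite E' ev -[LHS]jordan_per1; congr c; ring.
  left; right; exists (v - s, 0).
    split; rewrite /= subr0 ?normr0 // ltr_norml; apply/andP; split; last lra.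
    by have : s - rho < v; [rewrite lt_neqAle eq_sym nv | lra].
  rewrite hax; first by rewrite E' addrC subrK.
  by rewrite ltr_norml; apply/andP; split; lra.
have ia u v : s + rho <= u <= s + 1 - rho -> s + rho <= v <= s + 1 - rho -> c u = c v -> u = v.
  by move=> hu hv /jordan_inj_lt; apply; rewrite ltr_norml; apply/andP; split; lra.
have offU u : s + rho <= u <= s + 1 - rho -> ~ U (c u) by move=> _ [av _]; apply: (av u).
have offV u : s + rho <= u <= s + 1 - rho -> ~ V (c u).
  move=> hu [[av _]|[y by_ E]]; first exact: (av u).
  have [_ _ h3] := hab y (brho _ by_).
  have y0 : y.2 = 0 by apply: contrapT => /h3 /(_ u); rewrite E.
  have [by1 _] := by_; rewrite /= subr0 in by1.
  move: E; rewrite [y]surjective_pairing y0 hax; last by apply: lt_le_trans by1 _; lra.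
  move: by1; rewrite ltr_norml => /andP[b1 b2] E.
  have : s + y.1 = u by apply: jordan_inj_lt => //; rewrite ltr_norml; apply/andP; split; lra.
  lra.
have clos (A B : set (R * R)) : open B -> (forall z, A z -> B z -> False) ->
    (forall z, A z \/ B z \/ exists2 u, s + rho <= u <= s + 1 - rho & z = c u) ->
    forall z, closure A z -> A z \/ exists2 u, s + rho <= u <= s + 1 - rho & z = c u.
  move=> oB dAB cAB z clz; case: (cAB z) => [|[Bz|]]; [by left | | by right].
  have [|w [Aw Bw]] := clz B; first by apply: open_nbhs_nbhs.
  by case: (dAB w).
have bnd (A : set (R * R)) : (forall z, A z -> ~ (forall u, c u <> z) \/ wnd z <> 0) ->
    forall z, A z -> `|z.1| < M /\ `|z.2| < M.
  move=> hA z Az; case: (ltP `|z.1| M) => h1; last by have [av w] := far z (or_introl h1); case: (hA z Az).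
  by case: (ltP `|z.2| M) => // h2; have [av w] := far z (or_intror h2); case: (hA z Az).
have ss : s + rho <= s + 1 - rho by lra.
have z0 : box (0, 0) rho ((0, 0) : R * R) by exact: box_center.
(* Far from the curve the winding number is 0, so [V] would be bounded otherwise. *)
have hz : a = 0 \/ b = 0.
  apply: contrapT => /not_orP[na nb].
  apply: (@arc_no_bounded_component R c (s + rho) (s + 1 - rho) V M (h (0, 0)) ss cc ia oV) => //.
  - apply: bnd => z [[_ [->|->]]|[y by_ <-]]; [by right | by right |].
    have [h1 h2 h3] := hab y (brho _ by_).
    case: (ltgtP y.2 0) => y0; [by right; rewrite h2 | by right; rewrite h1 |].
    left=> /(_ (s + y.1)); apply; rewrite [y in h y]surjective_pairing y0 hax //.
    by have [+ _] := brho _ by_; rewrite /= subr0.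
  - apply: (clos V U) => //; first by move=> z Vz Uz; exact: (disj z).
    by move=> z; case: (cov z) => [|[]]; [by right; left | by left | by right; right].
  - by right; exists (0, 0).
(* Now the value 0 is among the two, so that [U] is bounded. *)
move=> p av; apply: contrapT => nw.
apply: (@arc_no_bounded_component R c (s + rho) (s + 1 - rho) U M p ss cc ia oU) => //.
- apply: bnd => z [_ nz]; right=> E; apply: nz; rewrite E.
  by case: hz => ->; [left | right].
- by apply: (clos U V) => // z; exact: disj.
Qed.

(** The values seen at any other place are among the same two and have the same nonzero difference,
    so left and right values agree along the whole curve. *)
Lemma jordan_sides m : (m = 1 \/ m = -1) -> exists a : R,
  forall h e s, flat h e s m -> exists2 d, 0 < d <= e &
    forall y, box (0, 0) d y -> [/\ 0 < y.2 -> wnd (h y) = a + 2 * pi * m%:~R, y.2 < 0 -> wnd (h y) = a &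
      y.2 <> 0 -> forall u, c u <> h y].
Proof.
move=> hm; have m0 : 2 * pi * m%:~R <> 0 :> R.
  by case: hm => ->; rewrite ?mulrNz ?mulr1z; have := twopi_gt0 R; lra.
have [[h [e [s hf]]]|nex] := pselect (exists h e s, flat h e s m); last first.
  by exists 0 => h e s hf; case: nex; exists h, e, s.
have [d [a [b [de ab hab]]]] := flat_jump hf.
have two := jordan_two_values hf de hab.
exists b => h' e' s' hf'; have [d' [a' [b' [de' ab' hab']]]] := flat_jump hf'.
have d'0 : 0 < d' by case/andP: de'.
have bx v : `|v| < d' -> box (0, 0) d' (0, v) by move=> hv; split; rewrite /= subr0 ?normr0.
have b1 : box (0, 0) d' (0, d' / 2) by apply: bx; rewrite gtr0_norm; lra.
have b2 : box (0, 0) d' (0, - (d' / 2)) by apply: bx; rewrite normrN gtr0_norm; lra.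
have [u1 _ /= u3] := hab' _ b1; have [_ l2 /= l3] := hab' _ b2.
have {u1}u1 : wnd (h' (0, d' / 2)) = a' by apply: u1; rewrite /=; lra.
have {l2}l2 : wnd (h' (0, - (d' / 2))) = b' by apply: l2; rewrite /=; lra.
have := two (h' (0, d' / 2)); have := two (h' (0, - (d' / 2))); rewrite u1 l2 => t2 t1.
have {}t1 : a' = a \/ a' = b by apply: t1; apply: u3; lra.
have {}t2 : b' = a \/ b' = b by apply: t2; apply: l3; lra.
have [ea eb] : a' = a /\ b' = b by case: t1 => t1; case: t2 => t2; split; lra.
exists d' => // y /hab'[h1 h2 h3]; split=> //.
- by move=> /h1 ->; lra.
- by move=> /h2 ->.
Qed.

End Jordan.

(** * The sphere *)

Section Sphere.
Variable R : realType.
Implicit Types (p : sphere R) (v w : R * R * R) (y z : R * R).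

Definition sq v : R := v.1.1 ^+ 2 + v.1.2 ^+ 2 + v.2 ^+ 2.

Lemma sphereP p : sq (\val p) = 1.
Proof. by have := set_valP p. Qed.

Lemma sphere_inj p p' : \val p = \val p' -> p = p'.
Proof. exact: val_inj. Qed.

Lemma cta_sphere (X : topologicalType) (f : X -> sphere R) x :
  cta (fun u => \val (f u)) x -> cta f x.
Proof.
move=> h A [B [[W oW <-] /= Wx sub]].
have : \forall u \near x, W (\val (f u)) by apply: h; apply: open_nbhs_nbhs.
by apply: filterS => u Wu; apply: sub.
Qed.

Lemma cta_val p : cta (fun q : sphere R => \val q : R * R * R) p.
Proof. exact: (@initial_continuous _ _ (fun q : sphere R => \val q : R * R * R)). Qed.

Lemma space_hausdorff : hausdorff_space (R * R * R)%type.
Proof. exact: norm_hausdorff. Qed.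

Lemma sphere_hausdorff : hausdorff_space (sphere R).
Proof.
move=> p q cpq; apply: sphere_inj; apply: space_hausdorff => A B nA nB.
have [x [Ax Bx]] := cpq _ _ (cta_val (p := p) nA) (cta_val (p := q) nB).
by exists (\val x).
Qed.

Lemma sphere_set_compact : compact [set v : R * R * R | sq v = 1].
Proof.
apply: (@subclosed_compact _ _ (((`[-1, 1]%classic `*` `[-1, 1]%classic) `*` `[-1, 1]%classic) : set (R * R * R))).
- have cs : continuous (fun v : R * R * R => sq v) by rewrite /sq; ct.
  have /continuous_closedP := cs; move=> /(_ [set 1]); apply.
  exact: closed_eq.
- by apply: compact_setX; [apply: compact_setX|]; exact: segment_compact.
- move=> [[a b] c]; rewrite /sq /= => h; rewrite !in_itv /=.
  have := sqr_ge0 a; have := sqr_ge0 b; have := sqr_ge0 c => h1 h2 h3.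
  by split; [split|]; apply/andP; split; nra.
Qed.

Lemma sphere_compact : compact [set: sphere R].
Proof.
move=> F PF _.
pose G : set_system (R * R * R) := (fun q : sphere R => \val q : R * R * R) @ F.
have PG : ProperFilter G by exact: fmap_proper_filter.
have [|x [Sx cx]] := sphere_set_compact PG.
  have : F setT by exact: filterT.
  have hS : setT `<=` [set q : sphere R | [set v : R * R * R | sq v = 1] (\val q)] by move=> q _; exact: sphereP.
  exact: (filterS hS).
pose q : sphere R := exist _ x (mem_set Sx).
exists q; split=> // A B FA [C [[W oW <-] /= Wx sub]].
have [z [[a Aa e] Wz]] := cx [set \val a | a in A] W
  (filterS (fun a (h : A a) => ex_intro2 _ _ a h erefl) FA) (open_nbhs_nbhs (conj oW Wx)).
by exists a; split=> //; apply: sub; move: Wz; rewrite -e.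
Qed.

(** Involutions of the space which preserve the sphere. Composing them with one stereographic
    projection gives all the charts, each with its own pole. *)
Record refl_map := ReflMap {
  rf : R * R * R -> R * R * R;
  rf_cont : continuous rf;
  rf_inv : forall v, rf (rf v) = v;
  rf_sq : forall v, sq (rf v) = sq v }.

Implicit Type F : refl_map.

(** Stereographic projection from [(0, 0, 1)]; [ist] below is its inverse. *)
Definition st v : R * R := (v.1.1 / (1 - v.2), v.1.2 / (1 - v.2)).
Definition nr z : R := z.1 ^+ 2 + z.2 ^+ 2.
Definition ist z : R * R * R :=
  (2 * z.1 / (nr z + 1), 2 * z.2 / (nr z + 1), (nr z - 1) / (nr z + 1)).

Lemma nr1_gt0 z : 0 < nr z + 1.
Proof. by rewrite /nr ltr_pwDr // addr_ge0 ?sqr_ge0. Qed.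

Lemma nr1_neq0 z : nr z + 1 != 0.
Proof. by rewrite gt_eqF // nr1_gt0. Qed.

Lemma ist_sq z : sq (ist z) = 1.
Proof. rewrite /sq /ist /=; have := nr1_neq0 z; rewrite /nr => h; field; exact: h. Qed.

Lemma ist_neq1 z : (ist z).2 != 1.
Proof.
rewrite /ist /=; apply/eqP => h; have h0 := nr1_neq0 z.
by have := congr1 (fun a => a * (nr z + 1)) h; rewrite mulfVK // mul1r; lra.
Qed.

Lemma istK z : st (ist z) = z.
Proof.
have h := nr1_neq0 z; rewrite [RHS]surjective_pairing /st /ist /=.
have -> : 1 - (nr z - 1) / (nr z + 1) = 2 / (nr z + 1) by field.
by congr (_, _); field.
Qed.

Lemma stK v : sq v = 1 -> v.2 != 1 -> ist (st v) = v.
Proof.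
case: v => [[a b] c]; rewrite /sq /= => e h.
have h1 : 1 - c != 0 by rewrite subr_eq0 eq_sym.
have en : nr (st (a, b, c)) = (1 + c) / (1 - c).
  rewrite /nr /st /= !expr_div_n -mulrDl.
  have -> : a ^+ 2 + b ^+ 2 = (1 - c) * (1 + c) by lra.
  by field.
have en1 : nr (st (a, b, c)) + 1 = 2 / (1 - c) by rewrite en; field.
by rewrite /ist en1 en /st /=; congr (_, _, _); field.
Qed.

Definition mk v (h : sq v = 1) : sphere R := exist _ v (mem_set (h : [set v | sq v = 1] v)).

Definition of_st F z : sphere R := mk (etrans (rf_sq F (ist z)) (ist_sq z)).

Lemma val_of_st F z : \val (of_st F z) = rf F (ist z).
Proof. by []. Qed.

Definition sphere_chart F : chart R (sphere R).
Proof.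
refine (@Chart R (sphere R) [set p : sphere R | (rf F (\val p)).2 != 1] setT (fun p : sphere R => st (rf F (\val p))) (of_st F) _ _ _ _ _ _ _ _).
- have cf := @rf_cont F; have cv := cta_val.
  rewrite openE => p /= hp.
  have c0 : cta (fun q : sphere R => ((rf F (\val q)).2 - 1) ^+ 2) p.
    by ct; exact: cv.
  have : 0 < ((rf F (\val p)).2 - 1) ^+ 2 by rewrite lt_neqAle sqr_ge0 andbT eq_sym sqrf_eq0 subr_eq0.
  move=> /(cta_gt0 c0); apply: filterS => q hq; apply/eqP => e.
  by move: hq; rewrite e subrr expr0n ltxx.
- exact: openT.
- by [].
- by move=> z _ /=; rewrite rf_inv ist_neq1.
- move=> p hp; apply: sphere_inj; rewrite val_of_st stK ?rf_inv // rf_sq; exact: sphereP.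
- by move=> z _; rewrite /= rf_inv istK.
- have cf := @rf_cont F; have cv := cta_val.
  move=> p hp; rewrite /st; apply: (_ : cta _ p).
  have h1 : 1 - (rf F (\val p)).2 != 0 by rewrite subr_eq0 eq_sym.
  by ct; solve [exact: h1 | exact: cv].
- have cf := @rf_cont F.
  move=> z _; apply: cta_sphere; rewrite /of_st /=.
  apply: (@cta_comp _ _ _ ist (rf F)); last exact: cf.
  have := nr1_neq0 z; rewrite /ist /nr => h; ct; exact: h.
Defined.

Definition rf_id : refl_map.
Proof. by refine (@ReflMap id _ _ _) => //; move=> x; exact: cvg_id. Defined.

(** A half turn and not the reflection in the equator, so that the transition between the two charts
    of the atlas preserves the orientation. *)
Definition rf_south : refl_map.
Proof.
refine (@ReflMap (fun v => (v.1.1, - v.1.2, - v.2)) _ _ _).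
- by ct.
- by move=> [[a b] c] /=; rewrite !opprK.
- by move=> v; rewrite /sq /= !sqrrN.
Defined.

Section Pole.
Variable N : R * R * R.
Hypotheses (N1 : sq N = 1) (N3 : N.2 != 1).

(** The coefficient of the reflection exchanging [N] and [(0, 0, 1)]: the squared length of their
    difference is [2 * (1 - N.2)]. A chart built from this reflection may reverse the orientation,
    which is why a sign [m] is carried along in the sequel. *)
Definition ip v : R := (v.1.1 * N.1.1 + v.1.2 * N.1.2 + v.2 * (N.2 - 1)) / (1 - N.2).

Definition rf_pole : refl_map.
Proof.
refine (@ReflMap (fun v => (v.1.1 - ip v * N.1.1, v.1.2 - ip v * N.1.2, v.2 - ip v * (N.2 - 1))) _ _ _).
- by rewrite /ip; ct.
- have h1 : 1 - N.2 != 0 by rewrite subr_eq0 eq_sym.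
  have e1 : N.1.1 ^+ 2 = 1 - N.1.2 ^+ 2 - N.2 ^+ 2 by have := N1; rewrite /sq; lra.
  have ipr v : ip (v.1.1 - ip v * N.1.1, v.1.2 - ip v * N.1.2, v.2 - ip v * (N.2 - 1)) = - ip v.
    rewrite {1}/ip /=.
    have -> : (v.1.1 - ip v * N.1.1) * N.1.1 + (v.1.2 - ip v * N.1.2) * N.1.2 +
       (v.2 - ip v * (N.2 - 1)) * (N.2 - 1) =
       (v.1.1 * N.1.1 + v.1.2 * N.1.2 + v.2 * (N.2 - 1)) - ip v * (N.1.1 ^+ 2 + N.1.2 ^+ 2 + (N.2 - 1) ^+ 2) by ring.
    have -> : N.1.1 ^+ 2 + N.1.2 ^+ 2 + (N.2 - 1) ^+ 2 = 2 * (1 - N.2) by rewrite e1; ring.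
    by rewrite mulrBl mulrA mulfK // -/(ip v); ring.
  move=> v /=; rewrite ipr [RHS]surjective_pairing [v.1 in RHS]surjective_pairing /=.
  by congr (_, _, _); ring.
- have h1 : 1 - N.2 != 0 by rewrite subr_eq0 eq_sym.
  have e1 : N.1.1 ^+ 2 = 1 - N.1.2 ^+ 2 - N.2 ^+ 2 by have := N1; rewrite /sq; lra.
  move=> v; rewrite /sq /=.
  have q : ip v * (1 - N.2) = v.1.1 * N.1.1 + v.1.2 * N.1.2 + v.2 * (N.2 - 1) by rewrite /ip mulfVK.
  have -> : (v.1.1 - ip v * N.1.1) ^+ 2 + (v.1.2 - ip v * N.1.2) ^+ 2 + (v.2 - ip v * (N.2 - 1)) ^+ 2 =
    v.1.1 ^+ 2 + v.1.2 ^+ 2 + v.2 ^+ 2 - 2 * ip v * (v.1.1 * N.1.1 + v.1.2 * N.1.2 + v.2 * (N.2 - 1)) +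
    ip v ^+ 2 * (N.1.1 ^+ 2 + N.1.2 ^+ 2 + (N.2 - 1) ^+ 2) by ring.
  by rewrite -q e1; ring.
Defined.

Lemma rf_pole_eq v : sq v = 1 -> (rf rf_pole v).2 = 1 -> v = N.
Proof.
move=> s1 h; have sr : sq (rf rf_pole v) = 1 by rewrite rf_sq.
have [a0 b0] : (rf rf_pole v).1.1 = 0 /\ (rf rf_pole v).1.2 = 0.
  have := sr; rewrite /sq h expr1n => e.
  have := sqr_ge0 (rf rf_pole v).1.1; have := sqr_ge0 (rf rf_pole v).1.2 => g1 g2.
  by split; apply/eqP; rewrite -sqrf_eq0; apply/eqP; lra.
have e : rf rf_pole v = (0, 0, 1).
  by rewrite [LHS]surjective_pairing [(rf _ v).1]surjective_pairing a0 b0 h.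
have <- := rf_inv rf_pole v; rewrite e /= /ip /=.
have h1 : 1 - N.2 != 0 by rewrite subr_eq0 eq_sym.
have -> : (0 * N.1.1 + 0 * N.1.2 + 1 * (N.2 - 1)) / (1 - N.2) = -1 by field.
rewrite [RHS]surjective_pairing [N.1 in RHS]surjective_pairing.
by congr (_, _, _); ring.
Qed.

End Pole.

Lemma sphere_chart_avoiding p : exists k : chart R (sphere R), cod k = setT /\ forall q, q <> p -> dom k q.
Proof.
case: (eqVneq (\val p).2 1) => [e|ne].
  exists (sphere_chart rf_id); split=> // q nq; apply/eqP => /= e'; apply: nq; apply: sphere_inj.
  have h (r : sphere R) : (\val r).2 = 1 -> \val r = (0, 0, 1).
    move=> er; have := sphereP r; rewrite /sq er expr1n => e1.
    have := sqr_ge0 (\val r).1.1; have := sqr_ge0 (\val r).1.2 => g1 g2.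
    have [a0 b0] : (\val r).1.1 = 0 /\ (\val r).1.2 = 0.
      by split; apply/eqP; rewrite -sqrf_eq0; apply/eqP; lra.
    by rewrite [LHS]surjective_pairing [(\val r).1]surjective_pairing a0 b0 er.
  by rewrite (h q e') (h p e).
exists (sphere_chart (rf_pole (sphereP p) ne)); split=> // q nq; apply/eqP => e; apply: nq.
by apply: sphere_inj; exact: (rf_pole_eq (sphereP q) e).
Qed.

Definition north := sphere_chart rf_id.
Definition south := sphere_chart rf_south.
Definition sphere_atlas : set (chart R (sphere R)) := [set f | f = north \/ f = south].

Lemma op_id z : orientation_preserving_at (fun y : R * R => y) z.
Proof. by apply: (@op_rot _ _ 0) => r u; rewrite addr0. Qed.

(** The inverse [1 / z] of a complex number. *)
Definition inversion z : R * R := (z.1 / nr z, - z.2 / nr z).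

Lemma op_inversion z : z <> (0, 0) -> orientation_preserving_at inversion z.
Proof.
move=> nz.
have nr_gt0 y : y <> (0, 0) -> 0 < nr y.
  by move=> /dot_gt0; rewrite /dot /= !subr0 /nr -!expr2.
have z0 := nr_gt0 z nz.
have cd : cta (fun y : R * R => dot y (0, 0) z (0, 0)) z by rewrite /dot; ct.
have [e e0 he] := nbhs_box (cta_gt0 cd (dot_gt0 nz)).
have n0 y : box z e y -> y <> (0, 0).
  by move=> /he + e1; rewrite e1 /dot /= !subrr !mul0r addr0 ltxx.
have hemb : emb inversion z e.
  split=> // [y /n0/nr_gt0 y0|y y' /n0/nr_gt0 y0 /n0/nr_gt0 y0' E].
    have : nr y != 0 by rewrite gt_eqF.
    by rewrite /inversion /nr => h; ct.
  have K x : 0 < nr x -> inversion (inversion x) = x.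
    move=> x0; have h : nr x != 0 by rewrite gt_eqF.
    have en : nr (inversion x) = (nr x)^-1.
      by rewrite {1}/nr /inversion /= !expr_div_n sqrrN -mulrDl -/(nr x); field.
    rewrite {1}/inversion en /= [RHS]surjective_pairing.
    by congr (_, _); field.
  by rewrite -(K y) // -(K y') // E.
have re : 0 < e / 2 < e by lra.
have r0 : 0 < e / 2 by lra.
apply: (degr_op hemb re); rewrite /degr.
(* As a complex number, [(a, b)] is minus the square of the conjugate of [z], a positive multiple of
   the derivative [-1 / z ^ 2]. The image of the small circle is compared with the circle turned by
   the argument of this derivative. *)
pose a := - (z.1 ^+ 2 - z.2 ^+ 2); pose b := 2 * z.1 * z.2.
have [|k [al [k0 ek]]] := @polar_ex R (a, b) (0, 0).
  move=> [a0 b0]; have : a ^+ 2 + b ^+ 2 = nr z ^+ 2 by rewrite /a /b /nr; ring.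
  by rewrite a0 b0 expr0n addr0 => /esym/eqP; rewrite sqrf_eq0 gt_eqF.
move: ek; rewrite /polar /= !add0r => -[ea eb].
pose c' u : R * R := (e / 2 * k * cos (u + al), e / 2 * k * sin (u + al)).
have p0 := twopi_gt0 R.
rewrite (@ang_dot R _ c' _ (0, 0)).
- rewrite (ang_lift_on (a := fun u => u + al)); [by ring | exact: ltW | by ct |].
  by move=> u _; exists (e / 2 * k); split; [exact: mulr_gt0 | rewrite /polar !add0r].
- exact: ltW.
- move=> u _; apply: (@cta_comp _ _ _ (polar z (e / 2)) inversion); first exact: polar_cont.
  by case: hemb => _ ch _; apply/ch/circ_polar/circ_center.
- by move=> u _; rewrite /c'; ct.
- move=> u _; have bz := box_polar0 z u re.
  have dz := he _ bz; have zz' := nr_gt0 _ (n0 _ bz).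
  move: dz zz'; rewrite /dot /c' /inversion /polar /= !subr0 cosD sinD.
  set X := z.1; set Y := z.2; set d1 := e / 2 * cos u; set d2 := e / 2 * sin u.
  rewrite /nr /= -/X -/Y => dz zz'.
  have -> : e / 2 * k * (cos u * cos al - sin u * sin al) = d1 * a - d2 * b.
    by rewrite ea eb /d1 /d2; ring.
  have -> : e / 2 * k * (sin u * cos al + cos u * sin al) = d2 * a + d1 * b.
    by rewrite ea eb /d1 /d2; ring.
  have zn : X ^+ 2 + Y ^+ 2 != 0 by rewrite gt_eqF.
  have zn' : (X + d1) ^+ 2 + (Y + d2) ^+ 2 != 0 by rewrite gt_eqF.
  have -> : ((X + d1) / ((X + d1) ^+ 2 + (Y + d2) ^+ 2) - X / (X ^+ 2 + Y ^+ 2)) * (d1 * a - d2 * b) +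
    (- (Y + d2) / ((X + d1) ^+ 2 + (Y + d2) ^+ 2) - - Y / (X ^+ 2 + Y ^+ 2)) * (d2 * a + d1 * b) =
    (d1 ^+ 2 + d2 ^+ 2) * ((X + d1) * X + (Y + d2) * Y) / ((X + d1) ^+ 2 + (Y + d2) ^+ 2).
    rewrite /a /b -/X -/Y; field; rewrite ?zn ?zn' //.
  apply: divr_gt0 => //; apply: mulr_gt0 => //.
  have -> : d1 ^+ 2 + d2 ^+ 2 = (e / 2) ^+ 2 * (cos u ^+ 2 + sin u ^+ 2) by rewrite /d1 /d2; ring.
  by rewrite cos2Dsin2 mulr1 exprn_gt0.
- by have := polar_02pi z (e / 2); rewrite /polar => ->.
- rewrite /c'; have := polar_2pi ((0, 0) : R * R) 1 al; rewrite /polar !mul1r !add0r => -[h1 h2].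
  by rewrite [2 * pi + al]addrC h1 h2.
Qed.

Lemma north_south z : z <> (0, 0) -> st (rf rf_south (ist z)) = inversion z.
Proof.
move=> nz; have h := nr1_neq0 z.
have z0 : nr z != 0 by rewrite gt_eqF //; have := dot_gt0 nz; rewrite /dot /= !subr0 /nr -!expr2.
rewrite /st /inversion /=.
have -> : 1 - - ((nr z - 1) / (nr z + 1)) = 2 * nr z / (nr z + 1) by field.
by congr (_, _); field; rewrite ?h ?z0.
Qed.

Lemma nonzero_near z : z <> (0, 0) -> \forall y \near z, y <> (0, 0).
Proof.
move=> nz; have cd : cta (fun y : R * R => dot y (0, 0) z (0, 0)) z by rewrite /dot; ct.
have := cta_gt0 cd (dot_gt0 nz); apply: filterS => y + e1.
by rewrite e1 /dot /= !subrr !mul0r addr0 ltxx.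
Qed.

Lemma sphere_oriented : oriented_atlas sphere_atlas.
Proof.
split.
  move=> p; case: (eqVneq (\val p).2 1) => [e|ne]; last by exists north => //; left.
  by exists south; [right | rewrite /= e; apply/eqP; lra].
have zero (p : sphere R) F : (rf F (\val p)).2 != 1 -> (rf F (\val p)).2 != -1 ->
    st (rf F (\val p)) <> (0, 0).
  move=> h1 h2 [e1 e2]; have s1 : sq (rf F (\val p)) = 1 by rewrite rf_sq; exact: sphereP.
  have h : 1 - (rf F (\val p)).2 != 0 by rewrite subr_eq0 eq_sym.
  have a0 : (rf F (\val p)).1.1 = 0 by rewrite -[LHS](mulfVK h) e1 mul0r.
  have b0 : (rf F (\val p)).1.2 = 0 by rewrite -[LHS](mulfVK h) e2 mul0r.
  move: s1; rewrite /sq a0 b0 expr0n !add0r => /eqP; rewrite -subr_eq0 subr_sqr_1 mulf_eq0.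
  by rewrite subr_eq0 (negbTE h1) addr_eq0 (negbTE h2).
move=> f hf g hg p fp gp.
have idop F : orientation_preserving_at (to_plane (sphere_chart F) \o of_plane (sphere_chart F)) (to_plane (sphere_chart F) p).
  have -> : to_plane (sphere_chart F) \o of_plane (sphere_chart F) = (fun y => y).
    by apply/funext => y; rewrite /= rf_inv istK.
  exact: op_id.
case: hf fp => -> fp; case: hg gp => -> gp; try exact: idop.
- apply: (@op_near _ inversion).
    have : \forall y \near st (rf rf_id (\val p)), y <> (0, 0).
      apply: nonzero_near; apply: zero => //; apply/eqP => e.
      by move: gp; rewrite /= -[(\val p).2]/((rf rf_id (\val p)).2) e opprK eqxx.
    by apply: filterS => y ny; rewrite -north_south.
  apply: op_inversion; apply: zero => //; apply/eqP => e.
  by move: gp; rewrite /= -[(\val p).2]/((rf rf_id (\val p)).2) e opprK eqxx.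
- have e0 : rf rf_south (\val p) = rf rf_south (\val p) by [].
  have ne : (rf rf_south (\val p)).2 != -1.
    by apply/eqP => /= e; move: fp => /=; have := gp => /= + _; rewrite -[(\val p).2]opprK e opprK eqxx.
  apply: (@op_near _ inversion).
    have : \forall y \near st (rf rf_south (\val p)), y <> (0, 0) by apply: nonzero_near; exact: zero.
    by apply: filterS => y ny; rewrite -north_south.
  by apply: op_inversion; exact: zero.
Qed.

Lemma plane_connected : connected [set: (R * R)%type].
Proof.
have -> : [set: R * R] = \bigcup_(y : R * R) [set ((t * y.1, t * y.2) : R * R) | t in `[0, 1]%classic].
  apply/seteqP; split=> // y _; exists y => //=; exists 1; last by rewrite !mul1r -surjective_pairing.
  by rewrite in_itv /= ler01 lexx.
apply: bigcup_connected.
  by exists (0, 0) => y _; exists 0; [rewrite /= in_itv /= ler01 lexx | rewrite !mul0r].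
move=> y _; apply: connected_continuous_connected; first exact: segment_connected.
by apply: continuous_subspaceT; ct.
Qed.

Lemma sphere_connected : connected [set: sphere R].
Proof.
have im F : connected (range (of_plane (sphere_chart F))).
  apply: connected_continuous_connected; first exact: plane_connected.
  apply: continuous_subspaceT => z; apply: (@of_plane_continuous _ _ (sphere_chart F)).
  by [].
have -> : [set: sphere R] = range (of_plane north) `|` range (of_plane south).
  apply/seteqP; split=> // p _; have [g gO gp] := sphere_oriented.1 p.
  case: gO gp => -> gp; [left; exists (to_plane north p) | right; exists (to_plane south p)] => //; exact: to_planeK.
apply: connectedU; [| exact: (im rf_id) | exact: (im rf_south)].
have q1 : sq ((1, 0, 0) : R * R * R) = 1 by rewrite /sq /=; ring.
exists (mk q1); split.
  exists (to_plane north (mk q1)) => //; apply: to_planeK => /=.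
  by rewrite eq_sym oner_eq0.
exists (to_plane south (mk q1)) => //; apply: to_planeK => /=.
by rewrite oppr0 eq_sym oner_eq0.
Qed.

Lemma sphere_surface : closed_oriented_surface sphere_atlas.
Proof.
split.
- have q1 : sq ((1, 0, 0) : R * R * R) = 1 by rewrite /sq /=; ring.
  by exists (mk q1).
- exact: sphere_compact.
- exact: sphere_hausdorff.
- exact: sphere_connected.
- exact: sphere_oriented.
Qed.

End Sphere.

(** * The intersection form *)

Section Rows.
Variable n : nat.

Definition passage : Type := ('I_n * (bool * 'I_n))%type.
Implicit Types (x y : passage) (r : 'I_n -> seq (bool * 'I_n)) (al be de : passage -> int) (i j : 'I_n).

(* The passage [(i, (b, j))] is the visit of curve [i] to its crossing of sign [b] with
   curve [j]; [th] is the same crossing as visited by [j]. Integer functions on passages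
   are chains, the passage [x] standing for the edge which follows it. *)
Definition valid x : bool := x.1 != x.2.2.
Definition th x : passage := (x.2.2, (~~ x.2.1, x.1)).
Definition good r : Prop := forall i, uniq (r i) /\ forall e, (e \in r i) = (e.2 != i).
Definition nx r x : passage := (x.1, next (r x.1) x.2).
Definition pv r x : passage := (x.1, prev (r x.1) x.2).

(** Kirchhoff's law at the crossing of [x]: the edges leaving it are [x] and [th x], those arriving
    are their predecessors. *)
Definition cyc r al : Prop := forall x, valid x ->
  al x - al (pv r x) + (al (th x) - al (pv r (th x))) = 0.

(* The intersection number of two cycles of the arrangement graph. *)
Definition isect r al be : int :=
  \sum_(x : passage | valid x && x.2.1) (be x * al (th x) - be (pv r (th x)) * al (pv r x)).

Definition planar r : Prop := forall al be, cyc r al -> cyc r be -> isect r al be = 0.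

Definition sup (s : seq 'I_n) al : Prop := forall x, x.1 \notin s -> al x = 0.

Lemma thK : involutive th.
Proof. by case=> i [b j]; rewrite /th /= negbK. Qed.

Lemma th_valid x : valid (th x) = valid x.
Proof. by rewrite /valid /th /= eq_sym. Qed.

Variable r : 'I_n -> seq (bool * 'I_n).
Hypothesis gr : good r.

Lemma rowP x : (x.2 \in r x.1) = valid x.
Proof. by case: (gr x.1) => _ ->; rewrite /valid eq_sym. Qed.

Lemma nx_valid x : valid (nx r x) = valid x.
Proof. by rewrite -!rowP /= mem_next. Qed.

Lemma pv_valid x : valid (pv r x) = valid x.
Proof. by rewrite -!rowP /= mem_prev. Qed.

Lemma nxK x : pv r (nx r x) = x.
Proof. by case: (gr x.1) => u _; rewrite /pv /nx /= prev_next //; case: x u. Qed.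

Lemma pvK x : nx r (pv r x) = x.
Proof. by case: (gr x.1) => u _; rewrite /pv /nx /= next_prev //; case: x u. Qed.

Lemma sum_rows (V : nmodType) (f : passage -> V) :
  \sum_(x | valid x) f x = \sum_(i : 'I_n) \sum_(e <- r i) f (i, e).
Proof.
rewrite (eq_bigl (fun x : passage => true && (x.2 \in r x.1))); last by move=> x; rewrite rowP.
rewrite (eq_bigr (fun x : passage => f (x.1, x.2))); last by case.
rewrite -(pair_big_dep xpredT (fun i e => e \in r i) (fun i e => f (i, e))) /=.
by apply: eq_bigr => i _; case: (gr i) => u _; rewrite big_uniq.
Qed.

Lemma sum_pv (V : nmodType) (f : passage -> V) : \sum_(x | valid x) f (pv r x) = \sum_(x | valid x) f x.
Proof.
rewrite [RHS](reindex (pv r)) /=; last by exists (nx r) => x _; [exact: pvK | exact: nxK].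
by apply: eq_bigl => x; rewrite pv_valid.
Qed.

Lemma sum_half (V : nmodType) (f : passage -> V) :
  \sum_(x | valid x) f x = \sum_(x : passage | valid x && x.2.1) (f x + f (th x)).
Proof.
rewrite (bigID (fun x : passage => x.2.1)) /= big_split /=; congr (_ + _).
rewrite (reindex th) /=; last by exists th => x _; exact: thK.
by apply: eq_bigl => x; rewrite th_valid negbK.
Qed.

(** By Kirchhoff's law the symmetrized term of a crossing is, up to sign, the increment of [al * be]
    along the two curves through it, and increments telescope along the rows. *)
Lemma isect_anti al be : cyc r al -> cyc r be -> isect r al be = - isect r be al.
Proof.
move=> ca cb; apply/eqP; rewrite -addr_eq0 /isect -big_split /=.
have : \sum_(x | valid x) (al x * be x - al (pv r x) * be (pv r x)) = 0.
  by rewrite sumrB (sum_pv (fun x => al x * be x)) subrr.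
rewrite sum_half => /(congr1 -%R); rewrite oppr0 -sumrN => h; apply/eqP; apply: etrans h.
apply: eq_bigr => x /andP[v b].
have := ca x v; have := cb x v.
set a1 := al x; set a0 := al (pv r x); set c1 := al (th x); set c0 := al (pv r (th x)).
set b1 := be x; set b0 := be (pv r x); set d1 := be (th x); set d0 := be (pv r (th x)) => e1 e2.
have -> : a1 = a0 - c1 + c0 by lia.
have -> : b1 = b0 - d1 + d0 by lia.
ring.
Qed.

Lemma isectDl al al' be : isect r (fun x => al x + al' x) be = isect r al be + isect r al' be.
Proof. by rewrite /isect -big_split; apply: eq_bigr => x _ /=; ring. Qed.

Lemma isectDr al be be' : isect r al (fun x => be x + be' x) = isect r al be + isect r al be'.
Proof. by rewrite /isect -big_split; apply: eq_bigr => x _ /=; ring. Qed.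

Lemma isectZr al be k : isect r al (fun x => k * be x) = k * isect r al be.
Proof. by rewrite /isect big_distrr /=; apply: eq_bigr => x _ /=; ring. Qed.

Lemma isect_sumr (I : finType) (P : pred I) al (F : I -> passage -> int) :
  isect r al (fun x => \sum_(k | P k) F k x) = \sum_(k | P k) isect r al (F k).
Proof.
rewrite /isect exchange_big /=; apply: eq_bigr => x _.
by rewrite sumrB !big_distrl.
Qed.

Lemma isect_eqr al be be' : (forall x, valid x -> be x = be' x) -> isect r al be = isect r al be'.
Proof.
move=> h; apply: eq_bigr => x /andP[v _]; rewrite !h //.
by rewrite pv_valid th_valid.
Qed.

Definition ga i x : int := (x.1 == i)%:Z.

Lemma cyc_ga i : cyc r (ga i). Proof. by move=> x v; rewrite /ga /=; ring. Qed.

Lemma sup_ga i : sup [:: i] (ga i).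
Proof. by move=> x; rewrite inE /ga => /negbTE ->. Qed.

(** A primitive of [de] along each row, starting from the head of the list and including the passage
    [x] itself. *)
Definition integ de x : int := \sum_(e <- take (index x.2 (r x.1)).+1 (r x.1)) de (x.1, e).

Lemma integD de de' x : integ (fun y => de y + de' y) x = integ de x + integ de' x.
Proof. by rewrite /integ big_split. Qed.

Lemma integZ k de x : integ (fun y => k * de y) x = k * integ de x.
Proof. by rewrite /integ big_distrr. Qed.

Lemma integ_sum (I : finType) (P : pred I) (F : I -> passage -> int) x :
  integ (fun y => \sum_(k | P k) F k y) x = \sum_(k | P k) integ (F k) x.
Proof. by rewrite /integ exchange_big. Qed.

Lemma integ_sup s de : sup s de -> sup s (integ de).
Proof. by move=> h x ns; rewrite /integ big1 // => e _; exact: h. Qed.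

(** What characterizes the increments of a cycle: they cancel at each crossing and add up to 0
    around each curve. *)
Definition closed_delta de : Prop :=
  (forall x, valid x -> de (th x) = - de x) /\ forall i, \sum_(e <- r i) de (i, e) = 0.

Lemma integP de x : (forall i, \sum_(e <- r i) de (i, e) = 0) -> valid x ->
  integ de x - integ de (pv r x) = de x.
Proof.
case: x => i e h v; have := v; rewrite -rowP /= => ei; rewrite /integ /=.
have [u _] := gr i; have hi := h i.
move: ei u hi; case E : (r i) => [|y q] // ei u hi.
have lt : (index e q < size (y :: q))%N by rewrite /= ltnS index_size.
rewrite prev_nth ei (index_uniq _ lt u).
(* The predecessor of the head is the last entry, where the primitive has reached the total sum
   0. *)
have [ye|ne] := eqVneq y e.
  subst y; have nq : e \notin q by case/andP: u.
  rewrite (memNindex nq) /= eqxx take0 take_size big_seq1.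
  by rewrite hi subr0.
have kq : (index e q < size q)%N by rewrite index_mem; move: ei; rewrite inE eq_sym (negbTE ne).
have -> : index e (y :: q) = (index e q).+1 by rewrite /= (negbTE ne).
have kq' : ((index e q).+1 < size (y :: q))%N by [].
rewrite (take_nth e kq') big_rcons /=.
by rewrite nth_index -?index_mem //; ring.
Qed.

Lemma cyc_integ de : closed_delta de -> cyc r (integ de).
Proof.
move=> [ha hs] x v; rewrite !integP // ?th_valid //.
by rewrite ha // subrr.
Qed.

Lemma delta_closed al : cyc r al -> closed_delta (fun x => al x - al (pv r x)).
Proof.
move=> ca; split=> [x v|i]; first by have := ca x v; lia.
rewrite sumrB; apply/eqP; rewrite subr_eq0; apply/eqP.
have [u _] := gr i.
rewrite [RHS](_ : _ = \sum_(e <- [seq prev (r i) e | e <- r i]) al (i, e)); last by rewrite big_map.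
apply: perm_big; apply: uniq_perm => //.
  by rewrite map_inj_uniq //; exact: can_inj (next_prev u).
move=> e; apply/idP/mapP => [ei|[e' ei ->]]; last by rewrite mem_prev.
by exists (next (r i) e); rewrite ?mem_next // prev_next.
Qed.

Lemma row_constant al : (forall x, valid x -> al x = al (pv r x)) ->
  exists a : 'I_n -> int, forall x, valid x -> al x = \sum_i a i * ga i x.
Proof.
move=> h; exists (fun i => if r i is e :: _ then al (i, e) else 0) => x v.
rewrite (bigD1 x.1) //= big1 => [|i ni]; last by rewrite /ga eq_sym (negbTE ni) mulr0.
rewrite /ga eqxx mulr1 addr0; case: x v => i e v /=.
have := v; rewrite -rowP /= => ei; have [u _] := gr i.
case E : (r i) ei u => [|y q] // ei u.
have H k : (k < size (y :: q))%N -> al (i, nth y (y :: q) k) = al (i, y).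
  elim: k => [//|k IH] hk; rewrite -IH; last exact: ltnW.
  have hz : nth y (y :: q) k.+1 \in y :: q by rewrite mem_nth.
  have ek : index (nth y (y :: q) k.+1) q = k by apply: (@index_uniq _ y k q) => //; case/andP: u.
  move: hz ek; set z := nth y (y :: q) k.+1 => hz ek.
  have vz : valid (i, z) by rewrite -rowP /= E.
  have -> := h _ vz; have -> : pv r (i, z) = (i, prev (y :: q) z) by rewrite /pv /= E.
  by rewrite prev_nth hz ek.
by have := H _ (etrans (index_mem e _) ei); rewrite nth_index.
Qed.

Definition el (v : passage) x : int := (x == v)%:Z - (x == th v)%:Z.
(** The increment of a path which turns from curve [j] into curve [i] at one chosen crossing of the
    two. It is 0 for [i = j], so that degenerate cycles obey the same identities. *)
Definition ed i j x : int := if i == j then 0 else el (i, (true, j)) x.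

Lemma th_eq x y : (th x == y) = (x == th y).
Proof. by rewrite -(inj_eq (inv_inj thK)) thK. Qed.

Lemma el_th v x : el v (th x) = - el v x.
Proof. by rewrite /el !th_eq thK; ring. Qed.

Lemma el_sum v i : valid v -> \sum_(e <- r i) el v (i, e) = (v.1 == i)%:Z - (v.2.2 == i)%:Z.
Proof.
have H w : valid w -> \sum_(e <- r i) (((i, e) : passage) == w)%:Z = (w.1 == i)%:Z.
  case: w => j f vw; have [u _] := gr i; rewrite /=.
  rewrite (eq_bigr (fun e => if e == f then ((j == i)%:Z : int) else 0)); last first.
    by move=> e _; rewrite xpair_eqE eq_sym [e == f]eq_sym; case: (f == e); rewrite ?andbT ?andbF.
  rewrite -big_mkcond /=; case: (eqVneq j i) vw => [-> vw|_ _].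
    rewrite -big_filter filter_pred1_uniq ?big_seq1 //.
    by have := vw; rewrite -rowP.
  by rewrite big1.
by move=> vv; rewrite sumrB !H ?th_valid.
Qed.

Lemma ed_th i j x : ed i j (th x) = - ed i j x.
Proof. by rewrite /ed; case: eqP => _; rewrite ?oppr0 ?el_th. Qed.

Lemma ed_sum i j k : \sum_(e <- r k) ed i j (k, e) = (i == k)%:Z - (j == k)%:Z.
Proof.
rewrite /ed; case: (eqVneq i j) => [->|ne]; first by rewrite big1 // subrr.
by rewrite el_sum.
Qed.

Lemma sup_el s v : v.1 \in s -> v.2.2 \in s -> sup s (el v).
Proof.
move=> h1 h2 x hx; rewrite /el.
have -> : (x == v) = false by apply: contraNF hx => /eqP ->.
have -> // : (x == th v) = false by apply: contraNF hx => /eqP ->.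
Qed.

Lemma sup_ed s i j : i \in s -> j \in s -> sup s (ed i j).
Proof. by move=> h1 h2 x hx; rewrite /ed; case: eqP => // _; exact: (sup_el (v := (i, (true, j))) h1 h2). Qed.

Lemma supD s al be : sup s al -> sup s be -> sup s (fun x => al x + be x).
Proof. by move=> h1 h2 x hx; rewrite h1 // h2. Qed.

Lemma supN s al : sup s al -> sup s (fun x => - al x).
Proof. by move=> h1 x hx; rewrite h1. Qed.

Lemma sup_sub s s' al : {subset s <= s'} -> sup s al -> sup s' al.
Proof. by move=> h h1 x hx; apply: h1; apply: contra hx; exact: h. Qed.

(** Cycles on two and three curves, turning at the chosen crossings. In [star o v] the corner
    between the last two curves is the arbitrary crossing [v]. *)
Definition lens i j : passage -> int := integ (fun x => ed i j x + ed j i x).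
Definition tri i j k : passage -> int := integ (fun x => ed i j x + ed j k x + ed k i x).
Definition star o (v : passage) : passage -> int :=
  integ (fun x => el v x + ed o v.1 x - ed o v.2.2 x).

Lemma closed_lens i j : closed_delta (fun x => ed i j x + ed j i x).
Proof. by split=> [x _|k]; rewrite ?big_split /= ?ed_sum ?ed_th; ring. Qed.

Lemma closed_tri i j k : closed_delta (fun x => ed i j x + ed j k x + ed k i x).
Proof. by split=> [x _|l]; rewrite ?big_split /= ?big_split /= ?ed_sum ?ed_th; ring. Qed.

Lemma closed_star o v : valid v -> closed_delta (fun x => el v x + ed o v.1 x - ed o v.2.2 x).
Proof.
move=> vv; split=> [x _|l]; first by rewrite !ed_th el_th; ring.
rewrite (eq_bigr (fun e => (el v (l, e) + ed o v.1 (l, e)) + -1 * ed o v.2.2 (l, e))); last by move=> e _; ring.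
by rewrite big_split /= big_split /= -big_distrr /= !ed_sum el_sum //; ring.
Qed.

(** Coning from [o]: the terms in [el] reproduce [de], and the terms in [ed o], collected by rows,
    are multiples of the row sums, which vanish. *)
Lemma star_decomp o de : closed_delta de -> forall x, valid x ->
  de x = \sum_(v : passage | valid v && v.2.1) de v * (el v x + ed o v.1 x - ed o v.2.2 x).
Proof.
move=> [ha hs] x vx.
have e1 : \sum_(v : passage | valid v && v.2.1) de v * el v x = de x.
  transitivity (\sum_(v : passage | valid v) de v * (x == v)%:Z).
    rewrite [RHS](sum_half (fun v => de v * (x == v)%:Z)); apply: eq_bigr => v /andP[vv _].
    by rewrite ha // /el; ring.
  rewrite (bigD1 x) //= eqxx mulr1 big1 ?addr0 // => v /andP[_ nv].
  by rewrite eq_sym (negbTE nv) mulr0.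
have e2 : \sum_(v : passage | valid v && v.2.1) de v * (ed o v.1 x - ed o v.2.2 x) = 0.
  transitivity (\sum_(v : passage | valid v) de v * ed o v.1 x).
    rewrite [RHS](sum_half (fun v => de v * ed o v.1 x)); apply: eq_bigr => v /andP[vv _].
    by rewrite ha //=; ring.
  rewrite (sum_rows (fun v => de v * ed o v.1 x)) big1 // => i _ /=.
  by rewrite -big_distrl /= hs mul0r.
rewrite (eq_bigr (fun v => de v * el v x + de v * (ed o v.1 x - ed o v.2.2 x))).
  by rewrite big_split /= e1 e2 addr0.
by move=> v _; ring.
Qed.

Lemma sup_star o v : sup [:: o; v.1; v.2.2] (star o v).
Proof.
apply: integ_sup; apply: supD; last by apply: supN; apply: sup_ed; rewrite !inE eqxx ?orbT.
apply: supD; first by apply: sup_el; rewrite !inE eqxx ?orbT.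
by apply: sup_ed; rewrite !inE eqxx ?orbT.
Qed.

Lemma cyc_star o v : valid v -> cyc r (star o v).
Proof. by move=> vv; apply: cyc_integ; exact: closed_star. Qed.

(** Removing from [be] the primitive of its increments leaves a combination of whole curves, and the
    primitive is a combination of cones with apex [o]. *)
Lemma isect_decomp o al be : cyc r be ->
  (forall i, isect r al (ga i) = 0) ->
  (forall v, valid v -> v.2.1 -> isect r al (star o v) = 0) -> isect r al be = 0.
Proof.
move=> cb hg hstar; pose de x := be x - be (pv r x).
have cd : closed_delta de by exact: delta_closed.
have [a ha] : exists a : 'I_n -> int, forall x, valid x -> be x - integ de x = \sum_i a i * ga i x.
  apply: row_constant => x vx; have := integP (proj2 cd) vx; rewrite {3}/de; lia.
have hb x : valid x -> be x = (\sum_i a i * ga i x) +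
    \sum_(v : passage | valid v && v.2.1) de v * star o v x.
  move=> vx; rewrite -ha // -[LHS](subrK (integ de x)); congr (_ + _).
  rewrite /star -(eq_bigr _ (fun v _ => integZ _ _ _)) -integ_sum /integ big_seq [RHS]big_seq.
  apply: eq_bigr => e /mem_take ei; apply: (star_decomp o cd).
  by rewrite -rowP.
rewrite (isect_eqr _ hb) isectDr !isect_sumr.
rewrite big1 => [|i _]; last by rewrite isectZr hg mulr0.
by rewrite add0r big1 // => v /andP[v1 v2]; rewrite isectZr hstar // mulr0.
Qed.

(** * Reduction to cycles on four curves *)

Section Local.
Hypothesis loc : forall s al be, (size s <= 4)%N -> cyc r al -> cyc r be -> sup s al -> sup s be ->
  isect r al be = 0.

(** With the apex on [i], a cone adds at most two curves to [i] and [j], so that [loc] applies to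
    each test. *)
Lemma sup2_ann i j al be : cyc r al -> sup [:: i; j] al -> cyc r be -> isect r al be = 0.
Proof.
move=> ca sa cb; apply: (@isect_decomp i) => // [k|v v1 v2].
  apply: (loc (s := [:: i; j; k])) => //; first exact: cyc_ga.
    by apply: (sup_sub _ sa) => z; rewrite !inE => /orP[]->; rewrite ?orbT.
  by apply: (sup_sub _ (@sup_ga k)) => z; rewrite !inE => ->; rewrite ?orbT.
apply: (loc (s := [:: i; j; v.1; v.2.2])) => //; first exact: cyc_star.
  by apply: (sup_sub _ sa) => z; rewrite !inE => /orP[]->; rewrite ?orbT.
by apply: (sup_sub _ (@sup_star i v)) => z; rewrite !inE => /or3P[]->; rewrite ?orbT.
Qed.

Lemma ann_lens i j be : cyc r be -> isect r (lens i j) be = 0.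
Proof.
apply: (@sup2_ann i j); first exact/cyc_integ/closed_lens.
by apply: integ_sup; apply: supD; apply: sup_ed; rewrite !inE eqxx ?orbT.
Qed.

Lemma cyc_tri i j k : cyc r (tri i j k).
Proof. exact/cyc_integ/closed_tri. Qed.

Lemma sup_tri i j k : sup [:: i; j; k] (tri i j k).
Proof.
by apply: integ_sup; apply: supD; [apply: supD|]; apply: sup_ed; rewrite !inE eqxx ?orbT.
Qed.

Lemma tri_rot i j k : tri i j k = tri j k i.
Proof.
rewrite /tri; congr integ; apply/funext => x; ring.
Qed.

(** The boundary of a tetrahedron: a triangle is the sum of the three triangles on its sides with
    apex [c], up to lenses, which pair to 0 with every cycle. *)
Lemma tri_split (x a b c : 'I_n) be : cyc r be ->
  isect r (tri x a b) be = isect r (tri x a c) be + isect r (tri x c b) be + isect r (tri c a b) be.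
Proof.
move=> cb.
have E : (fun y => tri x a b y + (lens a c y + (lens c x y + lens c b y))) =
         (fun y => tri x a c y + (tri x c b y + tri c a b y)).
  apply/funext => y; rewrite /tri /lens -!integD; congr (integ _ y); apply/funext => z; ring.
have := congr1 (fun f => isect r f be) E; rewrite !isectDl !ann_lens //.
by rewrite !addr0 addrA.
Qed.

Lemma tri_loc (x a b : 'I_n) be s : cyc r be -> sup s be -> {subset [:: x; a; b] <= s} -> (size s <= 4)%N ->
  isect r (tri x a b) be = 0.
Proof.
move=> cb sb ss s4; apply: (loc s4) => //; first exact: cyc_tri.
by apply: (sup_sub ss); exact: sup_tri.
Qed.

(** Of the three triangles obtained by splitting [tri x a b] at [c], two share two curves with
    [tri x c d]; these pairs live on four curves and vanish. *)
Lemma tri_shift (x a b c d : 'I_n) :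
  isect r (tri x a b) (tri x c d) = isect r (tri c a b) (tri c d x).
Proof.
have cb := cyc_tri x c d; have sb := @sup_tri x c d.
rewrite (@tri_split x a b c) // (@tri_loc x a c _ [:: a; x; c; d]) //; first last.
- by move=> z; rewrite !inE => /or3P[]->; rewrite ?orbT.
- by apply: (sup_sub _ sb) => z; rewrite !inE => /or3P[]->; rewrite ?orbT.
rewrite (@tri_loc x c b _ [:: b; x; c; d]) //; first last.
- by move=> z; rewrite !inE => /or3P[]->; rewrite ?orbT.
- by apply: (sup_sub _ sb) => z; rewrite !inE => /or3P[]->; rewrite ?orbT.
by rewrite !add0r (tri_rot x c d).
Qed.

Lemma tri_shift' (x a b c d : 'I_n) :
  isect r (tri x a b) (tri x c d) = isect r (tri a b x) (tri a c d).
Proof.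
rewrite (isect_anti (cyc_tri _ _ _) (cyc_tri _ _ _)) tri_shift.
by rewrite -(isect_anti (cyc_tri _ _ _) (cyc_tri _ _ _)).
Qed.

(* The five indices can be permuted by every even permutation, among them the
   one exchanging the two triangles: antisymmetry then forces the value 0. *)
Lemma tri5 (x a b c d : 'I_n) : isect r (tri x a b) (tri x c d) = 0.
Proof.
have : isect r (tri x a b) (tri x c d) = isect r (tri x c d) (tri x a b).
  by rewrite [LHS]tri_shift [LHS]tri_shift' [LHS]tri_shift [LHS]tri_shift' [LHS]tri_shift.
rewrite (isect_anti (cyc_tri x c d) (cyc_tri x a b)); lia.
Qed.

Lemma star_tri o v be : valid v -> v.2.1 -> cyc r be ->
  isect r (star o v) be = isect r (tri o v.1 v.2.2) be.
Proof.
case: v => i [[] j] // vv _ cb.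
have E : (fun y => star o (i, (true, j)) y + lens o j y) = tri o i j.
  apply/funext => y; rewrite /star /tri /lens -!integD; congr (integ _ y); apply/funext => z /=.
  by rewrite /ed (negbTE (vv : i != j)); ring.
by have := congr1 (fun f => isect r f be) E; rewrite isectDl ann_lens // addr0.
Qed.

Lemma planar_of_local : planar r.
Proof.
move=> al be ca cb.
have [[k0]|nk] := pselect (inhabited 'I_n); last first.
  by rewrite /isect big1 // => x _; case: nk; exact: inhabits x.1.
have H v be' : valid v -> v.2.1 -> cyc r be' -> isect r be' (star k0 v) = - isect r (tri k0 v.1 v.2.2) be'.
  move=> v1 v2 cb'; rewrite (isect_anti cb' (cyc_star k0 v1)) star_tri //.
have G i be' : cyc r be' -> isect r be' (ga i) = 0.
  move=> cb'; rewrite (isect_anti cb' (cyc_ga i)) (@sup2_ann i i) ?oppr0 //; first exact: cyc_ga.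
  by apply: (sup_sub _ (@sup_ga i)) => z; rewrite !inE => ->.
rewrite (isect_anti ca cb); apply/eqP; rewrite oppr_eq0; apply/eqP.
apply: (isect_decomp (o := k0)) => // [i|v v1 v2]; first exact: G.
rewrite H //; apply/eqP; rewrite oppr_eq0; apply/eqP.
apply: (isect_decomp (o := k0)) => // [i|w w1 w2]; first by apply: G; exact: cyc_tri.
rewrite H // ?tri5 ?oppr0 //; exact: cyc_tri.
Qed.

End Local.
End Rows.

(** * Rows of an arrangement *)

Section RowData.
Variables (R : realType) (T : topologicalType) (O : set (chart R T)) (n : nat) (c : 'I_n -> R -> T).
Notation entry := (R * (bool * 'I_n))%type.
Implicit Types (z : seq entry) (w : seq (bool * 'I_n)) (i j : 'I_n) (p q : entry).

Definition before p q : bool := p.1 < q.1.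

(** One row of [describes], as a list which keeps the times next to the entries; lists can be cut,
    shifted by periods and rotated. *)
Definition rowdata i z : Prop :=
  [/\ pairwise before z,
      forall p q, p \in z -> q \in z -> q.1 < p.1 + 1,
      forall j (s : R), j != i -> range (c j) (c i s) -> exists2 p, p \in z & c i s = c i p.1 &
      forall p, p \in z -> p.2.2 != i /\ exists u, crossing O p.2.1 (c i) (c p.2.2) p.1 u].

Definition rowdesc i w : Prop := exists2 z, rowdata i z & w = unzip2 z.

Lemma before_trans : transitive before.
Proof. by move=> q p s; rewrite /before; exact: lt_trans. Qed.

Lemma before_irr : irreflexive before.
Proof. by move=> p; rewrite /before ltxx. Qed.

Lemma before_eq z z' : pairwise before z -> pairwise before z' -> z =i z' -> z = z'.
Proof.
move=> h h'; apply: (irr_sorted_eq before_trans before_irr); exact: pairwise_sorted.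
Qed.

Definition rowseq (M : intersection_mx n) i : seq (bool * 'I_n) :=
  [seq M i a | a <- enum 'I_(2 * n.-1)].

Lemma describes_rows (M : intersection_mx n) : describes O M c -> forall i, rowdesc i (rowseq M i).
Proof.
move=> h i; have [t [t1 t2 t3 t4]] := h i.
exists [seq (t a, M i a) | a <- enum 'I_(2 * n.-1)]; last by rewrite /unzip2 -map_comp.
split.
- rewrite pairwise_map; have : sorted ltn (map val (enum 'I_(2 * n.-1))) by rewrite val_enum_ord; exact: iota_ltn_sorted.
  rewrite sorted_map => hs; have tr : transitive (relpre (val : 'I_(2 * n.-1) -> nat) ltn) by move=> x y z'; exact: ltn_trans.
  rewrite sorted_pairwise // in hs; apply: sub_pairwise hs => a b ab; exact: t1.
- move=> p q /mapP[a _ ->] /mapP[b _ ->]; exact: t2.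
- move=> j s ji hj; have [a ea] := t3 j s ji hj.
  by exists (t a, M i a) => //; apply/mapP; exists a; rewrite ?mem_enum.
- by move=> p /mapP[a _ ->]; exact: t4.
Qed.

Definition rows_mx (w : 'I_n -> seq (bool * 'I_n)) : intersection_mx n :=
  \matrix_(i, a) nth (true, i) (w i) a.

Lemma rows_describe (w : 'I_n -> seq (bool * 'I_n)) : (forall i, rowdesc i (w i)) ->
  (forall i, size (w i) = 2 * n.-1)%N -> describes O (rows_mx w) c.
Proof.
move=> h hs i; have [z [h1 h2 h3 h4] e] := h i.
have sz : size z = (2 * n.-1)%N by rewrite -(hs i) e size_map.
pose z0 : entry := (0, (true, i)).
have inz (a : 'I_(2 * n.-1)) : nth z0 z a \in z by rewrite mem_nth // sz.
exists (fun a => (nth z0 z a).1); split.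
- move=> a b ab; have := h1 => /(pairwiseP z0) hp.
  by apply: hp => //; rewrite inE sz.
- by move=> a b; apply: h2; exact: inz.
- move=> j s ji hj; have [p pz ->] := h3 j s ji hj.
  have lt : (index p z < 2 * n.-1)%N by rewrite -sz index_mem.
  by exists (Ordinal lt); rewrite /= nth_index.
- move=> a; rewrite mxE e (nth_map z0); last by rewrite sz.
  exact: h4 _ (inz a).
Qed.

Hypothesis hO : oriented_atlas O.
Hypothesis hc : arrangement O c.

Let jc i : pseudocircle (c i). Proof. by case: hc. Qed.
Let cc i : continuous (c i). Proof. by case: (jc i). Qed.

Lemma curve_per i (u : R) (k : int) : c i (u + k%:~R) = c i u.
Proof.
have [_ h] := jc i; apply/h; have -> : u + k%:~R - u = k%:~R by ring.
exact: intr_int.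
Qed.

Lemma curve_inj i (u v : R) : c i u = c i v -> exists k : int, u = v + k%:~R.
Proof.
have [_ h] := jc i; move=> /h/intrP[k ek]; exists k; lra.
Qed.

Lemma curve_inj_lt i (u v : R) : c i u = c i v -> u < v + 1 -> v < u + 1 -> u = v.
Proof.
move=> /curve_inj[k ->] h1 h2; suff -> : k = 0 by rewrite addr0.
have : (k%:~R : R) < 1%:~R by rewrite mulr1z; lra.
have : ((-1)%:~R : R) < k%:~R by rewrite rmorphN /= mulr1z; lra.
rewrite !ltr_int; lia.
Qed.

Lemma curve_frac i (u : R) : exists v, [/\ 0 <= v, v < 1 & c i v = c i u].
Proof.
have := floor_itv (u : R); set k := Num.floor u => /andP[h1 h2].
rewrite intrD mulr1z in h2.
exists (u + (- k)%:~R); rewrite curve_per intrN; split=> //; lra.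
Qed.

Lemma crossing_shift b i j (s t : R) (k k' : int) :
  crossing O b (c i) (c j) s t -> crossing O b (c i) (c j) (s + k%:~R) (t + k'%:~R).
Proof.
move=> [e [f [pf fp hf]]]; split; first by rewrite !curve_per.
exists f; rewrite curve_per; split=> //; apply: filterS hf => u.
by rewrite !(addrAC _ _ u) !curve_per.
Qed.

(** The absence of triple points determines the other curve, and [crossing_sign] the sign. *)
Lemma label_uniq i b b' j j' (s t u u' : R) : i != j -> i != j' -> c i s = c i t ->
  crossing O b (c i) (c j) s u -> crossing O b' (c i) (c j') t u' -> (b, j) = (b', j').
Proof.
move=> ij ij' est x1 x2; have [e1 _] := x1; have [e2 _] := x2.
have ejj : j = j'.
  apply: contrapT => /eqP jj; have [_ tri _ _] := hc.
  have : (range (c i) `&` range (c j) `&` range (c j')) (c i s).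
    by split; [split; [exists s | exists u] | exists u'; rewrite // est].
  by rewrite tri.
subst j'; have [k ek] := curve_inj est.
have [k' ek'] : exists k' : int, u = u' + k'%:~R by apply: (@curve_inj j); rewrite -e1 -e2.
have := crossing_shift k k' x2; rewrite -ek -ek' => x2'.
by rewrite (crossing_sign hO (@cc i) (@cc j) x1 x2').
Qed.

Definition shift (k : int) z : seq entry := [seq (p.1 + k%:~R, p.2) | p <- z].

Lemma shift_unzip2 k z : unzip2 (shift k z) = unzip2 z.
Proof. by rewrite /unzip2 -map_comp. Qed.

Lemma rowdata_shift i k z : rowdata i z -> rowdata i (shift k z).
Proof.
move=> [h1 h2 h3 h4]; split.
- by rewrite pairwise_map; apply: sub_pairwise h1 => p q; rewrite /before /= ltrD2r.
- by move=> _ _ /mapP[p pz ->] /mapP[q qz ->] /=; have := h2 p q pz qz; lra.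
- move=> j s ji hj; have [p pz e] := h3 j s ji hj.
  by exists (p.1 + k%:~R, p.2); rewrite /= ?curve_per //; apply/mapP; exists p.
- move=> _ /mapP[p pz ->] /=; have [pi [u hu]] := h4 p pz; split=> //; exists (u + 0%:~R).
  exact: crossing_shift.
Qed.

Lemma rowdata_cat i z z' : rowdata i (z ++ z') -> rowdata i (z' ++ shift 1 z).
Proof.
move=> [h1 h2 h3 h4]; have sh : rowdata i (shift 1 (z ++ z')) by exact: rowdata_shift.
have mz p : p \in z -> p \in z ++ z' by rewrite mem_cat => ->.
have mz' p : p \in z' -> p \in z ++ z' by rewrite mem_cat orbC => ->.
have := h1; rewrite pairwise_cat => /and3P[/allrelP ar pz pz'].
split.
- rewrite pairwise_cat pz' pairwise_map; apply/and3P; split=> //.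
    by apply/allrelP => p _ pz1 /mapP[q qz ->]; rewrite /before /= mulr1z; exact: h2 (mz q qz) (mz' p pz1).
  by apply: sub_pairwise pz => p q; rewrite /before /= ltrD2r.
- move=> p q; rewrite !mem_cat => /orP[pz1|/mapP[p0 pz1 ->]] /orP[qz1|/mapP[q0 qz1 ->]] /=; rewrite ?mulr1z.
  + exact: h2 (mz' _ pz1) (mz' _ qz1).
  + by have := ar _ _ qz1 pz1; rewrite /before; lra.
  + have := h2 _ _ (mz _ pz1) (mz' _ qz1); lra.
  + have := h2 _ _ (mz _ pz1) (mz _ qz1); lra.
- move=> j s ji hj; have [p] := h3 j s ji hj; rewrite mem_cat => /orP[] pz1 e.
    exists (p.1 + 1%:~R, p.2); last by rewrite curve_per.
    by rewrite mem_cat; apply/orP; right; apply/mapP; exists p.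
  by exists p; rewrite // mem_cat pz1.
- have [_ _ _ h4'] := sh; move=> p; rewrite mem_cat => /orP[pz1|pz1]; first exact: h4 _ (mz' _ pz1).
  by apply: h4'; rewrite /shift map_cat mem_cat pz1.
Qed.

Lemma rowdesc_rot i k w : rowdesc i w -> rowdesc i (rot k w).
Proof.
move=> [z hz ->]; exists (drop k z ++ shift 1 (take k z)).
  by apply: rowdata_cat; rewrite cat_take_drop.
by rewrite /rot /unzip2 map_cat -map_drop -map_take -/(unzip2 (shift _ _)) shift_unzip2.
Qed.

Lemma rowdesc_unrot i k w : rowdesc i (rot k w) -> rowdesc i w.
Proof. by move=> h; rewrite -(rotK k w); exact: rowdesc_rot. Qed.

(** A shift brings the first time into [[a, a + 1[], hence all times into [[a, a + 2[]; the entries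
    from [a + 1] on are moved to the front, one period earlier. *)
Lemma rowdata_window i z (a : R) : rowdata i z -> exists z' k,
  [/\ rowdata i z', forall p, p \in z' -> a <= p.1 < a + 1 & unzip2 z' = rot k (unzip2 z)].
Proof.
case: z => [|p0 z0] hz; first by exists [::], 0%N.
have := floor_itv (p0.1 - a); set k0 := Num.floor _; rewrite intrD mulr1z => /andP[f1 f2].
pose z1 := shift (- k0) (p0 :: z0).
have hz1 : rowdata i z1 by exact: rowdata_shift.
have lo p : p \in z1 -> a <= p.1 < a + 2.
  have [h1 h2 _ _] := hz.
  move=> /mapP[q qz ->] /=; have := h2 p0 q (mem_head _ _) qz; rewrite intrN => u1.
  have u2 : p0.1 <= q.1.
    move: qz; rewrite inE => /orP[/eqP->//|qz]; move: h1 => /= /andP[/allP/(_ q qz)].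
    by rewrite /before => /ltW.
  by apply/andP; split; lra.
pose zl : seq entry := [seq p : entry <- z1 | p.1 < a + 1]; pose zr : seq entry := [seq p : entry <- z1 | a + 1 <= p.1].
have [g1 _ _ _] := hz1.
have ez : z1 = zl ++ zr.
  apply: before_eq => //.
    rewrite pairwise_cat !pairwise_filter // !andbT; apply/allrelP => p q.
    by rewrite !mem_filter /before => /andP[u1 _] /andP[u2 _]; lra.
  move=> p; rewrite mem_cat !mem_filter -andb_orl; case: (leP (a + 1) p.1) => _ //=.
have E : unzip2 (p0 :: z0) = unzip2 zl ++ unzip2 zr.
  by rewrite -(shift_unzip2 (- k0)) -/z1 {1}ez /unzip2 map_cat.
exists (shift (-1) (zr ++ shift 1 zl)), (size (unzip2 zl)); split.
- by apply: rowdata_shift; apply: rowdata_cat; rewrite -ez.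
- move=> p /mapP[q]; rewrite mem_cat => /orP[|/mapP[q']]; rewrite mem_filter => /andP[u1 u2].
    by move=> -> /=; have := lo _ u2; rewrite intrN mulr1z => /andP[u3 u4]; apply/andP; split; lra.
  by move=> -> -> /=; have := lo _ u2; rewrite intrN mulr1z => /andP[u3 u4]; apply/andP; split; lra.
- rewrite shift_unzip2 E rot_size_cat /unzip2 map_cat; congr (_ ++ _); exact: shift_unzip2.
Qed.

Lemma rowdata_uniq i z z' (a : R) : rowdata i z -> rowdata i z' ->
  (forall p, p \in z -> a <= p.1 < a + 1) -> (forall p, p \in z' -> a <= p.1 < a + 1) -> z = z'.
Proof.
have sub y y' : rowdata i y -> rowdata i y' ->
  (forall p, p \in y -> a <= p.1 < a + 1) -> (forall p, p \in y' -> a <= p.1 < a + 1) -> forall p, p \in y -> p \in y'.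
  move=> [_ _ _ h4] [_ _ h3 h4'] w w' p py; have [pi [u hu]] := h4 p py.
  have mt : range (c p.2.2) (c i p.1) by have [-> _] := hu; exists u.
  have [q qy e] := h3 _ _ pi mt; have [qi [u' hu']] := h4' q qy.
  have := w p py; have := w' q qy => /andP[w1 w2] /andP[w3 w4].
  have e1 : p.1 = q.1 by apply: (curve_inj_lt e); lra.
  have : (p.2.1, p.2.2) = (q.2.1, q.2.2).
    by apply: (label_uniq _ _ e hu hu'); rewrite eq_sym.
  by rewrite -!surjective_pairing => e2; rewrite (surjective_pairing p) e1 e2 -surjective_pairing.
move=> hz hz' w w'; have [h1 _ _ _] := hz; have [h1' _ _ _] := hz'.
by apply: before_eq => // p; apply/idP/idP; exact: sub.
Qed.

Lemma rowdesc_uniq i w w' : rowdesc i w -> rowdesc i w' -> exists k k', rot k w = rot k' w'.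
Proof.
move=> [z hz ->] [z' hz' ->].
have [y [k [hy wy ey]]] := rowdata_window 0 hz; have [y' [k' [hy' wy' ey']]] := rowdata_window 0 hz'.
by exists k, k'; rewrite -ey -ey' (rowdata_uniq hy hy' wy wy').
Qed.

(** Each other curve gives two entries with times in [[0, 1[]; they are collected and sorted by
    time. *)
Lemma rowdesc_exists i : exists2 w, rowdesc i w & size w = (2 * n.-1)%N.
Proof.
have [_ tri crs two] := hc.
have /choice[L hL] : forall j, exists l : seq entry, j != i ->
  [/\ size l = 2%N, uniq (map fst l), forall p, p \in l -> [/\ p.2.2 = j, 0 <= p.1, p.1 < 1 & exists u, crossing O p.2.1 (c i) (c j) p.1 u] &
      forall s : R, range (c j) (c i s) -> exists2 p, p \in l & c i s = c i p.1].
  move=> j; have [->|ji] := eqVneq j i; first by exists [::].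
  have ij : i != j by rewrite eq_sym.
  have [P [Q [PQ ePQ]]] := two i j ij.
  have mk X : (range (c i) `&` range (c j)) X -> exists s b u, [/\ c i s = X, 0 <= s, s < 1 & crossing O b (c i) (c j) s u].
    move=> [[s0 _ <-] [u _ eu]]; have [s [s1 s2 es]] := curve_frac i s0.
    have [b hb] := crs i j ij s u (etrans es (esym eu)).
    by exists s, b, u.
  have [s [b [u [es s0 s1 hb]]]] : exists s b u, [/\ c i s = P, 0 <= s, s < 1 & crossing O b (c i) (c j) s u].
    by apply: mk; rewrite ePQ; left.
  have [s' [b' [u' [es' s0' s1' hb']]]] : exists s b u, [/\ c i s = Q, 0 <= s, s < 1 & crossing O b (c i) (c j) s u].
    by apply: mk; rewrite ePQ; right.
  exists [:: (s, (b, j)); (s', (b', j))] => _; split=> //.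
  - rewrite /= inE andbT; apply/eqP => e; by apply: PQ; rewrite -es -es' e.
  - by move=> p; rewrite !inE => /orP[]/eqP->; split=> //; [exists u | exists u'].
  - move=> v hv; have : (range (c i) `&` range (c j)) (c i v) by split=> //; exists v.
    rewrite ePQ => -[->|->]; [exists (s, (b, j)) | exists (s', (b', j))]; rewrite ?inE ?eqxx ?orbT //.
pose js := enum (predC1 i).
have jsP j : (j \in js) = (j != i) by rewrite mem_enum inE.
pose z0 := flatten [seq L j | j <- js].
(* Equal times for two different curves would be a triple point. *)
have u0 : uniq (map fst z0).
  have : uniq js by exact: enum_uniq.
  have : forall j, j \in js -> j != i by move=> j; rewrite jsP.
  rewrite /z0; elim: (js) => [//|j l IH] ne /= /andP[jl ul].
  have ji : j != i by apply: ne; rewrite mem_head.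
  rewrite map_cat cat_uniq; have [_ -> lj _] := hL j ji; rewrite IH ?andbT //=; last first.
    by move=> j' hj'; apply: ne; rewrite inE hj' orbT.
  apply/hasPn => t /mapP[p /flattenP[_ /mapP[j' j'l ->] pj'] ->]; apply/negP => /mapP[q qj e].
  have j'i : j' != i by apply: ne; rewrite inE j'l orbT.
  have jj : j != j' by apply: contraNneq jl => ->.
  have [_ _ lj' _] := hL j' j'i.
  have [_ _ _ [u [eu _]]] := lj' p pj'; have [_ _ _ [u' [eu' _]]] := lj q qj.
  have : (range (c i) `&` range (c j) `&` range (c j')) (c i p.1).
    by split; [split; [exists p.1 | exists u'; rewrite // -eu' e] | exists u].
  by rewrite tri // eq_sym.
pose z := sort (fun p q : entry => p.1 <= q.1) z0.
have mz : z =i z0 by exact: mem_sort.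
exists (unzip2 z); last first.
  rewrite size_map size_sort size_flatten /shape -map_comp.
  have : forall j, j \in js -> j != i by move=> j; rewrite jsP.
  have sj : size js = n.-1 by rewrite -cardE cardC1 card_ord.
  rewrite -sj; elim: (js) => [|j l IH] ne //=.
  rewrite IH; last by move=> j' hj'; apply: ne; rewrite inE hj' orbT.
  by have [-> _ _ _] := hL j (ne j (mem_head _ _)); rewrite mulnS.
exists z => //; split.
- have : sorted <%R (map fst z).
    rewrite lt_sorted_uniq_le (perm_uniq (perm_map fst (permEl (perm_sort _ z0)))) u0 /=.
    by rewrite sorted_map; apply: sort_sorted => p q; exact: le_total.
  by rewrite sorted_map => h; rewrite -sorted_pairwise //; exact: before_trans.
- move=> p q; rewrite !mz => /flattenP[_ /mapP[j hj ->] pj] /flattenP[_ /mapP[j' hj' ->] pj'].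
  rewrite !jsP in hj hj'; have [_ _ lj _] := hL j hj; have [_ _ lj' _] := hL j' hj'.
  by have [_ a1 a2 _] := lj p pj; have [_ b1 b2 _] := lj' q pj'; lra.
- move=> j s ji hj; have [_ _ _ h] := hL j ji; have [p pl e] := h s hj.
  by exists p => //; rewrite mz; apply/flattenP; exists (L j) => //; apply/mapP; exists j; rewrite ?jsP.
- move=> p; rewrite mz => /flattenP[_ /mapP[j hj ->] pj]; rewrite jsP in hj.
  by have [_ _ lj _] := hL j hj; have [-> _ _ hu] := lj p pj.
Qed.

Lemma rowdesc_size i w : rowdesc i w -> size w = (2 * n.-1)%N.
Proof.
move=> hw; have [w' hw' <-] := rowdesc_exists i; have [k [k' e]] := rowdesc_uniq hw hw'.
by rewrite -(size_rot k) e size_rot.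
Qed.

End RowData.

Section Sub.
Variables (R : realType) (T : topologicalType) (O : set (chart R T)) (n : nat) (c : 'I_n -> R -> T).

Lemma arrangement_inj (m : nat) (s : 'I_m -> 'I_n) : injective s -> arrangement O c -> arrangement O (c \o s).
Proof.
move=> inj [h1 h2 h3 h4].
have ne i j : i != j -> s i != s j by apply: contra => /eqP/inj->.
split.
- by move=> i; exact: h1.
- by move=> i j k ij jk ik; apply: h2; exact: ne.
- by move=> i j ij; apply: h3; exact: ne.
- by move=> i j ij; apply: h4; exact: ne.
Qed.

Variable A : {set 'I_n}.

Lemma subarrangement_arr : arrangement O c -> arrangement O (subarrangement c A).
Proof. by move=> hc; exact: (arrangement_inj (@enum_val_inj _ (mem A)) hc). Qed.

Definition relabel (i : 'I_#|A|) (w : seq (bool * 'I_n)) : seq (bool * 'I_#|A|) :=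
  [seq (e.1, enum_rank_in (enum_valP i) e.2) | e <- w & e.2 \in A].

Lemma rowdesc_sub (hc : arrangement O c) (i : 'I_#|A|) w : rowdesc O c (enum_val i) w ->
  rowdesc O (subarrangement c A) i (relabel i w).
Proof.
move=> [z [h1 h2 h3 h4] ->].
pose rk := enum_rank_in (enum_valP i).
pose g (p : R * (bool * 'I_n)) := (p.1, (p.2.1, rk p.2.2)).
exists [seq g p | p <- z & p.2.2 \in A]; last first.
  by rewrite /relabel /unzip2 filter_map -!map_comp.
split.
- by rewrite pairwise_map; have : pairwise (@before R n) [seq p <- z | p.2.2 \in A] by exact: pairwise_filter.
- by move=> _ _ /mapP[p hp ->] /mapP[q hq ->]; move: hp hq; rewrite !mem_filter => /andP[_ hp] /andP[_ hq]; exact: h2.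
- move=> j s ji hj; have ne : enum_val j != enum_val i by apply: contra ji => /eqP/enum_val_inj->.
  have [p pz e] := h3 _ s ne hj; have [_ [u [eu _]]] := h4 p pz.
  exists (g p) => //; apply/mapP; exists p => //; rewrite mem_filter pz andbT.
  have [v _ ev] := hj; have [_ tri _ _] := hc.
  suff -> : p.2.2 = enum_val j by exact: enum_valP.
  have [pi _] := h4 p pz; apply: contrapT => /eqP pj.
  have : (range (c (enum_val i)) `&` range (c (enum_val j)) `&` range (c p.2.2)) (c (enum_val i) s).
    by split; [split; [exists s | exists v] | exists u; rewrite // -eu -e].
  by rewrite tri // eq_sym.
- move=> _ /mapP[p + ->]; rewrite mem_filter => /andP[pA pz].
  have [pi [u hu]] := h4 p pz; rewrite /= /subarrangement enum_rankK_in //; split; last by exists u.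
  by apply: contra pi => /eqP <-; rewrite enum_rankK_in.
Qed.

End Sub.

(** * Arrangements on the sphere *)

Lemma small_pos (R : realType) (s : seq R) : (forall x, x \in s -> 0 < x) ->
  exists2 k : R, 0 < k & forall x, x \in s -> k < x.
Proof.
elim: s => [|a s IH] h; first by exists 1.
have [|k k0 hk] := IH; first by move=> x xs; apply: h; rewrite inE xs orbT.
have a0 : 0 < a by apply: h; rewrite mem_head.
have a20 : 0 < a / 2 by lra.
have [m0 m1 m2] := min_pos2 a20 k0.
exists (Num.min (a / 2) k) => // x; rewrite inE => /orP[/eqP->|/hk]; lra.
Qed.

Lemma intr_small (R : realType) (q : int) : (q%:~R : R) < 1 -> -1 < (q%:~R : R) -> q = 0.
Proof.
move=> h1 h2; have : (q%:~R : R) < 1%:~R by rewrite mulr1z.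
have : ((-1)%:~R : R) < q%:~R by rewrite rmorphN /= mulr1z.
rewrite !ltr_int; lia.
Qed.

Lemma near_forall (X : topologicalType) (I : finType) (P : I -> X -> Prop) (x : X) :
  (forall i, \forall y \near x, P i y) -> \forall y \near x, forall i, P i y.
Proof.
move=> h; have : \forall y \near x, forall i, i \in enum I -> P i y.
  elim: (enum I) => [|i s IH]; first by apply: nearW.
  apply: filterS2 (h i) IH => y pi ps j; rewrite inE => /orP[/eqP->//|]; exact: ps.
by apply: filterS => y hy i; apply: hy; rewrite mem_enum.
Qed.

Lemma conv_in (R : realType) (a b u v k : R) : 0 <= k -> k <= 1 -> a < u -> u < b -> a < v -> v < b ->
  a < (1 - k) * u + k * v < b.
Proof.
move=> k0 k1 au ub av vb; case: (leP k (1 / 2)) => k2; apply/andP; split; nra.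
Qed.

(** * Winding numbers of cycles in a plane drawing *)

Section Top.
Variables (R : realType) (n : nat) (r : 'I_n -> seq (bool * 'I_n)).
Variables (e : 'I_n -> R -> R * R) (t : 'I_n -> nat -> R) (m : int).
Notation P := (passage n).
Implicit Types (x z : P) (y : R * R) (al be : P -> int) (i l : 'I_n) (p : R * R) (u v : R) (k : nat) (q : int).

Definition tm x : R := t x.1 (index x.2 (r x.1)).
Definition tn x : R := t x.1 (index x.2 (r x.1)).+1.

Hypotheses (gr : good r) (je : forall i, pseudocircle (e i)).
Hypotheses (t_lt : forall i k, (k < size (r i))%N -> t i k < t i k.+1)
  (t_end : forall i, t i (size (r i)) = t i 0%N + 1).
Hypothesis meet : forall i l u v, i != l -> e i u = e l v ->
  exists k (q : int), (k < size (r i))%N /\ u = t i k + q%:~R.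
Hypothesis m1 : m = 1 \/ m = -1.
(** One map straightens both curves: [x.1] runs rightwards and, after a quarter turn of the source,
    [x.2.2] runs downwards; no curve enters the four open quadrants of the box. *)
Hypothesis vertex : forall x, valid x -> x.2.1 -> exists h d,
  [/\ flat (e x.1) h d (tm x) m, flat (e x.2.2) (fun y => h (y.2, - y.1)) d (tm (th x)) m &
      forall y, box (0, 0) d y -> y.1 <> 0 -> y.2 <> 0 -> forall l u, e l u <> h y].

Let ce i : continuous (e i). Proof. by case: (je i). Qed.

Let t_mono i k k' : (k <= k')%N -> (k' <= size (r i))%N -> t i k <= t i k'.
Proof.
elim: k' => [|k' IH]; first by rewrite leqn0 => /eqP->.
rewrite leq_eqVlt ltnS => /orP[/eqP->//|kk] hs.
by apply: le_trans (IH kk (ltnW hs)) _; exact/ltW/t_lt.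
Qed.

Let idx x : valid x -> (index x.2 (r x.1) < size (r x.1))%N.
Proof. by rewrite -(rowP gr) index_mem. Qed.

Lemma tm_tn x : valid x -> tm x < tn x.
Proof. by move=> vx; exact: t_lt (idx vx). Qed.

Lemma tn_nx x : valid x -> exists q : int, tn x = tm (nx r x) + q%:~R.
Proof.
move=> vx; have lt := idx vx; have [ur _] := gr x.1.
have hx : x.2 \in r x.1 by rewrite (rowP gr).
rewrite /tn /tm /nx /= next_nth hx; move: (t_end x.1) lt ur hx.
case: (r x.1) => [//|y p] te lt ur hx; set k := index x.2 _ in lt *.
have [kp|kp] := ltnP k (size p).
  exists 0; rewrite addr0; congr (t _ _).
  by rewrite -[nth y p k]/(nth y (y :: p) k.+1) index_uniq.
have ek : k = size p by apply/eqP; rewrite eqn_leq kp andbT; move: lt => /=; rewrite ltnS.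
by exists 1; rewrite nth_default // /= eqxx mulr1z ek te.
Qed.

Lemma no_time x i k q u : valid x -> x.1 = i -> (k < size (r i))%N ->
  tm x < t i k + q%:~R -> t i k + q%:~R < tn x -> False.
Proof.
move=> vx <- kr h1 h2; set j := x.1 in kr h1 h2 *; have lt := idx vx.
have b1 : t j 0%N <= t j k by exact: t_mono (ltnW kr).
have b2 : t j k < t j 0%N + 1.
  by rewrite -t_end; apply: lt_le_trans (t_lt kr) _; exact: t_mono.
have b3 : t j 0%N <= tm x by apply: t_mono (ltnW lt).
have b4 : tn x <= t j 0%N + 1 by rewrite -t_end; exact: t_mono.
have q0 : q = 0.
  apply: (@intr_small R); lra.
rewrite q0 addr0 in h1 h2; have [kx|kx] := leqP k (index x.2 (r x.1)).
  by have := t_mono kx (ltnW lt); rewrite -/(tm x); lra.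
by have := t_mono kx (ltnW kr); rewrite -/(tn x) -/j; lra.
Qed.

Definition off al p : Prop := forall z u, valid z -> al z <> 0 -> tm z <= u <= tn z -> e z.1 u <> p.

(** Curves meet only at crossing times, and there is none inside the edge; an edge of the same curve
    which reaches the interior of [x] is [x] itself, whose coefficient is 0. *)
Lemma edge_off x al u : valid x -> al x = 0 -> tm x < u < tn x -> off al (e x.1 u).
Proof.
move=> vx ax /andP[u1 u2] z v vz az /andP[v1 v2] E.
have [il|il] := eqVneq x.1 z.1; last first.
  have [k [q [kr eu]]] := meet il (esym E).
  by apply: (@no_time x x.1 k q u) => //; rewrite -eu.
have [q eq] : exists q : int, u = v + q%:~R by apply: (jordan_inj (je x.1)); rewrite -E il.
have n1 : ~ (tm x < tm z + q%:~R < tn x).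
  move=> /andP[w1 w2]; apply: (@no_time x z.1 (index z.2 (r z.1)) q u) => //; exact: idx.
have [q' eq'] := tn_nx vz.
have n2 : ~ (tm x < tn z + q%:~R < tn x).
  move=> /andP[w1 w2].
  apply: (@no_time x z.1 (index (nx r z).2 (r z.1)) (q' + q) u) => //.
  - by apply: (@idx (nx r z)); rewrite nx_valid.
  - by move: w1; rewrite eq' -addrA -intrD.
  - by move: w2; rewrite eq' -addrA -intrD.
have n3 : ~ (tm z < tm x - q%:~R < tn z).
  move=> /andP[w1 w2].
  apply: (@no_time z x.1 (index x.2 (r x.1)) (- q) u) => //; rewrite ?intrN //; exact: idx.
have zx := tm_tn vz; have xx := tm_tn vx.
have a1 : tm z + q%:~R <= tm x by rewrite leNgt; apply/negP => w; apply: n1; apply/andP; split=> //; lra.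
have a2 : tn x <= tn z + q%:~R by rewrite leNgt; apply/negP => w; apply: n2; apply/andP; split=> //; lra.
have a3 : tm x = tm z + q%:~R.
  apply: le_anti; rewrite a1 andbT leNgt; apply/negP => w; apply: n3; apply/andP; split; lra.
have kz := idx vz; have kx := idx vx.
have q0 : q = 0.
  have c1 := t_mono (leq0n _) (ltnW kz); have c2 := t_mono kz (leqnn _).
  have c3 := t_mono (leq0n _) (ltnW kx); have c4 := t_mono kx (leqnn _).
  have c5 := t_lt kz; have c6 := t_lt kx.
  rewrite !t_end -/(tm z) -/(tm x) -/(tn z) -/(tn x) -il in c1 c2 c3 c4 c5 c6.
  apply: (@intr_small R); lra.
rewrite q0 addr0 in a3; apply: az; suff -> : z = x by [].
have ei : index x.2 (r x.1) = index z.2 (r x.1).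
  move: a3; rewrite /tm -il; case: (ltngtP (index x.2 (r x.1)) (index z.2 (r x.1))) => // w E'.
    exfalso; rewrite -il in kz; have := t_mono w (ltnW kz); have := t_lt kx; lra.
  exfalso; have := t_mono w (ltnW kx); rewrite -il in kz; have := t_lt kz; lra.
have mx : x.2 \in r x.1 by rewrite (rowP gr).
have mz : z.2 \in r x.1 by rewrite il (rowP gr).
by rewrite (surjective_pairing z) (surjective_pairing x) -il -(nth_index x.2 mx) ei nth_index.
Qed.

(* The winding number of the chain [al]: the variations of its angles at the vertices
   cancel by Kirchhoff's law, so it is locally constant off the support of [al]. *)
Definition Omega al p : R := \sum_(z : P | valid z) (al z)%:~R * ang (e z.1) (tm z) (tn z) p.

Lemma vertex_eq x : valid x -> e x.1 (tm x) = e (th x).1 (tm (th x)).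
Proof.
have H (y : P) : valid y -> y.2.1 -> e y.1 (tm y) = e (th y).1 (tm (th y)).
  move=> vy b; have [h [d [[[d0 _ _] f1 _ _] [_ f2 _ _] _]]] := vertex vy b.
  have n0 : `|0 : R| < d by rewrite normr0.
  by have := f1 _ n0; have := f2 _ n0; rewrite /= !addr0 oppr0 => <- <-.
move=> vx; case: (boolP x.2.1) => b; first exact: H.
by have := H (th x); rewrite th_valid thK => ->.
Qed.

Lemma Omega_path al (g : R -> R * R) : cyc r al -> continuous g -> (forall k : R, off al (g k)) ->
  Omega al (g 0) = Omega al (g 1).
Proof.
move=> ca cg og.
suff near0 (k0 : R) : \forall k \near k0, Omega al (g k) = Omega al (g k0).
  by apply: (@locconst R R (fun k : R => Omega al (g k)) 0 1 ler01) => k0 _; exact: near0.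
pose V (k : R) z := eta (e z.1 (tm z)) (g k0) (e z.1 (tm z)) (g k).
have near_ : \forall k \near k0, forall z, valid z -> al z <> 0 ->
    ang (e z.1) (tm z) (tn z) (g k) - ang (e z.1) (tm z) (tn z) (g k0) = V k (nx r z) - V k z.
  apply: (@near_forall R _ _ k0) => z.
  have [[vz az]|nz] := pselect (valid z /\ al z <> 0); last by apply: (@filterE R (nbhs k0)) => k vz az; case: nz.
  have := @ang_near R (fun _ => e z.1) g (tm z) (tn z) k0 (ltW (tm_tn vz)).
  have c2 : forall (x u : R), tm z <= u <= tn z -> cta (fun w : R * R => e z.1 w.2) (x, u).
    by move=> x u _; apply: (@cta_comp _ _ _ snd (e z.1)); [exact: cvg_snd | exact: ce].
  move=> /(_ c2 cg) H.
  have : forall (x u : R), tm z <= u <= tn z -> e z.1 u <> g x by move=> x u hu; exact: og.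
  move=> /H; apply: filterS => k E _ _; rewrite E /V.
  have [q eq] := tn_nx vz; rewrite eq.
  by rewrite (jordan_per (je z.1)).
apply: filterS near_ => k E; apply/eqP; rewrite -subr_eq0 /Omega -sumrB.
rewrite (eq_bigr (fun z => (al z)%:~R * V k (nx r z) - (al z)%:~R * V k z)); last first.
  move=> z vz; rewrite -!mulrBr; have [->|/eqP az] := eqVneq (al z) 0; first by rewrite !mul0r.
  by rewrite E.
(* The term of the far end of an edge is moved to the passage found there. The four edges at a
   crossing then carry the same angle [V], with total coefficient 0. *)
rewrite sumrB -(sum_pv gr (fun z => (al z)%:~R * V k (nx r z))) -sumrB sum_half.
rewrite big1 // => z /andP[vz bz].
have -> : V k (nx r (pv r z)) = V k z by rewrite pvK.
have -> : V k (nx r (pv r (th z))) = V k z by rewrite pvK // /V -(vertex_eq vz).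
have -> : V k (th z) = V k z by rewrite /V -(vertex_eq vz).
have := ca z vz => /(congr1 (fun q => (q%:~R : R))); rewrite !(intrD, intrN) mulr0z => E0.
have -> : (al z)%:~R = (al (pv r z))%:~R - (al (th z))%:~R + (al (pv r (th z)))%:~R :> R by lra.
by ring.
Qed.

Definition gam i : P -> int := fun z => (z.1 == i)%:Z.

Lemma Omega_gam i p : (forall u, e i u <> p) -> Omega (gam i) p = wnd (e i) p.
Proof.
move=> ne; rewrite /Omega (sum_rows gr) (bigD1 i) //= [X in _ + X]big1 ?addr0; last first.
  by move=> l /negbTE li; rewrite big1 // => f _; rewrite /gam /= li mul0r.
have [ur _] := gr i.
rewrite (eq_bigr (fun f => ang (e i) (t i (index f (r i))) (t i (index f (r i)).+1) p)); last first.
  by move=> f _; rewrite /gam /= eqxx mul1r.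
have [[f0 Ef0]|r0] : (exists f0, f0 \in r i) \/ r i = [::].
- by case: (r i) => [|f0 s]; [right | left; exists f0; rewrite inE eqxx].
- rewrite (big_nth f0) big_nat.
  rewrite (eq_bigr (fun k => ang (e i) (t i k) (t i k.+1) p)); last first.
    by move=> k /andP[_ kr]; rewrite index_uniq.
  rewrite -big_nat -(wnd_start (je i) (t i 0%N)) // -t_end.
  have: (size (r i) <= size (r i))%N by [].
  elim: {1 3 4}(size (r i)) => [|K IH] hK.
    by rewrite big_nil ang_const // => u /andP[h1 h2]; congr (e i _); lra.
  rewrite big_nat_recr //= IH ?(ltnW hK) // ang_add //.
  + exact: t_mono (ltnW hK).
  + exact: ltW (t_lt hK).
  + by move=> v _; exact: ce.
- by have := t_end i; rewrite r0 /=; lra.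
Qed.

Lemma OmegaD al be q p : Omega (fun z => al z + q * be z) p = Omega al p + q%:~R * Omega be p.
Proof.
rewrite /Omega big_distrr -big_split /=; apply: eq_bigr => z _.
by rewrite intrD intrM; ring.
Qed.

Lemma cyc_gam i : cyc r (gam i).
Proof. by move=> x vx; rewrite /gam /=; ring. Qed.

Section Chain.
Variable al : P -> int.
Hypothesis ca : cyc r al.
Variable a : 'I_n -> R.
Hypothesis ha : forall i, forall h d s, flat (e i) h d s m -> exists2 d' : R, 0 < d' <= d &
  forall y, box (0, 0) d' y -> [/\ 0 < y.2 -> wnd (e i) (h y) = a i + 2 * pi * m%:~R,
    y.2 < 0 -> wnd (e i) (h y) = a i & y.2 <> 0 -> forall u, e i u <> h y].

Definition red x : P -> int := fun z => al z + (- al x) * gam x.1 z.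
(* The value of [Omega al] on the right of the edge [x]: off [x], [al] differs by a
   multiple of a whole curve from a chain which vanishes on [x]. *)
Definition RS x : R := Omega (red x) (e x.1 ((tm x + tn x) / 2)) + (al x)%:~R * a x.1.

Lemma red0 x : red x x = 0.
Proof. by rewrite /red /gam eqxx mulr1 subrr. Qed.

Lemma cyc_red x : cyc r (red x).
Proof.
move=> z vz; have := ca vz; have := cyc_gam x.1 vz; rewrite /red => E1 E2.
transitivity (al z - al (pv r z) + (al (th z) - al (pv r (th z))) - al x * (gam x.1 z - gam x.1 (pv r z) + (gam x.1 (th z) - gam x.1 (pv r (th z))))); first by ring.
by rewrite E1 E2; ring.
Qed.

Lemma edge_const x u v : valid x -> tm x < u < tn x -> tm x < v < tn x ->
  Omega (red x) (e x.1 u) = Omega (red x) (e x.1 v).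
Proof.
move=> vx /andP[u1 u2] /andP[v1 v2].
pose g (k : R) := e x.1 ((1 - clamp 0 1 k) * u + clamp 0 1 k * v).
have g0 : g 0 = e x.1 u by rewrite /g clamp_id ?ler01 ?lexx //; congr (e x.1 _); ring.
have g1 : g 1 = e x.1 v by rewrite /g clamp_id ?ler01 ?lexx //; congr (e x.1 _); ring.
rewrite -g0 -g1; apply: Omega_path; first exact: cyc_red.
  apply: ctI => k; apply: (@cta_comp _ _ _ (fun k : R => (1 - clamp 0 1 k) * u + clamp 0 1 k * v) (e x.1)); last exact: ce.
  have cl := @clamp_cont R 0 1; by ct.
move=> k; apply: edge_off => //; first exact: red0.
have /andP[c1 c2] := @clamp_in R 0 1 k ler01.
exact: conv_in.
Qed.

(** The reduced chain does not see the edge, so the point may be moved onto it; only the multiple of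
    the whole curve jumps, by [jordan_sides]. The integer [q] brings the times of the straightening
    to the period of the edge. *)
Lemma side x h d s q : valid x -> flat (e x.1) h d s m ->
  (forall y, box (0, 0) d y -> y.1 <> 0 -> y.2 <> 0 -> forall l u, e l u <> h y) ->
  exists2 d' : R, 0 < d' <= d & forall y, box (0, 0) d' y -> y.1 <> 0 -> y.2 <> 0 ->
    tm x < s + y.1 + q%:~R < tn x ->
    Omega al (h y) = RS x + (if 0 < y.2 then 2 * pi * m%:~R * (al x)%:~R else 0).
Proof.
move=> vx fl bp; have [d' d'0 hd'] := ha fl; exists d' => // y by_ y1 y2 hin.
have bd : box (0, 0) d y by apply: boxW by_; lra.
have off_ l u : e l u <> h y by exact: bp.
have [[d0 ch _] hax _ _] := fl.
have -> : Omega al (h y) = Omega (red x) (h y) + (al x)%:~R * wnd (e x.1) (h y).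
  by rewrite /red OmegaD Omega_gam // intrN; ring.
have -> : Omega (red x) (h y) = Omega (red x) (e x.1 (s + y.1)).
  have y1d : `|y.1| < d by have := bd; rewrite /box /= subr0 => -[].
  rewrite -hax //.
  pose g (k : R) := h (y.1, (1 - clamp 0 1 k) * y.2).
  have g0 : g 0 = h y by rewrite /g clamp_id ?ler01 ?lexx // subr0 mul1r -surjective_pairing.
  have g1 : g 1 = h (y.1, 0) by rewrite /g clamp_id ?ler01 ?lexx // subrr mul0r.
  have bk (k : R) : box (0, 0) d (y.1, (1 - clamp 0 1 k) * y.2).
    have /andP[c1 c2] := @clamp_in R 0 1 k ler01.
    move: bd; rewrite /box /= !subr0 => -[b1 b2]; split=> //.
    rewrite normrM; apply: le_lt_trans b2; rewrite ger0_norm; last by lra.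
    by have := normr_ge0 y.2; nra.
  rewrite -g0 -g1; apply: Omega_path; first exact: cyc_red.
    apply: ctI => k; apply: (@cta_comp _ _ _ (fun k : R => (y.1, (1 - clamp 0 1 k) * y.2)) h); last exact: ch.
    have cl := @clamp_cont R 0 1; by ct.
  move=> k; have [ek|nk] := eqVneq ((1 - clamp 0 1 k) * y.2) 0; last first.
    move=> z u vz az _; apply: bp => //; exact/eqP.
  rewrite /g ek hax // -(jordan_per (je x.1) _ q).
  by apply: edge_off => //; exact: red0.
rewrite -(jordan_per (je x.1) _ q) (@edge_const x _ ((tm x + tn x) / 2)) //; last first.
  by have := tm_tn vx; lra.
rewrite /RS; have [w1 w2 _] := hd' y by_.
case: (ltgtP 0 y.2) => [yp|yn|/esym//]; first by rewrite w1 //; ring.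
by rewrite w2 // addr0.
Qed.

Lemma vertex_sides x : valid x -> x.2.1 ->
  [/\ RS x = RS (th x) + 2 * pi * m%:~R * (al (th x))%:~R, RS (pv r x) = RS (th x) &
      RS (pv r (th x)) = RS (pv r x) + 2 * pi * m%:~R * (al (pv r x))%:~R].
Proof.
move=> vx bx; have [h [d [f1 f2 bp]]] := vertex vx bx.
have vy : valid (th x) by rewrite th_valid.
have vpx : valid (pv r x) by rewrite pv_valid.
have vpy : valid (pv r (th x)) by rewrite pv_valid.
have bp' (y : R * R) : box (0, 0) d y -> y.1 <> 0 -> y.2 <> 0 -> forall l u, e l u <> h (y.2, - y.1).
  move=> by_ y1 y2 l u; apply: bp => //=; last by move=> /eqP; rewrite oppr_eq0 => /eqP.
  by move: by_; rewrite /box /= !subr0 normrN => -[].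
have [q1 e1] := tn_nx vpx; rewrite pvK // in e1.
have [q2 e2] := tn_nx vpy; rewrite pvK // in e2.
have [d1 d10 s1] := side 0 vx f1 bp.
have [d2 d20 s2] := side q1 vpx f1 bp.
have [d3 d30 s3] := side 0 vy f2 bp'.
have [d4 d40 s4] := side q2 vpy f2 bp'.
have g1 := tm_tn vx; have g2 := tm_tn vpx; have g3 := tm_tn vy; have g4 := tm_tn vpy.
have [k [k0 kk]] : exists k : R, 0 < k /\ [/\ [/\ k < d1, k < d2, k < d3 & k < d4],
    tm x + k < tn x, tm (pv r x) < tn (pv r x) - k, tm (th x) + k < tn (th x) & tm (pv r (th x)) < tn (pv r (th x)) - k].
  have [|k k0 hk] := @small_pos R [:: d1; d2; d3; d4; tn x - tm x; tn (pv r x) - tm (pv r x); tn (th x) - tm (th x); tn (pv r (th x)) - tm (pv r (th x))].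
    by move=> v; rewrite !inE; do !(case/orP => [/eqP->|]); [lra|lra|lra|lra|lra|lra|lra|move=> /eqP->; lra].
  have K v : v \in [:: d1; d2; d3; d4; tn x - tm x; tn (pv r x) - tm (pv r x); tn (th x) - tm (th x); tn (pv r (th x)) - tm (pv r (th x))] -> k < v by exact: hk.
  have := K (tn x - tm x); have := K (tn (pv r x) - tm (pv r x)); have := K (tn (th x) - tm (th x)); have := K (tn (pv r (th x)) - tm (pv r (th x))).
  rewrite !inE !eqxx !orbT => /(_ isT) K1 /(_ isT) K2 /(_ isT) K3 /(_ isT) K4.
  by exists k; split=> //; split; [split; apply: K; rewrite !inE eqxx ?orbT | lra | lra | lra | lra].
have [[k1 k2 k3 k4] k5 k6 k7 k8] := kk.
have bx4 (D u v : R) : k < D -> `|u| = k -> `|v| = k -> box (0, 0) D (u, v).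
  by move=> kD uk vk; rewrite /box /= !subr0 uk vk.
have nk : `|k| = k by rewrite gtr0_norm.
have nmk : `|- k| = k by rewrite normrN.
have kn : k <> 0 by lra.
have mkn : - k <> 0 by lra.
have lk : (0 < k) = true by [].
have lmk : (0 < - k) = false by apply/negbTE; rewrite -leNgt; lra.
have i1 : tm x < tm x + k + 0%:~R < tn x by rewrite addr0; lra.
have i2 : tm (pv r x) < tm x + - k + q1%:~R < tn (pv r x) by lra.
have i3 : tm (th x) < tm (th x) + k + 0%:~R < tn (th x) by rewrite addr0; lra.
have i4 : tm (pv r (th x)) < tm (th x) + - k + q2%:~R < tn (pv r (th x)) by lra.
(* Three of the four quadrants are each evaluated from the two edges bordering them. *)
have A1 := s1 (k, - k) (bx4 _ _ _ k1 nk nmk) kn mkn i1.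
have A2 := s3 (k, k) (bx4 _ _ _ k3 nk nk) kn kn i3.
have B1 := s2 (- k, - k) (bx4 _ _ _ k2 nmk nmk) mkn mkn i2.
have B2 := s3 (k, - k) (bx4 _ _ _ k3 nk nmk) kn mkn i3.
have C1 := s2 (- k, k) (bx4 _ _ _ k2 nmk nk) mkn kn i2.
have C2 := s4 (- k, - k) (bx4 _ _ _ k4 nmk nmk) mkn mkn i4.
rewrite /= ?lk ?lmk ?opprK in A1 A2 B1 B2 C1 C2.
rewrite A1 in A2; rewrite B1 in B2; rewrite C1 in C2.
by split; lra.
Qed.

Lemma isect0 be : cyc r be -> isect r al be = 0.
Proof.
move=> cb; apply/eqP; rewrite -(intr_eq0 R).
have K0 : 2 * pi * m%:~R != 0 :> R.
  apply: mulf_neq0; first exact: lt0r_neq0 (twopi_gt0 R).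
  by rewrite intr_eq0; case: m1 => ->.
rewrite -(mulrI_eq0 _ (lregP K0)).
(* A sum which telescopes along the rows. Grouped by crossings, [vertex_sides] and Kirchhoff's law
   for [be] turn it into [2 * pi * m] times the form. *)
have <- : \sum_(z | valid z) ((be z)%:~R * RS z - (be (pv r z))%:~R * RS (pv r z)) = 0 :> R.
  by rewrite sumrB (sum_pv gr (fun z => (be z)%:~R * RS z)) subrr.
rewrite sum_half /isect rmorph_sum /= big_distrr /=; apply/eqP; apply: eq_bigr => z /andP[vz bz].
have [E1 E2 E3] := vertex_sides vz bz.
have := cb z vz => /(congr1 (fun q => (q%:~R : R))); rewrite !(intrD, intrN) mulr0z => E0.
rewrite E3 E1 E2 !(intrD, intrN, intrM).
have -> : (be z)%:~R = (be (pv r z))%:~R - (be (th z))%:~R + (be (pv r (th z)))%:~R :> R by lra.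
by ring.
Qed.

End Chain.

Theorem drawn_planar : planar r.
Proof.
move=> al be ca cb.
have /choice[a ha] : forall i, exists a : R, forall h d s, flat (e i) h d s m -> exists2 d' : R, 0 < d' <= d &
  forall y, box (0, 0) d' y -> [/\ 0 < y.2 -> wnd (e i) (h y) = a + 2 * pi * m%:~R,
    y.2 < 0 -> wnd (e i) (h y) = a & y.2 <> 0 -> forall u, e i u <> h y].
  by move=> i; exact: jordan_sides (je i) m m1.
exact: (isect0 ca ha cb).
Qed.

End Top.

Lemma near0_ball (R : realType) (P : set R) : nbhs (0 : R) P ->
  exists2 e : R, 0 < e & forall u, `|u| < e -> P u.
Proof.
move=> /nbhs_ballP[e /= e0 h]; exists e => // u hu.
by apply: h; rewrite /ball /= sub0r normrN.
Qed.

(** * From a spherical arrangement to a plane drawing *)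

Section Local.
Variables (R : realType) (T : topologicalType) (O : set (chart R T)).
Hypotheses (hO : oriented_atlas O) (hT : hausdorff_space T).

Lemma image_closed (c : R -> T) (s t : R) : continuous c -> closed [set c u | u in `[s, t]%classic].
Proof.
move=> cc; apply: compact_closed hT _; apply: continuous_compact; last exact: segment_compact.
exact: continuous_subspaceT.
Qed.

Variables (n : nat) (d : 'I_n -> R -> T).
Hypothesis hd : arrangement O d.
Implicit Types (i j l : 'I_n) (s t u v : R).

Let cd i : continuous (d i). Proof. by case: hd => /(_ i)[]. Qed.

(** The times of a period at distance at least [de] from [s] form a compact set whose image misses
    [d i s]. *)
Lemma curve_near i s (de : R) : 0 < de ->
  \forall q \near d i s, forall u, d i u = q -> exists2 v, `|v| < de & d i (s + v) = q.
Proof.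
move=> de0; have q0 : 0 < 1 / 4 :> R by lra.
have [e0 e1 e2] := min_pos2 de0 q0; set e := Num.min de (1 / 4) in e0 e1 e2.
have nb : nbhs (d i s) (~` [set d i u | u in `[s + e, s + 1 - e]%classic]).
  apply: open_nbhs_nbhs; split; first exact/closed_openC/image_closed.
  move=> [u /=]; rewrite in_itv /= => /andP[u1 u2] E.
  have us : u = s by apply: (curve_inj_lt hd E); lra.
  by lra.
apply: filterS nb => q nq u E.
have /andP[k1 k2] := floor_itv (u - (s - e)); rewrite intrD mulr1z in k2.
set k := Num.floor _ in k1 k2.
have E' : d i (u - k%:~R) = q by rewrite -E -intrN (curve_per hd).
exists (u - k%:~R - s); last by rewrite addrC subrK.
have v1 : u - k%:~R <> s - e.
  move=> e'; apply: nq; exists (s + 1 - e).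
    by rewrite /= in_itv /=; apply/andP; split; lra.
  rewrite -E' e' -(curve_per hd i (s - e) 1) mulr1z; congr (d i _); ring.
have v2 : ~ (s + e <= u - k%:~R).
  move=> le; apply: nq; exists (u - k%:~R) => //=.
  by rewrite in_itv /=; apply/andP; split; lra.
have v1' : u - k%:~R != s - e by exact/eqP.
rewrite ltr_norml; apply/andP; split; last by lra.
by move: v1'; rewrite neq_lt => /orP[]; lra.
Qed.

Lemma curve_away i p : (forall u, d i u <> p) -> \forall q \near p, forall u, d i u <> q.
Proof.
move=> ne; have nb : nbhs p (~` [set d i u | u in `[0, 1]%classic]).
  apply: open_nbhs_nbhs; split; first exact/closed_openC/image_closed.
  by move=> [u _]; exact: ne.
apply: filterS nb => q nq u E; have [v [v0 v1 ev]] := curve_frac hd i u.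
apply: nq; exists v; last by rewrite ev.
by rewrite /= in_itv /=; apply/andP; split=> //; exact: ltW.
Qed.

Lemma local_axes (b : bool) i j s t (f : chart R T) : i != j -> d i s = d j t -> dom f (d i s) ->
  (\forall u \near (0 : R), to_plane f (d i (s + u)) = (u, 0) /\
      to_plane f (d j (t + u)) = (0, if b then - u else u)) ->
  \forall y \near ((0, 0) : R * R), cod f y /\
     forall l u, d l u = of_plane f y -> (l = i /\ y.2 = 0) \/ (l = j /\ y.1 = 0).
Proof.
move=> ij est fp hf.
have f0 : to_plane f (d i s) = (0, 0).
  by have := nbhs_singleton hf; rewrite /= addr0 => -[].
have c0 : cod f (0, 0) by rewrite -f0; exact: to_plane_cod.
have of0 : of_plane f (0, 0) = d i s by rewrite -f0 to_planeK.
have nc : \forall y \near ((0, 0) : R * R), cod f y.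
  by apply: open_nbhs_nbhs; split=> //; exact: cod_open.
have tr_ (A : set T) : nbhs (d i s) A -> \forall y \near ((0, 0) : R * R), A (of_plane f y).
  by move=> nA; apply: (of_plane_continuous c0); rewrite of0.
move: hf => /nbhs_ballP[de /= de0 hde].
have hde' u : `|u| < de -> to_plane f (d i (s + u)) = (u, 0) /\ to_plane f (d j (t + u)) = (0, if b then - u else u).
  by move=> hu; apply: hde; rewrite /ball /= sub0r normrN.
have all_ : \forall y \near ((0, 0) : R * R), forall l, cod f y -> forall u, d l u = of_plane f y -> (l = i /\ y.2 = 0) \/ (l = j /\ y.1 = 0).
  apply: near_forall => l.
  have [li|li] := eqVneq l i.
    subst l; have := tr_ _ (curve_near i s de0); apply: filterS => y h cy u /h[v vd ev].
    left; split=> //; have [e1 _] := hde' v vd.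
    by rewrite -(of_planeK cy) -ev e1.
  have [lj|lj] := eqVneq l j.
    subst l; have := curve_near j t de0; rewrite -est => /tr_; apply: filterS => y h cy u /h[v vd ev].
    right; split=> //; have [_ e1] := hde' v vd.
    by rewrite -(of_planeK cy) -ev e1.
  have ne u : d l u <> d i s.
    move=> E; have [_ tri _ _] := hd.
    have : (range (d i) `&` range (d j) `&` range (d l)) (d i s).
      by split; [split; [exists s | exists t] | exists u].
    by rewrite tri // eq_sym.
  by have := tr_ _ (curve_away ne); apply: filterS => y h cy u /h.
by apply: filterS2 nc all_ => y cy h; split=> // l; exact: h.
Qed.

(** Near a crossing, in the adapted chart, the curves fill only the two axes. The point found is the
    pole of the projection to the plane. *)
Lemma off_point i j : i != j -> exists p, forall l u, d l u <> p.
Proof.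
move=> ij; have [_ _ crs two] := hd; have [P [Q [_ ePQ]]] := two i j ij.
have [[s _ es] [t _ et]] : (range (d i) `&` range (d j)) P by rewrite ePQ; left.
have est : d i s = d j t by rewrite es et.
have [b [_ [f [pf fp hf]]]] := crs i j ij s t est.
have [e e0 he] := nbhs_box (local_axes ij est fp hf).
have [|_ h] := he (e / 2, e / 2).
  by rewrite /box /= !subr0 gtr0_norm; lra.
exists (of_plane f (e / 2, e / 2)) => l u /h[][_ /=]; lra.
Qed.

Section Plane.
Variables (k : chart R T) (m : int).
Hypotheses (kT : cod k = setT) (kd : forall l u, dom k (d l u)).
Hypotheses (m1 : m = 1 \/ m = -1) (hm : forall y, signed O k y m).

Definition pc l u : R * R := to_plane k (d l u).

Lemma pc_jordan l : pseudocircle (pc l).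
Proof.
have [c h] : pseudocircle (d l) by case: hd.
split=> [u|u v]; first by apply: (@cta_comp _ _ _ (d l) (to_plane k)); [exact: c | exact: to_plane_continuous].
rewrite -h; split=> [E|E]; last by rewrite /pc E.
by rewrite -(to_planeK (kd l u)) -(to_planeK (kd l v)) -/(pc l u) E.
Qed.

(** The transition from the adapted chart to the plane chart straightens the plane curve, with
    degree the sign [m] of the plane chart; openness comes from the inverse transition. *)
Lemma flat_of (f : chart R T) l s : positive_chart O f -> dom f (d l s) ->
  (\forall u \near (0 : R), to_plane f (d l (s + u)) = (u, 0)) ->
  exists2 e : R, 0 < e & flat (pc l) (tr f k) e s m.
Proof.
move=> pf fp hf.
have f0 : to_plane f (d l s) = (0, 0) by have := nbhs_singleton hf; rewrite /= addr0.
have [e1 E1 hb] := tr_emb fp (kd l s); rewrite f0 in E1 hb.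
have nd : \forall u \near (0 : R), dom f (d l (s + u)).
  have c1 : cta (fun u => d l (s + u)) 0 by have c : continuous (d l) := @cd l; ct.
  by apply: c1; rewrite addr0; apply: open_nbhs_nbhs; split=> //; exact: dom_open.
have [e2 e20 h2] := near0_ball (filterI hf nd).
have [e10 _ _] := E1; have [e0 ee1 ee2] := min_pos2 e10 e20.
exists (Num.min e1 e2) => //; split.
- by apply: (embW E1 e0); rewrite /= subrr normr0 add0r.
- move=> u hu; have [|h3 h4] := h2 u; first by lra.
  by rewrite /tr /= -h3 to_planeK.
- move=> y by_ A nA; have [cy dy] : cod f y /\ dom k (of_plane f y) by apply: hb; apply: boxW by_.
  have fq : dom f (of_plane f y) by exact: of_plane_dom.
  have n1 := tr_near dy (@dom_open _ _ f) fq.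
  have n2 : \forall x \near to_plane k (of_plane f y), A (tr k f x).
    have c2 : cta (tr k f) (to_plane k (of_plane f y)).
      apply: (@cta_comp _ _ _ (of_plane k) (to_plane f)).
        by apply: of_plane_continuous; rewrite kT.
      by rewrite to_planeK //; exact: to_plane_continuous.
    by apply: c2; rewrite /tr /= to_planeK // of_planeK.
  apply: filterS2 n1 n2 => x [cx dx] Ax; exists (tr k f x) => //.
  by rewrite /tr /= to_planeK // of_planeK // kT.
- move=> r hr; have [g Og gp] := atlas_at hO (d l s).
  have E : of_plane k (pc l s) = d l s by exact: to_planeK.
  have := @hm (pc l s) f (Num.min e1 e2) r pf; rewrite E f0; apply=> //.
  by apply: (embW E1 e0); rewrite /= subrr normr0 add0r.
Qed.

Lemma crossing_flat i j s t : i != j -> crossing O true (d i) (d j) s t ->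
  exists h e, [/\ flat (pc i) h e s m, flat (pc j) (fun y => h (y.2, - y.1)) e t m &
    forall y, box (0, 0) e y -> y.1 <> 0 -> y.2 <> 0 -> forall l u, pc l u <> h y].
Proof.
move=> ij [est [f [pf fp hf]]].
have [e3 e30 h3] := nbhs_box (local_axes (b := true) ij est fp hf).
pose A (z : R * R) := (- z.2, z.1); pose B (z : R * R) := (z.2, - z.1).
have AB : cancel A B by move=> z; rewrite /A /B [RHS]surjective_pairing /= opprK.
have BA : cancel B A by move=> z; rewrite /A /B [RHS]surjective_pairing /= opprK.
have cA : continuous A by rewrite /A; ct.
have cB : continuous B by rewrite /B; ct.
have [e1 e10 F1] : exists2 e : R, 0 < e & flat (pc i) (tr f k) e s m.
  by apply: flat_of => //; apply: filterS hf => u [].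
have [e2 e20 F2] : exists2 e : R, 0 < e & flat (pc j) (tr (comp_chart f cA cB AB BA) k) e t m.
  apply: flat_of => /=.
  - apply: comp_chart_positive => // x.
    apply: (@op_rot _ B (- (pi / 2))) => r u; rewrite /B /polar /=.
    by rewrite cosBpihalf sinBpihalf; congr (_, _); ring.
  - by rewrite -est.
  - by apply: filterS hf => u [_ ->]; rewrite /A /= opprK.
have [e4 [e40 _ _] hb] := tr_emb fp (kd i s).
have f0 : to_plane f (d i s) = (0, 0) by have := nbhs_singleton hf; rewrite /= addr0 => -[].
rewrite f0 in hb.
have [e e0 he] : exists2 e : R, 0 < e & forall x, x \in [:: e1; e2; e3; e4] -> e < x.
  by apply: small_pos => x; rewrite !inE => /or4P[]/eqP->.
have b1 : e < e1 by apply: he; rewrite !inE eqxx.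
have b2 : e < e2 by apply: he; rewrite !inE eqxx orbT.
have b3 : e < e3 by apply: he; rewrite !inE eqxx !orbT.
have b4 : e < e4 by apply: he; rewrite !inE eqxx !orbT.
exists (tr f k), e; split.
- by apply: flat_small F1 _; rewrite e0 /=; lra.
- by apply: flat_small F2 _; rewrite e0 /=; lra.
- move=> y by_ y1 y2 l u E.
  have [cy h] : cod f y /\ forall l u, d l u = of_plane f y -> (l = i /\ y.2 = 0) \/ (l = j /\ y.1 = 0).
    by apply: h3; apply: boxW by_; lra.
  have [_ dk] : cod f y /\ dom k (of_plane f y) by apply: hb; apply: boxW by_; lra.
  have : d l u = of_plane f y.
    by rewrite -(to_planeK (kd l u)) -(to_planeK dk) -/(pc l u) E.
  by move=> /h[][].
Qed.

(** At a crossing of sign [true] curve [i] passes from the right of curve [j] to its left, and in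
    the other direction for [false]; the winding number around [j] records it. *)
Lemma crossing_sides (a : R) i j : i != j ->
  (forall h e s, flat (pc j) h e s m -> exists2 e' : R, 0 < e' <= e &
    forall y, box (0, 0) e' y -> [/\ 0 < y.2 -> wnd (pc j) (h y) = a + 2 * pi * m%:~R,
      y.2 < 0 -> wnd (pc j) (h y) = a & y.2 <> 0 -> forall u, pc j u <> h y]) ->
  forall b s t, crossing O b (d i) (d j) s t -> exists2 e : R, 0 < e &
    forall v, 0 < v < e -> wnd (pc j) (pc i (s + v)) = a + (if b then 2 * pi * m%:~R else 0) /\
      wnd (pc j) (pc i (s - v)) = a + (if b then 0 else 2 * pi * m%:~R).
Proof.
move=> ij ha b s t /(crossing_sym) [est [f [pf fp hf]]].
have [e1 e10 F1] : exists2 e : R, 0 < e & flat (pc j) (tr f k) e t m.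
  by apply: flat_of => //; apply: filterS hf => u [].
have [e2 /andP[e20 _] h2] := ha _ _ _ F1.
have nd : \forall u \near (0 : R), dom f (d i (s + u)).
  have c1 : cta (fun u => d i (s + u)) 0 by have c : continuous (d i) := @cd i; ct.
  by apply: c1; rewrite addr0 -est; apply: open_nbhs_nbhs; split=> //; exact: dom_open.
have [e3 e30 h3] := near0_ball (filterI hf nd).
have [m0 m2 m3] := min_pos2 e20 e30; exists (Num.min e2 e3) => // v /andP[v0 v1].
have H u : `|u| < Num.min e2 e3 -> u <> 0 -> wnd (pc j) (pc i (s + u)) = a + (if (0 < u) == b then 2 * pi * m%:~R else 0).
  move=> hu u0; have [|[_ h4] h5] := h3 u; first by lra.
  have -> : pc i (s + u) = tr f k (0, if ~~ b then - u else u) by rewrite /tr /= -h4 to_planeK.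
  have [|w1 w2 _] := h2 (0, if ~~ b then - u else u).
    by split=> /=; rewrite subr0 ?normr0 //; case: (b) => /=; rewrite ?normrN; lra.
  have [ug|ul] : 0 < u \/ u < 0 by case: (ltgtP 0 u) u0 => [|| <-] //; [left | right].
    rewrite ug; move: w1 w2 => /=; case: (b) => /= w1 w2; first by rewrite w1.
    by rewrite w2 ?addr0 // oppr_lt0.
  have -> : (0 < u) = false by apply/negbTE; rewrite -leNgt ltW.
  move: w1 w2 => /=; case: (b) => /= w1 w2; first by rewrite w2 ?addr0.
  by rewrite w1 // oppr_gt0.
have lv : (0 < v) = true by [].
have lmv : (0 < - v) = false by apply/negbTE; rewrite -leNgt; lra.
split; rewrite H ?lv ?lmv ?normrN ?gtr0_norm //; try lra; by case: (b).
Qed.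

(** Suppose two crossings have the same sign. Just after the first and just before the second, curve
    [i] is on opposite sides of [j], although it does not meet [j] in between, as there are only two
    common points. *)
Lemma crossing_once b i j s t s' t' : i != j -> crossing O b (d i) (d j) s t ->
  crossing O b (d i) (d j) s' t' -> d i s = d i s'.
Proof.
move=> ij x1 x2; apply: contrapT => ne.
have [a ha] := jordan_sides (pc_jordan j) m1.
have /andP[k1 k2] := floor_itv (s' - s); rewrite intrD mulr1z in k2.
set q := Num.floor _ in k1 k2.
have := crossing_shift hd (- q) 0 x2; set w := s' + (- q)%:~R => x3.
have dw : d i w = d i s' by rewrite /w (curve_per hd).
have [w1 w2] : s < w /\ w < s + 1.
  have : s != w by apply/eqP => e; apply: ne; rewrite e dw.
  by rewrite neq_lt /w intrN => /orP[]; lra.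
have [e1 e10 h1] := crossing_sides ij ha x1; have [e2 e20 h2] := crossing_sides ij ha x3.
have [v v0 hv] : exists2 v : R, 0 < v & forall x, x \in [:: e1; e2; (w - s) / 2] -> v < x.
  apply: small_pos => x; rewrite !inE => /or3P[]/eqP->; lra.
have v1 : v < e1 by apply: hv; rewrite !inE eqxx.
have v2 : v < e2 by apply: hv; rewrite !inE eqxx orbT.
have v3 : v < (w - s) / 2 by apply: hv; rewrite !inE eqxx !orbT.
have [A1 _] : _ /\ _ := h1 v (introT andP (conj v0 v1)).
have [_ A2] : _ /\ _ := h2 v (introT andP (conj v0 v2)).
pose g (c : R) := pc i ((1 - c) * (s + v) + c * (w - v)).
have g0 : g 0 = pc i (s + v) by rewrite /g; congr (pc i _); ring.
have g1 : g 1 = pc i (w - v) by rewrite /g; congr (pc i _); ring.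
have : wnd (pc j) (g 0) = wnd (pc j) (g 1).
  apply: (wnd_path (pc_jordan j)).
    move=> c _; have [cc _] := pc_jordan i; rewrite /g.
    by apply: (@cta_comp _ _ _ (fun c : R => (1 - c) * (s + v) + c * (w - v)) (pc i)); [ct | exact: cc].
  move=> c u /andP[c0 c1] E.
  have /andP[i1 i2] : s < (1 - c) * (s + v) + c * (w - v) < w by apply: conv_in; lra.
  set x := _ + c * _ in i1 i2 E.
  have E' : d i x = d j u.
    by rewrite -(to_planeK (kd i x)) -(to_planeK (kd j u)) -/(pc j u) E.
  have [_ _ _ two] := hd; have [P [Q [PQ ePQ]]] := two i j ij.
  have mem y z : d i y = d j z -> d i y = P \/ d i y = Q.
    move=> e; have : (range (d i) `&` range (d j)) (d i y) by split; [exists y | exists z].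
    by rewrite ePQ.
  have [e1' _] := x1; have [e3' _] := x3.
  have xs : d i x <> d i s by move=> e; have := curve_inj_lt hd e; lra.
  have xw : d i x <> d i w by move=> e; have := curve_inj_lt hd e; lra.
  rewrite -dw in ne.
  case: (mem _ _ E') (mem _ _ e1') (mem _ _ e3') => a1 [] a2 [] a3;
    by [apply: ne; rewrite a2 a3 | apply: xs; rewrite a1 a2 | apply: xw; rewrite a1 a3].
have K0 : 2 * pi * m%:~R <> 0 :> R.
  apply/eqP; apply: mulf_neq0; first exact: lt0r_neq0 (twopi_gt0 R).
  by rewrite intr_eq0; case: m1 => ->.
by rewrite g0 g1 A1 A2; case: (b); lra.
Qed.

Variables (r : 'I_n -> seq (bool * 'I_n)) (z : 'I_n -> seq (R * (bool * 'I_n))).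
Hypotheses (hz : forall i, rowdata O d i (z i)) (rz : forall i, r i = unzip2 (z i)).
Hypothesis n2 : forall i : 'I_n, exists j, j != i.

Lemma entry_inj i p q : p \in z i -> q \in z i -> p.2 = q.2 -> p = q.
Proof.
move=> pz qz e; have [_ h2 _ h4] := hz i.
have [pi [u hu]] := h4 p pz; have [_ [v hv]] := h4 q qz; rewrite -e in hv.
have ij : i != p.2.2 by rewrite eq_sym.
have E := crossing_once ij hu hv.
have e1 : p.1 = q.1 by apply: (curve_inj_lt hd E); [exact: h2 | exact: h2].
by rewrite (surjective_pairing p) e1 e -surjective_pairing.
Qed.

Lemma rows_good : good r.
Proof.
move=> i; have [h1 h2 h3 h4] := hz i; split.
  rewrite rz map_inj_in_uniq; last by move=> p q; exact: entry_inj.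
  exact: pairwise_uniq (@before_irr R n) h1.
move=> [b j]; rewrite rz; apply/mapP/idP => [[p pz ->]|ji /=]; first by have [] := h4 p pz.
have ij : i != j by rewrite eq_sym.
have [_ _ crs two] := hd; have [P [Q [PQ ePQ]]] := two i j ij.
have ent X : (range (d i) `&` range (d j)) X -> exists2 p, p \in z i & d i p.1 = X /\ p.2.2 = j.
  move=> [[s _ es] [t _ et]]; have [|p pz ep] := h3 j s ji; first by exists t; rewrite // et es.
  exists p => //; split; first by rewrite -ep.
  have [pi [u hu]] := h4 p pz; have [b' hb'] := crs i j ij s t (etrans es (esym et)).
  have := label_uniq hO hd _ ij (esym ep) hu hb'; rewrite eq_sym => /(_ pi) e.
  by move: e => /(congr1 snd).
have [p pz [ep lp]] : exists2 p, p \in z i & d i p.1 = P /\ p.2.2 = j by apply: ent; rewrite ePQ; left.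
have [q qz [eq lq]] : exists2 p, p \in z i & d i p.1 = Q /\ p.2.2 = j by apply: ent; rewrite ePQ; right.
(* The two common points have opposite signs, so both labels occur in the row. *)
have npq : p.2.1 != q.2.1.
  apply/eqP => e0; apply: PQ; have epq : p = q.
    apply: (entry_inj pz qz).
    by rewrite (surjective_pairing p.2) e0 lp -lq -surjective_pairing.
  by rewrite -ep -eq epq.
have [e|e] := eqVneq p.2.1 b; first by exists p; rewrite // -e -lp -surjective_pairing.
exists q => //; rewrite -lq; have -> : b = q.2.1 by move: npq e; case: (p.2.1); case: (q.2.1); case: (b).
by rewrite -surjective_pairing.
Qed.

(** Past the end of the list comes the first time of the next period, as [t_end] requires. *)
Definition time i (a : nat) : R :=
  let t := map fst (z i) in if (a < size t)%N then nth 0 t a else nth 0 t 0 + 1.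

Let sz i : size (r i) = size (map fst (z i)). Proof. by rewrite rz !size_map. Qed.

Lemma entry_time x : valid x -> exists2 p, p \in z x.1 & p.2 = x.2 /\ tm r time x = p.1.
Proof.
move=> vx; have : x.2 \in r x.1 by rewrite (rowP rows_good).
rewrite /tm /time -sz -index_mem => lt; rewrite lt.
have p0 : R * (bool * 'I_n) := (0, x.2).
have lt' : (index x.2 (r x.1) < size (z x.1))%N by move: lt; rewrite sz size_map.
exists (nth p0 (z x.1) (index x.2 (r x.1))); first by rewrite mem_nth.
split; last by rewrite (nth_map p0).
by rewrite -(nth_map p0 p0.2) // -/(unzip2 _) -rz nth_index // -index_mem.
Qed.

Theorem drawing_planar : planar r.
Proof.
have ne i : (0 < size (r i))%N.
  have [j ji] := n2 i; have [_ /(_ (true, j))] := rows_good i; rewrite /= ji.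
  by case: (r i).
apply: (@drawn_planar R n r pc time m rows_good pc_jordan) => //.
- move=> i a ar; have [h1 h2 _ _] := hz i; rewrite /time -sz ar.
  have p0 : R * (bool * 'I_n) := (0, head (true, i) (r i)).
  have ar' : (a < size (z i))%N by move: ar; rewrite sz size_map.
  have ne' : (0 < size (z i))%N by apply: leq_ltn_trans ar'.
  case: ifP => [ar1|_]; last by rewrite !(nth_map p0) //; apply: h2; rewrite mem_nth.
  have ar2 : (a.+1 < size (z i))%N by move: ar1; rewrite sz size_map.
  rewrite !(nth_map p0) //; move: h1 => /(pairwiseP p0); apply=> //.
- by move=> i; rewrite /time -sz ltnn ne.
- move=> i l u v il E; have [_ _ h3 _] := hz i.
  have E' : d i u = d l v by rewrite -(to_planeK (kd i u)) -(to_planeK (kd l v)) -/(pc i u) E.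
  have li : l != i by rewrite eq_sym.
  have rg : range (d l) (d i u) by exists v.
  have [p pz e] := h3 l u li rg.
  have [q eq] := curve_inj hd e; exists (index p (z i)), q.
  have lt : (index p (z i) < size (z i))%N by rewrite index_mem.
  rewrite /time -sz sz size_map lt; split=> //; by rewrite (nth_map p) // nth_index.
- move=> x vx bx; have vy : valid (th x) by rewrite th_valid.
  have [p pz [ep ->]] := entry_time vx; have [p' pz' [ep' ->]] := entry_time vy.
  have [_ _ _ h4] := hz x.1; have [_ _ _ h4'] := hz (th x).1.
  have [_ [u hu]] := h4 p pz; have [_ [u' /crossing_sym hu']] := h4' p' pz'.
  rewrite ep in hu; rewrite ep' /= negbK in hu'; rewrite bx in hu hu'.
  have E := crossing_once vx hu hu'; have [e1 _] := hu; have [e2 _] := hu'.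
  have [q eq] : exists q : int, p'.1 = u + q%:~R.
    by apply: (@curve_inj _ _ _ _ _ hd x.2.2); rewrite -e1 E e2.
  have := crossing_shift hd 0 q hu; rewrite addr0 -eq => hu2.
  exact: crossing_flat vx hu2.
Qed.

End Plane.
End Local.

Theorem sphere_rows (R : realType) (O : set (chart R (sphere R))) (n : nat) (d : 'I_n -> R -> sphere R)
    (r : 'I_n -> seq (bool * 'I_n)) : closed_oriented_surface O -> arrangement O d -> (1 < n)%N ->
  (forall i, rowdesc O d i (r i)) -> good r /\ planar r.
Proof.
move=> [_ _ hT _ hO] hd n1 hr.
have n2 (i : 'I_n) : exists j, j != i.
  have : (0 < #|predC1 i|)%N by rewrite cardC1 card_ord; case: n n1 {i d r hd hr} => [|[]].
  by move=> /card_gt0P[j]; exists j.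
have [i0] : inhabited 'I_n by exact: inhabits (Ordinal (ltnW n1)).
have [j0 ji] := n2 i0; have [N hN] := off_point hT hd ji.
have [k [kT kd]] := sphere_chart_avoiding N.
have kd' l u : dom k (d l u) by apply: kd; exact: hN.
have [m m1 hm] := signed_const hO kT.
have /choice[z hz] : forall i, exists z, rowdata O d i z /\ r i = unzip2 z by move=> i; have [z] := hr i; exists z.
have hz1 i : rowdata O d i (z i) by case: (hz i).
have rz i : r i = unzip2 (z i) by case: (hz i).
split; first exact: (rows_good hO hd kT kd' m1 hm hz1 rz).
exact: (drawing_planar hO hT hd kT kd' m1 hm hz1 rz n2).
Qed.

(** * Subarrangements of four curves *)

Section Filter.
Variables (X : eqType) (Y : Type) (a : pred X) (f : X -> Y).

Lemma last_filter x l : (forall l1 y l2, l = l1 ++ y :: l2 -> ~~ a y -> f y = f (last x l1)) ->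
  f (last x l) = f (last x [seq y <- l | a y]).
Proof.
elim/last_ind: l => [//|l y IH] h; rewrite last_rcons filter_rcons.
case: ifP => [_|/negbT ay]; first by rewrite last_rcons.
rewrite (h l y [::]) ?cats1 //; apply: IH => l1 z l2 e; apply: (h l1 z (rcons l2 y)).
by rewrite e rcons_cat.
Qed.

Lemma prev_at_last (x y : X) l : x \notin l -> prev_at x x y l = last y l.
Proof.
elim: l y => [|z l IH] y /=; first by rewrite eqxx.
by rewrite inE negb_or => /andP[/negbTE-> xl]; exact: IH.
Qed.

Lemma prev_at_mid (x y0 y : X) l l' : x \notin l -> prev_at x y0 y (l ++ x :: l') = last y l.
Proof.
elim: l y => [|z l IH] y /=; first by rewrite eqxx.
by rewrite inE negb_or => /andP[/negbTE-> xl]; exact: IH.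
Qed.

(** [f] does not change at the entries which are filtered out, so going back over them one still
    reads its value at the last kept entry. *)
Lemma prev_filter (s : seq X) x : uniq s -> x \in s -> a x ->
  (forall z, z \in s -> ~~ a z -> f z = f (prev s z)) -> f (prev s x) = f (prev [seq y <- s | a y] x).
Proof.
move=> us xs ax h; have [k l e] := rot_to xs.
have ul : uniq (x :: l) by rewrite -e rot_uniq.
rewrite -(prev_rot k us) e.
have [k' ek'] : exists k', rot k' [seq y <- s | a y] = [seq y <- x :: l | a y].
  exists (size [seq y <- take k s | a y]); rewrite -e /rot filter_cat.
  by rewrite -{2 4}(cat_take_drop k s) filter_cat drop_size_cat // take_size_cat.
have uf : uniq [seq y <- s | a y] by exact: filter_uniq.
rewrite -[prev [seq y <- s | a y] x](prev_rot k' uf) ek' /= ax.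
have nx : x \notin l by case/andP: ul.
rewrite /prev !prev_at_last //; last by rewrite mem_filter (negbTE nx) andbF.
apply: last_filter => l1 y l2 el ay.
rewrite h //; last by rewrite -(mem_rot k) e el inE mem_cat inE eqxx !orbT.
rewrite -(prev_rot k us) e el /= prev_at_mid //.
by move: ul; rewrite el /= cat_uniq => /and4P[_ _ /norP[]].
Qed.

End Filter.

Section Extend.
Variable n : nat.

Lemma card_extend (B : {set 'I_n}) k : (#|B| <= k)%N -> (k <= n)%N ->
  exists A : {set 'I_n}, #|A| = k /\ B \subset A.
Proof.
elim: k => [|k IH] Bk kn.
  by exists B; split; [apply/eqP; rewrite -leqn0 | ].
have [e|ne] := eqVneq #|B| k.+1; first by exists B.
have [|A [cA BA]] := IH _ (ltnW kn); first by rewrite -ltnS ltn_neqAle ne.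
have [x xA] : exists x, x \notin A.
  apply/existsP; apply: contraLR kn; rewrite negb_exists => /forallP h; rewrite -leqNgt.
  rewrite -cA -[X in (X <= _)%N](card_ord n); apply/subset_leq_card/fintype.subsetP => x _.
  by have := h x; rewrite negbK.
exists (x |: A); split; first by rewrite cardsU1 xA cA.
exact: fintype.subset_trans BA (finset.subsetUr _ _).
Qed.

Lemma four_set (s : seq 'I_n) : (size s <= 4)%N -> (4 <= n)%N ->
  exists A : {set 'I_n}, #|A| = 4%N /\ {subset s <= A}.
Proof.
move=> s4 n4; have [|A [cA sA]] := @card_extend [set x in s] 4 _ n4.
  by apply: leq_trans s4; rewrite cardsE; exact: card_size.
by exists A; split=> // x xs; apply: (fintype.subsetP sA); rewrite inE.
Qed.

Variable r : 'I_n -> seq (bool * 'I_n).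
Definition subrow (A : {set 'I_n}) (i : 'I_#|A|) : seq (bool * 'I_#|A|) := relabel i (r (enum_val i)).
Hypothesis n4 : (4 <= n)%N.
Hypothesis lab : forall i e, e \in r i -> e.2 != i.
Hypothesis loc : forall A : {set 'I_n}, #|A| = 4%N -> good (subrow (A := A)) /\ planar (subrow (A := A)).

Lemma count_uniq (X : eqType) (s : seq X) : (forall x, x \in s -> exists2 a : pred X, a x & uniq [seq y <- s | a y]) -> uniq s.
Proof.
move=> h; apply: count_mem_uniq => x; have [xs|xs] := boolP (x \in s); last exact/count_memPn.
have [a ax ua] := h x xs.
have := count_uniq_mem x ua; rewrite mem_filter ax xs /= count_filter => <-.
by apply: eq_count => y /=; case: eqP => // ->; rewrite ax.
Qed.

Lemma good_of_local : good r.
Proof.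
have pick i j : exists A : {set 'I_n}, [/\ #|A| = 4%N, i \in A & j \in A].
  have [A [cA sA]] := @four_set [:: i; j] isT n4.
  by exists A; split=> //; apply: sA; rewrite !inE eqxx ?orbT.
move=> i; split.
  apply: count_uniq => -[b j] ej; have [A [cA iA jA]] := pick i j.
  exists (fun e => e.2 \in A) => //.
  have [g _] := loc cA; have [u _] := g (enum_rank_in iA i).
  by have := map_uniq u; rewrite enum_rankK_in.
move=> [b j]; apply/idP/idP => [/lab//|/= ji]; have [A [cA iA jA]] := pick i j.
have [g _] := loc cA; have [_ h] := g (enum_rank_in iA i).
have : (b, enum_rank_in iA j) \in subrow (enum_rank_in iA i).
  rewrite h /=; apply: contra ji => /eqP/(congr1 enum_val).
  by rewrite !enum_rankK_in // => ->.
move=> /mapP[[b' j'] mem [-> e]]; move: mem; rewrite mem_filter enum_rankK_in // => /andP[/= j'A hj'].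
by move: e => /(congr1 enum_val); rewrite !enum_rankK_in // => ->.
Qed.

Section Restrict.
Variable A : {set 'I_n}.
Hypothesis cA : #|A| = 4%N.
Let gr := good_of_local.
Let rA := subrow (A := A).
Let gA : good rA. Proof. by case: (loc cA). Qed.

Definition emb_pass (x : passage #|A|) : passage n := (enum_val x.1, (x.2.1, enum_val x.2.2)).

Let emb_valid x : valid (emb_pass x) = valid x.
Proof. by rewrite /valid /= (inj_eq enum_val_inj). Qed.

Let emb_th x : emb_pass (th x) = th (emb_pass x).
Proof. by []. Qed.

(** At a crossing with a curve outside of [A] the other curve carries nothing, so by Kirchhoff's law
    [al] does not change there, and the deleted passages are invisible. *)
Lemma restrict_pv (s : seq 'I_n) al x : {subset s <= A} -> sup s al -> cyc r al -> valid x ->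
  al (emb_pass (pv rA x)) = al (pv r (emb_pass x)).
Proof.
move=> sA sal ca vx; case: x vx => i [b j] vx.
have ax : enum_val j \in A by exact: enum_valP.
have [u _] := gr (enum_val i).
have ex : (b, enum_val j) \in r (enum_val i).
  by rewrite (rowP gr (enum_val i, (b, enum_val j))) -(emb_valid (i, (b, j))) in vx *.
rewrite /pv /= (@prev_filter _ _ (fun e => e.2 \in A) (fun e => al (enum_val i, e))) //; last first.
  move=> [b' j'] mem /= j'A.
  have vz : valid (enum_val i, (b', j')) by rewrite -(rowP gr).
  have j's : j' \notin s by apply: contra j'A => /sA.
  have z1 : al (th (enum_val i, (b', j'))) = 0 by exact: sal.
  have z2 : al (pv r (th (enum_val i, (b', j')))) = 0 by exact: sal.
  by have := ca _ vz; rewrite z1 z2 /= => E0; apply/eqP; rewrite -subr_eq0 -[X in X == _]addr0; apply/eqP; rewrite -[RHS]E0; congr (_ + _); rewrite subrr.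
pose g (e : bool * 'I_#|A|) : bool * 'I_n := (e.1, enum_val e.2).
have gI : injective g by move=> [b1 j1] [b2 j2] [-> /enum_val_inj ->].
have -> : [seq y <- r (enum_val i) | y.2 \in A] = map g (rA i).
  rewrite /rA /subrow /relabel -map_comp map_id_in // => e; rewrite mem_filter => /andP[eA _].
  by rewrite /g /= enum_rankK_in // -surjective_pairing.
have [uA _] := gA i.
by rewrite (prev_map gI uA (b, j)).
Qed.

Lemma restrict_isect s al be : {subset s <= A} -> sup s al -> sup s be -> cyc r al -> cyc r be ->
  isect r al be = 0.
Proof.
move=> sA sal sbe ca cb.
have out (i : 'I_n) : i \notin A -> i \notin s by apply: contra => /sA.
have [_ plA] := loc cA.
have cyA ga : sup s ga -> cyc r ga -> cyc rA (ga \o emb_pass).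
  move=> sg cg x vx; rewrite /= !(restrict_pv sA) ?th_valid //.
  by have := cg (emb_pass x); rewrite emb_valid emb_th; apply.
have E0 := plA _ _ (cyA _ sal ca) (cyA _ sbe cb); apply: etrans E0; rewrite /isect.
(* A crossing involving a curve outside of [A] contributes 0: each of its two products has a factor
   on that curve. *)
rewrite (bigID (fun x : passage n => (x.1 \in A) && (x.2.2 \in A))) /= [X in _ + X]big1 ?addr0; last first.
  move=> x /andP[_]; rewrite negb_and => /orP[] h.
    by rewrite (sbe x) ?(sal (pv _ _)) /= ?out // mul0r mulr0 subrr.
  by rewrite (sal (th x)) ?(sbe (pv _ _)) /= ?out // mul0r mulr0 subrr.
have [a0 a0A] : exists a0, a0 \in A by apply/card_gt0P; rewrite cA.
pose back (x : passage n) : passage #|A| := (enum_rank_in a0A x.1, (x.2.1, enum_rank_in a0A x.2.2)).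
rewrite (reindex_onto emb_pass back) /=; last first.
  by move=> [i [b j]] /andP[_ /andP[/= iA jA]]; rewrite /emb_pass /back /= !enum_rankK_in.
apply: eq_big => [[i [b j]]|x /andP[/andP[/andP[vx _] _] _]].
  by rewrite /= !enum_valP /back /emb_pass /= !enum_valK_in eqxx !andbT -(emb_valid (i, (b, j))).
rewrite emb_valid in vx.
by rewrite !(restrict_pv sA) ?th_valid.
Qed.

End Restrict.

Theorem planar_of_four : good r /\ planar r.
Proof.
split; first exact: good_of_local.
apply: (planar_of_local good_of_local) => s al be s4 ca cb sal sbe.
have [A [cA sA]] := four_set s4 n4.
exact: (restrict_isect cA sA sal sbe ca cb).
Qed.

End Extend.

(** * Layout of a planar row system *)

Section Layout.
Variables (R : realType) (n : nat) (r : 'I_n -> seq (bool * 'I_n)).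
Hypothesis gr : good r.
Notation P := (passage n).
Implicit Types (x y z w : P) (a b c d p q h : R).

(** Cyclic order on the line closed up by a point at infinity; with [a] to [c] and [b] to [d] as
    chords, it says that they cross, and with which sign. *)
Definition cyc4 a b c d : Prop :=
  [\/ [/\ a < b, b < c & c < d], [/\ b < c, c < d & d < a],
      [/\ c < d, d < a & a < b] | [/\ d < a, a < b & b < c]].

Definition btw a b c : bool := (a < c) && (c < b) || (b < c) && (c < a).

Lemma btwl a b : btw a b a = false.
Proof. by rewrite /btw !ltxx andbF. Qed.

Lemma btwr a b : btw a b b = false.
Proof. by rewrite /btw !ltxx andbF. Qed.

Lemma cyc4_btw a b c d : cyc4 a b c d -> btw a c d = ~~ btw a c b.
Proof.
case=> -[h1 h2 h3]; rewrite /btw.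
- have -> : (d < c) = false by apply/negP; lra.
  have -> : (c < d) && (d < a) = false by apply/negP => /andP[]; lra.
  by rewrite h1 h2 andbF.
- have -> : (a < d) = false by apply/negP; lra.
  have -> : (a < b) = false by apply/negP; lra.
  have -> : (c < b) = false by apply/negP; lra.
  by rewrite h2 h3.
- have -> : (a < d) = false by apply/negP; lra.
  have -> : (b < c) = false by apply/negP; lra.
  have -> : (b < a) = false by apply/negP; lra.
  by rewrite h1 h2 !andbF.
- have -> : (a < d) = false by apply/negP; lra.
  have -> : (c < d) = false by apply/negP; lra.
  by rewrite h2 h3.
Qed.

Lemma cyc4_btw' a b c d : cyc4 d c b a -> btw a c b = ~~ btw a c d.
Proof.
by move=> h; apply: cyc4_btw; case: h => -[h1 h2 h3]; [constructor 2|constructor 3|constructor 4|constructor 1].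
Qed.

Lemma far_lt (p h a u v : R) : h < `|a - p| -> `|u - p| <= h -> `|v - p| <= h ->
  (a < u) = (a < v) /\ (u < a) = (v < a).
Proof.
rewrite ltr_normr !ler_norml => /orP[]a1 /andP[u1 u2] /andP[v1 v2]; split; apply/idP/idP; lra.
Qed.

Lemma btw_far (p h a b u v : R) : h < `|a - p| -> h < `|b - p| -> `|u - p| <= h -> `|v - p| <= h ->
  btw a b u = btw a b v.
Proof.
by move=> a1 b1 u1 v1; rewrite /btw; have [-> ->] := far_lt a1 u1 v1; have [-> ->] := far_lt b1 u1 v1.
Qed.

Lemma btw_near (p h a u v : R) : h < `|a - p| -> `|u - p| <= h -> `|v - p| <= h -> btw u v a = false.
Proof.
by move=> a1 u1 v1; rewrite /btw; have [-> ->] := far_lt a1 u1 v1; case: ltgtP.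
Qed.

Definition eqv a b : Prop := a = b \/ (a = 0 /\ b = 4) \/ (a = 4 /\ b = 0).

Section Positions.
Variables S E : P -> R.

(* The passage [x] lies on a chord from [S x] to [E x] of the upper half plane, crossed by
   the chord of [th x], one end of which ([ipos]) is inside and the other ([opos]) outside.
   Chords are drawn as two segments, [tau] is the time of the crossing on [[0, 1]]. *)
Definition ipos x : R := if btw (S x) (E x) (S (th x)) then S (th x) else E (th x).
Definition opos x : R := if btw (S x) (E x) (S (th x)) then E (th x) else S (th x).
Definition frac x : R := (ipos x - S x) / (E x - S x).
(** If the outer end of the crossing chord lies beyond [E x], that chord leaves through the second
    segment, and otherwise through the first. *)
Definition late x : bool := 0 < (opos x - E x) * (E x - S x).
Definition tau x : R := (frac x + (late x)%:R) / 2.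

Definition xing w w' : Prop := btw (S w) (E w) (S w') != btw (S w) (E w) (E w').

End Positions.

(* A partial drawing in which the edges not in [lk] are cut open: [Q] is the set of passages
   already drawn, [he] and [hs] are half-widths of intervals around the ends of the chords
   which meet no other end, [rb] and [lb] mark the sides of the edge leading to a passage.
   All positions are in [[0, 4]], whose ends are identified by [eqv]. *)
Record state := State {
  Q : pred P; lk : pred P;
  S : P -> R; E : P -> R; he : P -> R; hs : P -> R; rb : P -> R; lb : P -> R }.

(** A letter is a free end of a chord: [(x, true)] the end after its last passage [x], [(x, false)]
    the start before its first passage [x]. *)
Definition lett (s : state) (l : P * bool) : bool :=
  Q s l.1 && ~~ lk s (if l.2 then l.1 else pv r l.1).
Definition pos (s : state) (l : P * bool) : R := if l.2 then E s l.1 else S s l.1.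
Definition wd (s : state) (l : P * bool) : R := if l.2 then he s l.1 else hs s l.1.
(** Right and left of the edge after [x]. A chord comes down to its end from the upper half plane,
    so the right side has the smaller coordinate; at the start of a chord it is the reverse. *)
Definition RA (s : state) x : R := E s x - he s x.
Definition LA (s : state) x : R := E s x + he s x.

(** [i_xing] says that chords cross only at recorded passages, [i_tau] that passages follow each
    other along a chord. In [i_corner] each of the four quadrants at a crossing is named twice, by
    the two edges bordering it, and the names must agree. *)
Record inv (s : state) : Prop := Inv {
  i_valid : forall x, Q s x -> valid x;
  i_th : forall x, Q s (th x) = Q s x;
  i_lk : forall x, lk s x -> [/\ Q s x, Q s (nx r x), S s (nx r x) = S s x, E s (nx r x) = E s x &
                               rb s (nx r x) = RA s x /\ lb s (nx r x) = LA s x];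
  i_wd : forall l, lett s l -> 0 < wd s l;
  i_he : forall x, Q s x -> 0 < he s x;
  i_disj : forall l l', lett s l -> lett s l' -> l <> l' -> wd s l + wd s l' <= `|pos s l - pos s l'|;
  i_fwd : forall w, Q s w -> exists x, [/\ lett s (x, true), E s x = E s w & S s x = S s w];
  i_bwd : forall w, Q s w -> exists x, [/\ lett s (x, false), E s x = E s w & S s x = S s w];
  i_row : forall w w', Q s w -> Q s w' -> S s w = S s w' \/ E s w = E s w' -> w.1 = w'.1;
  i_cyc4 : forall x, Q s x -> x.2.1 -> cyc4 (S s x) (E s (th x)) (E s x) (S s (th x));
  i_xing : forall w w', Q s w -> Q s w' -> xing (S s) (E s) w w' ->
     exists z, [/\ Q s z, S s z = S s w & S s (th z) = S s w'];
  i_tau : forall x, lk s x -> tau (S s) (E s) x < tau (S s) (E s) (nx r x);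
  i_start : forall x, Q s x -> ~~ lk s (pv r x) -> rb s x = S s x + hs s x /\ lb s x = S s x - hs s x;
  i_corner : forall x, Q s x -> x.2.1 -> [/\ eqv (LA s x) (lb s (th x)), eqv (RA s x) (LA s (th x)),
     eqv (rb s x) (RA s (th x)) & eqv (lb s x) (rb s (th x))];
  i_range : forall l, lett s l -> 0 <= pos s l - wd s l /\ pos s l + wd s l <= 4 }.

Section Facts.
Variable s : state.
Hypothesis hs0 : inv s.

Lemma pos_ne l l' : lett s l -> lett s l' -> l <> l' -> pos s l <> pos s l'.
Proof.
move=> h h' ne e; have := i_disj hs0 h h' ne; rewrite e subrr normr0.
by have := i_wd hs0 h; have := i_wd hs0 h'; lra.
Qed.

Lemma SE_ne w w' : Q s w -> Q s w' -> S s w <> E s w'.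
Proof.
move=> qw qw'; have [x [lx ex sx]] := i_bwd hs0 qw; have [y [ly ey sy]] := i_fwd hs0 qw'.
by rewrite -sx -ey; exact: (pos_ne lx ly).
Qed.

Lemma S_E w w' : Q s w -> Q s w' -> S s w = S s w' -> E s w = E s w'.
Proof.
move=> qw qw' e; have [x [lx ex sx]] := i_bwd hs0 qw; have [y [ly ey sy]] := i_bwd hs0 qw'.
rewrite -ex -ey; suff -> : x = y by [].
apply: contrapT => ne; apply: (pos_ne lx ly) => [[]//|].
by rewrite /pos /= sx sy.
Qed.

Lemma E_S w w' : Q s w -> Q s w' -> E s w = E s w' -> S s w = S s w'.
Proof.
move=> qw qw' e; have [x [lx ex sx]] := i_fwd hs0 qw; have [y [ly ey sy]] := i_fwd hs0 qw'.
rewrite -sx -sy; suff -> : x = y by [].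
apply: contrapT => ne; apply: (pos_ne lx ly) => [[]//|].
by rewrite /pos /= ex ey.
Qed.

Lemma far_pos x w : lett s (x, true) -> Q s w -> E s w <> E s x ->
  he s x < `|E s w - E s x| /\ he s x < `|S s w - E s x|.
Proof.
move=> lx qw ne; have [y [ly ey sy]] := i_fwd hs0 qw; have [y' [ly' ey' sy']] := i_bwd hs0 qw.
have wy := i_wd hs0 ly; have wy' := i_wd hs0 ly'.
have n1 : (y, true) <> (x, true) by move=> [e]; apply: ne; rewrite -ey e.
have n2 : (y', false) <> (x, true) by [].
have := i_disj hs0 ly lx n1; have := i_disj hs0 ly' lx n2.
rewrite /wd /pos /= ey sy' in wy wy' *; lra.
Qed.

Lemma far_start x w : lett s (x, true) -> Q s w -> he s x < `|S s w - E s x|.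
Proof.
move=> lx qw; have [y' [ly' ey' sy']] := i_bwd hs0 qw.
have wy' := i_wd hs0 ly'; have n2 : (y', false) <> (x, true) by [].
by have := i_disj hs0 ly' lx n2; rewrite /wd /pos /= sy' in wy' *; lra.
Qed.

End Facts.

(** * Adding one crossing to a partial layout *)

Section Step.
Variables (s : state) (x0 : P).
Hypotheses (is_ : inv s) (q0 : Q s x0) (nq0 : ~~ Q s (nx r x0)).

Let z0 := nx r x0.
Let y0 := th z0.
Let p := E s x0.
Let h := he s x0.
(** The interval of half-width [h] around [p] is divided into three intervals of half-width [h / 3],
    centred at [p] and [p + sg * (2 * h / 3)] and [p - sg * (2 * h / 3)]; neighbours share an end,
    which is what [i_corner] needs. The sign of the crossing decides in which outer one the new
    chord starts. *)
Let sg : R := if z0.2.1 then -1 else 1.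

Definition upd (f : P -> R) (a b : R) : P -> R := fun w => if w == z0 then a else if w == y0 then b else f w.

(* The edge after [x0] is prolonged up to the next crossing, where a short new chord for the
   other curve is put across its end. *)
Definition step : state := State
  (fun w => [|| w == z0, w == y0 | Q s w]) (fun w => (w == x0) || lk s w)
  (upd (S s) (S s x0) (p - sg * (2 * h / 3))) (upd (E s) p (p + sg * (2 * h / 3)))
  (upd (he s) (h / 3) (h / 3)) (upd (hs s) 1 (h / 3))
  (upd (rb s) (p - h) (p - sg * (2 * h / 3) + h / 3)) (upd (lb s) (p + h) (p - sg * (2 * h / 3) - h / 3)).

Let vz : valid z0. Proof. by rewrite nx_valid // (i_valid is_). Qed.
Let zy : z0 <> y0.
Proof. by move: vz; rewrite /y0 /valid; case: (z0) => i [b j] /= + [e _ _]; rewrite e eqxx. Qed.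
Let nQz : Q s z0 = false. Proof. exact: negbTE. Qed.
Let nQy : Q s y0 = false. Proof. by rewrite /y0 (i_th is_). Qed.
Let h0 : 0 < h. Proof. exact: i_he is_ _ q0. Qed.
Let nlk0 : lk s x0 = false.
Proof. by apply/negP => /(i_lk is_)[_]; rewrite -/z0 nQz. Qed.
Let lx0 : lett s (x0, true). Proof. by rewrite /lett /= q0 nlk0. Qed.
Let sg1 : sg = 1 \/ sg = -1. Proof. by rewrite /sg; case: ifP; [right | left]. Qed.

Let upz f a b : upd f a b z0 = a. Proof. by rewrite /upd eqxx. Qed.
Let upy f a b : upd f a b y0 = b.
Proof. by rewrite /upd eqxx; case: eqP => // e; case: zy. Qed.
Let upQ f a b w : Q s w -> upd f a b w = f w.
Proof.
move=> qw; rewrite /upd; case: eqP => [e|_]; first by rewrite e nQz in qw.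
by case: eqP => // e; rewrite e nQy in qw.
Qed.
Let thz : th z0 = y0. Proof. by []. Qed.
Let thy : th y0 = z0. Proof. by rewrite /y0 thK. Qed.
Let pvz : pv r z0 = x0. Proof. by rewrite /z0 nxK. Qed.
Let nlkz : lk s z0 = false. Proof. by apply/negP => /(i_lk is_)[]; rewrite nQz. Qed.
Let nlky : lk s y0 = false. Proof. by apply/negP => /(i_lk is_)[]; rewrite nQy. Qed.
Let zx : (z0 == x0) = false. Proof. by apply/eqP => e; move: q0; rewrite -e nQz. Qed.
Let yx : (y0 == x0) = false. Proof. by apply/eqP => e; move: q0; rewrite -e nQy. Qed.
Let nlkpy : lk step (pv r y0) = false.
Proof.
rewrite /=; apply/negP => /orP[/eqP e|/(i_lk is_)[_]]; last by rewrite pvK // nQy.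
by apply: zy; rewrite -[y0](pvK gr) e.
Qed.
Let Qcase w : Q step w -> [\/ w = z0, w = y0 | Q s w].
Proof. by rewrite /= => /or3P[/eqP|/eqP|]; [constructor 1|constructor 2|constructor 3]. Qed.

Let lcase l : lett step l -> [\/ l = (z0, true), l = (y0, true), l = (y0, false) |
   [/\ lett s l, l <> (x0, true), pos step l = pos s l & wd step l = wd s l]].
Proof.
case: l => w b; rewrite {1}/lett => /andP[/Qcase[]/= hw nl].
- subst w; case: b nl => nl; first by constructor 1.
  by move: nl; rewrite pvz eqxx.
- by subst w; case: b nl => nl; [constructor 2 | constructor 3].
- constructor 4; split.
  + rewrite /lett /= hw /=; move: nl; rewrite negb_or => /andP[_]; by case: b.
  + by move=> [e1 e2]; move: nl; rewrite e1 e2 eqxx.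
  + by rewrite /pos /=; case: (b); rewrite upQ.
  + by rewrite /wd /=; case: (b); rewrite upQ.
Qed.

Let pos_z : pos step (z0, true) = p. Proof. exact: upz. Qed.
Let pos_yt : pos step (y0, true) = p + sg * (2 * h / 3). Proof. exact: upy. Qed.
Let pos_yf : pos step (y0, false) = p - sg * (2 * h / 3). Proof. exact: upy. Qed.
Let wd_z : wd step (z0, true) = h / 3. Proof. exact: upz. Qed.
Let wd_yt : wd step (y0, true) = h / 3. Proof. exact: upy. Qed.
Let wd_yf : wd step (y0, false) = h / 3. Proof. exact: upy. Qed.

Let old_far l : lett s l -> l <> (x0, true) -> h + wd s l <= `|p - pos s l|.
Proof. by move=> hl nl; have := i_disj is_ lx0 hl (nesym nl). Qed.

Let new_old l (k : R) : (k = 0 \/ k = 1 \/ k = -1) -> lett s l -> l <> (x0, true) ->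
  h / 3 + wd s l <= `|p + k * (2 * h / 3) - pos s l|.
Proof.
move=> hk hl nl; have := old_far hl nl; have := h0.
case: (ger0P (p - pos s l)) => u1; case: (ger0P (p + k * (2 * h / 3) - pos s l)) => u2;
  case: hk u2 => [->|[->|->]]; rewrite ?mul0r ?mul1r ?mulN1r => *; lra.
Qed.

Let new3 l : lett step l -> (exists k : R, [/\ (k = 0 /\ l = (z0, true)) \/ (k = sg /\ l = (y0, true)) \/
    (k = - sg /\ l = (y0, false)), pos step l = p + k * (2 * h / 3) & wd step l = h / 3]) \/
   [/\ lett s l, l <> (x0, true), pos step l = pos s l & wd step l = wd s l].
Proof.
move=> /lcase[->|->|->|]; last by right.
- by left; exists 0; rewrite pos_z wd_z; split; [left | ring |].
- by left; exists sg; rewrite pos_yt wd_yt; split; [right; left | |].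
- by left; exists (- sg); rewrite pos_yf wd_yf; split; [right; right | ring |].
Qed.

Lemma step_inv : inv step.
Proof.
have hp := h0; have hsg := sg1.
have k3 (k : R) l : (k = 0 /\ l = (z0, true)) \/ (k = sg /\ l = (y0, true)) \/
    (k = - sg /\ l = (y0, false)) -> k = 0 \/ k = 1 \/ k = -1.
  by case: hsg => e; rewrite e => -[[->]|[[->]|[->]]]; rewrite ?opprK; auto.
have fx w : Q s w -> h < `|S s w - p| by exact: far_start.
have fe w : Q s w -> E s w <> p -> h < `|E s w - p| by move=> qw ne; have [] := far_pos is_ lx0 qw ne.
have lzt : lett step (z0, true) by rewrite /lett /= eqxx nlkz zx.
have lyt : lett step (y0, true) by rewrite /lett /= eqxx orbT nlky yx.
have lyf : lett step (y0, false) by rewrite /lett [pv _ _]/=; rewrite nlkpy /= eqxx orbT.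
have keep l : lett s l -> l <> (x0, true) -> lett step l.
  case: l => w b; rewrite /lett /= => /andP[qw nl] ne; rewrite qw !orbT /= negb_or nl andbT.
  apply/eqP; case: b ne nl => ne nl e; first by apply: ne; rewrite e.
  by move: qw; rewrite -(pvK gr w) e -/z0 nQz.
split.
- move=> x /Qcase[->//|->|]; last exact: i_valid.
  by rewrite th_valid.
- move=> x; rewrite /= !th_eq thz thy (i_th is_); by case: (x == z0); case: (x == y0).
- move=> x /= /orP[/eqP->|lx].
    rewrite -/z0 eqxx q0 orbT !upz !(upQ _ _ _ q0); split=> //; rewrite ?orbT //.
    by rewrite /RA /LA /= !(upQ _ _ _ q0).
  have [q1 q2 e1 e2 [e3 e4]] := i_lk is_ lx.
  rewrite q1 q2 !orbT !(upQ _ _ _ q1) !(upQ _ _ _ q2); split=> //.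
  by rewrite /RA /LA /= !(upQ _ _ _ q1).
- by move=> l /new3[[k [_ _ ->]]|[hl _ _ ->]]; [lra | exact: i_wd hl].
- move=> x /Qcase[->|->|qx] /=; rewrite ?upz ?upy ?upQ //; [lra | lra | exact: i_he].
- move=> l l' /new3[[k [hk -> ->]]|[hl nl -> ->]] /new3[[k' [hk' -> ->]]|[hl' nl' -> ->]] ne.
  + have kk : 1 <= `|k - k'|.
      case: hk hk' => [[-> e]|[[-> e]|[-> e]]] [[-> e']|[[-> e']|[-> e']]];
        try (by case: ne; rewrite e e'); rewrite ler_normr; apply/orP;
        by case: hsg => ->; first [left; lra | right; lra].
    have -> : p + k * (2 * h / 3) - (p + k' * (2 * h / 3)) = (k - k') * (2 * h / 3) by ring.
    have e3 : 0 < 2 * h / 3 by lra.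
    by rewrite normrM (gtr0_norm e3); nra.
  + exact: new_old (k3 _ _ hk) hl' nl'.
  + by rewrite addrC distrC; exact: new_old (k3 _ _ hk') hl nl.
  + exact: i_disj hl hl' ne.
- move=> w /Qcase[->|->|qw].
  + by exists z0.
  + by exists y0.
  + have [x [lx ex sx]] := i_fwd is_ qw; rewrite /= !(upQ _ _ _ qw).
    have qx : Q s x by case/andP: lx.
    have [e|ne] := eqVneq x x0; last first.
      exists x; rewrite !(upQ _ _ _ qx); split=> //; apply: keep => // -[e].
      by rewrite e eqxx in ne.
    by exists z0; rewrite !upz -ex -sx e.
- move=> w /Qcase[->|->|qw].
  + have [x [lx ex sx]] := i_bwd is_ q0; have qx : Q s x by case/andP: lx.
    by exists x; rewrite /= !upz !(upQ _ _ _ qx); split=> //; exact: keep.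
  + by exists y0.
  + have [x [lx ex sx]] := i_bwd is_ qw; have qx : Q s x by case/andP: lx.
    by exists x; rewrite /= !(upQ _ _ _ qx) !(upQ _ _ _ qw); split=> //; exact: keep.
- have yfar w : Q s w -> upd (S s) (S s x0) (p - sg * (2 * h / 3)) w <> p - sg * (2 * h / 3) /\
      upd (E s) p (p + sg * (2 * h / 3)) w <> p + sg * (2 * h / 3).
    move=> qw; rewrite !(upQ _ _ _ qw); split=> e.
      by have := fx w qw; rewrite e; case: hsg => ->; rewrite ?mul1r ?mulN1r ltNge;
         move=> /negP; apply; rewrite ler_norml; lra.
    have ne : E s w <> p by rewrite e; case: hsg => ->; lra.
    by have := fe w qw ne; rewrite e; case: hsg => ->; rewrite ?mul1r ?mulN1r ltNge;
         move=> /negP; apply; rewrite ler_norml; lra.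
  have zfar : S s x0 <> p - sg * (2 * h / 3).
    by have [] := yfar x0 q0; rewrite !(upQ _ _ _ q0).
  move=> w w' /Qcase[->|->|qw] /Qcase[->|->|qw'] //=; rewrite ?upz ?upy.
  + by case=> [//|e]; exfalso; case: hsg e => ->; lra.
  + rewrite !(upQ _ _ _ qw') => e; exact: (i_row is_ q0 qw' e).
  + by case=> [/esym//|e]; exfalso; case: hsg e => ->; lra.
  + by have [h1 h2] := yfar w' qw'; case=> /esym.
  + rewrite !(upQ _ _ _ qw) => e; exact: (i_row is_ qw q0 e).
  + by have [h1 h2] := yfar w qw; case.
  + rewrite !(upQ _ _ _ qw) !(upQ _ _ _ qw'); exact: i_row.
- have far0 := fx x0 q0.
  have c4 : z0.2.1 -> cyc4 (S s x0) (p + sg * (2 * h / 3)) p (p - sg * (2 * h / 3)).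
    rewrite /sg => ->; move: far0; case: (ger0P (S s x0 - p)) => u1 u2.
      by constructor 2; split; lra.
    by constructor 1; split; lra.
  have c4' : ~~ z0.2.1 -> cyc4 (p - sg * (2 * h / 3)) p (p + sg * (2 * h / 3)) (S s x0).
    rewrite /sg => /negbTE ->; move: far0; case: (ger0P (S s x0 - p)) => u1 u2.
      by constructor 1; split; lra.
    by constructor 4; split; lra.
  move=> x /Qcase[->|->|qx] /=; rewrite -?/y0 ?thy ?upz ?upy //.
  rewrite !(upQ _ _ _ qx) !upQ ?(i_th is_) //; exact: i_cyc4.
(* Both ends of the new chord are within [h] of [p], where no older end lies except [p]; so it
   crosses only the chord ending at [p]. *)
- have [n23 p23] : `|p - sg * (2 * h / 3) - p| <= h /\ `|p + sg * (2 * h / 3) - p| <= h.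
    by rewrite !ler_norml; case: hsg => ->; split; apply/andP; split; lra.
  have bsame w : Q s w -> E s w <> p -> btw (p - sg * (2 * h / 3)) (p + sg * (2 * h / 3)) (S s w) = false /\
      btw (p - sg * (2 * h / 3)) (p + sg * (2 * h / 3)) (E s w) = false.
    move=> qw ne; by split; apply: (btw_near (p := p) (h := h)) => //; first [exact: fx | exact: fe].
  have osame w : Q s w -> E s w <> p -> btw (S s w) (E s w) (p - sg * (2 * h / 3)) = btw (S s w) (E s w) (p + sg * (2 * h / 3)).
    by move=> qw ne; apply: (btw_far (p := p) (h := h)) => //; [exact: fx | exact: fe].
  have bz : btw (p - sg * (2 * h / 3)) (p + sg * (2 * h / 3)) p.
    by rewrite /btw; case: hsg => ->; apply/orP; [left|right]; apply/andP; split; lra.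
  move=> w w' /Qcase[->|->|qw] /Qcase[->|->|qw']; rewrite /xing /= ?upz ?upy.
  + by rewrite btwl btwr.
  + by move=> _; exists z0; rewrite /= eqxx upz thz upy.
  + rewrite !(upQ _ _ _ qw') => H; have [z [qz ez ez']] := i_xing is_ q0 qw' H.
    by exists z; rewrite /= qz !orbT !upQ // (i_th is_).
  + by move=> _; exists y0; rewrite /= eqxx orbT upy thy upz.
  + by rewrite btwl btwr.
  + rewrite !(upQ _ _ _ qw'); have [e|/eqP ne] := eqVneq (E s w') p.
      by move=> _; exists y0; rewrite /= eqxx orbT upy thy upz (E_S is_ qw' q0 e).
    by have [-> ->] := bsame w' qw' ne; rewrite eqxx.
  + rewrite !(upQ _ _ _ qw) => H; have [z [qz ez ez']] := i_xing is_ qw q0 H.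
    by exists z; rewrite /= qz !orbT !upQ // (i_th is_).
  + rewrite !(upQ _ _ _ qw); have [e|/eqP ne] := eqVneq (E s w) p.
      by move=> _; exists z0; rewrite /= eqxx upz thz upy (E_S is_ qw q0 e).
    by rewrite (osame w qw ne) eqxx.
  + rewrite !(upQ _ _ _ qw) !(upQ _ _ _ qw') => H; have [z [qz ez ez']] := i_xing is_ qw qw' H.
    by exists z; rewrite /= qz !orbT !upQ // (i_th is_).
- have tauQ x : Q s x -> tau (S step) (E step) x = tau (S s) (E s) x.
    move=> qx; have qt : Q s (th x) by rewrite (i_th is_).
    by rewrite /tau /frac /late /ipos /opos /= !(upQ _ _ _ qx) !(upQ _ _ _ qt).
  move=> x /= /orP[/eqP ->|lx]; last first.
    by have [q1 q2 _ _ _] := i_lk is_ lx; rewrite !tauQ //; exact: i_tau.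
  rewrite -/z0 tauQ //.
  have qt : Q s (th x0) by rewrite (i_th is_).
  have nEt : E s (th x0) <> p.
    by move=> e; have := i_row is_ qt q0 (or_intror e); have := i_valid is_ q0; rewrite /valid /= => /eqP + /esym.
  have f1 := fx (th x0) qt; have f2 := fe (th x0) qt nEt; have f0 := fx x0 q0.
  (* The outer end of the new chord is beyond [p], so its crossing is on the second segment; the
     inner end is at distance [2 * h / 3] from [p], which gives the fraction. The chord crossing at
     [x0] has its ends farther than [h] from [p], hence a smaller fraction. *)
  have tz : tau (S step) (E step) z0 = (1 + (1 - (2 * h / 3) / `|p - S s x0|)) / 2.
    rewrite /tau /frac /late /ipos /opos thz /= !upz !upy.
    case: (ger0P (S s x0 - p)) f0 => u1 u2.
      have e1 : `|p - S s x0| = S s x0 - p by rewrite distrC ger0_norm.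
      have np : p - S s x0 != 0 by apply/eqP; lra.
      case: hsg => sE; rewrite sE.
        have -> : btw (S s x0) p (p - 1 * (2 * h / 3)) = false by apply/negP => /orP[]/andP[]; lra.
        rewrite (_ : 0 < _) /=; last by nra.
        by rewrite e1; field; rewrite -opprB oppr_eq0 np.
      have -> : btw (S s x0) p (p - -1 * (2 * h / 3)) by apply/orP; right; apply/andP; split; lra.
      rewrite (_ : 0 < _) /=; last by nra.
      by rewrite e1; field; rewrite -opprB oppr_eq0 np.
    have e1 : `|p - S s x0| = p - S s x0 by rewrite gtr0_norm; lra.
    have np : p - S s x0 != 0 by apply/eqP; lra.
    case: hsg => sE; rewrite sE.
      have -> : btw (S s x0) p (p - 1 * (2 * h / 3)) by apply/orP; left; apply/andP; split; lra.
      rewrite (_ : 0 < _) /=; last by nra.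
      by rewrite e1; field.
    have -> : btw (S s x0) p (p - -1 * (2 * h / 3)) = false by apply/negP => /orP[]/andP[]; lra.
    rewrite (_ : 0 < _) /=; last by nra.
    by rewrite e1; field.
  rewrite tz /tau; set D := `|p - S s x0|.
  have D0 : 0 < D by rewrite /D distrC; lra.
  have hD : (2 * h / 3) / D < 1 by rewrite ltr_pdivrMr // mul1r /D distrC; lra.
  (* The cyclic order at [x0] places exactly one end of the crossing chord between [S s x0] and
     [p]. *)
  have btwip : btw (S s x0) p (ipos (S s) (E s) x0).
    have c4 : cyc4 (S s x0) (E s (th x0)) p (S s (th x0)) \/ cyc4 (S s (th x0)) p (E s (th x0)) (S s x0).
      case: (boolP x0.2.1) => bx; first by left; exact: i_cyc4.
      by right; have := i_cyc4 is_ qt bx; rewrite thK.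
    rewrite /ipos -/p; case: ifP => // nb; case: c4 => [/cyc4_btw|/cyc4_btw' ->]; last by rewrite nb.
    by rewrite nb => /esym/negbFE.
  have ipfar : 2 * h / 3 < `|ipos (S s) (E s) x0 - p| by rewrite /ipos; case: ifP => _; lra.
  have fr : frac (S s) (E s) x0 < 1 - (2 * h / 3) / D.
    rewrite /frac -/p /D; set i := ipos _ _ _ in btwip ipfar *.
    case/orP: btwip => /andP[b1 b2].
      have D1 : 0 < p - S s x0 by lra.
      rewrite (gtr0_norm D1) ltr_pdivrMr // mulrBl mul1r mulfVK ?gt_eqF //.
      by move: ipfar; rewrite ltr0_norm; lra.
    have D1 : 0 < S s x0 - p by lra.
    rewrite distrC (gtr0_norm D1) -[X in X / _]opprB -[X in _ / X]opprB invrN mulrNN.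
    rewrite ltr_pdivrMr // mulrBl mul1r mulfVK ?gt_eqF //.
    by move: ipfar; rewrite gtr0_norm; lra.
  by case: (late _ _ _) => /=; lra.
- move=> x /Qcase[->|->|qx] nl.
  + by move: nl; rewrite pvz /= eqxx.
  + by rewrite /= !upy.
  + rewrite /= !(upQ _ _ _ qx); apply: (i_start is_) => //.
    by move: nl; rewrite /= negb_or => /andP[].
- move=> x /Qcase[->|->|qx] bx.
  + rewrite thz /LA /RA /= !upz !upy /sg bx.
    by split; left; lra.
  + rewrite thy /LA /RA /= !upz !upy /sg.
    have -> : z0.2.1 = false by move: bx => /= /negbTE.
    by split; left; lra.
  + have qt : Q s (th x) by rewrite (i_th is_).
    rewrite /LA /RA /= !(upQ _ _ _ qx) !(upQ _ _ _ qt); exact: i_corner.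
- have [r1 r2] := i_range is_ lx0; rewrite /pos /wd /= -/p -/h in r1 r2.
  move=> l /new3[[k [hk -> ->]]|[hl _ -> ->]]; last exact: i_range.
  by case: (k3 _ _ hk) => [->|[->|->]]; rewrite ?mul0r ?mul1r ?mulN1r; split; lra.
Qed.

End Step.
End Layout.

(** * Complete layouts and the arcs closing them *)

Section Final.
Variables (R : realType) (n : nat) (r : 'I_n -> seq (bool * 'I_n)).
Hypothesis gr : good r.
Notation P := (passage n).
Implicit Types (x y z w : P) (a b c d p q h : R) (s : state R n).

Section Base.
Variable x1 : P.
Hypotheses (v1 : valid x1) (b1 : x1.2.1).
Let y1 := th x1.

(** Two crossing chords, from [1 / 2] to [5 / 2] and from [7 / 2] to [3 / 2]. The intervals of
    half-width [1 / 2] around the four ends tile [[0, 4]], and the outermost sides agree through the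
    identification of 0 and 4. *)
Definition base : state R n := State (fun w => (w == x1) || (w == y1)) (fun _ => false)
  (fun w => if w == x1 then 1 / 2 else 7 / 2) (fun w => if w == x1 then 5 / 2 else 3 / 2)
  (fun _ => 1 / 2) (fun _ => 1 / 2) (fun w => if w == x1 then 1 else 4) (fun w => if w == x1 then 0 else 3).

Lemma base_inv : inv r base.
Proof.
have n1 : (1 / 2 : R) <> 7 / 2 by lra.
have n2 : (5 / 2 : R) <> 3 / 2 by lra.
have yx : (y1 == x1) = false.
  by apply/eqP => /(congr1 (fun w : P => w.2.1)) /=; rewrite b1.
have thy : th y1 = x1 by rewrite /y1 thK.
have Qc w : Q base w -> w = x1 \/ w = y1 by move=> /orP[/eqP|/eqP]; auto.
have q1 : Q base x1 by rewrite /= eqxx.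
have q2 : Q base y1 by rewrite /= eqxx orbT.
split.
- by move=> x /Qc[]->; rewrite ?th_valid.
- by move=> x; rewrite /= !th_eq thy orbC.
- by [].
- by move=> [x []] _; rewrite /wd /=; lra.
- by move=> x _ /=; lra.
- move=> [w bw] [w' bw'] /andP[/= /Qc hw _] /andP[/= /Qc hw' _] ne.
  rewrite /wd /pos /=.
  have -> : (if bw then 1 / 2 else 1 / 2) + (if bw' then 1 / 2 else 1 / 2) = 1 :> R by case: (bw); case: (bw'); lra.
  by rewrite ler_normr; apply/orP; case: hw hw' ne => -> [] ->; case: bw bw' => -[] ne;
    rewrite ?eqxx ?yx; try (by case: ne); first [left; lra | right; lra].
- by move=> w qw; exists w; rewrite /lett /= (qw : _ || _).
- by move=> w qw; exists w; rewrite /lett /= (qw : _ || _).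
- move=> w w' /Qc[]-> /Qc[]->; rewrite //= ?eqxx ?yx => -[] e0; exfalso;
    first [exact: n1 e0 | exact: n2 e0 | exact: n1 (esym e0) | exact: n2 (esym e0)].
- move=> x /Qc[]-> bx; last by move: bx; rewrite /y1 /= b1.
  by rewrite /= eqxx -/y1 yx; constructor 1; split; lra.
- move=> w w' /Qc[]-> /Qc[]-> H.
  + by move: H; rewrite /xing btwl btwr.
  + by exists x1.
  + by exists y1; rewrite thy.
  + by move: H; rewrite /xing btwl btwr.
- by [].
- by move=> x /Qc[]-> _ /=; rewrite ?eqxx ?yx; split; lra.
- move=> x /Qc[]-> bx; last by move: bx; rewrite /y1 /= b1.
  rewrite /LA /RA /= eqxx -/y1 yx; split; try by left; lra.
  by right; left; split; lra.
- by move=> [w []] /andP[/= /Qc[]-> _]; rewrite /pos /wd /= ?eqxx ?yx; split; lra.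
Qed.

End Base.

Lemma row_closed (A : pred P) i e e' : (forall x, A x -> A (nx r x)) ->
  e \in r i -> e' \in r i -> A (i, e) -> A (i, e').
Proof.
move=> hA he he' hi; have [u _] := gr i.
have : fconnect (next (r i)) e e' by rewrite (fconnect_cycle (cycle_next u) he).
move=> /iter_findex <-; elim: (findex _ _ _) => [//|k IH] /=.
exact: (hA (i, _)).
Qed.

(** Each step draws new passages. When none is possible the drawn ones are closed under [nx r] and
    [th], and they are all the passages because any two curves cross. *)
Lemma state_exists x1 : valid x1 -> exists s, inv r s /\ forall x, valid x -> Q s x.
Proof.
move=> v1.
have [x [vx bx]] : exists x, valid x /\ x.2.1.
  case: (boolP x1.2.1) => b1; first by exists x1.
  by exists (th x1); rewrite th_valid.
have : exists s, inv r s /\ Q s x by exists (base x); split; [exact: base_inv | rewrite /= eqxx].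
move=> {v1 bx x1} [s [is_ qx]].
have [m hm] := ubnP #|[pred w | valid w && ~~ Q s w]|.
elim: m s is_ qx hm => // m IH s is_ qx hm.
have [all_|/existsNP[w /not_implyP[vw nw]]] := pselect (forall w, valid w -> Q s w); first by exists s.
have [[x0 [q0 n0]]|nex] := pselect (exists x0, Q s x0 /\ ~~ Q s (nx r x0)); last first.
  exfalso; apply: nw.
  have cl y : Q s y -> Q s (nx r y).
    by move=> qy; apply/negPn/negP => nq; apply: nex; exists y.
  have rowQ i e e' : e \in r i -> e' \in r i -> Q s (i, e) -> Q s (i, e') by exact: row_closed.
  case: x qx vx {IH} => i e qx vx; case: w vw => k f vw.
  have ei : e \in r i by have := rowP gr (i, e); rewrite vx.
  have fk : f \in r k by have := rowP gr (k, f); rewrite vw.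
  have [ek|nk] := eqVneq i k; first by subst k; apply: rowQ qx.
  have gi : (true, k) \in r i by rewrite (rowP gr (i, (true, k))).
  have gk : (false, i) \in r k by rewrite (rowP gr (k, (false, i))) /valid /= eq_sym.
  apply: (rowQ k (false, i)) => //.
  by rewrite -(i_th is_); apply: rowQ qx.
apply: (IH (step r s x0)); first exact: step_inv.
  by rewrite /= qx !orbT.
rewrite ltnS in hm; apply: leq_trans hm; apply: proper_card; apply/properP; split.
  apply/fintype.subsetP => y; rewrite !inE => /andP[-> /=].
  by rewrite !negb_or => /and3P[].
exists (nx r x0); first by rewrite inE nx_valid // (i_valid is_ q0).
by rewrite inE /= eqxx andbF.
Qed.

Section Planar.
Hypothesis pl : planar r.
Variable s : state R n.
Hypotheses (is_ : inv r s) (allQ : forall x, valid x -> Q s x).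

Definition cut x : bool := valid x && ~~ lk s x.

Lemma cut_letters x : cut x -> lett r s (x, true) /\ lett r s (nx r x, false).
Proof.
move=> /andP[v nl]; rewrite /lett /= allQ // nl nxK // nl allQ //.
by rewrite nx_valid.
Qed.

Lemma letter_const l a b t t' : lett r s l ->
  (exists l1, [/\ lett r s l1, l1 <> l & pos s l1 = a]) ->
  (exists l2, [/\ lett r s l2, l2 <> l & pos s l2 = b]) ->
  `|t - pos s l| <= wd s l -> `|t' - pos s l| <= wd s l -> btw a b t = btw a b t'.
Proof.
move=> hl [l1 [h1 n1 <-]] [l2 [h2 n2 <-]].
have := i_disj is_ h1 hl n1; have := i_disj is_ h2 hl n2.
have := i_wd is_ h1; have := i_wd is_ h2; have := i_wd is_ hl.
rewrite !ler_norml !ler_normr => w0 w1 w2 /orP[]d2 /orP[]d1 /andP[t1 t2] /andP[t3 t4];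
by rewrite /btw; apply/idP/idP => /orP[]/andP[u1 u2]; apply/orP;
  first [by left; apply/andP; split; lra | by right; apply/andP; split; lra | exfalso; lra].
Qed.

Definition phi x t : int := (btw (E s x) (S s (nx r x)) t)%:Z.
(* The boundary of the region cut out by the lower arc closing the edge [x]: as a cycle, it
   has intersection number [0] with that of [y], so the two arcs need not cross. *)
Definition bnd x y : int := if valid y then phi x (LA s y) - phi x (RA s y) else 0.

(** All ends lie strictly inside [[0, 4]], so both extremities are outside of the arc. *)
Lemma phi_eqv x a b : cut x -> eqv a b -> phi x a = phi x b.
Proof.
move=> /cut_letters[l1 l2] [->//|h].
have [a1 a2] := i_range is_ l1; have [c1 c2] := i_range is_ l2.
have := i_wd is_ l1; have := i_wd is_ l2.
rewrite /pos /wd /= in a1 a2 c1 c2 * => w1 w2.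
have f0 : btw (E s x) (S s (nx r x)) 0 = false by apply/negP => /orP[]/andP[]; lra.
have f4 : btw (E s x) (S s (nx r x)) 4 = false by apply/negP => /orP[]/andP[]; lra.
by rewrite /phi; case: h => -[-> ->]; rewrite f0 f4.
Qed.

Lemma cut_other x y : cut x -> cut y -> y <> x ->
  [/\ phi x (LA s y) = phi x (E s y), phi x (RA s y) = phi x (E s y),
      phi x (lb s (nx r y)) = phi x (S s (nx r y)) & phi x (rb s (nx r y)) = phi x (S s (nx r y))].
Proof.
move=> cx cy ne; have [l1 l2] := cut_letters cx; have [m1 m2] := cut_letters cy.
have nn : nx r y <> nx r x by move=> /(congr1 (pv r)); rewrite !nxK.
have [vy nly] := andP cy.
have [er el] : rb s (nx r y) = S s (nx r y) + hs s (nx r y) /\ lb s (nx r y) = S s (nx r y) - hs s (nx r y).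
  by apply: (i_start is_); rewrite ?nxK // allQ // nx_valid.
have w1 := i_wd is_ m1; have w2 := i_wd is_ m2; rewrite /wd /= in w1 w2.
have H1 t : `|t - E s y| <= he s y -> phi x t = phi x (E s y).
  move=> ht; rewrite /phi (@letter_const (y, true) _ _ t (E s y)) //.
  - by exists (x, true); split=> // -[/esym].
  - by exists (nx r x, false); split.
  - by rewrite /pos /wd /= subrr normr0 ltW.
have H2 t : `|t - S s (nx r y)| <= hs s (nx r y) -> phi x t = phi x (S s (nx r y)).
  move=> ht; rewrite /phi (@letter_const (nx r y, false) _ _ t (S s (nx r y))) //.
  - by exists (x, true); split.
  - by exists (nx r x, false); split=> // /(congr1 fst)/= /esym.
  - by rewrite /pos /wd /= subrr normr0 ltW.
rewrite er el /LA /RA; split; [apply: H1|apply: H1|apply: H2|apply: H2];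
  by rewrite ler_norml; apply/andP; split; lra.
Qed.

Lemma cut_self x : cut x -> phi x (LA s x) - phi x (RA s x) <> 0 /\
  phi x (LA s x) - phi x (RA s x) = phi x (lb s (nx r x)) - phi x (rb s (nx r x)).
Proof.
move=> cx; have [l1 l2] := cut_letters cx; have [vx nlx] := andP cx.
have [er el] : rb s (nx r x) = S s (nx r x) + hs s (nx r x) /\ lb s (nx r x) = S s (nx r x) - hs s (nx r x).
  by apply: (i_start is_); rewrite ?nxK // allQ // nx_valid.
have w1 := i_wd is_ l1; have w2 := i_wd is_ l2.
have ne : (x, true) <> (nx r x, false) by [].
have := i_disj is_ l1 l2 ne; rewrite /wd /pos /= in w1 w2 * => d.
rewrite /phi er el /LA /RA.
set e := E s x in d *; set f := S s (nx r x) in d *; set a := he s x in w1 d *; set b := hs s (nx r x) in w2 d *.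
move: d; rewrite ler_normr => /orP[] d.
  have -> : btw e f (e + a) = false by apply/negP => /orP[]/andP[]; lra.
  have -> : btw e f (e - a) by apply/orP; right; apply/andP; split; lra.
  have -> : btw e f (f + b) by apply/orP; right; apply/andP; split; lra.
  by have -> : btw e f (f - b) = false by apply/negP => /orP[]/andP[]; lra.
have -> : btw e f (e - a) = false by apply/negP => /orP[]/andP[]; lra.
have -> : btw e f (e + a) by apply/orP; left; apply/andP; split; lra.
have -> : btw e f (f - b) by apply/orP; left; apply/andP; split; lra.
by have -> : btw e f (f + b) = false by apply/negP => /orP[]/andP[]; lra.
Qed.

(** The jump of [phi x] across an edge is the same at its beginning and at its end: trivially for a
    linked edge, by [cut_self] for [x], and because both vanish for the other cut edges. *)
Lemma bnd_pv x y : cut x -> valid y -> bnd x (pv r y) = phi x (lb s y) - phi x (rb s y).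
Proof.
move=> cx vy; rewrite /bnd pv_valid // vy.
have [l|nl] := boolP (lk s (pv r y)).
  by have [_ _ _ _ []] := i_lk is_ l; rewrite pvK // => -> ->.
have cy : cut (pv r y) by rewrite /cut pv_valid // vy.
have [e|/eqP ne] := eqVneq (pv r y) x.
  by rewrite e; have [_ ->] := cut_self cx; rewrite -e pvK.
by have := cut_other cx cy ne; rewrite pvK // => -[-> -> -> ->]; rewrite !subrr.
Qed.

Lemma corner_phi x y : cut x -> valid y -> y.2.1 ->
  [/\ phi x (LA s y) = phi x (lb s (th y)), phi x (RA s y) = phi x (LA s (th y)),
      phi x (rb s y) = phi x (RA s (th y)) & phi x (lb s y) = phi x (rb s (th y))].
Proof.
by move=> cx vy b; have [h1 h2 h3 h4] := i_corner is_ (allQ vy) b; split; exact: phi_eqv.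
Qed.

Lemma bnd_cyc x : cut x -> cyc r (bnd x).
Proof.
move=> cx.
have H y : valid y -> y.2.1 -> bnd x y - bnd x (pv r y) + (bnd x (th y) - bnd x (pv r (th y))) = 0.
  move=> vy b; rewrite !bnd_pv ?th_valid // /bnd th_valid vy.
  by have [-> -> -> ->] := corner_phi cx vy b; ring.
move=> y vy; case: (boolP y.2.1) => b; first exact: H.
by rewrite addrC; have := H (th y); rewrite thK th_valid; apply.
Qed.

(** Planarity is used here. The intersection number of the two boundary cycles reduces to a nonzero
    multiple of the difference of [phi x] at the two ends of the arc of [y]. *)
Lemma cut_noncrossing x y : cut x -> cut y ->
  btw (E s x) (S s (nx r x)) (E s y) = btw (E s x) (S s (nx r x)) (S s (nx r y)).
Proof.
move=> cx cy; have [->|/eqP ne] := eqVneq y x; first by rewrite btwl btwr.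
have := pl (bnd_cyc cx) (bnd_cyc cy); rewrite /isect => H.
(* The corner identities turn the form into this sum along the rows, with [phi x] in the role of a
   primitive. *)
have : \sum_(z | valid z) (bnd y z * phi x (RA s z) - bnd y (pv r z) * phi x (rb s z)) = 0.
  rewrite sum_half -[RHS]H; apply: eq_bigr => z /andP[vz bz].
  have [c1 c2 c3 c4] := corner_phi cx vz bz.
  have ez := bnd_cyc cy vz; have e1 := bnd_pv cx vz.
  have e2 : bnd x (th z) = phi x (LA s (th z)) - phi x (RA s (th z)) by rewrite /bnd th_valid vz.
  rewrite e1 e2 c2 c3 -c4; rewrite -/(phi x _) in c3 *.
  have -> : bnd y z = bnd y (pv r z) - (bnd y (th z) - bnd y (pv r (th z))) by lia.
  ring.
rewrite sumrB.
have -> : \sum_(z | valid z) bnd y (pv r z) * phi x (rb s z) = \sum_(z | valid z) bnd y z * phi x (rb s (nx r z)).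
  rewrite -(sum_pv gr (fun z => bnd y z * phi x (rb s (nx r z)))); apply: eq_bigr => z _.
  by rewrite pvK.
(* A linked edge has the same right side at both ends, and a cut edge other than [y] has coefficient
   0 in the cycle of [y]. *)
rewrite -sumrB (bigD1 y) /=; last by case/andP: cy.
rewrite big1 => [|z /andP[vz nz]]; last first.
  have [l|nl] := boolP (lk s z); first by have [_ _ _ _ [-> _]] := i_lk is_ l; rewrite subrr.
  have cz : cut z by rewrite /cut vz.
  have [e1 e2 _ _] := cut_other cy cz (elimN eqP nz).
  by rewrite /bnd vz e1 e2 subrr !mul0r subrr.
rewrite addr0 -mulrBr => /eqP; rewrite mulf_eq0 => /orP[/eqP h|].
  by have [] := cut_self cy; rewrite /bnd in h; move: h; case/andP: cy => -> _ ->.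
have [_ -> _ ->] := cut_other cx cy ne.
rewrite subr_eq0 /phi => /eqP/eqP; rewrite eqz_nat; by case: btw; case: btw.
Qed.

(** On a row without cut edges the times [tau] would increase all the way around the cycle. *)
Lemma row_cut i : r i != [::] -> exists x, cut x /\ x.1 = i.
Proof.
move=> ne; apply: contrapT => nc.
have lkall x : valid x -> x.1 = i -> lk s x.
  by move=> vx xi; apply/negPn/negP => nl; apply: nc; exists x; rewrite /cut vx nl.
case E1 : (r i) ne => [|e q] // _.
have ei : e \in r i by rewrite E1 inE eqxx.
pose A (x : P) := (x.1 == i) && valid x && (tau (S s) (E s) (i, e) < tau (S s) (E s) (nx r x)).
have ve : valid (i, e) by rewrite -(rowP gr).
have Ae : A (i, e) by rewrite /A /= eqxx ve /=; apply: (i_tau is_); exact: lkall.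
have clA x : A x -> A (nx r x).
  move=> /andP[/andP[/eqP xi vx] lt]; rewrite /A /= xi eqxx nx_valid // vx /=.
  by apply: lt_trans lt _; apply: (i_tau is_); apply: lkall; rewrite ?nx_valid.
have : A (i, prev (r i) e) by apply: (row_closed clA) Ae; rewrite ?mem_prev.
have -> : (i, prev (r i) e) = pv r (i, e) by [].
by rewrite /A pvK // ltxx andbF.
Qed.

End Planar.
End Final.

(** * Drawing the layout *)

Section Arc.
Variable R : realType.
Implicit Types (a b th f : R) (q : R * R).

Lemma clamp_0 (u : R) : u <= 0 -> clamp 0 1 u = 0.
Proof. by move=> h; rewrite /clamp min_l; [rewrite max_l | lra]. Qed.

Lemma clamp_1 (u : R) : 1 <= u -> clamp 0 1 u = 1.
Proof. by move=> h; rewrite /clamp min_r // max_r // ler01. Qed.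

(* The arc joins the diagonal points [(a, a)] and [(b, b)] along a horizontal and a
   vertical segment above the diagonal, the corner being reached at time [1 / 2]. *)
Definition up a b th : R * R :=
  let p := a + (b - a) * clamp 0 1 (2 * th) in
  let q := a + (b - a) * clamp 0 1 (2 * th - 1) in (Num.min p q, Num.max p q).

Lemma up_cont a b : continuous (up a b).
Proof.
have cl := @clamp_cont R 0 1; rewrite /up.
have c1 : continuous (fun th => clamp 0 1 (2 * th) : R).
  by apply: ctI => x; apply: (@cta_comp _ _ _ (fun th : R => 2 * th) (clamp 0 1)); [ct | exact: cl].
have c2 : continuous (fun th => clamp 0 1 (2 * th - 1) : R).
  by apply: ctI => x; apply: (@cta_comp _ _ _ (fun th : R => 2 * th - 1) (clamp 0 1)); [ct | exact: cl].
apply: ctI => x; apply: cta_pair.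
  by apply: cta_min; [have := c1 x | have := c2 x] => ?; ct.
by apply: cta_max; [have := c1 x | have := c2 x] => ?; ct.
Qed.

Lemma up_first a b th : 0 <= th -> th <= 1 / 2 ->
  up a b th = if a < b then (a, a + (b - a) * (2 * th)) else (a + (b - a) * (2 * th), a).
Proof.
move=> h1 h2; rewrite /up clamp_id; last by apply/andP; split; lra.
rewrite clamp_0; last by lra.
rewrite mulr0 addr0; case: (ltP a b) => ab.
  have le : a <= a + (b - a) * (2 * th) by nra.
  by rewrite min_r // max_l.
have le : a + (b - a) * (2 * th) <= a by nra.
by rewrite min_l // max_r.
Qed.

Lemma up_second a b th : 1 / 2 <= th -> th <= 1 ->
  up a b th = if a < b then (a + (b - a) * (2 * th - 1), b) else (b, a + (b - a) * (2 * th - 1)).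
Proof.
move=> h1 h2; rewrite /up clamp_1; last by lra.
rewrite clamp_id; last by apply/andP; split; lra.
have -> : a + (b - a) * 1 = b by ring.
case: (ltP a b) => ab.
  have le : a + (b - a) * (2 * th - 1) <= b by nra.
  by rewrite min_r // max_l.
have le : b <= a + (b - a) * (2 * th - 1) by nra.
by rewrite min_l // max_r.
Qed.

Lemma up_0 a b : up a b 0 = (a, a).
Proof. by rewrite up_first ?lexx // !mulr0 addr0 if_same. Qed.

Lemma up_1 a b : up a b 1 = (b, b).
Proof.
rewrite up_second ?lexx //; last by lra.
have -> : a + (b - a) * (2 * 1 - 1) = b by ring.
by rewrite if_same.
Qed.

Lemma up_lt a b th : a != b -> 0 < th -> th < 1 -> (up a b th).1 < (up a b th).2.
Proof.
move=> ab h1 h2; case: (leP th (1 / 2)) => h.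
  rewrite (up_first _ _ (ltW h1) h); case: (ltP a b) => l /=; first by nra.
  have l' : b < a by rewrite lt_neqAle l eq_sym ab.
  by nra.
rewrite (up_second _ _ (ltW h) (ltW h2)); case: (ltP a b) => l /=; first by nra.
have l' : b < a by rewrite lt_neqAle l eq_sym ab.
by nra.
Qed.

Lemma up_le0 a b th : th <= 0 -> up a b th = (a, a).
Proof.
by move=> h; rewrite /up !clamp_0; [rewrite mulr0 addr0 minxx maxxx | lra | lra].
Qed.

Lemma up_ge1 a b th : 1 <= th -> up a b th = (b, b).
Proof.
move=> h; rewrite /up !clamp_1; [|lra|lra].
have -> : a + (b - a) * 1 = b by ring.
by rewrite minxx maxxx.
Qed.

Lemma up_inj a b th th' : a != b -> 0 <= th -> th <= 1 -> 0 <= th' -> th' <= 1 ->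
  up a b th = up a b th' -> th = th'.
Proof.
have E (x : R) : 0 <= x -> x <= 1 -> (up a b x).1 + (up a b x).2 = 2 * a + (b - a) * (2 * x).
  move=> x0 x1; case: (leP x (1 / 2)) => h.
    by rewrite (up_first _ _ x0 h); case: ifP => _ /=; ring.
  by rewrite (up_second _ _ (ltW h) x1); case: ifP => _ /=; ring.
move=> ab h1 h2 h3 h4 e; have := E _ h1 h2; rewrite e E // => e'.
have nz : b - a != 0 by rewrite subr_eq0 eq_sym.
have : (b - a) * (2 * th' - 2 * th) = 0 by lra.
by move=> /eqP; rewrite mulf_eq0 (negbTE nz) /= => /eqP; lra.
Qed.

(** Above the diagonal, this is the hook from [(m, m)] up to [(m, M)] and right to [(M, M)]. *)
Definition onL m M q : Prop := [/\ m < M, q.1 = m \/ q.2 = M, m <= q.1 & q.2 <= M].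

Lemma up_onL a b th : a != b -> 0 <= th -> th <= 1 -> onL (Num.min a b) (Num.max a b) (up a b th).
Proof.
move=> ab h1 h2; case: (ltP a b) => l.
  case: (leP th (1 / 2)) => h.
    by rewrite (up_first _ _ h1 h) l; split=> //=; [left | nra].
  by rewrite (up_second _ _ (ltW h) h2) l; split=> //=; [right | nra].
have l' : b < a by rewrite lt_neqAle l eq_sym ab.
have nl : (a < b) = false by apply/negbTE; rewrite -leNgt.
case: (leP th (1 / 2)) => h.
  by rewrite (up_first _ _ h1 h) nl; split=> //=; [right | nra].
by rewrite (up_second _ _ (ltW h) h2) nl; split=> //=; [left | nra].
Qed.

(** The vertical side of one hook has to meet the horizontal side of the other; this fixes the point
    and interleaves the ends. *)
Lemma L_meet (m M m' M' : R) q : onL m M q -> onL m' M' q -> q.1 < q.2 -> m <> m' -> M <> M' ->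
  [/\ m' < m, m < M', M' < M & q = (m, M')] \/ [/\ m < m', m' < M, M < M' & q = (m', M)].
Proof.
case: q => x y [/= l1 e1 a1 a2] [l2 e2 a3 a4] xy nm nM.
have lt_ (u v : R) : u <= v -> u <> v -> u < v by move=> h ne; rewrite lt_neqAle h andbT; apply/eqP.
rewrite /= in e2 a3 a4; case: e1 e2 => e1 [] e2.
- by case: nm; rewrite -e1 -e2.
- left; rewrite e1 e2; split=> //; [apply: lt_ => [|e]; [lra | exact: nm] | lra | apply: lt_ => [|e]; [lra | exact: nM]].
- right; rewrite e1 e2; split=> //; [apply: lt_ => [|e]; [lra | exact: nm] | lra | apply: lt_ => [|e]; [lra | exact: nM]].
- by case: nM; rewrite -e1 -e2.
Qed.

Lemma btwC a b (c : R) : btw a b c = btw b a c.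
Proof. by rewrite /btw orbC. Qed.

Lemma ilv_btw (m M m' M' : R) : m < m' -> m' < M -> M < M' ->
  [/\ btw m M m' = true, btw m M M' = false, btw m' M' m = false & btw m' M' M = true].
Proof.
move=> h1 h2 h3; split.
- by rewrite /btw h1 h2.
- by apply/negP => /orP[]/andP[]; lra.
- by apply/negP => /orP[]/andP[]; lra.
- by rewrite /btw h2 h3.
Qed.

Lemma arcs_cross a b a' b' q : [/\ a <> a', a <> b', b <> a' & b <> b'] ->
  onL (Num.min a b) (Num.max a b) q -> onL (Num.min a' b') (Num.max a' b') q -> q.1 < q.2 ->
  btw a b a' != btw a b b'.
Proof.
move=> [n1 n2 n3 n4] o1 o2 lt.
have nm : Num.min a b <> Num.min a' b' by case: (leP a b); case: (leP a' b').
have nM : Num.max a b <> Num.max a' b' by case: (leP a b); case: (leP a' b').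
have H : btw (Num.min a b) (Num.max a b) (Num.min a' b') != btw (Num.min a b) (Num.max a b) (Num.max a' b').
  case: (L_meet o1 o2 lt nm nM) => -[h1 h2 h3 _].
    by have [_ _ -> ->] := ilv_btw h1 h2 h3.
  by have [-> -> _ _] := ilv_btw h1 h2 h3.
move: H; case: (leP a b) => _; case: (leP a' b') => _; rewrite ?(btwC b a) //; by rewrite eq_sym.
Qed.

Lemma arcs_meet a b a' b' q q' : [/\ a <> a', a <> b', b <> a' & b <> b'] ->
  onL (Num.min a b) (Num.max a b) q -> onL (Num.min a' b') (Num.max a' b') q -> q.1 < q.2 ->
  onL (Num.min a b) (Num.max a b) q' -> onL (Num.min a' b') (Num.max a' b') q' -> q'.1 < q'.2 -> q = q'.
Proof.
move=> [n1 n2 n3 n4] o1 o2 lt o1' o2' lt'.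
have nm : Num.min a b <> Num.min a' b' by case: (leP a b); case: (leP a' b').
have nM : Num.max a b <> Num.max a' b' by case: (leP a b); case: (leP a' b').
case: (L_meet o1 o2 lt nm nM) => -[h1 h2 h3 ->]; case: (L_meet o1' o2' lt' nm nM) => -[h1' h2' h3' ->] //; exfalso; lra.
Qed.

Lemma up_local a b f (lt_ : bool) : a != b -> 0 < f -> f < 1 -> exists2 e : R, 0 < e & forall de, `|de| < e ->
  up a b ((f + lt_%:R) / 2 + de) =
    if (a < b) == lt_ then (a + (b - a) * f + 2 * (b - a) * de, if lt_ then b else a)
    else (if lt_ then b else a, a + (b - a) * f + 2 * (b - a) * de).
Proof.
move=> ab f0 f1; have g0 : 0 < f / 2 by lra.
have g1 : 0 < (1 - f) / 2 by lra.
have [m0 m1 m2] := min_pos2 g0 g1; exists (Num.min (f / 2) ((1 - f) / 2)) => // de.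
rewrite ltr_norml => /andP[d1 d2].
have e1 : a + (b - a) * (2 * (f / 2 + de)) = a + (b - a) * f + 2 * (b - a) * de by field.
have e2 : a + (b - a) * (2 * ((f + 1) / 2 + de) - 1) = a + (b - a) * f + 2 * (b - a) * de by field.
case: lt_ => /=.
  rewrite up_second; [|lra|lra]; rewrite e2; by case: (a < b).
rewrite addr0 up_first; [|lra|lra]; rewrite e1; by case: (a < b).
Qed.

End Arc.

Section Geom.
Variables (R : realType) (n : nat) (S E : passage n -> R).
Implicit Types x : passage n.

(** The coordinate which is constant on the segment carrying the crossing; [hor] tells whether this
    segment is horizontal. *)
Definition fixd x : R := if late S E x then E x else S x.
Definition hor x : bool := (S x < E x) == late S E x.

Definition pass_geom_at x : Prop :=
  [/\ ipos S E x = fixd (th x), ipos S E (th x) = fixd x, hor (th x) = ~~ hor x,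
      (0 < frac S E x /\ frac S E x < 1) /\ (0 < frac S E (th x) /\ frac S E (th x) < 1) &
      S x != E x /\ S (th x) != E (th x)].

(** In terms of directions on the two segments: the chord of [th x] comes from the left of the chord
    of [x]. *)
Definition pass_sign x : Prop :=
  if hor x then (E x - S x) * (E (th x) - S (th x)) < 0 else 0 < (E x - S x) * (E (th x) - S (th x)).

Lemma pass_geom_sym x : pass_geom_at x -> pass_geom_at (th x).
Proof. by move=> [i1 i2 hh [f1 f2] [n1 n2]]; split; rewrite ?thK // hh negbK. Qed.

Lemma frac01 (i a b : R) : btw a b i -> 0 < (i - a) / (b - a) /\ (i - a) / (b - a) < 1.
Proof.
move=> /orP[]/andP[h1 h2].
  have p : 0 < b - a by lra.
  by split; [apply: divr_gt0; lra | rewrite ltr_pdivrMr // mul1r; lra].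
have p : 0 < a - b by lra.
have -> : (i - a) / (b - a) = (a - i) / (a - b) by rewrite -(opprB a i) -(opprB a b) invrN mulrNN.
by split; [apply: divr_gt0; lra | rewrite ltr_pdivrMr // mul1r; lra].
Qed.

Lemma pass_geom x : cyc4 (S x) (E (th x)) (E x) (S (th x)) -> pass_geom_at x /\ pass_sign x.
Proof.
rewrite /pass_sign /pass_geom_at /fixd /hor /late /frac /ipos /opos thK.
move: (S x) (E x) (S (th x)) (E (th x)) => a b a' b' h.
have B1 := cyc4_btw h.
have h' : cyc4 b' b a' a by case: h => -[h1 h2 h3]; [constructor 4|constructor 1|constructor 2|constructor 3].
have B2 := cyc4_btw h'; rewrite !(btwC b' a') in B2.
case: h => -[h1 h2 h3] {h'}.
- have f1 : btw a b a' = false by apply/negP => /orP[]/andP[]; lra.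
  have f2 : btw a' b' a = false by apply/negP => /orP[]/andP[]; lra.
  have t1 : btw a b b' by rewrite f1 in B1; rewrite -[btw a b b']negbK -B1.
  have t2 : btw a' b' b by rewrite f2 in B2; rewrite -[btw a' b' b]negbK -B2.
  have L1 : 0 < (a' - b) * (b - a) by nra.
  have L2 : 0 < (a - b') * (b' - a') by nra.
  have c1 : (a < b) = true by lra.
  have c2 : (a' < b') = false by apply/negP; lra.
  rewrite f1 f2 L1 L2 c1 c2 /=; split; last by nra.
  by split=> //; [split; exact: frac01 | split; apply/eqP; lra].
- have f1 : btw a b a' by apply/orP; right; apply/andP; split; lra.
  have f2 : btw a' b' a = false by apply/negP => /orP[]/andP[]; lra.
  have t2 : btw a' b' b by rewrite f2 in B2; rewrite -[btw a' b' b]negbK -B2.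
  have L1 : (0 < (b' - b) * (b - a)) by nra.
  have L2 : (0 < (a - b') * (b' - a')) = false by apply/negP; nra.
  have c1 : (a < b) = false by apply/negP; lra.
  have c2 : (a' < b') = false by apply/negP; lra.
  rewrite f1 f2 L1 L2 c1 c2 /=; split; last by nra.
  by split=> //; [split; exact: frac01 | split; apply/eqP; lra].
- have f1 : btw a b a' by apply/orP; right; apply/andP; split; lra.
  have f2 : btw a' b' a by apply/orP; left; apply/andP; split; lra.
  have L1 : (0 < (b' - b) * (b - a)) = false by apply/negP; nra.
  have L2 : (0 < (b - b') * (b' - a')) = false by apply/negP; nra.
  have c1 : (a < b) = false by apply/negP; lra.
  have c2 : (a' < b') = true by lra.
  rewrite f1 f2 L1 L2 c1 c2 /=; split; last by nra.
  by split=> //; [split; exact: frac01 | split; apply/eqP; lra].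
- have f1 : btw a b a' = false by apply/negP => /orP[]/andP[]; lra.
  have f2 : btw a' b' a by apply/orP; left; apply/andP; split; lra.
  have t1 : btw a b b' by rewrite f1 in B1; rewrite -[btw a b b']negbK -B1.
  have L1 : (0 < (a' - b) * (b - a)) = false by apply/negP; nra.
  have L2 : (0 < (b - b') * (b' - a')) by nra.
  have c1 : (a < b) = true by lra.
  have c2 : (a' < b') = true by lra.
  rewrite f1 f2 L1 L2 c1 c2 /=; split; last by nra.
  by split=> //; [split; exact: frac01 | split; apply/eqP; lra].
Qed.

Lemma frac_ipos x : S x != E x -> S x + (E x - S x) * frac S E x = ipos S E x.
Proof.
move=> ne; rewrite /frac mulrCA divff ?mulr1 ?subrKC //.
by rewrite subr_eq0 eq_sym.
Qed.

Lemma pass_point x : pass_geom_at x ->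
  up (S x) (E x) (tau S E x) = up (S (th x)) (E (th x)) (tau S E (th x)).
Proof.
move=> [i1 i2 hh [[f1 f2] [f3 f4]] [n1 n2]].
have [e1 e10 h1] := up_local (late S E x) n1 f1 f2; have [e2 e20 h2] := up_local (late S E (th x)) n2 f3 f4.
have := h1 0; have := h2 0; rewrite normr0 !mulr0 !addr0 => /(_ e20) E2 /(_ e10) E1.
rewrite /tau E1 E2 !frac_ipos // -/(fixd x) -/(fixd (th x)) -/(hor x) -/(hor (th x)) hh i1 i2.
by case: (hor x).
Qed.

End Geom.

Section Glue.
Variable (R : realType).

(** The piece [g k] is used on [[k, k + 1[]. Near an integer the function is a choice between two
    continuous pieces with the same value there. *)
Lemma glue_cont (Y : topologicalType) (g : int -> R -> Y) : (forall k, continuous (g k)) ->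
  (forall k : int, g k (k%:~R + 1) = g (k + 1) (k%:~R + 1)) ->
  continuous (fun y : R => g (Num.floor y) y).
Proof.
move=> cg eg; apply: ctI => y0.
have /andP[k1 k2] := floor_itv y0; set k := Num.floor y0 in k1 k2; rewrite intrD mulr1z in k2.
have fl (y : R) (m : int) : m%:~R <= y -> y < m%:~R + 1 -> Num.floor y = m.
  by move=> h1 h2; apply: floor_def; rewrite h1 intrD mulr1z.
have n1 : \forall y \near y0, y < k%:~R + 1.
  by apply: (@cta_lt R R (fun y => y) (fun=> k%:~R + 1)) => //; ct.
case: (ltP (k%:~R) y0) => k3.
  have n2 : \forall y \near y0, k%:~R < y by apply: (@cta_lt R R (fun=> k%:~R) (fun y => y)) => //; ct.
  apply: (@cta_near _ _ (g k)); last exact: cg.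
  by apply: filterS2 n1 n2 => y h1 h2; rewrite (fl y k) // ltW.
have ey : y0 = k%:~R by apply: le_anti; rewrite k3 k1.
have n2 : \forall y \near y0, k%:~R - 1 < y.
  by apply: (@cta_lt R R (fun=> k%:~R - 1) (fun y => y)); [ct | ct | lra].
apply: (@cta_near R Y (fun y : R => if `[< [set w : R | k%:~R <= w] y >] then g k y else g (k - 1) y)).
  apply: filterS2 n1 n2 => y h1 h2; case: asboolP => /= [le|/negP]; first by rewrite (fl y k).
  rewrite -ltNge => lt; rewrite (fl y (k - 1)) // intrB mulr1z; lra.
apply: cta_if; [exact: cg | exact: cg | ].
have := eg (k - 1); rewrite subrK intrB mulr1z subrK ey => -> //.
Qed.

End Glue.

Section Linear.
Variable R : realType.
Implicit Types (x y q X : R * R) (a b : R).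

Lemma emb_of h x : continuous h -> injective h -> emb h x (1 : R).
Proof. by move=> ch ih; split=> // [y _|y y' _ _]; [exact: ch | exact: ih]. Qed.

Definition scl X a b q : R * R := (X.1 + a * q.1, X.2 + b * q.2).
Definition rot_ (k : R) q : R * R := (cos k * q.1 - sin k * q.2, sin k * q.1 + cos k * q.2).

Lemma scl_inj X a b : 0 < a -> 0 < b -> injective (scl X a b).
Proof.
move=> a0 b0 [y1 y2] [z1 z2] [/addrI/(mulfI (lt0r_neq0 a0)) -> /addrI/(mulfI (lt0r_neq0 b0)) ->].
by [].
Qed.

Lemma scl_cont X a b : continuous (scl X a b).
Proof. by rewrite /scl; ct. Qed.

Lemma rot_cont k : continuous (rot_ k).
Proof. by rewrite /rot_; ct. Qed.

Lemma rot_inj k : injective (rot_ k).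
Proof.
have E q : (cos k * (rot_ k q).1 + sin k * (rot_ k q).2, - sin k * (rot_ k q).1 + cos k * (rot_ k q).2) = q.
  have cs := cos2Dsin2 k; case: q => q1 q2; rewrite /rot_ /=.
  have -> : cos k * (cos k * q1 - sin k * q2) + sin k * (sin k * q1 + cos k * q2) = (cos k ^+ 2 + sin k ^+ 2) * q1 by ring.
  have -> : - sin k * (cos k * q1 - sin k * q2) + cos k * (sin k * q1 + cos k * q2) = (cos k ^+ 2 + sin k ^+ 2) * q2 by ring.
  by rewrite cs !mul1r.
by move=> y z e; rewrite -(E y) -(E z) e.
Qed.

Lemma op_scl X a b x : 0 < a -> 0 < b -> orientation_preserving_at (scl X a b) x.
Proof.
move=> a0 b0; have he := emb_of x (@scl_cont X a b) (scl_inj (X := X) a0 b0).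
apply: (op_dot he) => y _ ne; rewrite /dot /scl /=.
have -> : (y.1 - x.1) * (X.1 + a * y.1 - (X.1 + a * x.1)) + (y.2 - x.2) * (X.2 + b * y.2 - (X.2 + b * x.2))
  = a * (y.1 - x.1) ^+ 2 + b * (y.2 - x.2) ^+ 2 by ring.
have [e|n1] := eqVneq y.1 x.1.
  have n2 : y.2 - x.2 != 0.
    by rewrite subr_eq0; apply/eqP => e2; apply: ne; rewrite (surjective_pairing y) e e2 -surjective_pairing.
  by rewrite e subrr expr0n mulr0 add0r mulr_gt0 // exprn_even_gt0.
apply: ltr_pwDl; first by rewrite mulr_gt0 // exprn_even_gt0 // subr_eq0.
by rewrite mulr_ge0 ?sqr_ge0 // ltW.
Qed.

Lemma op_scl_rot X a b k x : 0 < a -> 0 < b -> orientation_preserving_at (scl X a b \o rot_ k) x.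
Proof.
move=> a0 b0; apply: (op_comp (emb_of x (@rot_cont k) (@rot_inj k)) (emb_of _ (@scl_cont X a b) (scl_inj (X := X) a0 b0))).
  by apply: (@op_rot _ _ k) => r u; rewrite /rot_ /polar /= cosD sinD; congr (_, _); ring.
exact: op_scl.
Qed.

Lemma axis_crossing (h : bool) X a b (c d : R -> R * R) (s t : R) (e : R) : 0 < e ->
  (if h then a * b < 0 else 0 < a * b) ->
  (forall u, `|u| < e -> c (s + u) = if h then (X.1 + a * u, X.2) else (X.1, X.2 + a * u)) ->
  (forall u, `|u| < e -> d (t + u) = if h then (X.1, X.2 + b * u) else (X.1 + b * u, X.2)) ->
  crossing (@sphere_atlas R) true (of_plane (@north R) \o c) (of_plane (@north R) \o d) s t.
Proof.
move=> e0 sg hc hd.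
have n0 : `|0 : R| < e by rewrite normr0.
have c0 : c s = X by have := hc 0 n0; rewrite !addr0 !mulr0 !addr0 -surjective_pairing if_same.
have d0 : d t = X by have := hd 0 n0; rewrite !addr0 !mulr0 !addr0 -surjective_pairing if_same.
have a0 : a != 0 by apply/eqP => E; move: sg; rewrite E !mul0r ltxx if_same.
have b0 : b != 0 by apply/eqP => E; move: sg; rewrite E !mulr0 ltxx if_same.
pose A (p : R * R) := if h then ((p.1 - X.1) / a, - ((p.2 - X.2) / b)) else ((p.2 - X.2) / a, - ((p.1 - X.1) / b)).
pose B (q : R * R) := if h then (X.1 + a * q.1, X.2 - b * q.2) else (X.1 - b * q.2, X.2 + a * q.1).
have AB : cancel A B.
  by move=> [p1 p2]; rewrite /A /B; case: (h) => /=; congr (_, _); field.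
have BA : cancel B A.
  by move=> [p1 p2]; rewrite /A /B; case: (h) => /=; congr (_, _); field.
have cA : continuous A by rewrite /A; case: (h); ct.
have cB : continuous B by rewrite /B; case: (h); ct.
have opB x : orientation_preserving_at B x.
  (* The sign condition makes [B] a positive scaling of the axes after a rotation by a multiple of a
     quarter turn, one multiple for each case of [h] and of the sign of [a]. *)
  have [k [a' [b' [a0' b0' ->]]]] : exists k a' b' : R, [/\ 0 < a', 0 < b' & B = scl X a' b' \o rot_ k].
    have [ap|an] : 0 < a \/ a < 0 by case: (ltgtP a 0) a0 => //; [right | left].
      have sb : if h then b < 0 else 0 < b by move: sg; case: (h); rewrite ?pmulr_rlt0 ?pmulr_rgt0.
      case: (h) sb @B {A AB BA cA cB sg hc hd} => sb B.
        exists 0, a, (- b); split=> //; first by rewrite oppr_gt0.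
        by apply/funext => -[q1 q2]; rewrite /B /scl /rot_ /= cos0 sin0; congr (_, _); ring.
      exists (pi / 2), b, a; split=> //.
      by apply/funext => -[q1 q2]; rewrite /B /scl /rot_ /= cos_pihalf sin_pihalf; congr (_, _); ring.
    have sb : if h then 0 < b else b < 0 by move: sg; case: (h); rewrite ?nmulr_rlt0 ?nmulr_rgt0.
    case: (h) sb @B {A AB BA cA cB sg hc hd} => sb B.
      exists pi, (- a), b; split=> //; first by rewrite oppr_gt0.
      by apply/funext => -[q1 q2]; rewrite /B /scl /rot_ /= cospi sinpi; congr (_, _); ring.
    exists (- (pi / 2)), (- b), (- a); split; rewrite ?oppr_gt0 //.
    by apply/funext => -[q1 q2]; rewrite /B /scl /rot_ /= cosN sinN cos_pihalf sin_pihalf; congr (_, _); ring.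
  exact: op_scl_rot.
have nK (x : R * R) : to_plane (@north R) (of_plane (@north R) x) = x by exact: of_planeK.
split; first by rewrite /= c0 d0.
exists (comp_chart (@north R) cA cB AB BA); split.
- apply: comp_chart_positive => //.
  by apply: atlas_positive; [exact: sphere_oriented | left].
- by apply: of_plane_dom.
- have nb : nbhs (0 : R) [set u | `|u| < e].
    by apply/nbhs_ballP; exists e => // u; rewrite /ball /= sub0r normrN.
  apply: filterS nb => u hu; split.
    rewrite -[LHS]/(A (to_plane (@north R) (of_plane (@north R) (c (s + u))))) nK hc // /A.
    by case: (h) => /=; congr (_, _); field.
  rewrite -[LHS]/(A (to_plane (@north R) (of_plane (@north R) (d (t + u))))) nK hd // /A.
  by case: (h) => /=; congr (_, _); field.
Qed.

End Linear.

Section ListLemmas.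
Variables (X : eqType) (ct : pred X) (x0 : X).

(** Cut entries close the blocks of the list, and [val] is constant on each block; counting the cuts
    before position [k] finds the entry closing its block. *)
Lemma seg_val (Y : Type) (val : X -> Y) l k : (k < size l)%N -> ct (last x0 l) ->
  (forall j, (j.+1 < size l)%N -> ~~ ct (nth x0 l j) -> val (nth x0 l j.+1) = val (nth x0 l j)) ->
  (count ct (take k l) < count ct l)%N /\
  val (nth x0 [seq x <- l | ct x] (count ct (take k l))) = val (nth x0 l k).
Proof.
elim: l k => [|e l IH] k // kl lst lnk.
have lnk' j : (j.+1 < size l)%N -> ~~ ct (nth x0 l j) -> val (nth x0 l j.+1) = val (nth x0 l j).
  by move=> h; exact: (lnk j.+1).
have lst' : l <> [::] -> ct (last x0 l) by case: (l) lst.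
case: k kl => [_|k kl] /=.
  case: (boolP (ct e)) => [//|ne] /=.
  have l0 : l <> [::] by move=> E; move: lst; rewrite E /= (negbTE ne).
  have s0 : (0 < size l)%N by case: (l) l0.
  have := IH 0%N s0 (lst' l0) lnk'; rewrite take0 /= => -[-> ->]; split=> //.
  by rewrite -(lnk 0%N) // ltnS.
have l0 : l <> [::] by move=> E; move: kl; rewrite E.
have := IH k kl (lst' l0) lnk'; case: (ct e) => -[h1 h2]; split=> //=.
Qed.

Lemma cut_nth l e : e \in l -> ct e -> nth x0 [seq x <- l | ct x] (count ct (take (index e l) l)) = e.
Proof.
move=> + ce; elim: l => [//|y l IH]; rewrite inE [index _ _]/= eq_sym.
have [->|ne] /= := eqVneq y e; first by rewrite ce.
by move=> /IH; case: (ct y).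
Qed.

Lemma next_at l j : uniq l -> (j.+1 < size l)%N -> next l (nth x0 l j) = nth x0 l j.+1.
Proof.
move=> ul jl; rewrite next_nth mem_nth ?(ltnW jl) //.
case: l ul jl => [//|y p] ul jl; rewrite index_uniq ?(ltnW jl) //=.
exact: set_nth_default.
Qed.

Lemma next_end l j : uniq l -> j.+1 = size l -> next l (nth x0 l j) = nth x0 l 0.
Proof.
move=> ul jl; rewrite next_nth mem_nth -?jl //.
case: l ul jl => [//|y p] ul [jl]; rewrite index_uniq //= ?jl //.
by rewrite nth_default.
Qed.

Lemma count_take_S l j : (j < size l)%N -> count ct (take j.+1 l) = (count ct (take j l) + ct (nth x0 l j))%N.
Proof. by move=> jl; rewrite (take_nth x0) // -cats1 count_cat /= addn0. Qed.

End ListLemmas.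

(** * Curves following the layout *)

Section Draw.
Variables (R : realType) (n : nat) (r : 'I_n -> seq (bool * 'I_n)).
Hypotheses (gr : good r) (pl : planar r).
Variable s : state R n.
Hypotheses (is_ : inv r s) (allQ : forall x, valid x -> Q s x).
Variable l : 'I_n -> seq (bool * 'I_n).
Hypotheses (lu : forall i, uniq (l i)) (lm : forall i e, (e \in l i) = (e.2 != i)).
Hypothesis lnx : forall i e, next (r i) e = next (l i) e.
Hypotheses (l0 : forall i, l i <> [::]) (lcut : forall i e, cut s (i, last e (l i))).
Notation P := (passage n).
Implicit Types (x z c : P) (i j : 'I_n) (k : int).
Local Notation S := (S s).
Local Notation E := (E s).

Definition iscut i : pred (bool * 'I_n) := fun e => cut s (i, e).
Definition K i : nat := count (iscut i) (l i).
Definition cs i : seq (bool * 'I_n) := [seq e <- l i | iscut i e].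
(* [cu i k] is the last passage of the chord number [k] modulo [K i] of the curve [i]. *)
Definition cu i k : P := (i, nth (true, i) (cs i) `|(k %% (K i)%:Z)%Z|%N).
Definition kx x : nat := count (iscut x.1) (take (index x.2 (l x.1)) (l x.1)).
(** Time on a parametrization of period [K]: chord number [k] is run during [[k, k + 1/2]], the arc
    closing the cut edge after it during [[k + 1/2, k + 1]]. *)
Definition Y x : R := (kx x)%:R + tau S E x / 2.

Lemma mem_l x : valid x -> x.2 \in l x.1.
Proof. by rewrite lm /valid eq_sym. Qed.

Lemma cut_valid x : cut s x -> valid x. Proof. by case/andP. Qed.

Lemma K_gt0 i : (0 < K i)%N.
Proof.
rewrite /K -has_count; apply/hasP; exists (last (true, i) (l i)); last exact: lcut.
by move: (@l0 i); case: (l i) => [//|e q] _; exact: (mem_last e q).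
Qed.

Lemma K_neq0 i : (K i)%:Z != 0.
Proof. by have := K_gt0 i; case: (K i). Qed.

Lemma mod_lt i k : (`|(k %% (K i)%:Z)%Z|%N < size (cs i))%N.
Proof.
rewrite size_filter -/(K i) -ltz_nat gez0_abs ?modz_ge0 ?K_neq0 //.
exact: (ltz_mod k (K_neq0 i)).
Qed.

Lemma cu_cut i k : cut s (cu i k).
Proof.
have := mem_nth (true, i) (mod_lt i k); rewrite mem_filter => /andP[].
by [].
Qed.

Lemma cu_mod i k k' : (k = k' %[mod (K i)%:Z])%Z -> cu i k = cu i k'.
Proof. by rewrite /cu => ->. Qed.

Lemma cu_inj i j k k' : cu i k = cu j k' -> i = j /\ (k = k' %[mod (K i)%:Z])%Z.
Proof.
move=> [ij]; subst j => /eqP e; split=> //; move: e.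
have us : uniq (cs i) by apply: filter_uniq; exact: lu.
rewrite nth_uniq ?mod_lt // => /eqP e2.
by rewrite -[LHS]gez0_abs ?modz_ge0 ?K_neq0 // e2 gez0_abs ?modz_ge0 ?K_neq0.
Qed.

Lemma seg x : valid x -> [/\ (kx x < K x.1)%N, S x = S (cu x.1 (kx x)%:Z) & E x = E (cu x.1 (kx x)%:Z)].
Proof.
move=> vx; have xl := mem_l vx; set i := x.1 in xl *.
have ixl : (index x.2 (l i) < size (l i))%N by rewrite index_mem.
have lst : iscut i (last (true, i) (l i)) by exact: lcut.
have lnk (j : nat) : (j.+1 < size (l i))%N -> ~~ iscut i (nth (true, i) (l i) j) ->
    (S (i, nth (true, i) (l i) j.+1), E (i, nth (true, i) (l i) j.+1)) = (S (i, nth (true, i) (l i) j), E (i, nth (true, i) (l i) j)).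
  move=> jl nc; have v : valid (i, nth (true, i) (l i) j).
    by have := mem_nth (true, i) (ltnW jl); rewrite lm /valid eq_sym.
  have lk_ : lk s (i, nth (true, i) (l i) j) by move: nc; rewrite /iscut /cut v negbK.
  have [_ _ e1 e2 _] := i_lk is_ lk_.
  by move: e1 e2; rewrite /nx /= lnx next_at // => -> ->.
have [h1 h2] := @seg_val _ (iscut i) (true, i) _ (fun e => (S (i, e), E (i, e))) (l i) _ ixl lst lnk.
rewrite nth_index // -/(kx x) in h1 h2.
have e : cu i (kx x)%:Z = (i, nth (true, i) (cs i) (kx x)) by rewrite /cu modz_nat absz_nat modn_small.
by rewrite e; case: h2 => -> ->; rewrite /i -surjective_pairing.
Qed.

Lemma mod_abs i k : ((`|(k %% (K i)%:Z)%Z|%N)%:Z = k %[mod (K i)%:Z])%Z.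
Proof. by rewrite gez0_abs ?modz_ge0 ?K_neq0 // modz_mod. Qed.

Lemma kx_cu i k : kx (cu i k) = `|(k %% (K i)%:Z)%Z|%N.
Proof.
have cc := cu_cut i k; have xl := mem_l (cut_valid cc).
have [lt _ _] := seg (cut_valid cc).
have us : uniq (cs i) by apply: filter_uniq; exact: lu.
have := @cut_nth _ (iscut i) (true, i) (l i) (cu i k).2 xl cc; rewrite -/(kx (cu i k)) -/(cs i) => e.
by apply/eqP; rewrite -(nth_uniq (true, i) _ (mod_lt i k) us) ?size_filter //; apply/eqP.
Qed.

Lemma cu_next i k : S (nx r (cu i k)) = S (cu i (k + 1)).
Proof.
have cc := cu_cut i k; have vc := cut_valid cc; have xl := mem_l vc.
have ek := kx_cu i k; set c := cu i k in cc vc xl ek *.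
have ci : c.1 = i by [].
have nxE : nx r c = (i, next (l i) c.2) by rewrite /nx lnx.
have vn : valid (nx r c) by rewrite nx_valid.
have [_ sn _] := seg vn; rewrite sn; congr S; rewrite nxE; apply: cu_mod.
have <- : ((kx c)%:Z + 1 = k + 1 %[mod (K i)%:Z])%Z by rewrite -modzDml ek mod_abs modzDml.
set p := index c.2 (l i).
have pl_ : (p < size (l i))%N by rewrite index_mem.
have ep : nth (true, i) (l i) p = c.2 by rewrite nth_index.
have cS : count (iscut i) (take p.+1 (l i)) = (kx c).+1.
  rewrite (@count_take_S _ (iscut i) (true, i) _ _ pl_) ep.
  have -> : iscut i c.2 by exact: cc.
  by rewrite addn1.
have [ps|ps] := ltnP p.+1 (size (l i)).
  have -> : next (l i) c.2 = nth (true, i) (l i) p.+1 by rewrite -ep next_at.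
  have -> : kx (i, nth (true, i) (l i) p.+1) = (kx c).+1 by rewrite {1}/kx /= index_uniq.
  by rewrite -addn1 PoszD.
have pe : p.+1 = size (l i) by apply/eqP; rewrite eqn_leq pl_.
have -> : next (l i) c.2 = nth (true, i) (l i) 0 by rewrite -ep next_end.
have s0 : (0 < size (l i))%N by rewrite -pe.
have -> : kx (i, nth (true, i) (l i) 0) = 0%N by rewrite /kx /= index_uniq // take0.
have eK : K i = (kx c).+1 by rewrite -cS pe take_size.
by rewrite -PoszD addn1 -eK modzz mod0z.
Qed.

Lemma cutE_inj c c' : cut s c -> cut s c' -> E c = E c' -> c = c'.
Proof.
move=> h h' e; have [l1 _] := cut_letters gr allQ h; have [l2 _] := cut_letters gr allQ h'.
apply: contrapT => ne; apply: (pos_ne is_ l1 l2) => [[]//|]; exact: e.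
Qed.

Lemma cutS_inj c c' : cut s c -> cut s c' -> S c = S c' -> c = c'.
Proof.
move=> h h' e; apply: cutE_inj => //; apply: (S_E is_) e; exact/allQ/cut_valid.
Qed.

Lemma SE_neq x x' : valid x -> valid x' -> S x <> E x'.
Proof. by move=> v v'; apply: (SE_ne is_); exact: allQ. Qed.

Definition swp (q : R * R) : R * R := (q.2, q.1).

(** A chord above the diagonal followed by a closing arc below it. Since [up] stops at its ends, one
    of the two is always at rest at the junction, and a sum replaces a case distinction. *)
Definition piece i k (y : R) : R * R :=
  let f := 2 * (y - k%:~R) in
  let u := up (S (cu i k)) (E (cu i k)) f in
  let w := up (E (cu i k)) (S (cu i (k + 1))) (f - 1) in
  (u.1 + (w.2 - E (cu i k)), u.2 + (w.1 - E (cu i k))).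

Lemma piece_cont i k : continuous (piece i k).
Proof.
have c1 : continuous (fun y : R => up (S (cu i k)) (E (cu i k)) (2 * (y - k%:~R))).
  apply: ctI => y; apply: (@cta_comp _ _ _ (fun y : R => 2 * (y - k%:~R)) (up (S (cu i k)) (E (cu i k)))); [ct | exact: up_cont].
have c2 : continuous (fun y : R => up (E (cu i k)) (S (cu i (k + 1))) (2 * (y - k%:~R) - 1)).
  apply: ctI => y; apply: (@cta_comp _ _ _ (fun y : R => 2 * (y - k%:~R) - 1) (up (E (cu i k)) (S (cu i (k + 1))))); [ct | exact: up_cont].
apply: ctI => y; have d1 : cta _ y := c1 y; have d2 : cta _ y := c2 y.
apply: cta_pair; apply: cta_add.
- exact: cta_fst d1.
- by apply: cta_add; [exact: cta_snd d2 | exact: cta_cst].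
- exact: cta_snd d1.
- by apply: cta_add; [exact: cta_fst d2 | exact: cta_cst].
Qed.

Lemma piece_up i k (y : R) : 2 * (y - k%:~R) <= 1 -> piece i k y = up (S (cu i k)) (E (cu i k)) (2 * (y - k%:~R)).
Proof.
move=> h; rewrite /piece.
have -> : up (E (cu i k)) (S (cu i (k + 1))) (2 * (y - k%:~R) - 1) = (E (cu i k), E (cu i k)).
  by apply: up_le0; lra.
by case: (up _ _ _) => u1 u2 /=; rewrite subrr !addr0.
Qed.

Lemma piece_low i k (y : R) : 1 <= 2 * (y - k%:~R) ->
  piece i k y = swp (up (E (cu i k)) (S (cu i (k + 1))) (2 * (y - k%:~R) - 1)).
Proof.
move=> h; rewrite /piece (@up_ge1 R (S (cu i k))) //= /swp.
by congr (_, _); rewrite addrC subrK.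
Qed.

Definition F i (y : R) : R * R := piece i (Num.floor y) y.

Lemma F_cont i : continuous (F i).
Proof.
apply: glue_cont; first exact: piece_cont.
move=> k; rewrite piece_low; last by lra.
rewrite piece_up; last by rewrite intrD mulr1z; lra.
have -> : 2 * (k%:~R + 1 - k%:~R) - 1 = 1 :> R by ring.
have -> : 2 * (k%:~R + 1 - (k + 1)%:~R) = 0 :> R by rewrite intrD mulr1z; ring.
by rewrite up_1 up_0.
Qed.

Lemma floor_eq (y : R) k : k%:~R <= y -> y < k%:~R + 1 -> Num.floor y = k.
Proof. by move=> h1 h2; apply: floor_def; rewrite h1 intrD mulr1z. Qed.

Lemma F_per i (y : R) (q : int) : F i (y + (K i)%:R * q%:~R) = F i y.
Proof.
have /andP[h1 h2] := floor_itv y; set k := Num.floor y in h1 h2; rewrite intrD mulr1z in h2.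
have eK : (K i)%:R * q%:~R = (q * (K i)%:Z)%:~R :> R by rewrite intrM mulrC.
have fl : Num.floor (y + (K i)%:R * q%:~R) = q * (K i)%:Z + k by apply: floor_eq; rewrite eK intrD; lra.
have c1 : cu i (q * (K i)%:Z + k) = cu i k by apply: cu_mod; exact: modzMDl.
have c2 : cu i (q * (K i)%:Z + k + 1) = cu i (k + 1) by apply: cu_mod; rewrite -addrA modzMDl.
rewrite /F fl -/k /piece c1 c2.
have -> // : y + (K i)%:R * q%:~R - (q * (K i)%:Z + k)%:~R = y - k%:~R.
by rewrite eK intrD; ring.
Qed.

Lemma F_case i (y : R) : exists k (f : R), y = k%:~R + f / 2 /\
  [\/ f = 0 /\ F i y = (S (cu i k), S (cu i k)),
      [/\ 0 < f, f < 1, F i y = up (S (cu i k)) (E (cu i k)) f & (F i y).1 < (F i y).2],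
      f = 1 /\ F i y = (E (cu i k), E (cu i k)) |
      [/\ 0 < f - 1, f - 1 < 1, F i y = swp (up (E (cu i k)) (S (nx r (cu i k))) (f - 1)) & (F i y).2 < (F i y).1]].
Proof.
have /andP[h1 h2] := floor_itv y; set k := Num.floor y in h1 h2; rewrite intrD mulr1z in h2.
exists k, (2 * (y - k%:~R)); split; first by field.
have vc := cut_valid (cu_cut i k).
have ne : S (cu i k) != E (cu i k) by apply/eqP; exact: SE_neq.
have ne' : E (cu i k) != S (nx r (cu i k)) by apply/eqP => /esym; apply: SE_neq; rewrite ?nx_valid.
rewrite /F -/k cu_next; set f := 2 * (y - k%:~R).
case: (ltgtP f 1) => f1.
- rewrite piece_up -/f ?ltW //; case: (ltgtP f 0) => f0; first by exfalso; rewrite /f in f0; lra.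
    by constructor 2; split=> //; exact: up_lt.
  by constructor 1; rewrite f0 up_0.
- rewrite piece_low -/f ?ltW //; constructor 4.
  have g1 : 0 < f - 1 by lra.
  have g2 : f - 1 < 1 by rewrite /f; lra.
  by split=> //; rewrite /swp /=; rewrite -cu_next; exact: up_lt.
- by constructor 3; rewrite piece_up -/f ?f1 // up_1.
Qed.

Hypothesis geom : forall x, valid x -> pass_geom_at S E x.

Lemma tau_in x : valid x -> 0 < tau S E x /\ tau S E x < 1.
Proof.
move=> vx; have [_ _ _ [[f0 f1] _] _] := geom vx; rewrite /tau.
by case: (late S E x) => /=; split; lra.
Qed.

(** Points on, above and below the diagonal are ends of chords, points of chords and points of
    closing arcs, so only pieces of the same kind can meet. *)
Lemma meeting i j (y y' : R) : F i y = F j y' ->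
  (i = j /\ exists q : int, y = y' + (K i)%:R * q%:~R) \/
  (exists x, [/\ valid x, x.1 = i, x.2.2 = j & exists q q' : int,
     y = Y x + (K i)%:R * q%:~R /\ y' = Y (th x) + (K j)%:R * q'%:~R]).
Proof.
have [k [f [ey cy]]] := F_case i y; have [k' [f' [ey' cy']]] := F_case j y'.
set c := cu i k in cy *; set c' := cu j k' in cy'.
have cc : cut s c := cu_cut i k; have cc' : cut s c' := cu_cut j k'.
have vc := cut_valid cc; have vc' := cut_valid cc'.
have vn : valid (nx r c) by rewrite nx_valid.
have vn' : valid (nx r c') by rewrite nx_valid.
have modE (a b : int) p : (a = b %[mod (K p)%:Z])%Z -> exists q : int, a%:~R = b%:~R + (K p)%:R * q%:~R :> R.
  move=> /eqP; rewrite eqz_mod_dvd => /dvdzP[q eq]; exists q.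
  have -> : a = b + q * (K p)%:Z by rewrite -eq; ring.
  by rewrite intrD intrM mulrC.
have fin : c = c' -> f = f' -> i = j /\ exists q : int, y = y' + (K i)%:R * q%:~R.
  move=> ec ef; have [ij /modE[q eq]] := cu_inj ec; split=> //; exists q.
  by rewrite ey ey' eq ef; ring.
have ne : S c != E c by apply/eqP; exact: SE_neq.
have ne' : S c' != E c' by apply/eqP; exact: SE_neq.
move=> eF; rewrite -eF in cy'.
case: cy => [[f0 e]|[f0 f1 e lt]|[f1 e]|[f0 f1 e lt]].
- rewrite e /= ltxx in cy'; case: cy' => [[f0' [e1 _]]|[_ _ _ //]|[f1' [e1 _]]|[_ _ _ //]].
    by left; apply: fin; [exact: cutS_inj | rewrite f0 f0'].
  by case: (SE_neq vc vc' e1).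
- case: cy' => [[_ e']|[f0' f1' e' _]|[_ e']|[_ _ _ lt']].
  + by move: lt; rewrite e' ltxx.
  + have [ec|nc] := pselect (c = c').
      left; apply: fin => //; rewrite -ec in e'.
      by apply: (up_inj ne) => //; rewrite ?ltW // -e -e'.
    right.
    have dis : [/\ S c <> S c', S c <> E c', E c <> S c' & E c <> E c'].
      split; [|exact: SE_neq|by move=> /esym; exact: SE_neq|]; move=> e1; apply: nc.
        exact: cutS_inj.
      exact: cutE_inj.
    have o1 : onL (Num.min (S c) (E c)) (Num.max (S c) (E c)) (F i y) by rewrite e; apply: up_onL; rewrite ?ltW.
    have o2 : onL (Num.min (S c') (E c')) (Num.max (S c') (E c')) (F i y) by rewrite e'; apply: up_onL; rewrite ?ltW.
    (* Chords which meet have interleaved ends, so the layout records a crossing; as two hooks meet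
       only once above the diagonal, it is the point at hand. *)
    have [z [qz sz sz']] := i_xing is_ (allQ vc) (allQ vc') (arcs_cross dis o1 o2 lt).
    have vz := i_valid is_ qz; have vt : valid (th z) by rewrite th_valid.
    have qt := allQ vt.
    have zi : z.1 = i := i_row is_ qz (allQ vc) (or_introl sz).
    have zj : z.2.2 = j := i_row is_ qt (allQ vc') (or_introl sz').
    have ez := S_E is_ qz (allQ vc) sz; have ez' := S_E is_ qt (allQ vc') sz'.
    have pt := pass_point (geom vz); have [t0 t1] := tau_in vz; have [t0' t1'] := tau_in vt.
    rewrite sz ez sz' ez' in pt.
    have qq : F i y = up (S c) (E c) (tau S E z).
      apply: (arcs_meet dis o1 o2 lt).
      - by apply: up_onL; rewrite ?ltW.
      - by rewrite pt; apply: up_onL; rewrite ?ltW.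
      - exact: up_lt.
    have ft : f = tau S E z by apply: (up_inj ne); rewrite ?ltW // -e.
    have ft' : f' = tau S E (th z) by apply: (up_inj ne'); rewrite ?ltW // -e' -pt.
    have [_ s1 _] := seg vz; have [_ s2 _] := seg vt.
    rewrite sz zi in s1; rewrite sz' [(th z).1]zj in s2.
    have [_ /modE[q eq]] := cu_inj (cutS_inj cc (cu_cut _ _) s1).
    have [_ /modE[q' eq']] := cu_inj (cutS_inj cc' (cu_cut _ _) s2).
    exists z; split=> //; exists q, q'; rewrite ey ey' eq eq' ft ft' /Y -!pmulrn.
    by split; ring.
  + by move: lt; rewrite e' ltxx.
  + by have := lt_trans lt lt'; rewrite ltxx.
- rewrite e /= ltxx in cy'; case: cy' => [[f0' [e1 _]]|[_ _ _ //]|[f1' [e1 _]]|[_ _ _ //]].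
    by case: (SE_neq vc' vc (esym e1)).
  by left; apply: fin; [exact: cutE_inj | rewrite f1 f1'].
- have nl : E c != S (nx r c) by apply/eqP => /esym; exact: SE_neq.
  have nl' : E c' != S (nx r c') by apply/eqP => /esym; exact: SE_neq.
  case: cy' => [[_ e']|[_ _ _ lt']|[_ e']|[f0' f1' e' _]].
  + by move: lt; rewrite e' ltxx.
  + by have := lt_trans lt lt'; rewrite ltxx.
  + by move: lt; rewrite e' ltxx.
  + have g : swp (F i y) = up (E c) (S (nx r c)) (f - 1) by rewrite e /swp -surjective_pairing.
    have g' : swp (F i y) = up (E c') (S (nx r c')) (f' - 1) by rewrite e' /swp -surjective_pairing.
    have [ec|nc] := pselect (c = c').
      left; apply: fin => //; rewrite -ec in g'.
      have : f - 1 = f' - 1 by apply: (up_inj nl); rewrite ?ltW // -g -g'.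
      by lra.
    (* Two distinct closing arcs which meet would have interleaved ends, against
       [cut_noncrossing]. *)
    exfalso.
    have dis : [/\ E c <> E c', E c <> S (nx r c'), S (nx r c) <> E c' & S (nx r c) <> S (nx r c')].
      split; [|by move=> /esym; exact: SE_neq|exact: SE_neq|]; move=> e1; apply: nc; first exact: cutE_inj.
      move: e1; rewrite /c /c' !cu_next => /(cutS_inj (cu_cut _ _) (cu_cut _ _)) /cu_inj[ij E1].
      rewrite -ij in E1 *; apply: cu_mod.
      by rewrite -[k](addrK 1) -modzDml E1 modzDml addrK.
    have o1 : onL (Num.min (E c) (S (nx r c))) (Num.max (E c) (S (nx r c))) (swp (F i y)) by rewrite g; apply: up_onL; rewrite ?ltW.
    have o2 : onL (Num.min (E c') (S (nx r c'))) (Num.max (E c') (S (nx r c'))) (swp (F i y)) by rewrite g'; apply: up_onL; rewrite ?ltW.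
    have := arcs_cross dis o1 o2 lt.
    by rewrite (cut_noncrossing gr pl is_ allQ cc cc') eqxx.
Qed.

Lemma F_local x : valid x -> exists2 e : R, 0 < e & forall de, `|de| < e ->
  F x.1 (Y x + de) = if hor S E x then (ipos S E x + 4 * (E x - S x) * de, fixd S E x)
                     else (fixd S E x, ipos S E x + 4 * (E x - S x) * de).
Proof.
move=> vx; have [t0 t1] := tau_in vx; have [_ sx ex] := seg vx.
have [_ _ _ [[g0 g1] _] [ne _]] := geom vx.
have [e1 e10 h1] := up_local (late S E x) ne g0 g1.
have a0 : 0 < e1 / 2 by lra.
have b0 : 0 < tau S E x / 2 by lra.
have c0 : 0 < (1 - tau S E x) / 2 by lra.
have [m0 m1 m2] := min_pos2 b0 c0; have [m0' m1' m2'] := min_pos2 a0 m0.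
exists (Num.min (e1 / 2) (Num.min (tau S E x / 2) ((1 - tau S E x) / 2))) => // de.
rewrite ltr_norml => /andP[d1 d2].
rewrite /F (@floor_eq _ (kx x)%:Z); [|rewrite /Y -pmulrn; lra|rewrite /Y -pmulrn; lra].
have e : 2 * (Y x + de - (kx x)%:~R) = tau S E x + 2 * de by rewrite /Y -pmulrn; field.
rewrite piece_up e -?sx -?ex; last by lra.
rewrite {1}/tau h1; last by rewrite ltr_norml; apply/andP; split; lra.
rewrite frac_ipos // -/(hor S E x) -/(fixd S E x).
by have -> : 2 * (E x - S x) * (2 * de) = 4 * (E x - S x) * de by ring.
Qed.

Lemma Y_lt i p : (p.+1 < size (l i))%N ->
  Y (i, nth (true, i) (l i) p) < Y (i, nth (true, i) (l i) p.+1).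
Proof.
move=> ps; set x := (i, nth _ _ p); set x' := (i, nth _ _ p.+1).
have vx : valid x by have := mem_nth (true, i) (ltnW ps); rewrite lm /valid eq_sym.
have vx' : valid x' by have := mem_nth (true, i) ps; rewrite lm /valid eq_sym.
have [t0 t1] := tau_in vx; have [t0' t1'] := tau_in vx'.
have k1 : kx x = count (iscut i) (take p (l i)) by rewrite /kx /= index_uniq // ltnW.
have k2 : kx x' = (kx x + iscut i (nth (true, i) (l i) p))%N.
  by rewrite k1 -count_take_S ?(ltnW ps) // /kx /= index_uniq.
rewrite /Y k2 natrD; case: (boolP (iscut i (nth (true, i) (l i) p))) => [_|nc] /=; first by lra.
have lk_ : lk s x by move: nc; rewrite /iscut -/x /cut vx negbK.
have := i_tau is_ lk_; have -> : nx r x = x' by rewrite /nx /= lnx next_at.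
by rewrite addr0; lra.
Qed.

Lemma Y_in x : valid x -> 0 < Y x /\ Y x < (K x.1)%:R.
Proof.
move=> vx; have [t0 t1] := tau_in vx; have [lt _ _] := seg vx; rewrite /Y.
have : (kx x)%:R + 1 <= (K x.1)%:R :> R by rewrite natr1 ler_nat.
by have := ler0n R (kx x); split; lra.
Qed.

Hypothesis gsign : forall x, valid x -> x.2.1 -> pass_sign S E x.

Definition T x : R := Y x / (K x.1)%:R.
Definition curve i (t : R) : sphere R := of_plane (@north R) (F i ((K i)%:R * t)).

Let KR i : 0 < (K i)%:R :> R. Proof. by rewrite ltr0n K_gt0. Qed.

Lemma Y_mono i (p p' : nat) : (p < p')%N -> (p' < size (l i))%N ->
  Y (i, nth (true, i) (l i) p) < Y (i, nth (true, i) (l i) p').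
Proof.
elim: p' => [//|p' IH]; rewrite ltnS leq_eqVlt => /orP[/eqP->|lt] ps; first exact: Y_lt.
by apply: lt_trans (IH lt (ltnW ps)) _; exact: Y_lt.
Qed.

Lemma KT x : (K x.1)%:R * T x = Y x.
Proof. by rewrite /T mulrC divfK // lt0r_neq0. Qed.

Lemma T_in x : valid x -> 0 < T x /\ T x < 1.
Proof.
move=> vx; have [h1 h2] := Y_in vx; rewrite /T; split; first exact: divr_gt0.
by rewrite ltr_pdivrMr // mul1r.
Qed.

Lemma T_inj x x' (q : int) : valid x -> valid x' -> x.1 = x'.1 -> T x = T x' + q%:~R -> x = x'.
Proof.
move=> vx vx' xi et; have [a1 a2] := T_in vx; have [b1 b2] := T_in vx'.
have q0 : q = 0 by apply: (@intr_small R); lra.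
have eY : Y x = Y x' by rewrite -(KT x) -(KT x') et q0 addr0 xi.
have m1 := mem_l vx; have m2 := mem_l vx'; rewrite -xi in m2.
have e1 : x = (x.1, nth (true, x.1) (l x.1) (index x.2 (l x.1))) by rewrite nth_index // -surjective_pairing.
have e2 : x' = (x.1, nth (true, x.1) (l x.1) (index x'.2 (l x.1))) by rewrite nth_index // xi -surjective_pairing.
case: (ltngtP (index x.2 (l x.1)) (index x'.2 (l x.1))) => w.
- by have := @Y_mono x.1 _ _ w; rewrite index_mem => /(_ m2); rewrite -e1 -e2 eY ltxx.
- by have := @Y_mono x.1 _ _ w; rewrite index_mem => /(_ m1); rewrite -e1 -e2 eY ltxx.
- by rewrite e1 e2 w.
Qed.

Lemma curve_eq i j (u v : R) : curve i u = curve j v -> F i ((K i)%:R * u) = F j ((K j)%:R * v).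
Proof. by move=> /(congr1 (to_plane (@north R))); rewrite /curve !of_planeK. Qed.

Lemma curve_meet i j (u v : R) : i != j -> curve i u = curve j v ->
  exists x, [/\ valid x, x.1 = i, x.2.2 = j & exists q q' : int, u = T x + q%:~R /\ v = T (th x) + q'%:~R].
Proof.
have D p (a y : R) (q : int) : (K p)%:R * a = y + (K p)%:R * q%:~R -> a = y / (K p)%:R + q%:~R.
  move=> e; apply: (mulfI (lt0r_neq0 (KR p))); rewrite e mulrDr; congr (_ + _).
  by rewrite mulrC divfK // lt0r_neq0.
move=> ij /curve_eq/meeting[[e _]|[x [vx xi xj [q [q' [e1 e2]]]]]]; first by rewrite e eqxx in ij.
exists x; split=> //; exists q, q'; split; rewrite /T; first by rewrite xi; exact: D.
by have -> : (th x).1 = j by []; exact: D.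
Qed.

Lemma curve_jordan i : pseudocircle (curve i).
Proof.
split.
  apply: ctI => t; apply: (@cta_comp _ _ _ (fun t : R => F i ((K i)%:R * t)) (of_plane (@north R))).
    apply: (@cta_comp _ _ _ (fun t : R => (K i)%:R * t) (F i)); [by ct | exact: F_cont].
  exact: of_plane_continuous.
move=> u v; split=> [/curve_eq/meeting[[_ [q eq]]|[x [vx xi xj _]]]|/intrP[q eq]].
- apply/intrP; exists q; apply: (mulfI (lt0r_neq0 (KR i))); rewrite mulrBr eq; ring.
- by move: vx; rewrite /valid xi xj eqxx.
- rewrite /curve -(F_per i ((K i)%:R * v) q); congr (of_plane _ (F i _)).
  by rewrite -eq; ring.
Qed.

Lemma curve_shift i (u : R) (q : int) : curve i (u + q%:~R) = curve i u.
Proof. by apply/(proj2 (curve_jordan i)); rewrite addrAC subrr add0r intr_int. Qed.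

Lemma pass_crossing x : valid x ->
  crossing (@sphere_atlas R) x.2.1 (curve x.1) (curve x.2.2) (T x) (T (th x)).
Proof.
have main y : valid y -> y.2.1 -> crossing (@sphere_atlas R) true (curve y.1) (curve y.2.2) (T y) (T (th y)).
  move=> vy b; have vt : valid (th y) by rewrite th_valid.
  have [e1 e10 h1] := F_local vy; have [e2 e20 h2] := F_local vt.
  have [i1 i2 hh _ _] := geom vy; have sg := gsign vy b.
  have k1 := KR y.1; have k2 := KR y.2.2.
  have p1 : 0 < e1 / (K y.1)%:R by exact: divr_gt0.
  have p2 : 0 < e2 / (K y.2.2)%:R by exact: divr_gt0.
  have [m0 m1 m2] := min_pos2 p1 p2.
  pose X := if hor S E y then (ipos S E y, fixd S E y) else (fixd S E y, ipos S E y).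
  apply: (@axis_crossing R (hor S E y) X (4 * (E y - S y) * (K y.1)%:R) (4 * (E (th y) - S (th y)) * (K y.2.2)%:R)
    (fun t => F y.1 ((K y.1)%:R * t)) (fun t => F y.2.2 ((K y.2.2)%:R * t)) _ _ _ m0).
  - have -> : 4 * (E y - S y) * (K y.1)%:R * (4 * (E (th y) - S (th y)) * (K y.2.2)%:R) =
       (16 * ((K y.1)%:R * (K y.2.2)%:R)) * ((E y - S y) * (E (th y) - S (th y))) by ring.
    have kk : 0 < 16 * ((K y.1)%:R * (K y.2.2)%:R) :> R by rewrite !mulr_gt0.
    by move: sg; rewrite /pass_sign; case: (hor S E y); [rewrite (pmulr_rlt0 _ kk) | rewrite (pmulr_rgt0 _ kk)].
  - move=> u hu; rewrite mulrDr KT h1; last first.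
      rewrite normrM (gtr0_norm k1) mulrC -ltr_pdivlMr //; exact: lt_le_trans hu m1.
    by rewrite /X; case: (hor S E y) => /=; congr (_, _); rewrite mulrA.
  - move=> u hu; rewrite mulrDr -[(K y.2.2)%:R * T (th y)]/((K (th y).1)%:R * T (th y)) KT.
    rewrite -[F y.2.2]/(F (th y).1) h2; last first.
      rewrite normrM (gtr0_norm k2) mulrC -ltr_pdivlMr //; exact: lt_le_trans hu m2.
    by rewrite /X hh -i1 i2; case: (hor S E y) => /=; congr (_, _); rewrite mulrA.
move=> vx; case: (boolP x.2.1) => b; first exact: main.
have := main (th x); rewrite th_valid thK => /(_ vx b)/crossing_sym.
by [].
Qed.

Lemma drawing_arrangement : arrangement (@sphere_atlas R) curve.
Proof.
split.
- exact: curve_jordan.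
- move=> i j k ij jk ik; apply/seteqP; split=> // p [[[u _ eu] [v _ ev]] [w _ ew]].
  have [x [vx xi xj [q [_ [e1 _]]]]] := curve_meet ij (etrans eu (esym ev)).
  have [x' [vx' xi' xj' [q' [_ [e2 _]]]]] := curve_meet ik (etrans eu (esym ew)).
  have E0 : x = x'.
    apply: (@T_inj _ _ (q' - q)) => //; first by rewrite xi xi'.
    by rewrite intrB; move: e1; rewrite e2; lra.
  by move: jk; rewrite -xj -xj' E0 eqxx.
- move=> i j ij u v e; have [x [vx xi xj [q [q' [e1 e2]]]]] := curve_meet ij e.
  exists x.2.1; have [_ [f [pf fp hf]]] := pass_crossing vx; split=> //; exists f.
  rewrite xi xj in fp hf; split=> //; first by rewrite e1 curve_shift.
  by apply: filterS hf => w; rewrite e1 e2 !(addrAC _ _ w) !curve_shift.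
- move=> i j ij; pose x b : P := (i, (b, j)).
  have vx b : valid (x b) by [].
  exists (curve i (T (x true))), (curve i (T (x false))); split.
    move=> /(proj2 (curve_jordan i))/intrP[q eq].
    have : x true = x false by apply: (@T_inj _ _ q) => //; lra.
    by move=> [].
  apply/seteqP; split=> [p [[u _ eu] [v _ ev]]|p].
    have [y [vy yi yj [q [_ [e1 _]]]]] := curve_meet ij (etrans eu (esym ev)).
    have -> : p = curve i (T y) by rewrite -eu e1 curve_shift.
    case: y yi yj {vy e1} => i' [b j'] /= -> ->.
    by case: b; [left | right].
  have H b : (range (curve i) `&` range (curve j)) (curve i (T (x b))).
    split; first by exists (T (x b)).
    by have [e _] := pass_crossing (vx b); exists (T (th (x b))).
  by case=> ->.
Qed.

Lemma drawing_row i : rowdesc (@sphere_atlas R) curve i (l i).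
Proof.
pose e0 : bool * 'I_n := (true, i).
pose g p := (T (i, nth e0 (l i) p), nth e0 (l i) p).
have v p : (p < size (l i))%N -> valid (i, nth e0 (l i) p).
  by move=> ps; have := mem_nth e0 ps; rewrite lm /valid eq_sym.
exists (mkseq g (size (l i))); last first.
  by rewrite /unzip2 /mkseq -map_comp; exact: esym (mkseq_nth e0 (l i)).
split.
- apply/(pairwiseP (g 0%N)) => p p'; rewrite !inE size_mkseq => ps ps' lt.
  rewrite !nth_mkseq // /before /= /T ltr_pM2r ?invr_gt0 //; exact: Y_mono.
- move=> p p' /mapP[a]; rewrite mem_iota add0n => /andP[_ ha] -> /mapP[b]; rewrite mem_iota add0n => /andP[_ hb] -> /=.
  by have [] := T_in (v _ ha); have [] := T_in (v _ hb); lra.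
- move=> j u ji [w _ ew]; have ij : i != j by rewrite eq_sym.
  have [x [vx xi xj [q [_ [e1 _]]]]] := curve_meet ij (esym ew).
  have mx := mem_l vx; rewrite xi in mx.
  exists (g (index x.2 (l i))).
    by apply: map_f; rewrite mem_iota add0n index_mem.
  by rewrite /g /= nth_index // -[i in (i, x.2)]xi -surjective_pairing e1 curve_shift.
- move=> p /mapP[a]; rewrite mem_iota add0n => /andP[_ ha] -> /=.
  have va := v _ ha; split; first by move: va; rewrite /valid eq_sym.
  by exists (T (th (i, nth e0 (l i) a))); exact: (pass_crossing va).
Qed.

End Draw.

Theorem drawing (R : realType) (n : nat) (r : 'I_n -> seq (bool * 'I_n)) : (1 < n)%N -> good r -> planar r ->
  exists2 d : 'I_n -> R -> sphere R, arrangement (@sphere_atlas R) d & forall i, rowdesc (@sphere_atlas R) d i (r i).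
Proof.
move=> n1 gr pl.
have [x1 v1] : exists x : passage n, valid x.
  by exists (Ordinal (ltnW n1), (true, Ordinal n1)).
have [s [is_ allQ]] := state_exists R gr v1.
have rne i : r i != [::].
  have [j ji] : exists j : 'I_n, j != i.
    have : (0 < #|predC1 i|)%N by rewrite cardC1 card_ord -subn1 subn_gt0.
    by move=> /card_gt0P[j]; exists j.
  by have [_ /(_ (true, j))] := gr i; rewrite /= ji; case: (r i).
have /choice[l hl] : forall i, exists l, [/\ uniq l, forall e, (e \in l) = (e.2 != i), forall e, next (r i) e = next l e,
    l <> [::] /\ (forall e, cut s (i, last e l)) & exists k k', l = rot k (rot k' (r i))].
  move=> i; have [[i' e] [cx /= xi]] := row_cut gr is_ (rne i); subst i'.
  have [ur mr] := gr i.
  have er : e \in r i by rewrite (rowP gr (i, e)); case/andP: cx.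
  have [k q ek] := rot_to er.
  (* The row is rotated so as to end with a cut entry: no chord then runs over the end of the
     list. *)
  exists (rot 1 (rot k (r i))); split.
  - by rewrite !rot_uniq.
  - by move=> e'; rewrite !mem_rot.
  - by move=> e'; rewrite !next_rot ?rot_uniq.
  - by rewrite ek rot1_cons; split=> [|e']; [case: (q) | rewrite last_rcons].
  - by exists 1%N, k.
have lu i : uniq (l i) by case: (hl i).
have lm i e : (e \in l i) = (e.2 != i) by case: (hl i).
have lnx i e : next (r i) e = next (l i) e by case: (hl i).
have l0 i : l i <> [::] by case: (hl i) => _ _ _ [].
have lcut i e : cut s (i, last e (l i)) by case: (hl i) => _ _ _ [].
have gs x : valid x -> x.2.1 -> pass_geom_at (S s) (E s) x /\ pass_sign (S s) (E s) x.
  by move=> vx b; apply: pass_geom; exact: i_cyc4 is_ _ (allQ _ vx) b.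
have geom x : valid x -> pass_geom_at (S s) (E s) x.
  move=> vx; case: (boolP x.2.1) => b; first by case: (gs x vx b).
  by rewrite -(thK x); apply: pass_geom_sym; case: (gs (th x)); rewrite ?th_valid.
have gsign x : valid x -> x.2.1 -> pass_sign (S s) (E s) x by move=> vx b; case: (gs x vx b).
have ar := drawing_arrangement gr pl is_ allQ lu lm lnx l0 lcut geom gsign.
exists (curve s l) => // i.
have := drawing_row gr pl is_ allQ lu lm lnx l0 lcut geom gsign i.
by have [_ _ _ _ [k [k' ->]]] := hl i; move=> /(rowdesc_unrot ar)/(rowdesc_unrot ar).
Qed.

Theorem theorem3p6 (R : realType) (T : topologicalType) (O : set (chart R T))
    (hT : closed_oriented_surface O) (n : nat) (hn : (4 <= n)%N)
    (c : 'I_n -> R -> T) (hc : arrangement O c) :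
  embeddable O c (sphere R) <->
  (forall A : {set 'I_n}, #|A| = 4%N ->
     embeddable O (subarrangement c A) (sphere R)).
Proof.
have hO : oriented_atlas O by case: hT.
split=> [[ O' [d [hO' hd [s [bs [M [hM hM']]]]]]] A cA|H].
  have hds : arrangement O' (d \o s) by exact: arrangement_inj (bij_inj bs) hd.
  have w1 := describes_rows hM; have w2 := describes_rows hM'.
  (* The relabelling is composed into the curves beforehand, so that the same index set [A] selects
     corresponding curves on both sides. *)
  exists O', (subarrangement (d \o s) A); split=> //; first exact: subarrangement_arr.
  exists id; split; first by exists id.
  exists (rows_mx (fun i : 'I_#|A| => relabel i (rowseq M (enum_val i)))).
  have d1 i : rowdesc O (subarrangement c A) i (relabel i (rowseq M (enum_val i))) by exact: rowdesc_sub.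
  have sz i := rowdesc_size hO (@subarrangement_arr R T O n c A hc) (d1 i).
  split; apply: rows_describe => // i; exact: rowdesc_sub.
have /choice[w hw] : forall i, exists w, rowdesc O c i w by move=> i; have [w] := rowdesc_exists hc i; exists w.
have lab i e : e \in w i -> e.2 != i.
  by have [z [_ _ _ h4] ->] := hw i; move=> /mapP[p pz ->]; have [] := h4 p pz.
have loc (A : {set 'I_n}) : #|A| = 4%N -> good (subrow w (A := A)) /\ planar (subrow w (A := A)).
  move=> cA; have [ O' [d [hO' hd [s [bs [M [hM hM']]]]]]] := H A cA.
  have hds : arrangement O' (d \o s) by exact: arrangement_inj (bij_inj bs) hd.
  have hA := @subarrangement_arr R T O n c A hc.
  have hO2 : oriented_atlas O' by case: hO'.
  apply: (sphere_rows hO' hds); first by rewrite cA.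
  (* The row obtained by restricting the full row and the row of the given matrix describe the same
     curve, hence differ by a rotation, which the arrangement on the sphere tolerates too. *)
  move=> i; have [k [k' e]] := rowdesc_uniq hO hA (rowdesc_sub hc (hw (enum_val i))) (describes_rows hM i).
  have := rowdesc_rot hds k' (describes_rows hM' i); rewrite -e.
  exact: rowdesc_unrot.
have [gw pw] := planar_of_four hn lab loc.
have [d hd dw] := drawing R (leq_trans (isT : (1 < 4)%N) hn) gw pw.
exists (@sphere_atlas R), d; split=> //; first exact: sphere_surface.
exists id; split; first by exists id.
exists (rows_mx w); have sz i := rowdesc_size hO hc (hw i).
by split; exact: rows_describe.
Qed.
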